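(* Let $\chi\in C^\infty(\mathbb{R})$ be such that $0\le\chi\le3$, $\chi'\ge0$, $\chi(x)=0$ if $x\le0$, $\chi(x)=3$ if $x\ge3$, and $\chi(x)=x$ if $1\le x\le2$. Define $a\colon\mathbb{R}\to[1,4]$ by $$a(x)=1+\sum_{n=1}^\infty\Big(\chi\big(n(x-16n)\big)-\chi\big(n(x-(16n+8))\big)\Big).$$ Then $a\in C^\infty(\mathbb{R})$, $\sup a'=\infty$, and for the group $T$ and semigroup $S$ associated with $X=a\,d/dx$ the following hold. (i) $a(y)\le4\,a(x)$ for all $x,y\in\mathbb{R}$. In particular, for all $p\in[1,\infty)$, $T$ extends to a strongly continuous group and $S$ to a strongly continuous semigroup on $L_p(\mathbb{R};dx)$, with $\|S_t\|_{p\to p}\le4^{1/p}$ for all $t>0$. (ii) The real part of $H_{\min}=-X^2$ with domain $C_c^\infty(\mathbb{R})$ is not lower semibounded on $L_2(\mathbb{R};dx)$: for every $c\in\mathbb{R}$ there is a $\varphi\in C_c^\infty(\mathbb{R})$ with $\operatorname{Re}(\varphi,H_{\min}\varphi)<-c\,\|\varphi\|_2^2$. This is despite the uniform boundedness of $S$ on $L_2$. (iii) The distance $d(x;y)=\big|\int_x^ya(z)^{-1}dz\big|$ satisfies $\frac14|x-y|\le d(x;y)\le|x-y|$, and the kernel $K_t$ of $S_t$ satisfies $$K_t(x;y)\le(4\pi t)^{-1/2}\,e^{-|x-y|^2(64t)^{-1}}$$ for all $x,y\in\mathbb{R}$ and $t>0$. (iv) The spectrum $\sigma(H)$ of the generator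 $H$ of $S$ on $L_p$ is contained in the right half-plane and is independent of $p\in[1,\infty]$. (v) On $L_2$ the numerical range $\Theta(H)$ of $H$ contains $(-\infty,0]$, and therefore $\Theta(H)\ne\sigma(H)$. In fact $\Theta(H)=\mathbb{C}$. (vi) $S$ has a bounded holomorphic extension to the open right half-plane on each of the spaces $L_p(\mathbb{R};dx)$, $p\in[1,\infty)$. Therefore $H$ is of type $S_{0+}$. Nevertheless, since $\Theta(H)=\mathbb{C}$, the operator $H$ is not sectorial.
   Context: The measure on $\mathbb{R}$ is Lebesgue measure $dx$ (weight $\rho=1$). For $x_0\in\mathbb{R}$ let $t\mapsto e^{tX}x_0$ be the unique maximal solution of $\dot x=a(x)$, $x(0)=x_0$; it is defined for all $t\in\mathbb{R}$. The group $T$ is $(T_t\varphi)(y)=\varphi(e^{-tX}y)$, $t\in\mathbb{R}$, and the semigroup $S$ is $$S_t=(4\pi t)^{-1/2}\int_{-\infty}^\infty ds\,e^{-s^2(4t)^{-1}}\,T_s\qquad(t>0)$$ (weak$^*$ integral), both on $L_\infty(\mathbb{R})$. Its kernel $K_t$ is defined by $(S_t\varphi)(x)=\int K_t(x;y)\varphi(y)\,dy$. ''Extends to $L_p$'' means: for each $t$ the restriction of the operator to $L_p\cap L_\infty$ extends to a bounded operator on $L_p(\mathbb{R};dx)$, and these operators form the group (semigroup) in question; $\|\cdot\|_{p\to p}$ is the operator norm on $L_p(\mathbb{R};dx)$. The generator $H$ of $S$ is taken with the convention $S_t=e^{-tH}$, i.e. $H\varphi=\lim_{t\downarrow0}t^{-1}(I-S_t)\varphi$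 (weak$^*$ limit if $p=\infty$); on $C_c^\infty(\mathbb{R})\subseteq D(H)$ it acts by $H\varphi=H_{\min}\varphi=-a(a\varphi')'$. $(\cdot,\cdot)$ is the inner product of $L_2(\mathbb{R};dx)$, and the $L_2$-numerical range is $\Theta(H)=\{(\varphi,H\varphi):\varphi\in D(H),\ \|\varphi\|_2=1\}$. A bounded holomorphic extension to the open right half-plane is a holomorphic extension that is bounded on each sector $\{z\ne0:|\arg z|<\theta\}$ with $\theta<\pi/2$. $H$ is of type $S_{0+}$ if $\sigma(H)\subseteq[0,\infty)$ and, for each $\theta\in(0,\pi)$, $\|\lambda(\lambda I-H)^{-1}\|$ is bounded uniformly for all $\lambda\neq0$ with $|\arg\lambda|\ge\theta$. $H$ is sectorial (on $L_2$) if its numerical range is contained in a sector $\{z:|\arg(z-\gamma)|\le\theta\}\cup\{\gamma\}$ with $\gamma\in\mathbb{R}$ and $\theta<\pi/2$. *)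

(* Defs.v *)
From mathcomp Require Import all_boot all_order all_algebra.
From mathcomp Require Import all_classical all_reals all_analysis.
From mathcomp Require Import complex.

Set Implicit Arguments.
Unset Strict Implicit.
Unset Printing Implicit Defensive.

Import Order.TTheory GRing.Theory Num.Theory.
Import numFieldNormedType.Exports.
Import complex.

Local Open Scope ring_scope.
Local Open Scope classical_set_scope.
Local Open Scope complex_scope.

(* All function spaces are spaces of complex-valued functions on the line.
   Elements of L_p are handled through Borel measurable representatives
   [f : R -> R[i]]; equalities between them are almost everywhere equalities. *)

Definition smooth (R : realType) (f : R -> R) : Prop :=
  forall (n : nat) (x : R), derivable f^`(n) x 1.

Section coefficient.
Variables (R : realType) (chi : R -> R).

Definition bump_term (n : nat) (x : R) : R :=
  chi (n%:R * (x - 16 * n%:R)) - chi (n%:R * (x - (16 * n%:R + 8))).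

Definition bump_partial_sum (x : R) (N : nat) : R :=
  \sum_(1 <= n < N) bump_term n x.

Definition coeff (x : R) : R := 1 + limn (bump_partial_sum x).

End coefficient.

Section flow.
Variables (R : realType) (a : R -> R).

Definition integral_curve (I : set R) (x0 : R) (g : R -> R) : Prop :=
  g 0 = x0 /\ forall t, I t -> is_derive t (1 : R) g (a (g t)).

(* [flow t x0] is e^{tX} x0.  The choice is meaningful as soon as
   [flow_well_defined] holds: the maximal solution is then defined on the whole
   line and is the only one. *)
Definition flow (t x0 : R) : R :=
  xget (fun=> 0) [set g | integral_curve setT x0 g] t.

Definition flow_well_defined : Prop :=
  forall x0,
    integral_curve setT x0 (flow ^~ x0) /\
    forall (I : set R) (g : R -> R), is_interval I -> open I -> I 0 ->
      integral_curve I x0 g -> forall t, I t -> g t = flow t x0.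

(* The oriented integral of 1/a from x to y, in absolute value. *)
Definition dist (x y : R) : R :=
  `| if x <= y then \int[lebesgue_measure]_(z in `[x, y]) (a z)^-1
     else - \int[lebesgue_measure]_(z in `[y, x]) (a z)^-1 |.

End flow.

Section complex_functions.
Variable R : realType.
Local Notation C := R[i].
Local Notation mu := (@lebesgue_measure R).
Implicit Types (f g : R -> C) (z : C) (p : \bar R).

Definition cmeasurable f : Prop :=
  measurable_fun setT (fun x => complex.Re (f x)) /\
  measurable_fun setT (fun x => complex.Im (f x)).

Definition cintegrable f : Prop :=
  mu.-integrable setT (fun x => (complex.Re (f x))%:E) /\
  mu.-integrable setT (fun x => (complex.Im (f x))%:E).

Definition cint f : C :=
  (\int[mu]_x complex.Re (f x)) +i* (\int[mu]_x complex.Im (f x)).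

Definition cderive f (x : R) : C :=
  ((fun y => complex.Re (f y))^`() x) +i* ((fun y => complex.Im (f y))^`() x).

Definition csmooth f : Prop :=
  smooth (fun x => complex.Re (f x)) /\ smooth (fun x => complex.Im (f x)).

Definition Ccinfty f : Prop :=
  csmooth f /\ compact (closure [set x | f x <> 0]).

(* The argument with values in ]-pi, pi]; meaningless at 0. *)
Definition arg z : R :=
  (if 0 <= complex.Im z then 1 else -1) *
  acos (complex.Re z / Normc.normc z).

Definition Lpnorm p f : \bar R :=
  Lnorm mu p (fun x => (Normc.normc (f x))%:E).

Definition Lp p f : Prop := cmeasurable f /\ (Lpnorm p f < +oo)%E.

Definition dual_pairing f g : C := cint (fun x => f x * g x).

Definition inner f g : C := cint (fun x => (f x)^*%C * g x).

End complex_functions.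

Section operators.
Variable R : realType.
Local Notation C := R[i].
Local Notation mu := (@lebesgue_measure R).
Local Notation op := ((R -> C) -> (R -> C)).
Implicit Types (f g : R -> C) (z lam : C) (p : \bar R) (U V : op).

Definition bounded_op p U : Prop :=
  [/\ forall f, Lp p f -> Lp p (U f),
      forall c f g, Lp p f -> Lp p g ->
        U (fun x => c * f x + g x) = (fun x => c * U f x + U g x) %[ae mu]
    & exists M : R, forall f, Lp p f ->
        (Lpnorm p (U f) <= M%:E * Lpnorm p f)%E].

Definition opnorm p U : \bar R :=
  ereal_sup [set Lpnorm p (U f) | f in [set f | Lp p f /\ (Lpnorm p f <= 1)%E]].

(* [V] extends to L_p the restriction of [U] to the intersection of L_p and
   L_infinity. *)
Definition is_Lp_extension p U V : Prop :=
  bounded_op p V /\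
  forall f, Lp p f -> Lp +oo%E f -> V f = U f %[ae mu].

Definition Lp_extension p U : op :=
  xget (idfun : op) [set V | is_Lp_extension p U V].

Definition C0_group p (U : R -> op) : Prop :=
  [/\ forall t, bounded_op p (U t),
      forall f, Lp p f -> U 0 f = f %[ae mu],
      forall s t f, Lp p f -> U (s + t) f = U s (U t f) %[ae mu]
    & forall f, Lp p f -> forall t0,
        Lpnorm p (fun x => U t f x - U t0 f x) @[t --> t0] --> (0 : \bar R)].

(* The family is only used for t > 0, with the implicit convention U_0 = I. *)
Definition C0_semigroup p (U : R -> op) : Prop :=
  [/\ forall t, 0 < t -> bounded_op p (U t),
      forall s t f, 0 < s -> 0 < t -> Lp p f ->
        U (s + t) f = U s (U t f) %[ae mu],
      forall f, Lp p f -> forall t0, 0 < t0 ->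
        Lpnorm p (fun x => U t f x - U t0 f x) @[t --> t0] --> (0 : \bar R)
    & forall f, Lp p f ->
        Lpnorm p (fun x => U t f x - f x) @[t --> 0^'+] --> (0 : \bar R)].

(* An unbounded operator on L_p is given by its graph. *)
Local Notation graph := ((R -> C) -> (R -> C) -> Prop).

(* The graph of H, where U_t = e^{-tH}: a strong limit if p is finite, a weak*
   limit (L_infinity being the dual of L_1) if p is infinite. *)
Definition generator p (U : R -> op) : graph := fun f g =>
  [/\ Lp p f, Lp p g
    & if p == +oo%E then
        forall psi, Lp 1%E psi ->
          Normc.normc (dual_pairing (fun x => (t^-1)%:C * (f x - U t f x)) psi
                       - dual_pairing g psi) @[t --> 0^'+] --> (0 : R)
      else
        Lpnorm p (fun x => (t^-1)%:C * (f x - U t f x) - g x)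
          @[t --> 0^'+] --> (0 : \bar R)].

(* [V] is the inverse of lambda I - H. *)
Definition is_resolvent p (H : graph) lam V : Prop :=
  [/\ bounded_op p V,
      forall f, Lp p f -> exists2 h, H (V f) h &
        (fun x => lam * V f x - h x) = f %[ae mu]
    & forall f h, H f h -> V (fun x => lam * f x - h x) = f %[ae mu]].

Definition spectrum p (H : graph) : set C :=
  [set lam | ~ exists V, is_resolvent p H lam V].

Definition numerical_range (H : graph) : set C :=
  [set z | exists f h, [/\ H f h, Lpnorm 2%:E f = 1%E & z = inner f h]].

Definition sectorial (H : graph) : Prop :=
  exists gamma theta : R, theta < pi / 2 /\
    forall z, numerical_range H z ->
      z = gamma%:C \/ `|arg (z - gamma%:C)| <= theta.

Definition type_S0plus p (H : graph) : Prop :=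
  (forall lam, spectrum p H lam -> exists2 r : R, 0 <= r & lam = r%:C) /\
  forall theta : R, 0 < theta < pi ->
    exists M : R, forall lam, lam <> 0 -> theta <= `|arg lam| ->
      exists2 V, is_resolvent p H lam V &
        (opnorm p (fun f x => (lam * V f x)%R) <= M%:E)%E.

(* Holomorphy is complex differentiability for the operator norm. *)
Definition has_bounded_holomorphic_extension p (U : R -> op) : Prop :=
  exists V : C -> op,
  [/\ forall z, 0 < complex.Re z -> bounded_op p (V z),
      forall t : R, 0 < t -> forall f, Lp p f -> V t%:C f = U t f %[ae mu],
      forall z0, 0 < complex.Re z0 -> exists2 D : op, bounded_op p D &
        forall e : R, 0 < e -> exists2 d : R, 0 < d &
          forall z, 0 < complex.Re z -> Normc.normc (z - z0) < d ->
            (opnorm p (fun f x =>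
                       (V z f x - V z0 f x - (z - z0) * D f x)%R)
              <= (e * Normc.normc (z - z0))%:E)%E
    & forall theta : R, theta < pi / 2 -> exists M : R,
        forall z, z <> 0 -> `|arg z| < theta -> (opnorm p (V z) <= M%:E)%E].

End operators.

Section vector_field.
Variables (R : realType) (a : R -> R).
Local Notation C := R[i].
Local Notation mu := (@lebesgue_measure R).
Local Notation op := ((R -> C) -> (R -> C)).
Implicit Types (f g phi psi : R -> C) (p : \bar R).

Definition Xop phi : R -> C := fun x => (a x)%:C * cderive phi x.

Definition Hmin phi : R -> C := fun x => - Xop (Xop phi) x.

Definition Tgroup (t : R) : op := fun phi y => phi (flow a (- t) y).

(* [g] is the weak* integral defining S_t phi. *)
Definition is_Ssemigroup (t : R) phi g : Prop :=
  Lp +oo%E g /\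
  forall psi, Lp 1%E psi ->
    let F := fun s : R =>
      (expR (- (s ^+ 2 * (4 * t)^-1)))%:C * dual_pairing (Tgroup s phi) psi in
    cintegrable F /\
    dual_pairing g psi = ((4 * pi * t) `^ (- 2^-1))%:C * cint F.

Definition Ssemigroup (t : R) : op := fun phi => xget (fun=> 0) [set g | is_Ssemigroup t phi g].

Definition Tgroup_Lp p (t : R) : op := Lp_extension p (Tgroup t).

Definition Ssemigroup_Lp p (t : R) : op :=
  if p == +oo%E then Ssemigroup t else Lp_extension p (Ssemigroup t).

Definition Hgen p : (R -> C) -> (R -> C) -> Prop := generator p (Ssemigroup_Lp p).

(* A kernel is determined up to a null set only; pointwise statements are about
   its continuous version, which is unique. *)
Definition is_kernel (t : R) (K : R -> R -> R) : Prop :=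
  [/\ continuous (fun z : R * R => K z.1 z.2),
      forall x, mu.-integrable setT (fun y => (K x y)%:E)
    & forall phi, Lp +oo%E phi ->
        Ssemigroup t phi = (fun x => cint (fun y => (K x y)%:C * phi y)) %[ae mu]].

End vector_field.

(* Main.v *)
(* Let Phi(x) be the integral of 1/a from 0 to x.  In the coordinate u = Phi(x)
   the flow of X is translation, T is the translation group, S is the heat
   semigroup and H = - d^2/du^2; since 1 <= a <= 4, composition with
   Psi = Phi^-1 is an isomorphism between L_p(dx) and L_p(du) of norm at most 1
   whose inverse has norm at most 4^(1/p).  Boundedness, strong continuity,
   kernel bounds, holomorphy and the spectrum [0, oo) are thus those of
   convolution with the Gaussian kernel.  For p = oo and p < oo alike the
   resolvent off [0, oo) is convolution with - e^{- nu |u|} / (2 nu),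
   nu = sqrt(- lambda), and the points of [0, oo) are approximate eigenvalues.

   The numerical range is not invariant under this change of coordinates.  On
   the n-th bump a is the profile b = 1 + chi squeezed by the factor n, so that
   a test function squeezed in the same way has its form (phi, H phi) /
   (phi, phi) multiplied by n^2.  For u = 8 - chi cut off at a large distance,
   the form is - (integral of b (7 - 2 chi) chi'^2) + small < 0, and adding
   i epsilon s u gives it an imaginary part of either sign.  Adding a test
   function supported where a = 1 then reaches every complex number. *)

(* The heat semigroup is never differentiated in time. Averaging the second differences of g against
   the even Gaussian gives e^{-tH} g - g = rho_t * g'' (convolution), where rho_t is half the
   Gaussian average of tents, has mass t, and rho_t / t is an approximate identity. This single
   identity puts into the domain of H both the C^2 functions and the convolutions with the resolvent
   kernel, whose second derivative carries a Dirac mass.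

   The form of H can be negative because X^2 is not symmetric for dx: by parts it is the integral of
   (u b)' b u', and the term b b' u u' is negative where u decreases while b increases. For u = 8 -
   chi the bracket (u b)' is (7 - 2 chi) chi', and the 8 keeps 7 - 2 chi >= 1 for chi <= 3.

   To hit a given number with a function of norm 1, note that form values depend on n s^2 and l t^2,
   squared norms on s^2 / n and t^2 / l, for amplitudes s, t at scales n, l. Fixing n s^2 and l t^2
   fixes the value and leaves n and l free to normalise. *)
From HB Require Import structures.
Require Import Defs.
From mathcomp Require Import all_boot all_order all_algebra.
From mathcomp Require Import all_classical all_reals all_analysis.
From mathcomp Require Import measurable_realfun ess_sup_inf complex ring lra.
Import Order.TTheory GRing.Theory Num.Theory.
Import numFieldNormedType.Exports.
Local Open Scope ring_scope.
Local Open Scope classical_set_scope.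
Local Open Scope complex_scope.
Set Implicit Arguments.
Unset Strict Implicit.
Unset Printing Implicit Defensive.

(** * Change of variables *)

Section change_of_variables.
Variable R : realType.
Local Notation mu := (@lebesgue_measure R).
Local Open Scope ereal_scope.
Variables (theta : R -> R) (w : R -> R).
Hypothesis mtheta : measurable_fun setT theta.
Hypothesis mw : measurable_fun setT w.
Hypothesis w0 : forall x, (0 <= w x)%R.

Definition weighted_pushforward (A : set (measurableTypeR R)) : \bar R :=
  \int[mu]_(x in theta @^-1` A) (w x)%:E.

Let nu0 : weighted_pushforward set0 = 0.
Proof. by rewrite /weighted_pushforward preimage_set0 integral_set0. Qed.

Let nu_ge0 A : 0 <= weighted_pushforward A.
Proof. by apply: integral_ge0 => x _; rewrite lee_fin. Qed.

Let mpre (A : set (measurableTypeR R)) : measurable A ->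
  @measurable _ (measurableTypeR R) (theta @^-1` A).
Proof. by move=> mA; rewrite -[_ @^-1` _]setTI; exact: mtheta. Qed.

Let nu_sigma_additive :
  semi_sigma_additive weighted_pushforward.
Proof.
move=> F mF tF mUF; rewrite /weighted_pushforward preimage_bigcup.
rewrite ge0_integral_bigcup//.
- apply: is_cvg_ereal_nneg_natsum_cond => n _ _; exact: nu_ge0.
- by move=> k; exact: mpre.
- apply/measurable_EFinP; exact: measurable_funTS.
- by move=> x _; rewrite lee_fin.
- apply/trivIsetP => i j _ _ ij; rewrite -preimage_setI.
  by move/trivIsetP : tF => ->//; rewrite preimage_set0.
Qed.

HB.instance Definition _ := isMeasure.Build _ _ _
  weighted_pushforward nu0 nu_ge0 nu_sigma_additive.

Hypothesis nu_itv : forall a b : R, (a <= b)%R ->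
  weighted_pushforward `]a, b] = (b - a)%:E.

Let nuE A : measurable A -> mu A = weighted_pushforward A.
Proof.
pose nu : {measure set (measurableTypeR R) -> \bar R} := weighted_pushforward.
apply: (@lebesgue_measure_unique _ nu) => _ [[a b]] _ <-.
rewrite [RHS](_ : _ = weighted_pushforward `]a, b])//.
rewrite lebesgue_measure_itv/= lte_fin; case: ltP => ab.
  by rewrite nu_itv ?ltW// EFinB.
by rewrite set_itv_ge ?bnd_simp -?leNgt// nu0.
Qed.

Import HBNNSimple.

(** Only the weight of preimages of intervals is assumed, no differentiability of theta. Uniqueness
    of Lebesgue measure extends this to Borel sets, hence to simple functions, and monotone
    convergence does the rest. *)
Lemma ge0_change_of_variables (f : R -> \bar R) :
  measurable_fun setT f -> (forall x, 0 <= f x) ->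
  \int[mu]_x (f (theta x) * (w x)%:E) = \int[mu]_x f x.
Proof.
move=> mf f0.
pose f_ := nnsfun_approx measurableT mf.
have mwE : measurable_fun setT (EFin \o w) by exact/measurable_EFinP.
have mfth n : measurable_fun setT (f_ n \o theta).
  by apply: measurableT_comp.
have mfthE n : measurable_fun setT (fun x => (f_ n (theta x))%:E).
  by apply/measurable_EFinP; exact: mfth.
have mf_ n : measurable_fun setT (fun x : R => f_ n x) by exact: measurable_funP.
have mf_E n : measurable_fun setT (fun x : R => (f_ n x)%:E).
  by apply/measurable_EFinP; exact: mf_.
have ndf m n (x : R) : (m <= n)%N -> (f_ m x <= f_ n x)%R.
  by move=> mn; move: x; apply/lefP; exact: nd_nnsfun_approx.
have cf x : (f_ n x)%:E @[n --> \oo] --> f x.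
  by apply: cvg_nnsfun_approx => // y _; exact: f0.
transitivity (limn (fun n => \int[mu]_x ((f_ n (theta x))%:E * (w x)%:E))).
  rewrite -monotone_convergence//.
  - apply: eq_integral => x _; apply/esym/cvg_lim => //.
    by apply: cvgeMr => //; exact: cf.
  - by move=> n; apply: emeasurable_funM => //; exact: mfthE.
  - by move=> n x _; rewrite -EFinM lee_fin mulr_ge0.
  - move=> x _ m n mn; rewrite -!EFinM lee_fin ler_wpM2r//.
    exact: ndf.
transitivity (limn (fun n => \int[mu]_x (f_ n x)%:E)); last first.
  rewrite -monotone_convergence//.
  - by apply: eq_integral => x _; apply/cvg_lim => //; exact: cf.
  - by move=> n x _; rewrite lee_fin.
  - by move=> x _ m n mn; rewrite lee_fin; exact: ndf.
congr (limn _); apply/funext => n.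
have m1 k : measurable (f_ n @^-1` [set k]).
  by rewrite -[_ @^-1` _]setTI; exact: measurable_funP.
have m1th k : measurable_fun setT (fun x => \1_(f_ n @^-1` [set k]) (theta x) : R).
  by apply: measurableT_comp => //; exact: measurable_indic.
have mk1th k : measurable_fun setT
    (fun x => k * \1_(f_ n @^-1` [set k]) (theta x) : R)%R.
  by apply: measurable_funM => //; exact: m1th.
have m1w k : measurable_fun setT
    (fun x => (\1_(f_ n @^-1` [set k]) (theta x) * w x)%:E : \bar R).
  by apply/measurable_EFinP; apply: measurable_funM => //; exact: m1th.
have mk1E k : measurable_fun setT
    (fun x : R => (k * \1_(f_ n @^-1` [set k]) x)%:E : \bar R).
  by apply/measurable_EFinP; apply: measurable_funM => //; exact: measurable_indic.
have m1E k : measurable_fun setT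
    (fun x => (\1_(f_ n @^-1` [set k]) x)%:E : \bar R).
  by apply/measurable_EFinP; exact: measurable_indic.
transitivity (\sum_(k \in range (f_ n))
    \int[mu]_x (k * \1_(f_ n @^-1` [set k]) (theta x) * w x)%:E).
  rewrite -ge0_integral_fsum//.
  - apply: eq_integral => x _.
    by rewrite fsumEFin// -EFinM {1}(fimfunE (f_ n)) !fsbig_finite//= mulr_suml.
  - move=> k; apply/measurable_EFinP; apply: measurable_funM => //.
    exact: mk1th.
  - move=> k x _; rewrite EFinM mule_ge0 ?lee_fin//.
    by rewrite -lee_fin; exact: nnfun_muleindic_ge0.
transitivity (\sum_(k \in range (f_ n))
    \int[mu]_x (k * \1_(f_ n @^-1` [set k]) x)%:E); last first.
  rewrite -ge0_integral_fsum//.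
  - by apply: eq_integral => x _; rewrite fsumEFin// -fimfunE.
  - by move=> k x _; exact: nnfun_muleindic_ge0.
apply: eq_fsbigr => k; rewrite inE => -[y _ <-].
under eq_integral do rewrite -mulrA EFinM.
under [RHS]eq_integral do rewrite EFinM.
rewrite !ge0_integralZl_EFin//; last 3 first.
- exact: m1E.
- by move=> x _; rewrite lee_fin mulr_ge0.
- exact: m1w.
congr (_ * _).
transitivity (mu (f_ n @^-1` [set f_ n y])); last first.
  rewrite -[in LHS](setIT (f_ n @^-1` [set f_ n y])).
  apply/esym.
  exact: (@integral_indic _ (measurableTypeR R) R mu setT measurableT _ (m1 _)).
apply: (etrans _ (esym (nuE (m1 _)))).
rewrite /weighted_pushforward [RHS]integral_mkcond; apply: eq_integral => x _.
rewrite patchE indicE (_ : (x \in _) = (theta x \in f_ n @^-1` [set f_ n y]))//.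
by case: (theta x \in _); rewrite ?mul1r ?mul0r.
Qed.
End change_of_variables.

(** * Affine substitutions *)

Section affine_change.
Variable R : realType.
Local Notation mu := (@lebesgue_measure R).
Local Open Scope ereal_scope.

Lemma ge0_integral_affine (f : R -> \bar R) (c d : R) : c != 0%R ->
  measurable_fun setT f -> (forall x, 0 <= f x) ->
  \int[mu]_x (f (c * x + d)%R * `|c|%:E) = \int[mu]_x f x.
Proof.
move=> c0 mf f0.
have mth : measurable_fun setT (fun x : R => c * x + d)%R.
  by apply: measurable_funD => //; exact: measurable_funM.
apply: (@ge0_change_of_variables R (fun x => c * x + d)%R (cst `|c|%R)) => //.
move=> a b ab; rewrite /weighted_pushforward.
rewrite -[LHS]/(\int[mu]_(x in _) cst (`|c|%:E) x) integral_cst//; last first.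
  by rewrite -[_ @^-1` _]setTI; apply: mth.
have [cgt0|clt0|ceq0] := ltrgt0P c; last by rewrite ceq0 eqxx in c0.
- rewrite (_ : _ @^-1` _ = [set` `](a - d) / c, (b - d) / c]%R]); last first.
    apply/seteqP; split => x /=; rewrite !in_itv/=.
      by move=> /andP[h1 h2]; rewrite ltr_pdivrMr// ler_pdivlMr//; lra.
    by rewrite ltr_pdivrMr// ler_pdivlMr// => /andP[h1 h2]; lra.
  rewrite [X in _ * X]lebesgue_measure_itv/= lte_fin ltr_pM2r ?invr_gt0// ltrD2r.
  case: ltP => h; first by rewrite -EFinB -EFinM; congr (_%:E); field.
  by rewrite mule0 (_ : b = a) ?subrr//; apply/eqP; rewrite eq_le ab h.
(* A negative slope exchanges the open and the closed end of the interval. *)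
- rewrite (_ : _ @^-1` _ = [set` `[(b - d) / c, (a - d) / c[%R]); last first.
    apply/seteqP; split => x /=; rewrite !in_itv/=.
      by move=> /andP[h1 h2]; rewrite ltr_ndivlMr// ler_ndivrMr//; lra.
    by rewrite ltr_ndivlMr// ler_ndivrMr// => /andP[h1 h2]; lra.
  rewrite [X in _ * X]lebesgue_measure_itv/= lte_fin ltr_nM2r ?invr_lt0// ltrD2r.
  case: ltP => h; first by rewrite -EFinB -EFinM; congr (_%:E); field.
  by rewrite mule0 (_ : b = a) ?subrr//; apply/eqP; rewrite eq_le ab h.
Qed.

Lemma ge0_integral_shift (f : R -> \bar R) (d : R) :
  measurable_fun setT f -> (forall x, 0 <= f x) ->
  \int[mu]_x f (x + d)%R = \int[mu]_x f x.
Proof.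
move=> mf f0; rewrite -(ge0_integral_affine d (oner_neq0 R) mf f0).
by apply: eq_integral => x _; rewrite normr1 mule1 mul1r.
Qed.

Lemma ge0_integral_reflect (f : R -> \bar R) (d : R) :
  measurable_fun setT f -> (forall x, 0 <= f x) ->
  \int[mu]_x f (d - x)%R = \int[mu]_x f x.
Proof.
move=> mf f0.
have N1 : (-1 : R)%R != 0%R by rewrite oppr_eq0 oner_eq0.
rewrite -(ge0_integral_affine d N1 mf f0).
by apply: eq_integral => x _; rewrite normrN normr1 mule1 mulN1r addrC.
Qed.

End affine_change.

(** * Integration of complex-valued functions *)

Notation normc := Normc.normc.

Section complex_numbers.
Variable R : realType.
Local Notation C := R[i].
Implicit Types z w : C.

Lemma ReD z w : complex.Re (z + w) = complex.Re z + complex.Re w.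
Proof. by case: z w => ? ? [? ?]. Qed.
Lemma ImD z w : complex.Im (z + w) = complex.Im z + complex.Im w.
Proof. by case: z w => ? ? [? ?]. Qed.
Lemma ReN z : complex.Re (- z) = - complex.Re z.
Proof. by case: z. Qed.
Lemma ImN z : complex.Im (- z) = - complex.Im z.
Proof. by case: z. Qed.
Lemma ReB z w : complex.Re (z - w) = complex.Re z - complex.Re w.
Proof. by rewrite ReD ReN. Qed.
Lemma ImB z w : complex.Im (z - w) = complex.Im z - complex.Im w.
Proof. by rewrite ImD ImN. Qed.
Lemma ReM z w : complex.Re (z * w) =
  complex.Re z * complex.Re w - complex.Im z * complex.Im w.
Proof. by case: z w => ? ? [? ?]. Qed.
Lemma ImM z w : complex.Im (z * w) =
  complex.Re z * complex.Im w + complex.Im z * complex.Re w.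
Proof. by case: z w => ? ? [? ?]. Qed.
Lemma ReZ (a : R) z : complex.Re (a%:C * z) = a * complex.Re z.
Proof. by rewrite ReM /= mul0r subr0. Qed.
Lemma ImZ (a : R) z : complex.Im (a%:C * z) = a * complex.Im z.
Proof. by rewrite ImM /= mul0r addr0. Qed.
Lemma ReJ z : complex.Re (z^*)%C = complex.Re z.
Proof. by case: z. Qed.
Lemma ImJ z : complex.Im (z^*)%C = - complex.Im z.
Proof. by case: z. Qed.

Definition ReImE := (ReD, ImD, ReN, ImN, ReZ, ImZ, ReM, ImM, ReJ, ImJ).

Lemma complex_ext z w : complex.Re z = complex.Re w ->
  complex.Im z = complex.Im w -> z = w.
Proof. by case: z w => ? ? [? ?] /= -> ->. Qed.

Lemma normcE z : normc z = Num.sqrt (complex.Re z ^+ 2 + complex.Im z ^+ 2).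
Proof. by case: z. Qed.

Lemma sqr_normc z : normc z ^+ 2 = complex.Re z ^+ 2 + complex.Im z ^+ 2.
Proof. by rewrite normcE sqr_sqrtr// addr_ge0 ?sqr_ge0. Qed.

Lemma normc_ge0 z : 0 <= normc z.
Proof. by rewrite normcE sqrtr_ge0. Qed.

Lemma normc_real (a : R) : normc a%:C = `|a|.
Proof. by rewrite normcE/= expr0n addr0 sqrtr_sqr. Qed.

Lemma normc_triangle z w : normc (z + w) <= normc z + normc w.
Proof. exact: le_normcD. Qed.

Lemma normcBC z w : normc (z - w) = normc (w - z).
Proof. by rewrite -normcN opprB. Qed.

Lemma normc_dist z w : normc (z - w) <= normc z + normc w.
Proof. by rewrite -(normcN w) normc_triangle. Qed.

Lemma normcJ z : normc (z^*)%C = normc z.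
Proof. by rewrite !normcE ReJ ImJ sqrrN. Qed.

Lemma normc_eq0 z : normc z = 0 <-> z = 0.
Proof. by split; [exact: Normc.eq0_normc|move=> ->; exact: Normc.normc0]. Qed.

Lemma ler_normRe z : `|complex.Re z| <= normc z.
Proof.
rewrite -sqrtr_sqr normcE ler_sqrt ?addr_ge0 ?sqr_ge0//.
by rewrite lerDl sqr_ge0.
Qed.

Lemma ler_normIm z : `|complex.Im z| <= normc z.
Proof.
rewrite -sqrtr_sqr normcE ler_sqrt ?addr_ge0 ?sqr_ge0//.
by rewrite lerDr sqr_ge0.
Qed.

Lemma normc_le_ReIm z : normc z <= `|complex.Re z| + `|complex.Im z|.
Proof.
rewrite -(ger0_norm (normc_ge0 z)) -(@ler_pXn2r _ 2%N) ?nnegrE ?addr_ge0//.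
rewrite ger0_norm ?normc_ge0// sqr_normc sqrrD !real_normK ?num_real//.
by rewrite -addrA lerD2l lerDr mulrn_wge0 ?mulr_ge0.
Qed.

Lemma mulc_conj z : z * (z^*)%C = (normc z ^+ 2)%:C.
Proof. by apply: complex_ext; rewrite !ReImE/= ?sqr_normc; ring. Qed.

Lemma conjc_mul z : (z^*)%C * z = (normc z ^+ 2)%:C.
Proof. by rewrite mulrC mulc_conj. Qed.

Lemma exists_phase z : exists2 u : C, normc u = 1 & u * z = (normc z)%:C.
Proof.
have [->|z0] := eqVneq z 0.
  by exists 1; rewrite ?Normc.normc1// mulr0 Normc.normc0.
have nz0 : normc z != 0 by apply/eqP => /normc_eq0/eqP; apply/negP.
exists ((normc z)^-1%:C * (z^*)%C).
  by rewrite Normc.normcM normcJ normc_real ger0_norm ?invr_ge0 ?normc_ge0// mulVf.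
rewrite -mulrA conjc_mul; apply: complex_ext; rewrite !ReImE/=; first by field.
by rewrite mulr0.
Qed.

End complex_numbers.

Section complex_measurability.
Context d (T : measurableType d) (R : realType).
Local Notation C := R[i].
Implicit Types f g : T -> C.

(** [cmeasurable] over an arbitrary measurable space; Fubini needs it on the plane. *)
Definition cmf f := measurable_fun setT (fun x => complex.Re (f x)) /\
  measurable_fun setT (fun x => complex.Im (f x)).

Lemma cmf_cst (c : C) : cmf (fun=> c).
Proof. by split; exact: measurable_cst. Qed.

Lemma cmfD f g : cmf f -> cmf g -> cmf (fun x => f x + g x).
Proof.
move=> [f1 f2] [g1 g2]; split.
  by under eq_fun do rewrite ReD; exact: measurable_funD.
by under eq_fun do rewrite ImD; exact: measurable_funD.
Qed.

Lemma cmfN f : cmf f -> cmf (fun x => - f x).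
Proof.
move=> [f1 f2]; split.
  by under eq_fun do rewrite ReN; exact: measurable_funN.
by under eq_fun do rewrite ImN; exact: measurable_funN.
Qed.

Lemma cmfB f g : cmf f -> cmf g -> cmf (fun x => f x - g x).
Proof. by move=> mf mg; apply: cmfD => //; exact: cmfN. Qed.

Lemma cmfM f g : cmf f -> cmf g -> cmf (fun x => f x * g x).
Proof.
move=> [f1 f2] [g1 g2]; split.
  under eq_fun do rewrite ReM.
  by apply: measurable_funB; apply: measurable_funM.
under eq_fun do rewrite ImM.
by apply: measurable_funD; apply: measurable_funM.
Qed.

Lemma cmfZ (c : C) f : cmf f -> cmf (fun x => c * f x).
Proof. by move=> mf; apply: cmfM => //; exact: cmf_cst. Qed.

Lemma cmf_real (f : T -> R) : measurable_fun setT f -> cmf (fun x => (f x)%:C).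
Proof. by move=> mf; split => //=; exact: measurable_cst. Qed.

Lemma cmfJ f : cmf f -> cmf (fun x => (f x)^*%C).
Proof.
move=> [f1 f2]; split.
  by under eq_fun do rewrite ReJ.
by under eq_fun do rewrite ImJ; exact: measurable_funN.
Qed.

Lemma measurable_normc f : cmf f -> measurable_fun setT (fun x => normc (f x)).
Proof.
move=> [f1 f2]; under eq_fun do rewrite normcE.
have ms : measurable_fun setT (@Num.sqrt R).
  by apply: continuous_measurable_fun => x; exact: sqrt_continuous.
have mg : measurable_fun setT
    (fun x => complex.Re (f x) ^+ 2 + complex.Im (f x) ^+ 2).
  by apply: measurable_funD; apply: measurable_funX.
exact: (measurableT_comp ms mg).
Qed.

Lemma measurable_normcE f : cmf f ->
  measurable_fun setT (fun x => (normc (f x))%:E).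
Proof. by move=> mf; apply/measurable_EFinP; exact: measurable_normc. Qed.

End complex_measurability.

Lemma cmf_comp d (T : measurableType d) d' (T' : measurableType d')
    (R : realType) (f : T -> R[i]) (g : T' -> T) :
  measurable_fun setT g -> cmf f -> cmf (fun x => f (g x)).
Proof.
by move=> mg [f1 f2]; split; [exact: (measurableT_comp f1 mg)|
  exact: (measurableT_comp f2 mg)].
Qed.

Section almost_everywhere_combinators.
Context d (T : measurableType d) (R : realType) (mu : {measure set T -> \bar R}).

Lemma aeS (P Q : T -> Prop) : (forall x, P x -> Q x) ->
  (\forall x \ae mu, P x) -> (\forall x \ae mu, Q x).
Proof. exact: (@filterS _ _ (ae_filter_ringOfSetsType mu)). Qed.

Lemma aeS2 (P Q S : T -> Prop) : (forall x, P x -> Q x -> S x) ->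
  (\forall x \ae mu, P x) -> (\forall x \ae mu, Q x) -> (\forall x \ae mu, S x).
Proof. exact: (@filterS2 _ _ (ae_filter_ringOfSetsType mu)). Qed.

Lemma aeS3 (P Q S U : T -> Prop) : (forall x, P x -> Q x -> S x -> U x) ->
  (\forall x \ae mu, P x) -> (\forall x \ae mu, Q x) -> (\forall x \ae mu, S x) ->
  (\forall x \ae mu, U x).
Proof. exact: (@filterS3 _ _ (ae_filter_ringOfSetsType mu)). Qed.

End almost_everywhere_combinators.

Section complex_integral.
Variable R : realType.
Local Notation C := R[i].
Local Notation mu := (@lebesgue_measure R).
Implicit Types f g : R -> C.

Definition nint f : \bar R := (\int[mu]_x (normc (f x))%:E)%E.

Lemma nint_ge0 f : (0 <= nint f)%E.
Proof. by apply: integral_ge0 => x _; rewrite lee_fin normc_ge0. Qed.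

Lemma le_nint f g : cmeasurable g -> (forall x, normc (f x) <= normc (g x)) ->
  cmeasurable f -> (nint f <= nint g)%E.
Proof.
move=> mg fg mf; apply: ge0_le_integral => //.
- by move=> x _; rewrite lee_fin normc_ge0.
- exact: measurable_normcE.
- exact: measurable_normcE.
- by move=> x _; rewrite lee_fin.
Qed.

Lemma cintegrableP f :
  cintegrable f <-> cmeasurable f /\ (nint f < +oo)%E.
Proof.
split.
- move=> [/integrableP[m1 i1] /integrableP[m2 i2]].
  have {}m1 : measurable_fun setT (fun x => complex.Re (f x)).
    by apply/measurable_EFinP; exact: m1.
  have {}m2 : measurable_fun setT (fun x => complex.Im (f x)).
    by apply/measurable_EFinP; exact: m2.
  have mf : cmeasurable f by [].
  split => //.
  have n1 : measurable_fun setT (fun x => `|complex.Re (f x)|%:E : \bar R).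
    by apply/measurable_EFinP; exact: measurableT_comp.
  have n2 : measurable_fun setT (fun x => `|complex.Im (f x)|%:E : \bar R).
    by apply/measurable_EFinP; exact: measurableT_comp.
  apply: (@le_lt_trans _ _ (\int[mu]_x (`|complex.Re (f x)|%:E) +
                            \int[mu]_x (`|complex.Im (f x)|%:E))%E); last first.
    exact: lte_add_pinfty.
  rewrite -ge0_integralD//; apply: ge0_le_integral => //.
  + by move=> x _; rewrite lee_fin normc_ge0.
  + exact: measurable_normcE.
  + by apply: emeasurable_funD; [exact: n1|exact: n2].
  + by move=> x _; rewrite -EFinD lee_fin normc_le_ReIm.
- move=> [mf nf]; case: (mf) => m1 m2.
  split; apply/integrableP; split.
  + by apply/measurable_EFinP; exact: m1.
  + apply: le_lt_trans nf; apply: ge0_le_integral => //.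
    * by apply: measurableT_comp => //; apply/measurable_EFinP; exact: m1.
    * exact: measurable_normcE.
    * by move=> x _; rewrite lee_fin ler_normRe.
  + by apply/measurable_EFinP; exact: m2.
  + apply: le_lt_trans nf; apply: ge0_le_integral => //.
    * by apply: measurableT_comp => //; apply/measurable_EFinP; exact: m2.
    * exact: measurable_normcE.
    * by move=> x _; rewrite lee_fin ler_normIm.
Qed.

Lemma cintegrable_measurable f : cintegrable f -> cmeasurable f.
Proof. by move/cintegrableP => []. Qed.

Lemma cintegrable_le f g : cmeasurable f -> cintegrable g ->
  (forall x, normc (f x) <= normc (g x)) -> cintegrable f.
Proof.
move=> mf /cintegrableP[mg ig] fg; apply/cintegrableP; split => //.
by apply: le_lt_trans ig; exact: le_nint.
Qed.

Lemma cintegrableD f g : cintegrable f -> cintegrable g ->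
  cintegrable (fun x => f x + g x).
Proof.
move=> [f1 f2] [g1 g2]; split.
  under eq_fun do rewrite ReD EFinD; exact: integrableD.
under eq_fun do rewrite ImD EFinD; exact: integrableD.
Qed.

Lemma cintegrableZ (c : C) f : cintegrable f -> cintegrable (fun x => c * f x).
Proof.
move=> /cintegrableP[mf nf]; apply/cintegrableP; split; first exact: cmfZ.
rewrite /nint; under eq_integral do rewrite Normc.normcM EFinM.
rewrite ge0_integralZl_EFin ?normc_ge0//.
- by rewrite lte_mul_pinfty// lee_fin normc_ge0.
- by move=> x _; rewrite lee_fin normc_ge0.
- exact: measurable_normcE.
Qed.

Lemma cintegrableN f : cintegrable f -> cintegrable (fun x => - f x).
Proof.
move=> /(cintegrableZ (-1)); congr cintegrable.
by apply/funext => x; rewrite mulN1r.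
Qed.

Lemma cintegrableB f g : cintegrable f -> cintegrable g ->
  cintegrable (fun x => f x - g x).
Proof. by move=> intf intg; apply: cintegrableD => //; exact: cintegrableN. Qed.

Lemma cintD f g : cintegrable f -> cintegrable g ->
  cint (fun x => f x + g x) = cint f + cint g.
Proof.
move=> [f1 f2] [g1 g2]; rewrite /cint; apply: complex_ext => /=.
  by under eq_Rintegral do rewrite ReD; exact: RintegralD.
by under eq_Rintegral do rewrite ImD; exact: RintegralD.
Qed.

Lemma cintZ (c : C) f : cintegrable f ->
  cint (fun x => c * f x) = c * cint f.
Proof.
move=> [f1 f2]; rewrite /cint; apply: complex_ext; rewrite !ReImE/=.
  under eq_Rintegral do rewrite ReM.
  rewrite RintegralB ?RintegralZl//; exact: (integrableZl measurableT _ f1) || exact: (integrableZl measurableT _ f2).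
under eq_Rintegral do rewrite ImM.
rewrite RintegralD ?RintegralZl//; exact: (integrableZl measurableT _ f1) || exact: (integrableZl measurableT _ f2).
Qed.

Lemma cintN f : cintegrable f -> cint (fun x => - f x) = - cint f.
Proof.
move=> intf; rewrite -mulN1r -cintZ//; congr cint.
by apply/funext => x; rewrite mulN1r.
Qed.

Lemma cintB f g : cintegrable f -> cintegrable g ->
  cint (fun x => f x - g x) = cint f - cint g.
Proof.
by move=> intf intg; rewrite cintD ?cintN//; exact: cintegrableN.
Qed.

Lemma cintZr (c : C) f : cintegrable f ->
  cint (fun x => f x * c) = cint f * c.
Proof.
by move=> intf; rewrite mulrC -cintZ//; congr cint; apply/funext => x; rewrite mulrC.
Qed.

Lemma cint_real (f : R -> R) : cint (fun x => (f x)%:C) = (\int[mu]_x f x)%:C.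
Proof.
apply: complex_ext => //=.
by rewrite (@Rintegral_cst _ _ _ mu setT measurableT 0) mul0r.
Qed.

Lemma cint0 : cint (fun=> 0 : C) = 0.
Proof.
by rewrite -[0 in LHS]/((0:R)%:C) cint_real (@Rintegral_cst _ _ _ mu setT measurableT 0) mul0r.
Qed.

(** A phase u makes the integral real and nonnegative, so that it equals the integral of Re (u f),
    which |u f| = |f| dominates. *)
Lemma normc_cint_le f : cmeasurable f -> ((normc (cint f))%:E <= nint f)%E.
Proof.
move=> mf; have [nf|] := ltP (nint f) +oo%E; last first.
  by rewrite leye_eq => /eqP ->; rewrite leey.
have intf : cintegrable f by apply/cintegrableP.
have [u u1 uf] := exists_phase (cint f).
have intuf := cintegrableZ u intf.
have : normc (cint f) = \int[mu]_x complex.Re (u * f x).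
  by rewrite -[LHS]/(complex.Re (normc (cint f))%:C) -uf -cintZ.
move=> ->; rewrite /Rintegral fineK; last first.
  by apply: integrable_fin_num => //; case: intuf.
have mRe : measurable_fun setT (fun x => (complex.Re (u * f x))%:E).
  by case: intuf => /measurable_int.
apply: (le_trans (lee_abs _)).
apply: (le_trans (le_abse_integral mu measurableT mRe)).
apply: ge0_le_integral => //.
- exact: measurableT_comp.
- exact: measurable_normcE.
- by move=> x _; rewrite lee_fin (le_trans (ler_normRe _))// Normc.normcM u1 mul1r.
Qed.

Lemma normc_cint_ler f : cmeasurable f -> (nint f < +oo)%E ->
  normc (cint f) <= fine (nint f).
Proof.
move=> mf nf; rewrite -lee_fin fineK; first exact: normc_cint_le.
by rewrite ge0_fin_numE// nint_ge0.
Qed.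

Lemma ae_eq_cint f g : cmeasurable f -> cmeasurable g ->
  (\forall x \ae mu, f x = g x) -> cint f = cint g.
Proof.
move=> [f1 f2] [g1 g2] fg; rewrite /cint /Rintegral.
congr (_ +i* _); congr fine; apply: ae_eq_integral => //.
- by apply/measurable_EFinP; exact: f1.
- by apply/measurable_EFinP; exact: g1.
- by apply: aeS fg => x -> _.
- by apply/measurable_EFinP; exact: f2.
- by apply/measurable_EFinP; exact: g2.
- by apply: aeS fg => x -> _.
Qed.

End complex_integral.

(** * Change of variables for complex integrals *)

Section change_of_variables_complex.
Variable R : realType.
Local Notation C := R[i].
Local Notation mu := (@lebesgue_measure R).
Local Open Scope ereal_scope.

(** The change of variables formula as a property of a substitution and its density, so that
    translations, reflections, dilations, [Phi] and its inverse share all consequences. *)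
Definition is_cov (theta w : R -> R) :=
  [/\ measurable_fun setT theta, measurable_fun setT w, (forall x, 0 < w x)%R &
    forall f : R -> \bar R, measurable_fun setT f -> (forall x, 0 <= f x) ->
      \int[mu]_x (f (theta x) * (w x)%:E) = \int[mu]_x f x].

Variables (theta w : R -> R).
Hypothesis thetaw : is_cov theta w.
Let mtheta : measurable_fun setT theta. Proof. by case: thetaw. Qed.
Let mw : measurable_fun setT w. Proof. by case: thetaw. Qed.
Let wgt0 : forall x, (0 < w x)%R. Proof. by case: thetaw. Qed.
Let w0 x : (0 <= w x)%R. Proof. exact: ltW. Qed.
Let cov (f : R -> \bar R) : measurable_fun setT f -> (forall x, 0 <= f x) ->
  \int[mu]_x (f (theta x) * (w x)%:E) = \int[mu]_x f x.
Proof. by case: thetaw => _ _ _; exact. Qed.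

(** No integrability is required: multiplication by w > 0 commutes with taking positive and negative
    parts. *)
Lemma integral_cov (f : R -> R) : measurable_fun setT f ->
  \int[mu]_x (f (theta x) * w x)%:E = \int[mu]_x (f x)%:E.
Proof.
move=> mf; rewrite integralE [RHS]integralE.
have mfE : measurable_fun setT (fun x => (f x)%:E) by apply/measurable_EFinP.
congr (_ - _).
- rewrite -[RHS]cov; last 2 first.
  + exact: measurable_funepos.
  + by move=> x; rewrite funeposE le_max lexx orbT.
  apply: eq_integral => x _; rewrite !funeposE -EFin_max [in RHS]/= -EFin_max -EFinM.
  by rewrite maxr_pMl// mul0r.
- rewrite -[RHS]cov; last 2 first.
  + exact: measurable_funeneg.
  + by move=> x; rewrite funenegE le_max lexx orbT.
  apply: eq_integral => x _; rewrite !funenegE -!EFinN -!EFin_max -EFinM.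
  by rewrite maxr_pMl// mul0r mulNr.
Qed.

Lemma nint_cov (f : R -> C) : cmeasurable f ->
  nint (fun x => (w x)%:C * f (theta x))%R = nint f.
Proof.
move=> mf; rewrite /nint -(cov (measurable_normcE mf)); last first.
  by move=> x; rewrite lee_fin normc_ge0.
apply: eq_integral => x _.
by rewrite Normc.normcM normc_real ger0_norm// mulrC EFinM.
Qed.

Lemma cint_cov (f : R -> C) : cmeasurable f ->
  cint (fun x => (w x)%:C * f (theta x))%R = cint f.
Proof.
move=> [m1 m2]; rewrite /cint; apply: complex_ext => /=.
  rewrite /Rintegral -(integral_cov m1); congr fine.
  by apply: eq_integral => x _; rewrite ReZ mulrC.
rewrite /Rintegral -(integral_cov m2); congr fine.
by apply: eq_integral => x _; rewrite ImZ mulrC.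
Qed.

Lemma cintegrable_cov (f : R -> C) : cmeasurable f ->
  cintegrable (fun x => (w x)%:C * f (theta x))%R <-> cintegrable f.
Proof.
move=> mf; split => /cintegrableP[_ nf]; apply/cintegrableP; split => //.
- by rewrite -nint_cov.
- by apply: cmfM; [exact: cmf_real|exact: cmf_comp].
- by rewrite nint_cov.
Qed.

(** The indicator of theta^{-1}(N) times w has integral mu(N) = 0, and w > 0 then forces
    theta^{-1}(N) to be null. *)
Lemma ae_cov (P : R -> Prop) :
  (\forall u \ae mu, P u) -> (\forall x \ae mu, P (theta x)).
Proof.
move=> [N [mN N0 PN]].
have mN' : measurable_fun setT (fun x : R => (\1_N x)%:E : \bar R).
  by apply/measurable_EFinP; exact: measurable_indic.
pose g x := (\1_N (theta x))%:E * (w x)%:E.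
have mg : measurable_fun setT g.
  apply: emeasurable_funM; last by apply/measurable_EFinP.
  exact: (measurableT_comp mN' mtheta).
have : ae_eq mu setT g (cst 0).
  apply/(ae_eq_integral_abs mu measurableT mg).
  under eq_integral.
    move=> x _; rewrite gee0_abs; last by rewrite mule_ge0// lee_fin.
    over.
  rewrite (cov mN'); last by move=> x; rewrite lee_fin.
  rewrite (@integral_indic _ (measurableTypeR R) R mu setT measurableT _ mN).
  by rewrite setIT.
apply: aeS => x /(_ I); rewrite /g /= => gx.
apply: contrapT => nP; move: gx.
have Nx : N (theta x) by exact: PN.
by rewrite indicE mem_set// mul1e => -[] /eqP; rewrite gt_eqF.
Qed.

End change_of_variables_complex.

(** * Translations, reflections and dilations *)

Section translations.
Variable R : realType.
Local Notation C := R[i].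
Local Notation mu := (@lebesgue_measure R).
Implicit Type f : R -> C.

Lemma measurable_shift (d : R) : measurable_fun setT (fun x : R => x + d).
Proof. exact: measurable_funD. Qed.

Lemma measurable_reflect (d : R) : measurable_fun setT (fun x : R => d - x).
Proof. exact: measurable_funB. Qed.

Lemma cov_shift (d : R) : is_cov (fun x => x + d) (cst 1).
Proof.
split => //; first exact: measurable_shift.
move=> g mg g0; rewrite -(ge0_integral_shift d mg g0).
by apply: eq_integral => x _; rewrite mule1.
Qed.

Lemma cov_reflect (d : R) : is_cov (fun x => d - x) (cst 1).
Proof.
split => //; first exact: measurable_reflect.
move=> g mg g0; rewrite -(ge0_integral_reflect d mg g0).
by apply: eq_integral => x _; rewrite mule1.
Qed.

Lemma cov_scale (c : R) : 0 < c -> is_cov (fun x => c * x) (cst c).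
Proof.
move=> c0; split => //; first exact: measurable_funM.
move=> g mg g0; rewrite -(ge0_integral_affine 0 (lt0r_neq0 c0) mg g0).
by apply: eq_integral => x _; rewrite addr0 gtr0_norm.
Qed.

Lemma nint_shift f d : cmeasurable f -> nint (fun x => f (x + d)) = nint f.
Proof.
move=> mf; rewrite -(nint_cov (cov_shift d) mf).
by congr nint; apply/funext => x; rewrite mul1r.
Qed.

Lemma cint_shift f d : cmeasurable f -> cint (fun x => f (x + d)) = cint f.
Proof.
move=> mf; rewrite -(cint_cov (cov_shift d) mf).
by congr cint; apply/funext => x; rewrite mul1r.
Qed.

Lemma nint_reflect f d : cmeasurable f -> nint (fun x => f (d - x)) = nint f.
Proof.
move=> mf; rewrite -(nint_cov (cov_reflect d) mf).
by congr nint; apply/funext => x; rewrite mul1r.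
Qed.

Lemma cint_reflect f d : cmeasurable f -> cint (fun x => f (d - x)) = cint f.
Proof.
move=> mf; rewrite -(cint_cov (cov_reflect d) mf).
by congr cint; apply/funext => x; rewrite mul1r.
Qed.

Lemma cintegrable_reflect f d : cintegrable f -> cintegrable (fun x => f (d - x)).
Proof.
move=> /cintegrableP[mf nf]; apply/cintegrableP; split.
  by apply: cmf_comp mf; exact: measurable_reflect.
by rewrite nint_reflect.
Qed.

Lemma ae_shift (P : R -> Prop) d :
  (\forall x \ae mu, P x) -> (\forall x \ae mu, P (x + d)).
Proof.
exact: (ae_cov (cov_shift d)).
Qed.

End translations.

(** * Fubini's theorem for complex integrands *)

Section fubini.
Variable R : realType.
Local Notation C := R[i].
Local Notation mu := (@lebesgue_measure R).

(** The real integral is [fine] of the extended one and agrees with it only on integrable slices,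
    that is for almost every parameter; the exchange is therefore carried out in the extended reals
    and brought back by almost everywhere equalities. *)
Lemma real_Fubini (f : R -> R -> R) :
  measurable_fun setT (fun z : R * R => f z.1 z.2) ->
  (\int[mu]_x \int[mu]_y `|(f x y)%:E| < +oo)%E ->
  [/\ measurable_fun setT (fun x => \int[mu]_y f x y),
      mu.-integrable setT (fun x => (\int[mu]_y f x y)%:E),
      {ae mu, forall x, mu.-integrable setT (fun y => (f x y)%:E)} &
      \int[mu]_x \int[mu]_y f x y = \int[mu]_y \int[mu]_x f x y].
Proof.
move=> mf ff.
have mfE : measurable_fun setT (fun z : R * R => (f z.1 z.2)%:E).
  by apply/measurable_EFinP.
have intf : (mu \x mu)%E.-integrable setT (fun z : R * R => (f z.1 z.2)%:E).
  exact/(integrable12ltyP mu mu mfE).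
have iF := integrable_fubini_F intf.
have mF := measurable_fubini_F intf.
have mG := measurable_fubini_G intf.
have a1 := ae_integrable1 intf.
have a2 := ae_integrable2 intf.
have m1 : measurable_fun setT (fun x => \int[mu]_y f x y).
  by apply: (measurableT_comp (@fine_measurable R setT measurableT)).
have m1E : measurable_fun setT (fun x => (\int[mu]_y f x y)%:E).
  by apply/measurable_EFinP.
have m2E : measurable_fun setT (fun y => (\int[mu]_x f x y)%:E).
  apply/measurable_EFinP.
  by apply: (measurableT_comp (@fine_measurable R setT measurableT)).
have e1 : \forall x \ae mu, ((\int[mu]_y f x y)%:E = \int[mu]_y (f x y)%:E)%E.
  apply: aeS a1 => x ix; rewrite /Rintegral fineK//.
  exact: integrable_fin_num.
have e2 : \forall y \ae mu, ((\int[mu]_x f x y)%:E = \int[mu]_x (f x y)%:E)%E.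
  apply: aeS a2 => x ix; rewrite /Rintegral fineK//.
  exact: integrable_fin_num.
have i1 : mu.-integrable setT (fun x => (\int[mu]_y f x y)%:E).
  apply/integrableP; split => //.
  case/integrableP : iF => _; congr (_ < _)%E.
  apply: ae_eq_integral => //.
  - exact: measurableT_comp.
  - exact: measurableT_comp.
  - by apply: aeS e1 => x /= ex _; exact: (congr1 abse (esym ex)).
split => //.
rewrite {1}/Rintegral [RHS]/Rintegral; congr fine.
transitivity (\int[mu]_x \int[mu]_y (f x y)%:E)%E.
  apply: ae_eq_integral => //.
  by apply: aeS e1 => x /= ex _; exact: ex.
transitivity (\int[mu]_y \int[mu]_x (f x y)%:E)%E; first exact: (Fubini intf).
apply: ae_eq_integral => //.
by apply: aeS e2 => x /= ex _; exact: (esym ex).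
Qed.

Lemma nint_swap (F : R -> R -> C) : cmf (fun z : R * R => F z.1 z.2) ->
  (\int[mu]_x nint (F x) = \int[mu]_y nint (F ^~ y))%E.
Proof.
move=> mF; rewrite /nint.
apply: (@fubini_tonelli _ _ _ _ _ mu mu (fun z : R * R => (normc (F z.1 z.2))%:E)).
  exact: measurable_normcE.
by move=> z; rewrite lee_fin normc_ge0.
Qed.

Lemma measurable_nint (F : R -> R -> C) : cmf (fun z : R * R => F z.1 z.2) ->
  measurable_fun setT (fun x => nint (F x)).
Proof.
move=> mF.
apply: (@measurable_fun_fubini_tonelli_F _ _ _ _ _ mu
  (fun z : R * R => (normc (F z.1 z.2))%:E)).
  exact: measurable_normcE.
by move=> z; rewrite lee_fin normc_ge0.
Qed.

Lemma cFubini (F : R -> R -> C) : cmf (fun z : R * R => F z.1 z.2) ->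
  (\int[mu]_x nint (F x) < +oo)%E ->
  [/\ cmeasurable (fun x => cint (F x)), cintegrable (fun x => cint (F x)),
      (\forall x \ae mu, cintegrable (F x)) &
      cint (fun x => cint (F x)) = cint (fun y => cint (F ^~ y))].
Proof.
move=> mF iF; case: (mF) => m1 m2.
have dom (f : R -> R -> R) : measurable_fun setT (fun z : R * R => f z.1 z.2) ->
    (forall x y, `|f x y| <= normc (F x y)) ->
    (\int[mu]_x \int[mu]_y `|(f x y)%:E| < +oo)%E.
  move=> mf fF; apply: le_lt_trans iF.
  have mfE : measurable_fun setT (fun z : R * R => `|(f z.1 z.2)%:E|%E).
    by apply: measurableT_comp => //; apply/measurable_EFinP.
  apply: ge0_le_integral => //.
  - by move=> x _; apply: integral_ge0.
  - by apply: (@measurable_fun_fubini_tonelli_F _ _ _ _ _ mu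
      (fun z : R * R => `|(f z.1 z.2)%:E|%E)) => //.
  - exact: measurable_nint.
  - move=> x _; apply: ge0_le_integral => //.
    + exact: (measurableT_comp mfE (pair1_measurable x)).
    + exact: (measurableT_comp (measurable_normcE mF) (pair1_measurable x)).
    + by move=> y _; rewrite lee_fin.
have [a1 b1 c1 d1] := @real_Fubini (fun x y => complex.Re (F x y)) m1
  (dom _ m1 (fun x y => ler_normRe _)).
have [a2 b2 c2 d2] := @real_Fubini (fun x y => complex.Im (F x y)) m2
  (dom _ m2 (fun x y => ler_normIm _)).
split.
- by split.
- by split.
- by apply: aeS2 c1 c2 => x.
- by rewrite /cint d1 d2.
Qed.

End fubini.

(** * L_p spaces and convolutions *)

Section Lp_spaces.
Variable R : realType.
Local Notation C := R[i].
Local Notation mu := (@lebesgue_measure R).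
Implicit Types (f g : R -> C) (p : R) (q : \bar R).

(** The norm at p = +oo is the essential supremum only on a space of positive measure and a default
    value otherwise. *)
Lemma mu_setT_gt0 : (0 < mu [set: R])%E.
Proof.
rewrite (@lt_le_trans _ _ (mu `[0, 1]%classic))//.
  by rewrite lebesgue_measure_itv/= lte_fin ltr01 oppr0 adde0 lte_fin ltr01.
by apply: le_measure => //; rewrite inE//; exact: measurable_itv.
Qed.

Lemma ae_eqP f g : (f = g %[ae mu]) <-> (\forall x \ae mu, f x = g x).
Proof.
split => h; last by apply: aeS h => x ->.
by apply: aeS h => x; exact.
Qed.

(** The p-th power of the L_p norm: being an integral, it is open to Tonelli and Jensen. *)
Definition Npow p f : \bar R := (\int[mu]_x (normc (f x) `^ p)%:E)%E.

Lemma Npow_ge0 p f : (0 <= Npow p f)%E.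
Proof. by apply: integral_ge0 => x _; rewrite lee_fin powR_ge0. Qed.

Lemma measurable_powc p f : cmeasurable f ->
  measurable_fun setT (fun x => (normc (f x) `^ p)%:E : \bar R).
Proof.
move=> mf; apply/measurable_EFinP.
exact: (measurableT_comp (@measurable_powR R p) (measurable_normc mf)).
Qed.

Lemma Lpnorm_Npow p f : Lpnorm p%:E f = ((Npow p f) `^ p^-1)%E.
Proof.
rewrite /Lpnorm unlock /Npow; congr (poweR _ _); apply: eq_integral => x _.
by rewrite gee0_abs ?lee_fin ?normc_ge0// poweR_EFin.
Qed.

Lemma Lpnorm1 f : Lpnorm 1%E f = nint f.
Proof.
rewrite /Lpnorm Lnorm1; apply: eq_integral => x _.
by rewrite gee0_abs ?lee_fin ?normc_ge0.
Qed.

Lemma Lpnorm_ge0 q f : (0 <= Lpnorm q f)%E.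
Proof. exact: Lnorm_ge0. Qed.

Lemma LpnormyP f (M : R) : (Lpnorm +oo%E f <= M%:E)%E <->
  (\forall x \ae mu, normc (f x) <= M).
Proof.
rewrite /Lpnorm unlock mu_setT_gt0; split.
  move=> /ess_supP; apply: aeS => x /=.
  by rewrite lee_fin ger0_norm// normc_ge0.
move=> h; apply/ess_supP; apply: aeS h => x /=.
by rewrite lee_fin ger0_norm// normc_ge0.
Qed.

Lemma poweR_mono p (x y : \bar R) : 0 <= p -> (0 <= x)%E -> (x <= y)%E ->
  (x `^ p <= y `^ p)%E.
Proof.
move=> p0 x0 xy; apply: gt0_ler_poweR => //.
  by rewrite in_itv/= x0 leey.
by rewrite in_itv/= (le_trans x0 xy) leey.
Qed.

Lemma le_Lpnorm q f g : (1 <= q)%E -> cmeasurable f -> cmeasurable g ->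
  (\forall x \ae mu, normc (f x) <= normc (g x)) ->
  (Lpnorm q f <= Lpnorm q g)%E.
Proof.
case: q => [p p1 mf mg fg|_ mf mg fg|//].
  rewrite lee_fin in p1; have p0 : 0 <= p by rewrite (le_trans ler01).
  rewrite !Lpnorm_Npow; apply: poweR_mono; first by rewrite invr_ge0.
    exact: Npow_ge0.
  apply: ae_ge0_le_integral => //.
  - by move=> x _; rewrite lee_fin powR_ge0.
  - exact: measurable_powc.
  - by move=> x _; rewrite lee_fin powR_ge0.
  - exact: measurable_powc.
  - by apply: aeS fg => x fgx _; rewrite lee_fin ge0_ler_powR// nnegrE normc_ge0.
rewrite /Lpnorm unlock mu_setT_gt0; apply: le_ess_sup.
by apply: aeS fg => x fgx /=; rewrite lee_fin !ger0_norm ?normc_ge0.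
Qed.

Lemma ae_eq_Lpnorm q f g : (1 <= q)%E -> cmeasurable f -> cmeasurable g ->
  (\forall x \ae mu, f x = g x) -> Lpnorm q f = Lpnorm q g.
Proof.
move=> q1 mf mg fg; apply/eqP; rewrite eq_le !le_Lpnorm//.
- by apply: aeS fg => x ->.
- by apply: aeS fg => x ->.
Qed.

Lemma LpnormZ q (c : C) f : (1 <= q)%E -> cmeasurable f ->
  Lpnorm q (fun x => c * f x) = ((normc c)%:E * Lpnorm q f)%E.
Proof.
case: q => [p p1 mf|_ mf|//].
  rewrite lee_fin in p1; have p0 : 0 < p by rewrite (lt_le_trans ltr01).
  rewrite !Lpnorm_Npow /Npow.
  under eq_integral do rewrite Normc.normcM powRM ?normc_ge0// EFinM.
  rewrite ge0_integralZl_EFin ?powR_ge0//.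
  - rewrite poweRM ?lee_fin ?powR_ge0 ?Npow_ge0// poweR_EFin -powRrM.
    by rewrite mulfV ?gt_eqF// powRr1 ?normc_ge0.
  - by move=> x _; rewrite lee_fin powR_ge0.
  - exact: measurable_powc.
rewrite /Lpnorm unlock mu_setT_gt0.
rewrite -ess_supZl ?mu_setT_gt0 ?normc_ge0//; congr ess_sup.
by apply/funext => x /=; rewrite Normc.normcM -EFinM !ger0_norm ?mulr_ge0 ?normc_ge0.
Qed.

(** Minkowski's inequality is applied to the real functions |f| and |g|, whose sum dominates |f + g|
    pointwise. *)
Lemma Lpnorm_triangle q f g : (1 <= q)%E -> cmeasurable f -> cmeasurable g ->
  (Lpnorm q (fun x => (f x + g x)%R) <= Lpnorm q f + Lpnorm q g)%E.
Proof.
move=> q1 mf mg; apply: le_trans (eminkowski mu (measurable_normc mf) (measurable_normc mg) q1).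
pose h x := (normc (f x) + normc (g x))%:C.
have mh : cmeasurable h.
  by apply: cmf_real; apply: measurable_funD; exact: measurable_normc.
have hE x : normc (h x) = normc (f x) + normc (g x).
  by rewrite /h normc_real ger0_norm// addr_ge0 ?normc_ge0.
apply: (@le_trans _ _ (Lpnorm q h)); last first.
  rewrite /Lpnorm le_eqVlt; apply/orP; left; apply/eqP; congr Lnorm.
  by apply/funext => x; rewrite hE.
apply: le_Lpnorm => //; first exact: cmfD.
by apply: aeW => x; rewrite hE normc_triangle.
Qed.

Lemma LpnormN q f : Lpnorm q (fun x => - f x) = Lpnorm q f.
Proof. by rewrite /Lpnorm; congr Lnorm; apply/funext => x; rewrite normcN. Qed.

Lemma LpnormBC q f g : Lpnorm q (fun x => f x - g x) = Lpnorm q (fun x => g x - f x).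
Proof. by rewrite /Lpnorm; congr Lnorm; apply/funext => x; rewrite normcBC. Qed.

Lemma Lpnorm_dist q f g : (1 <= q)%E -> cmeasurable f -> cmeasurable g ->
  (Lpnorm q (fun x => (f x - g x)%R) <= Lpnorm q f + Lpnorm q g)%E.
Proof.
by move=> q1 mf mg; rewrite -(LpnormN q g); apply: Lpnorm_triangle => //; exact: cmfN.
Qed.

Lemma Lpnorm_0 q : (1 <= q)%E -> Lpnorm q (fun=> 0 : C) = 0%E.
Proof.
move=> q1; rewrite -[RHS](@Lnorm0 _ _ _ mu q).
  by rewrite /Lpnorm; congr Lnorm; apply/funext => x; rewrite Normc.normc0.
by rewrite gt_eqF// (lt_le_trans _ q1)// lte_fin.
Qed.

Lemma Lpnorm_eq0 q f : (1 <= q)%E -> cmeasurable f -> Lpnorm q f = 0%E ->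
  \forall x \ae mu, f x = 0.
Proof.
move=> q1 mf /Lnorm_eq0_eq0 h.
have := h (measurable_normcE mf) (lt_le_trans lte01 q1).
by apply: aeS => x /(_ I) [] /normc_eq0.
Qed.

Lemma Lp_measurable q f : Lp q f -> cmeasurable f. Proof. by case. Qed.

Lemma LpD q f g : (1 <= q)%E -> Lp q f -> Lp q g -> Lp q (fun x => f x + g x).
Proof.
move=> q1 [mf nf] [mg ng]; split; first exact: cmfD.
by apply: le_lt_trans (Lpnorm_triangle q1 mf mg) _; rewrite lte_add_pinfty.
Qed.

Lemma LpZ q (c : C) f : (1 <= q)%E -> Lp q f -> Lp q (fun x => c * f x).
Proof.
move=> q1 [mf nf]; split; first exact: cmfZ.
by rewrite LpnormZ// lte_mul_pinfty// lee_fin normc_ge0.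
Qed.

Lemma LpN q f : Lp q f -> Lp q (fun x => - f x).
Proof. by move=> [mf nf]; split; [exact: cmfN|rewrite LpnormN]. Qed.

Lemma LpB q f g : (1 <= q)%E -> Lp q f -> Lp q g -> Lp q (fun x => f x - g x).
Proof. by move=> q1 lf lg; apply: LpD => //; exact: LpN. Qed.

Lemma Lp_le q f g : (1 <= q)%E -> cmeasurable f -> Lp q g ->
  (\forall x \ae mu, normc (f x) <= normc (g x)) -> Lp q f.
Proof.
move=> q1 mf [mg ng] fg; split => //.
by apply: le_lt_trans ng; exact: le_Lpnorm.
Qed.

Lemma Lp1P f : Lp 1%E f <-> cintegrable f.
Proof. by rewrite cintegrableP /Lp Lpnorm1. Qed.

Lemma Lpnorm_lty_Npow p f : 1 <= p -> ((Lpnorm p%:E f < +oo) <-> (Npow p f < +oo))%E.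
Proof.
move=> p1; have p0 : p != 0 by rewrite gt_eqF// (lt_le_trans ltr01).
rewrite Lpnorm_Npow; split.
  by rewrite !ltey; apply: contra => /eqP ->; rewrite poweRyr// invr_eq0.
exact: poweR_lty.
Qed.

Lemma Lpnorm_le_Npow p f (M : R) : 1 <= p -> 0 <= M ->
  (Npow p f <= (M `^ p)%:E)%E -> (Lpnorm p%:E f <= M%:E)%E.
Proof.
move=> p1 M0 h; have p0 : 0 < p by rewrite (lt_le_trans ltr01).
rewrite Lpnorm_Npow.
have -> : M%:E = ((M `^ p)%:E `^ p^-1)%E.
  by rewrite poweR_EFin -powRrM mulfV ?gt_eqF// powRr1.
by apply: poweR_mono => //; [rewrite invr_ge0 ltW|exact: Npow_ge0].
Qed.

Lemma Npow_Lpnorm p f : 1 <= p -> (Lpnorm p%:E f `^ p)%E = Npow p f.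
Proof.
move=> p1; have p0 : p != 0 by rewrite gt_eqF// (lt_le_trans ltr01).
by rewrite Lpnorm_Npow -poweRrM mulVf// poweRe1// Npow_ge0.
Qed.

(** A bound by every finite e already forces finiteness near the limit, so extended norms can be
    estimated without checking that first. *)
Lemma cvge0P (T : Type) (F : set_system T) {FF : Filter F} (u : T -> \bar R) :
  (forall x, (0 <= u x)%E) ->
  (u @ F --> 0%E) <-> (forall e : R, 0 < e -> \forall x \near F, (u x <= e%:E)%E).
Proof.
move=> u0; split.
  move=> /fine_cvgP[h1 h2] e e0.
  move/cvgr0_norm_le : h2 => /(_ e e0); move: h1; apply: filterS2 => x ux.
  by rewrite -lee_fin; apply: le_trans; rewrite -{1}(fineK ux) lee_fin /= ler_norm.
move=> h; apply/fine_cvgP; split.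
  apply: filterS (h 1 ltr01) => x ux1.
  by rewrite ge0_fin_numE// (le_lt_trans ux1)// ltry.
apply/cvgr0Pnorm_le => e e0; apply: filterS (h e e0) => x uxe /=.
have ufin : u x \is a fin_num by rewrite ge0_fin_numE// (le_lt_trans uxe)// ltry.
by rewrite ger0_norm ?fine_ge0// -lee_fin fineK.
Qed.

End Lp_spaces.

(** * Integrals depending on a parameter, and Jensen's inequality *)

Section parameter_integrals.
Variable R : realType.
Local Notation C := R[i].
Local Notation mu := (@lebesgue_measure R).

(** Tonelli on the positive and negative parts separately, so that integrability of the slices is
    not at stake. *)
Lemma measurable_Rintegral_param (f : R -> R -> R) :
  measurable_fun setT (fun z : R * R => f z.1 z.2) ->
  measurable_fun setT (fun x => \int[mu]_y f x y).
Proof.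
move=> mf.
have mfE : measurable_fun setT (fun z : R * R => (f z.1 z.2)%:E : \bar R).
  by apply/measurable_EFinP.
have m1 : measurable_fun setT
    (fun x : R => \int[mu]_y (fun z : R * R => (f z.1 z.2)%:E)^\+ (x, y))%E.
  apply: measurable_fun_fubini_tonelli_F; first exact: measurable_funepos.
  by move=> z; rewrite funeposE le_max lexx orbT.
have m2 : measurable_fun setT
    (fun x : R => \int[mu]_y (fun z : R * R => (f z.1 z.2)%:E)^\- (x, y))%E.
  apply: measurable_fun_fubini_tonelli_F; first exact: measurable_funeneg.
  by move=> z; rewrite funenegE le_max lexx orbT.
have m3 : measurable_fun setT (fun x : R => \int[mu]_y (f x y)%:E)%E.
  rewrite (_ : (fun x : R => _) = (fun x : R =>
    \int[mu]_y (fun z : R * R => (f z.1 z.2)%:E)^\+ (x, y) -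
    \int[mu]_y (fun z : R * R => (f z.1 z.2)%:E)^\- (x, y))%E); last first.
    apply/funext => x; rewrite integralE.
    congr (_ - _)%E; apply: eq_integral => y _; by rewrite ?funeposE ?funenegE.
  exact: emeasurable_funB.
exact: (measurableT_comp (@fine_measurable R setT measurableT) m3).
Qed.

Lemma measurable_cint (F : R -> R -> C) : cmf (fun z : R * R => F z.1 z.2) ->
  cmeasurable (fun x => cint (F x)).
Proof. by move=> [m1 m2]; split; exact: measurable_Rintegral_param. Qed.

Lemma cmf_pair1 (F : R -> R -> C) x : cmf (fun z : R * R => F z.1 z.2) ->
  cmeasurable (F x).
Proof. exact: (cmf_comp (pair1_measurable x)). Qed.

Lemma cmf_pair2 (F : R -> R -> C) y : cmf (fun z : R * R => F z.1 z.2) ->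
  cmeasurable (F ^~ y).
Proof. exact: (cmf_comp (pair2_measurable y)). Qed.

Lemma ge0_intZl (c : R) (g : R -> \bar R) : 0 <= c -> measurable_fun setT g ->
  (forall x, (0 <= g x)%E) ->
  (\int[mu]_x (c%:E * g x) = c%:E * \int[mu]_x g x)%E.
Proof. by move=> c0 mg g0; rewrite ge0_integralZl_EFin. Qed.

Lemma ge0_intZr (c : \bar R) (g : R -> \bar R) : (0 <= c)%E ->
  measurable_fun setT g -> (forall x, (0 <= g x)%E) ->
  (\int[mu]_x (g x * c) = \int[mu]_x g x * c)%E.
Proof. by move=> c0 mg g0; rewrite ge0_integralZr. Qed.

(* Jensen's inequality for the measure |k| ds, obtained from Hoelder's. *)
Lemma cint_powR_le (p : R) (k g : R -> C) : 1 <= p ->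
  cintegrable k -> cmeasurable g ->
  ((normc (cint (fun s => k s * g s)) `^ p)%:E <=
   (fine (nint k) `^ (p - 1))%:E *
   \int[mu]_s (normc (k s) * normc (g s) `^ p)%:E)%E.
Proof.
move=> p1 /cintegrableP[mk ik] mg.
have mkg : cmeasurable (fun s => k s * g s) by exact: cmfM.
have kfin : nint k \is a fin_num by rewrite ge0_fin_numE// nint_ge0.
have mnk := measurable_normc mk; have mng := measurable_normc mg.
have mnp : measurable_fun setT (fun s => normc (g s) `^ p).
  exact: (measurableT_comp (@measurable_powR R p) mng).
have step : ((normc (cint (fun s => k s * g s)) `^ p)%:E <=
    (nint (fun s => (k s * g s)%R) `^ p))%E.
  rewrite -poweR_EFin; apply: poweR_mono; rewrite ?(le_trans ler01)//.
    by rewrite lee_fin normc_ge0.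
  exact: normc_cint_le.
apply: le_trans step _.
move: p1; rewrite le_eqVlt => /predU1P[<-|p1].
  rewrite subrr powRr0 mul1e poweRe1 ?nint_ge0//.
  rewrite /nint le_eqVlt; apply/orP; left; apply/eqP; apply: eq_integral => x _.
  by rewrite Normc.normcM powRr1// normc_ge0.
have p0 : 0 < p by rewrite (lt_trans ltr01).
pose q := p / (p - 1).
have pm1 : 0 < p - 1 by rewrite subr_gt0.
have q0 : 0 < q by rewrite divr_gt0.
have pq : p^-1 + q^-1 = 1.
  by rewrite /q; field; rewrite !gt_eqF.
(* The splitting |k| |g| = |k|^{1/q} (|k|^{1/p} |g|) for the conjugate exponents p and q. *)
pose f1 s := normc (k s) `^ q^-1.
pose f2 s := normc (k s) `^ p^-1 * normc (g s).
have mf1 : measurable_fun setT f1.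
  exact: (measurableT_comp (@measurable_powR R q^-1) mnk).
have mf2 : measurable_fun setT f2.
  apply: measurable_funM => //.
  exact: (measurableT_comp (@measurable_powR R p^-1) mnk).
have f12 s : (f1 s * f2 s) = normc (k s * g s).
  rewrite /f1 /f2 mulrA -powRD; last first.
    by rewrite addrC pq oner_eq0.
  by rewrite addrC pq powRr1 ?normc_ge0// Normc.normcM.
have f1ge0 s : 0 <= f1 s by rewrite powR_ge0.
have f2ge0 s : 0 <= f2 s by rewrite mulr_ge0 ?powR_ge0 ?normc_ge0.
have Nf1 : ('N[mu]_q%:E[EFin \o f1] = nint k `^ q^-1)%E.
  rewrite unlock /nint; congr poweR; apply: eq_integral => s _ /=.
  rewrite ger0_norm// /f1 -powRrM mulVf ?gt_eqF//.
  by rewrite powRr1 ?normc_ge0.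
have Nf2 : ('N[mu]_p%:E[EFin \o f2] =
    (\int[mu]_s (normc (k s) * normc (g s) `^ p)%:E) `^ p^-1)%E.
  rewrite unlock; congr poweR; apply: eq_integral => s _ /=.
  rewrite ger0_norm// /f2 powRM ?powR_ge0 ?normc_ge0//.
  by rewrite -powRrM mulVf ?gt_eqF// powRr1 ?normc_ge0.
have := hoelder mu mf2 mf1 p0 q0 pq.
rewrite Lnorm1 Nf1 Nf2.
have -> : (\int[mu]_x `|(EFin \o (f2 \* f1)%R) x| = nint (fun s => (k s * g s)%R))%E.
  apply: eq_integral => s _ /=.
  rewrite (ger0_norm (mulr_ge0 (f2ge0 s) (f1ge0 s))); congr EFin.
  exact: (etrans (mulrC _ _) (f12 s)).
set J := (\int[mu]_s _)%E => H.
have J0 : (0 <= J)%E.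
  by apply: integral_ge0 => s _; rewrite lee_fin mulr_ge0 ?normc_ge0 ?powR_ge0.
apply: (le_trans (poweR_mono (ltW p0) (nint_ge0 _) H)).
rewrite poweRM ?poweR_ge0// -!poweRrM mulVf ?gt_eqF// poweRe1//.
rewrite muleC le_eqVlt; apply/orP; left; apply/eqP; congr (_ * _)%E.
rewrite (_ : q^-1 * p = p - 1); last by rewrite /q; field; rewrite !gt_eqF.
by rewrite -poweR_EFin fineK.
Qed.

(** Jensen at each u, then Tonelli. It is the common source of Young's inequality (F is a translate
    of f) and of the approximate identity estimate (F is a translate minus f). *)
Lemma Npow_cint_le (p : R) (k : R -> C) (F : R -> R -> C) : 1 <= p ->
  cintegrable k -> cmf (fun z : R * R => F z.1 z.2) ->
  (Npow p (fun u => cint (fun s => (k s * F u s)%R)) <=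
   (fine (nint k) `^ (p - 1))%:E *
   \int[mu]_s ((normc (k s))%:E * Npow p (F ^~ s)))%E.
Proof.
move=> p1 ik mF; have [mk _] := (cintegrableP k).1 ik.
have mkp : cmf (fun z : R * R => k z.2) by apply: cmf_comp mk; exact: measurable_snd.
have mG : measurable_fun setT
   (fun z : R * R => (normc (k z.2) * normc (F z.1 z.2) `^ p)%:E).
  apply/measurable_EFinP; apply: measurable_funM; first exact: measurable_normc.
  exact: (measurableT_comp (@measurable_powR R p) (measurable_normc mF)).
have G0 (z : R * R) : (0 <= (normc (k z.2) * normc (F z.1 z.2) `^ p)%:E)%E.
  by rewrite lee_fin mulr_ge0 ?normc_ge0 ?powR_ge0.
have mI : measurable_fun setT
    (fun u : R => \int[mu]_s (normc (k s) * normc (F u s) `^ p)%:E)%E.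
  exact: (@measurable_fun_fubini_tonelli_F _ _ _ _ _ mu
    (fun z : R * R => (normc (k z.2) * normc (F z.1 z.2) `^ p)%:E)).
apply: (@le_trans _ _ (\int[mu]_u ((fine (nint k) `^ (p - 1))%:E *
   \int[mu]_s (normc (k s) * normc (F u s) `^ p)%:E))%E).
  apply: ge0_le_integral => //.
  - by move=> u _; rewrite lee_fin powR_ge0.
  - apply: measurable_powc; apply: measurable_cint.
    exact: (cmfM mkp mF).
  - exact: emeasurable_funM.
  - by move=> u _; apply: cint_powR_le => //; exact: cmf_pair1.
rewrite ge0_integralZl_EFin ?powR_ge0//; last first.
  by move=> u _; apply: integral_ge0 => s _; rewrite lee_fin mulr_ge0 ?normc_ge0 ?powR_ge0.
apply: lee_wpmul2l; first by rewrite lee_fin powR_ge0.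
have -> : (\int[mu]_u \int[mu]_s (normc (k s) * normc (F u s) `^ p)%:E =
    \int[mu]_s \int[mu]_u (normc (k s) * normc (F u s) `^ p)%:E)%E.
  exact: (@fubini_tonelli _ _ _ _ _ mu mu
    (fun z : R * R => (normc (k z.2) * normc (F z.1 z.2) `^ p)%:E)).
rewrite le_eqVlt; apply/orP; left; apply/eqP; apply: eq_integral => s _.
under eq_integral do rewrite EFinM.
rewrite ge0_integralZl_EFin ?normc_ge0//.
- by move=> u _; rewrite lee_fin powR_ge0.
- by apply: measurable_powc; exact: cmf_pair2.
Qed.

End parameter_integrals.

(** * Convolution with an integrable kernel *)

Section convolution.
Variable R : realType.
Local Notation C := R[i].
Local Notation mu := (@lebesgue_measure R).
Implicit Types (k l f g : R -> C) (p : R) (q : \bar R).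

Lemma le11 : (1 <= 1 :> \bar R)%E. Proof. exact: lexx. Qed.

Lemma cFubini_ae2 (F : R -> R -> C) : cmf (fun z : R * R => F z.1 z.2) ->
  (\int[mu]_x nint (F x) < +oo)%E -> \forall y \ae mu, cintegrable (F ^~ y).
Proof.
move=> mF iF; have mF' : cmf (fun z : R * R => F z.2 z.1).
  by apply: (cmf_comp _ mF (g := fun z : R * R => (z.2, z.1))); exact: measurable_swap.
by have [|_ _ ? _] := cFubini (F := fun y x => F x y) mF'; first by rewrite -nint_swap.
Qed.

(** Where the integrand is not integrable the value is a default one, which is why the algebraic
    laws below are stated almost everywhere. *)
Definition conv k f (u : R) : C := cint (fun s => k s * f (u - s)).

Lemma measurable_sub2 : measurable_fun setT (fun z : R * R => z.1 - z.2).
Proof. by apply: measurable_funB; [exact: measurable_fst|exact: measurable_snd]. Qed.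

Lemma cmf_conv k f : cmeasurable k -> cmeasurable f ->
  cmf (fun z : R * R => k z.2 * f (z.1 - z.2)).
Proof.
move=> mk mf; apply: cmfM; first by apply: cmf_comp mk; exact: measurable_snd.
by apply: cmf_comp mf; exact: measurable_sub2.
Qed.

Lemma measurable_conv k f : cmeasurable k -> cmeasurable f -> cmeasurable (conv k f).
Proof.
move=> mk mf; apply: (measurable_cint (F := fun u s => k s * f (u - s))).
exact: cmf_conv.
Qed.

Lemma le_nint_ae f g : cmeasurable f -> cmeasurable g ->
  (\forall x \ae mu, normc (f x) <= normc (g x)) -> (nint f <= nint g)%E.
Proof.
move=> mf mg fg; apply: ae_ge0_le_integral => //.
- by move=> x _; rewrite lee_fin normc_ge0.
- exact: measurable_normcE.
- by move=> x _; rewrite lee_fin normc_ge0.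
- exact: measurable_normcE.
- by apply: aeS fg => x ? _; rewrite lee_fin.
Qed.

Lemma nintZ (c : C) f : cmeasurable f ->
  nint (fun x => c * f x) = ((normc c)%:E * nint f)%E.
Proof.
move=> mf; rewrite /nint; under eq_integral do rewrite Normc.normcM EFinM.
rewrite ge0_integralZl_EFin ?normc_ge0//.
- by move=> x _; rewrite lee_fin normc_ge0.
- exact: measurable_normcE.
Qed.

Lemma ge0_ae_lty (g : R -> \bar R) : measurable_fun setT g ->
  (forall x, (0 <= g x)%E) -> (\int[mu]_x g x < +oo)%E ->
  \forall x \ae mu, (g x < +oo)%E.
Proof.
move=> mg g0 ig.
have intg : mu.-integrable setT g.
  apply/integrableP; split => //.
  by under eq_integral do rewrite gee0_abs//.
apply: aeS (integrable_ae measurableT intg) => x /(_ I).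
by rewrite ge0_fin_numE.
Qed.

Lemma Lpy_bound f : Lp +oo%E f ->
  exists2 M : R, 0 <= M & \forall x \ae mu, normc (f x) <= M.
Proof.
move=> [mf nf]; exists (fine (Lpnorm +oo%E f)); first by rewrite fine_ge0// Lpnorm_ge0.
by apply/LpnormyP; rewrite fineK// ge0_fin_numE// Lpnorm_ge0.
Qed.

Lemma Lpy_bounded f (M : R) : cmeasurable f -> (\forall x \ae mu, normc (f x) <= M) ->
  Lp +oo%E f.
Proof.
by move=> mf /LpnormyP h; split => //; apply: le_lt_trans h _; rewrite ltry.
Qed.

Lemma Npow_shift p f s : cmeasurable f -> Npow p (fun u => f (u - s)) = Npow p f.
Proof.
move=> mf; rewrite /Npow.
rewrite -(ge0_integral_shift (- s) (measurable_powc p mf))//.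
by move=> x; rewrite lee_fin powR_ge0.
Qed.

(** For finite p the convolution of |k| with |f|^p is integrable, hence finite almost everywhere,
    and |f| <= 1 + |f|^p converts this into absolute convergence for f. For p = +oo the function f
    is replaced by its essential bound. *)
Lemma ae_conv_integrable q k f : (1 <= q)%E -> cintegrable k -> Lp q f ->
  \forall u \ae mu, cintegrable (fun s => k s * f (u - s)).
Proof.
move=> q1 ik lf; have mf := Lp_measurable lf.
have [mk nk] := (cintegrableP k).1 ik.
have mkf u : cmeasurable (fun s => k s * f (u - s)).
  by apply: cmfM => //; apply: cmf_comp mf; exact: measurable_reflect.
case: q q1 lf => [p p1 lf|_ lf|//].
- rewrite lee_fin in p1.
  pose G := fun u : R => (\int[mu]_s (normc (k s) * normc (f (u - s)) `^ p)%:E)%E.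
  have mG2 : measurable_fun setT
     (fun z : R * R => (normc (k z.2) * normc (f (z.1 - z.2)) `^ p)%:E).
    apply/measurable_EFinP; apply: measurable_funM.
      apply: measurable_normc; apply: cmf_comp mk; exact: measurable_snd.
    apply: (measurableT_comp (@measurable_powR R p)).
    apply: measurable_normc; apply: cmf_comp mf; exact: measurable_sub2.
  have G20 (z : R * R) : (0 <= (normc (k z.2) * normc (f (z.1 - z.2)) `^ p)%:E)%E.
    by rewrite lee_fin mulr_ge0 ?normc_ge0 ?powR_ge0.
  have mG : measurable_fun setT G.
    exact: (@measurable_fun_fubini_tonelli_F _ _ _ _ _ mu
      (fun z : R * R => (normc (k z.2) * normc (f (z.1 - z.2)) `^ p)%:E)).
  have G0 u : (0 <= G u)%E.
    by apply: integral_ge0 => s _; exact: (G20 (u, s)).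
  have iG : (\int[mu]_u G u < +oo)%E.
    have -> : (\int[mu]_u G u = \int[mu]_s \int[mu]_u
        (normc (k s) * normc (f (u - s)) `^ p)%:E)%E.
      exact: (@fubini_tonelli _ _ _ _ _ mu mu
        (fun z : R * R => (normc (k z.2) * normc (f (z.1 - z.2)) `^ p)%:E)).
    have -> : (\int[mu]_s \int[mu]_u (normc (k s) * normc (f (u - s)) `^ p)%:E =
        \int[mu]_s ((normc (k s))%:E * Npow p f))%E.
      apply: eq_integral => s _; under eq_integral do rewrite EFinM.
      rewrite -(Npow_shift p s mf); apply: ge0_intZl.
      + exact: normc_ge0.
      + apply: measurable_powc; apply: cmf_comp mf; exact: measurable_shift.
      + by move=> u; rewrite lee_fin powR_ge0.
    rewrite (ge0_intZr (Npow_ge0 _ _) (measurable_normcE mk)); last first.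
      by move=> s; rewrite lee_fin normc_ge0.
    apply: lte_mul_pinfty; first exact: nint_ge0.
      by rewrite ge0_fin_numE// nint_ge0.
    by apply/Lpnorm_lty_Npow => //; case: lf.
  apply: aeS (ge0_ae_lty mG G0 iG) => u Gu.
  apply/cintegrableP; split => //.
  have mfp : measurable_fun setT (fun s => (normc (k s) * normc (f (u - s)) `^ p)%:E : \bar R).
    exact: (measurableT_comp mG2 (pair1_measurable u)).
  apply: (@le_lt_trans _ _ (nint k + G u)%E); last exact: lte_add_pinfty.
  rewrite /nint /G -ge0_integralD//.
  + apply: ge0_le_integral => //.
    * by move=> s _; rewrite lee_fin normc_ge0.
    * exact: (measurable_normcE (mkf u)).
    * exact: (emeasurable_funD (measurable_normcE mk) mfp).
    * move=> s _; rewrite -EFinD lee_fin Normc.normcM -{2}[normc (k s)]mulr1 -mulrDr.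
      apply: ler_wpM2l; first exact: normc_ge0.
      have [h|h] := leP (normc (f (u - s))) 1.
        by rewrite (le_trans h)// lerDl powR_ge0.
      rewrite (@le_trans _ _ (normc (f (u - s)) `^ p))//; last by rewrite lerDr.
      by rewrite -{1}[normc _]powRr1 ?normc_ge0// ler_powR// ltW.
  + by move=> s _; rewrite lee_fin normc_ge0.
  + exact: measurable_normcE.
  + by move=> s _; exact: (G20 (u, s)).
- have [M M0 fM] := Lpy_bound lf.
  apply: aeW => u; apply/cintegrableP; split => //.
  apply: (@le_lt_trans _ _ (nint (fun s => M%:C * k s)%R)).
    apply: le_nint_ae => //; first exact: cmfZ.
    apply: aeS (ae_cov (cov_reflect u) fM) => s fs.
    by rewrite !Normc.normcM normc_real ger0_norm// mulrC ler_wpM2r// normc_ge0.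
  by rewrite nintZ// lte_mul_pinfty// lee_fin normc_ge0.
Qed.

(** Young's inequality with an L_1 kernel. *)
Lemma Lpnorm_conv q k f : (1 <= q)%E -> cintegrable k -> Lp q f ->
  (Lpnorm q (conv k f) <= nint k * Lpnorm q f)%E.
Proof.
move=> q1 ik lf; have mf := Lp_measurable lf.
have [mk nk] := (cintegrableP k).1 ik.
have kfin : nint k \is a fin_num by rewrite ge0_fin_numE// nint_ge0.
have K0 : 0 <= fine (nint k) by rewrite fine_ge0// nint_ge0.
have nfin : Lpnorm q f \is a fin_num by case: lf => _ ?; rewrite ge0_fin_numE// Lpnorm_ge0.
case: q q1 lf nfin => [p p1 lf nfin|_ lf nfin|//].
- rewrite lee_fin in p1; have p0 : 0 < p by rewrite (lt_le_trans ltr01).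
  rewrite -(fineK kfin) -(fineK nfin) -EFinM.
  apply: Lpnorm_le_Npow => //; first by rewrite mulr_ge0// fine_ge0// Lpnorm_ge0.
  apply: le_trans (Npow_cint_le (F := fun u s => f (u - s)) p1 ik _) _.
    by apply: cmf_comp mf; exact: measurable_sub2.
  under eq_integral do rewrite Npow_shift//.
  rewrite (ge0_intZr (Npow_ge0 _ _) (measurable_normcE mk)); last first.
    by move=> s; rewrite lee_fin normc_ge0.
  rewrite -/(nint k) muleA -{2}(fineK kfin) -EFinM mulrC mulr_powRB1//.
  rewrite (powRM _ K0 (fine_ge0 (Lpnorm_ge0 _ _))) EFinM -(Npow_Lpnorm _ p1).
  by rewrite -{1}(fineK nfin) poweR_EFin.
- have [M M0 fM] : exists2 M : R, Lpnorm +oo f = M%:E & 0 <= M.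
    by exists (fine (Lpnorm +oo f)); rewrite ?fineK// fine_ge0// Lpnorm_ge0.
  have fM' : \forall x \ae mu, normc (f x) <= M by apply/LpnormyP; rewrite M0.
  rewrite M0 -(fineK kfin) -EFinM; apply/LpnormyP; apply: aeW => u.
  have mkf : cmeasurable (fun s => k s * f (u - s)).
    by apply: cmfM => //; apply: cmf_comp mf; exact: measurable_reflect.
  rewrite -lee_fin EFinM fineK//; apply: le_trans (normc_cint_le mkf) _.
  apply: (@le_trans _ _ (nint (fun s => M%:C * k s)%R)).
    apply: le_nint_ae => //; first exact: cmfZ.
    apply: aeS (ae_cov (cov_reflect u) fM') => s fs.
    by rewrite !Normc.normcM normc_real ger0_norm// mulrC ler_wpM2r// normc_ge0.
  by rewrite nintZ// normc_real ger0_norm// muleC.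
Qed.

Lemma Lp_conv q k f : (1 <= q)%E -> cintegrable k -> Lp q f -> Lp q (conv k f).
Proof.
move=> q1 ik lf; have [mk nk] := (cintegrableP k).1 ik.
split; first by apply: measurable_conv => //; exact: Lp_measurable lf.
apply: le_lt_trans (Lpnorm_conv q1 ik lf) _; case: lf => _ ?.
by rewrite lte_mul_pinfty// ?nint_ge0// ge0_fin_numE// nint_ge0.
Qed.

Lemma ae_convD q k f g (c : C) : (1 <= q)%E -> cintegrable k -> Lp q f -> Lp q g ->
  \forall u \ae mu, conv k (fun x => c * f x + g x) u = c * conv k f u + conv k g u.
Proof.
move=> q1 ik lf lg.
apply: aeS2 (ae_conv_integrable q1 ik lf) (ae_conv_integrable q1 ik lg) => u i1 i2.
rewrite /conv -cintZ// -cintD//; last exact: cintegrableZ.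
by congr cint; apply/funext => s; ring.
Qed.

Lemma ae_convDk q k l f (c : C) : (1 <= q)%E -> cintegrable k -> cintegrable l ->
  Lp q f ->
  \forall u \ae mu, conv (fun x => c * k x + l x) f u = c * conv k f u + conv l f u.
Proof.
move=> q1 ik il lf.
apply: aeS2 (ae_conv_integrable q1 ik lf) (ae_conv_integrable q1 il lf) => u i1 i2.
rewrite /conv -cintZ// -cintD//; last exact: cintegrableZ.
by congr cint; apply/funext => s; ring.
Qed.

Lemma convC k l u : cmeasurable k -> cmeasurable l -> conv k l u = conv l k u.
Proof.
move=> mk ml; rewrite /conv -(cint_reflect u); last first.
  by apply: cmfM => //; apply: cmf_comp ml; exact: measurable_reflect.
by congr cint; apply/funext => s; rewrite mulrC opprB addrC subrK.
Qed.

Lemma cintegrable_conv k l : cintegrable k -> cintegrable l -> cintegrable (conv k l).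
Proof. by move=> ik /Lp1P il; apply/Lp1P; exact: Lp_conv. Qed.

(** Fubini applies at every u where |k| convolved with |l| convolves absolutely with f, and this is
    almost every u by [ae_conv_integrable] for the kernel built from the absolute values. *)
Lemma conv_assoc q k l f : (1 <= q)%E -> cintegrable k -> cintegrable l -> Lp q f ->
  \forall u \ae mu, conv k (conv l f) u = conv (conv k l) f u.
Proof.
move=> q1 ik il lf; have mf := Lp_measurable lf.
have [mk nk] := (cintegrableP k).1 ik; have [ml nl] := (cintegrableP l).1 il.
pose ak s : C := (normc (k s))%:C; pose al s : C := (normc (l s))%:C.
have iabs h : cintegrable h -> cintegrable (fun s => (normc (h s))%:C).
  move=> ih; have mh := cintegrable_measurable ih.
  apply: cintegrable_le ih _; first exact: cmf_real (measurable_normc mh).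
  by move=> x; rewrite normc_real ger0_norm// normc_ge0.
have iak : cintegrable ak by exact: iabs.
have ial : cintegrable al by exact: iabs.
have [mak _] := (cintegrableP ak).1 iak; have [mal _] := (cintegrableP al).1 ial.
have ikl := cintegrable_conv iak ial.
have aekl := ae_conv_integrable le11 iak ((Lp1P al).2 ial).
apply: aeS (ae_conv_integrable q1 ikl lf) => u iu.
pose F r s := k s * l (r - s) * f (u - r).
have mF : cmf (fun z : R * R => F z.1 z.2).
  apply: cmfM; first exact: cmf_conv.
  apply: cmf_comp mf; apply: measurable_funB => //; exact: measurable_fst.
have mfu : cmeasurable (fun r => f (u - r)).
  by apply: cmf_comp mf; exact: measurable_reflect.
have nF : (\int[mu]_r nint (F r) < +oo)%E.
  have /cintegrableP[_] := iu; apply: le_lt_trans.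
  apply: ae_ge0_le_integral => //.
  - by move=> r _; exact: nint_ge0.
  - exact: measurable_nint.
  - by move=> r _; rewrite lee_fin normc_ge0.
  - exact: (measurable_normcE (cmfM (measurable_conv mak mal) mfu)).
  - apply: aeS aekl => r ir _.
    have -> : nint (F r) = nint (fun s => f (u - r) * (ak s * al (r - s)))%R.
      rewrite /nint; apply: eq_integral => s _; rewrite /F /ak /al !Normc.normcM.
      rewrite !normc_real !ger0_norm ?normc_ge0//; congr _%:E; ring.
    rewrite nintZ; last by case/cintegrableP : ir.
    rewrite Normc.normcM mulrC EFinM lee_wpmul2l ?lee_fin ?normc_ge0//.
    pose h s := ak s * al (r - s).
    have hE : h = (fun s => (normc (h s))%:C).
      apply/funext => s; rewrite /h /ak /al Normc.normcM !normc_real !ger0_norm ?normc_ge0//.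
      by apply: complex_ext; rewrite !ReImE/= ?mulr0 ?mul0r ?subr0 ?addr0.
    have -> : normc (conv ak al r) = fine (nint h).
      rewrite /conv -/h {1}hE cint_real normc_real ger0_norm//.
      by apply: Rintegral_ge0 => s _; exact: normc_ge0.
    by rewrite fineK// ge0_fin_numE ?nint_ge0//; case/cintegrableP : ir.
have [_ _ _ fub] := cFubini mF nF.
transitivity (cint (fun r => cint (F r))); last first.
  apply: ae_eq_cint.
  - exact: measurable_cint.
  - exact: (cmfM (measurable_conv mk ml) mfu).
  - have := ae_conv_integrable le11 ik ((Lp1P l).2 il).
    by apply: aeS => r ir; rewrite /F cintZr.
rewrite fub; apply: ae_eq_cint.
- exact: (cmfM mk (cmf_comp (measurable_reflect u) (measurable_conv ml mf))).
- apply: (measurable_cint (F := fun s r => F r s)).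
  by apply: (cmf_comp _ mF (g := fun z : R * R => (z.2, z.1))); exact: measurable_swap.
apply: aeS (cFubini_ae2 mF nF) => s ints.
(* Integrability of the slice says nothing on l and f when k s = 0, but then both sides vanish. *)
have [/eqP ks0|ks0] := boolP (k s == 0).
  by rewrite /F ks0 mul0r; under eq_fun do rewrite !mul0r; rewrite cint0.
have ints' : cintegrable (fun r => l (r - s) * f (u - r)).
  have := cintegrableZ (k s)^-1 ints; congr cintegrable; apply/funext => r.
  by rewrite /F -(mulrA (k s)) (mulKf ks0).
have mg : cmeasurable (fun t => l t * f (u - s - t)).
  exact: (cmfM ml (cmf_comp (measurable_reflect (u - s)) mf)).
rewrite /conv -(cint_shift (- s) mg) -cintZ.
  by congr cint; apply/funext => r; rewrite /F mulrA; congr (_ * f _); ring.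
by move: ints'; congr cintegrable; apply/funext => r; congr (_ * f _); ring.
Qed.

Lemma conv_comm q k l f : (1 <= q)%E -> cintegrable k -> cintegrable l -> Lp q f ->
  \forall u \ae mu, conv k (conv l f) u = conv l (conv k f) u.
Proof.
move=> q1 ik il lf.
apply: aeS2 (conv_assoc q1 ik il lf) (conv_assoc q1 il ik lf) => u -> ->.
have -> // : conv k l = conv l k.
by apply/funext => s; apply: convC; exact: cintegrable_measurable.
Qed.

Definition reflect k (s : R) : C := k (- s).

Lemma reflectE k : reflect k = (fun s => k (0 - s)).
Proof. by apply/funext => s; rewrite sub0r. Qed.

Lemma cintegrable_reflect0 k : cintegrable k -> cintegrable (reflect k).
Proof. by rewrite reflectE; exact: cintegrable_reflect. Qed.

Lemma dual_pairing_integrable f g : Lp +oo%E f -> cintegrable g ->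
  cintegrable (fun x => f x * g x).
Proof.
move=> lf ig; have [M M0 fM] := Lpy_bound lf.
have [mg ng] := (cintegrableP g).1 ig; have mf := Lp_measurable lf.
apply/cintegrableP; split; first exact: cmfM.
apply: (@le_lt_trans _ _ (nint (fun s => M%:C * g s)%R)).
  apply: le_nint_ae => //; [exact: cmfM|exact: cmfZ|].
  apply: aeS fM => s fs.
  by rewrite !Normc.normcM normc_real ger0_norm// ler_wpM2r// normc_ge0.
by rewrite nintZ// lte_mul_pinfty// lee_fin normc_ge0.
Qed.

(** The adjoint of a convolution is the convolution with the reflected kernel; this is how kernels
    are moved onto test functions in weak* limits. *)
Lemma dual_pairing_conv k f psi : cintegrable k -> Lp +oo%E f -> cintegrable psi ->
  dual_pairing (conv k f) psi = dual_pairing f (conv (reflect k) psi).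
Proof.
move=> ik lf ipsi; have mf := Lp_measurable lf.
have [mk nk] := (cintegrableP k).1 ik; have [mpsi npsi] := (cintegrableP psi).1 ipsi.
have [M M0 fM] := Lpy_bound lf.
have fin_k : nint k \is a fin_num by rewrite ge0_fin_numE// nint_ge0.
pose F u s := k s * f (u - s) * psi u.
have mF : cmf (fun z : R * R => F z.1 z.2).
  apply: cmfM; first exact: cmf_conv.
  by apply: cmf_comp mpsi; exact: measurable_fst.
have mkf u : cmeasurable (fun s => k s * f (u - s)).
  by apply: cmfM => //; apply: cmf_comp mf; exact: measurable_reflect.
have nF : (\int[mu]_u nint (F u) < +oo)%E.
  apply: (@le_lt_trans _ _ (\int[mu]_u ((M * fine (nint k))%:E * (normc (psi u))%:E))%E).
    apply: ge0_le_integral => //.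
    - by move=> u _; exact: nint_ge0.
    - exact: measurable_nint.
    - by apply: emeasurable_funM => //; exact: measurable_normcE.
    - move=> u _.
      have -> : nint (F u) = nint (fun s => psi u * (k s * f (u - s)))%R.
        by congr nint; apply/funext => s; rewrite /F mulrC.
      rewrite nintZ// muleC lee_wpmul2r ?lee_fin ?normc_ge0//.
      apply: (@le_trans _ _ (nint (fun s => M%:C * k s)%R)).
        apply: le_nint_ae => //; first exact: cmfZ.
        apply: aeS (ae_cov (cov_reflect u) fM) => s fs.
        by rewrite !Normc.normcM normc_real ger0_norm// mulrC ler_wpM2r// normc_ge0.
      by rewrite nintZ// normc_real ger0_norm// EFinM fineK.
  rewrite (ge0_intZl _ (measurable_normcE mpsi)); last 2 first.
  - by rewrite mulr_ge0// fine_ge0// nint_ge0.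
  - by move=> x; rewrite lee_fin normc_ge0.
  by rewrite lte_mul_pinfty// lee_fin mulr_ge0// fine_ge0// nint_ge0.
have [_ _ au eF] := cFubini mF nF.
pose G v s := f v * (reflect k s * psi (v - s)).
have ipk := cintegrable_reflect0 ik.
transitivity (cint (fun u => cint (F u))).
  apply: ae_eq_cint.
  - exact: (cmfM (measurable_conv mk mf) mpsi).
  - exact: measurable_cint.
  have := ae_conv_integrable (leey (1 : \bar R)) ik lf.
  by apply: aeS => u iu; rewrite /F cintZr.
rewrite eF.
(* Substituting u = v + s before exchanging the integrals back frees the argument of f from s. *)
pose F' v s := F (v + s) s.
have mF' : cmf (fun z : R * R => F' z.1 z.2).
  apply: (cmf_comp _ mF (g := fun z : R * R => (z.1 + z.2, z.2))).
  apply: measurable_fun_pair; last exact: measurable_snd.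
  by apply: measurable_funD; [exact: measurable_fst|exact: measurable_snd].
have mFs s : cmeasurable (F ^~ s) by exact: cmf_pair2.
have -> : (fun y => cint (F ^~ y)) = (fun s => cint (F' ^~ s)).
  by apply/funext => s; rewrite -(cint_shift s (mFs s)).
have nF' : (\int[mu]_v nint (F' v) < +oo)%E.
  rewrite (nint_swap mF').
  have -> : (fun s => nint (F' ^~ s)) = (fun s => nint (F ^~ s)).
    by apply/funext => s; rewrite -(nint_shift s (mFs s)).
  by rewrite -(nint_swap mF).
have [_ _ _ <-] := cFubini mF' nF'.
have iRpsi := ae_conv_integrable le11 (cintegrable_reflect0 ik) ((Lp1P psi).2 ipsi).
apply: ae_eq_cint.
- exact: measurable_cint.
- have [mpk _] := (cintegrableP _).1 ipk.
  exact: (cmfM mf (measurable_conv mpk mpsi)).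
apply: aeS iRpsi => v iv.
rewrite /conv -(cintZ _ iv).
rewrite -[RHS](cint_reflect 0); last first.
  apply: cmfZ; exact: cintegrable_measurable iv.
congr cint; apply/funext => s; rewrite /F' /F /reflect.
have -> : v + s - s = v by ring.
have -> : - (0 - s) = s by ring.
by rewrite (mulrC (k s)) mulrA.
Qed.

End convolution.

(** * Dominated convergence to zero *)

Section dominated_convergence_to_zero.
Variable R : realType.
Local Notation mu := (@lebesgue_measure R).

Lemma dct0 (F : nat -> R -> R) (G : R -> R) :
  (forall n, measurable_fun setT (F n)) -> (forall n x, 0 <= F n x <= G x) ->
  mu.-integrable setT (fun x => (G x)%:E) ->
  (forall x, F n x @[n --> \oo] --> 0) ->
  (\int[mu]_x (F n x)%:E)%E @[n --> \oo] --> 0%E.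
Proof.
move=> mF FG iG F0.
have mFE n : measurable_fun setT (fun x => (F n x)%:E).
  by apply/measurable_EFinP; exact: mF.
have [||||_ _] := @dominated_convergence _ _ R mu setT measurableT
  (fun n x => (F n x)%:E) (cst 0%E) (fun x => (G x)%:E) mFE.
- exact: measurable_cst.
- by apply: aeW => x _; apply: cvg_EFin; [exact: nearW|exact: F0].
- exact: iG.
- apply: aeW => x n _; rewrite lee_fin ger0_norm; by case/andP: (FG n x).
by rewrite integral0.
Qed.

(** A limit along a real parameter is tested on sequences w tending to a; their first N terms are
    dropped because the domination holds only within distance 1 of a. *)
Lemma dct0_at (F : R -> R -> R) (G : R -> R) (a : R) :
  (forall s, measurable_fun setT (F s)) ->
  (forall s x, `|s - a| <= 1 -> 0 <= F s x <= G x) ->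
  mu.-integrable setT (fun x => (G x)%:E) ->
  (forall x, F s x @[s --> a] --> 0) ->
  (\int[mu]_x (F s x)%:E)%E @[s --> a] --> 0%E.
Proof.
move=> mF FG iG F0.
have iF s : `|s - a| <= 1 -> mu.-integrable setT (fun x => (F s x)%:E).
  move=> sa; apply: (le_integrable measurableT _ _ iG).
    by apply/measurable_EFinP; exact: mF.
  move=> x _; rewrite lee_fin; have /andP[h1 h2] := FG s x sa.
  by rewrite ger0_norm// (le_trans h2)// ler_norm.
have nearA : \forall s \near a, `|s - a| <= 1.
  have : nbhs a (ball a 1) by exact: nbhsx_ballx.
  by apply: filterS => s; rewrite /ball/= => /ltW; rewrite distrC.
apply/fine_cvgP; split.
  apply: filterS nearA => s sa.
  by apply: integrable_fin_num => //; exact: iF.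
rewrite -[fine \o _]/(fun s => \int[mu]_x F s x).
apply/(@cvg_nbhsP _ R^o) => w wa.
have [N _ hN] : \forall n \near \oo, `|w n - a| <= 1 := wa _ nearA.
rewrite -(cvg_shiftn N).
have : (\int[mu]_x (F (w (n + N)%N) x)%:E)%E @[n --> \oo] --> 0%E.
  apply: (@dct0 _ G) => //.
  - by move=> n x; apply: FG; apply: hN => /=; exact: leq_addl.
  - move=> x; have wN : w (n + N)%N @[n --> \oo] --> a by rewrite cvg_shiftn.
    exact: (cvg_comp _ _ wN (F0 x)).
by move=> /fine_cvgP[].
Qed.

End dominated_convergence_to_zero.

(** * Continuity of translations in L_1 *)

Section translation_L1.
Variable R : realType.
Local Notation mu := (@lebesgue_measure R).

(** Shifts by at most 1 enlarge the support to [-(L + 1), L + 1], where 2 M dominates. *)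
Let shiftL1_cc (h : R -> R) (M L : R) : continuous h -> (forall u, `|h u| <= M) ->
  (forall u, L < `|u| -> h u = 0) ->
  (\int[mu]_u (`|h (u - s) - h u|)%:E)%E @[s --> (0:R)] --> 0%E.
Proof.
move=> ch hM hL.
have mh : measurable_fun setT h by exact: continuous_measurable_fun.
have M0 : 0 <= M by rewrite (le_trans _ (hM 0)).
pose G (u : R) := M *+ 2 * \1_(`[- (L + 1), L + 1]%classic : set R) u.
apply: (@dct0_at _ _ G).
- move=> s; apply: measurableT_comp => //; apply: measurable_funB => //.
  by apply: (measurableT_comp mh); exact: measurable_shift.
- move=> s u; rewrite subr0 => s1; rewrite normr_ge0/= /G indicE.
  have [uI|uI] := boolP (u \in _).
    rewrite mulr1 mulr2n (le_trans (ler_normB _ _))// lerD//.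
  have : `|u| > L + 1.
    move: uI; rewrite notin_setE/= in_itv/= -ler_norml => /negP; by rewrite -ltNge.
  move=> uL; rewrite !hL ?subrr ?normr0 ?mulr0//.
    by rewrite (lt_trans _ uL)// ltrDl.
  have : `|u| <= `|u - s| + `|s| by rewrite -{1}(subrK s u) ler_normD.
  lra.
- rewrite /G; under eq_fun do rewrite EFinM.
  apply: integrableZl => //; exact: integrable_indic_itv.
- move=> u.
  have : h (u - s) @[s --> (0:R)] --> h u.
    rewrite -{2}[u]subr0; apply: (@continuous_comp _ _ _ (fun s => u - s) h).
      by apply: cvgB; [exact: cvg_cst|exact: cvg_id].
    exact: ch.
  move=> hu; have : h (u - s) - h u @[s --> (0:R)] --> 0.
    by rewrite -[X in _ --> X](subrr (h u)); apply: cvgB => //; exact: cvg_cst.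
  by move=> /cvg_norm; rewrite normr0.
Qed.

(** f is replaced by a continuous compactly supported h at L_1 distance e/3, translates included;
    that e/3 is e/6 for cutting off the tail and e/6 for the continuous approximation on a compact
    interval. *)
Lemma shift_L1_cvg (f : R -> R) : mu.-integrable setT (fun u => (f u)%:E) ->
  (\int[mu]_u (`|f (u - s) - f u|)%:E)%E @[s --> (0:R)] --> 0%E.
Proof.
move=> intf.
have mf : measurable_fun setT f.
  by apply/measurable_EFinP; exact: measurable_int intf.
have mabs (g : R -> R) : measurable_fun setT g -> measurable_fun setT (fun u : R => `|g u|%:E : \bar R).
  by move=> mg; apply/measurable_EFinP; exact: measurableT_comp.
apply/(@cvge0P R R (nbhs (0:R))); first by move=> s; apply: integral_ge0.
move=> e e0.
have e6 : 0 < e / 6 by rewrite divr_gt0.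
(* A trapezoid equal to 1 on [-n, n] and to 0 beyond n + 1: multiplication by it keeps the
   approximant continuous. *)
pose cutoff (n : R) (u : R) : R := Num.max 0 (Num.min 1 (n + 1 - `|u|)).
have cutoff01 n u : 0 <= cutoff n u <= 1.
  rewrite /cutoff le_max lexx/= ge_max ler01/= ge_min lexx//.
have ccut n : continuous (cutoff n).
  move=> u; apply: (@continuous_max _ _ (cst 0) (fun u => Num.min 1 (n + 1 - `|u|))); first exact: cst_continuous.
  apply: (@continuous_min _ _ (cst 1) (fun u => n + 1 - `|u|)); first exact: cst_continuous.
  by apply: cvgB; [exact: cvg_cst|exact: norm_continuous].
have mcut n : measurable_fun setT (cutoff n) by exact: continuous_measurable_fun.
have mfc n : measurable_fun setT (fun u => f u * (1 - cutoff n u)).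
  by apply: measurable_funM => //; apply: measurable_funB.
have tail : (\int[mu]_u (`|f u * (1 - cutoff n%:R u)|)%:E)%E @[n --> \oo] --> 0%E.
  apply: (@dct0 _ _ (fun u => `|f u|)).
  - by move=> n; apply: measurableT_comp.
  - move=> n u; rewrite normr_ge0/= normrM ler_piMr//.
    have /andP[h1 h2] := cutoff01 n%:R u.
    by rewrite ger0_norm; lra.
  - exact: (integrable_abse intf).
  - move=> u; apply: cvg_near_cst; near=> n.
    have un : `|u| <= n%:R by near: n; exact: nbhs_infty_ger.
    have -> : cutoff n%:R u = 1.
      rewrite /cutoff min_l; last lra.
      by rewrite max_r.
    by rewrite subrr mulr0 normr0.
have [n _ /(_ n (leqnn n)) hn] : \forall n \near \oo,
   (\int[mu]_u (`|f u * (1 - cutoff n%:R u)|)%:E <= (e / 6)%:E)%E.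
  have H0 k : (0 <= \int[mu]_u (`|f u * (1 - cutoff k%:R u)|)%:E)%E by apply: integral_ge0.
  exact: ((cvge0P H0).1 tail _ e6).
pose E := `[- (n%:R + 1), n%:R + 1]%classic : set (measurableTypeR R).
have mE : measurable E by exact: measurable_itv.
have intfE : mu.-integrable E (EFin \o f).
  exact: (integrableS measurableT mE (@subsetT _ E) intf).
have muE : (mu E < +oo)%E.
  by rewrite lebesgue_measure_itv/=; case: ifP => _; rewrite ?ltry.
have [g_ [cg ig gf]] := approximation_continuous_integrable mE muE intfE.
have [m _ /(_ m (leqnn m)) hm] : \forall m \near \oo,
   (\int[mu]_(u in E) `|(f u - g_ m u)%:E| <= (e / 6)%:E)%E.
  have H0 k : (0 <= \int[mu]_(u in E) `|(f u - g_ k u)%:E|)%E by apply: integral_ge0.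
  exact: ((cvge0P H0).1 gf _ e6).
pose h u := g_ m u * cutoff n%:R u.
have ch : continuous h by move=> u; apply: cvgM; [exact: cg|exact: ccut].
have hout u : n%:R + 1 < `|u| -> h u = 0.
  move=> hu; rewrite /h /cutoff max_l ?mulr0//.
  by rewrite ge_min; apply/orP; right; rewrite subr_le0 ltW.
have n0 : - (n%:R + 1) <= n%:R + 1 :> R by rewrite ge0_cp// addr_ge0.
have [M hM] : exists M, forall u, `|h u| <= M.
  have [|c cI hc] := @EVT_max R (fun u => `|h u|) _ _ n0.
    by apply: continuous_subspaceT => u; apply: cvg_norm; exact: ch.
  exists `|h c| => u; have [uE|uE] := leP `|u| (n%:R + 1).
    by apply: hc; rewrite in_itv/= -ler_norml.
  by rewrite hout// normr0.
have mh : measurable_fun setT h by exact: continuous_measurable_fun.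
have mg : measurable_fun setT (g_ m) by exact: continuous_measurable_fun.
have fh : (\int[mu]_u (`|f u - h u|)%:E <= (e / 3)%:E)%E.
  have -> : e / 3 = e / 6 + e / 6 by lra.
  rewrite EFinD; apply: le_trans (leeD hn hm).
  rewrite [X in (_ <= _ + X)%E]integral_mkcond.
  have mfgE : measurable_fun setT ((fun u => `|(f u - g_ m u)%:E|%E) \_ E).
    have -> : (fun u => `|(f u - g_ m u)%:E|%E) \_ E =
        (fun u => (`|f u - g_ m u|%:E * (\1_E u)%:E)%E).
      apply/funext => u; rewrite patchE indicE.
      by case: (u \in E); rewrite ?mule1 ?mule0.
    apply: emeasurable_funM; first by apply: mabs; exact: measurable_funB.
    by apply/measurable_EFinP; exact: measurable_indic.
  rewrite -ge0_integralD//; last 2 first.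
  - exact: mabs.
  - by move=> u _; apply: erestrict_ge0.
  apply: ge0_le_integral => //.
  - by apply: mabs; exact: measurable_funB.
  - by apply: emeasurable_funD => //; exact: mabs.
  - move=> u _; have -> : f u - h u = f u * (1 - cutoff n%:R u) + (f u - g_ m u) * cutoff n%:R u.
      by rewrite /h; ring.
    apply: (@le_trans _ _ (`|f u * (1 - cutoff n%:R u)|%:E +
        `|(f u - g_ m u) * cutoff n%:R u|%:E)%E).
      by rewrite -EFinD lee_fin ler_normD.
    apply: leeD => //; rewrite patchE; have [uE|uE] := boolP (u \in E).
      rewrite lee_fin normrM ler_piMr//.
      by have /andP[h1 h2] := cutoff01 n%:R u; rewrite ger0_norm.
    have uL : n%:R + 1 < `|u|.
      by move: uE; rewrite notin_setE /E /= in_itv/= -ler_norml => /negP; rewrite -ltNge.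
    by rewrite /cutoff max_l ?mulr0 ?normr0// ge_min subr_le0 (ltW uL) orbT.
have H0 s : (0 <= \int[mu]_u (`|h (u - s) - h u|)%:E)%E by apply: integral_ge0.
have e3 : 0 < e / 3 by rewrite divr_gt0.
have := (cvge0P H0).1 (shiftL1_cc ch hM hout) _ e3.
move=> /(_ (nbhs_filter _)); apply: filterS => s hs.
have mfh : measurable_fun setT (fun u : R => `|f u - h u|%:E : \bar R).
  by apply: mabs; exact: measurable_funB.
have mfhs : measurable_fun setT (fun u : R => `|f (u - s) - h (u - s)|%:E : \bar R).
  exact: (measurableT_comp mfh (measurable_shift (- s))).
have mhs : measurable_fun setT (fun u : R => `|h (u - s) - h u|%:E : \bar R).
  apply: mabs; apply: measurable_funB => //.
  exact: (measurableT_comp mh (measurable_shift (- s))).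
have fhs : (\int[mu]_u (`|f (u - s) - h (u - s)|)%:E <= (e / 3)%:E)%E.
  have := ge0_integral_shift (- s) mfh (fun u => normr_ge0 _).
  by move=> ->.
have -> : e%:E = ((e / 3)%:E + (e / 3)%:E + (e / 3)%:E)%E.
  by rewrite -!EFinD; congr _%:E; lra.
apply: le_trans (leeD (leeD fhs hs) fh).
rewrite -!ge0_integralD//; last 2 first.
- by move=> u _; rewrite adde_ge0.
- exact: emeasurable_funD.
apply: ge0_le_integral => //.
- apply: mabs; apply: measurable_funB => //.
  exact: (measurableT_comp mf (measurable_shift (- s))).
- by apply: emeasurable_funD => //; exact: emeasurable_funD.
- move=> u _; rewrite -!EFinD lee_fin.
  have -> : f (u - s) - f u = (f (u - s) - h (u - s)) + (h (u - s) - h u) - (f u - h u) by ring.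
  by rewrite (le_trans (ler_normB _ _))// lerD2r ler_normD.
Unshelve. all: end_near. Qed.

End translation_L1.

(** * Continuity of translations in L_p *)

Section translation_continuity.
Variable R : realType.
Local Notation C := R[i].
Local Notation mu := (@lebesgue_measure R).
Implicit Types (k f g : R -> C) (p : R) (q : \bar R).

Lemma Lpnorm_shift q f s : (1 <= q)%E -> cmeasurable f ->
  Lpnorm q (fun u => f (u - s)) = Lpnorm q f.
Proof.
case: q => [p p1 mf|_ mf|//]; first by rewrite !Lpnorm_Npow Npow_shift.
have sh (g : R -> C) (d : R) : cmeasurable g ->
    (Lpnorm +oo%E (fun u : R => g (u - d)%R) <= Lpnorm +oo%E g)%E.
  move=> mg; have [h|] := ltP (Lpnorm +oo%E g) +oo%E; last first.
    by rewrite leye_eq => /eqP ->; exact: leey.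
  have gfin : Lpnorm +oo%E g \is a fin_num by rewrite ge0_fin_numE// Lpnorm_ge0.
  rewrite -(fineK gfin); apply/LpnormyP.
  have : \forall x \ae mu, normc (g x) <= fine (Lpnorm +oo%E g).
    by apply/LpnormyP; rewrite fineK.
  exact: ae_shift.
apply/eqP; rewrite eq_le sh//=.
have := sh (fun u => f (u - s)) (- s) (cmf_comp (measurable_shift (- s)) mf).
rewrite (_ : (fun u => f (u - - s - s)) = f)//.
by apply/funext => u; congr f; rewrite opprK addrK.
Qed.

Lemma Lp_shift q f s : (1 <= q)%E -> Lp q f -> Lp q (fun u => f (u - s)).
Proof.
move=> q1 [mf nf]; split; last by rewrite Lpnorm_shift.
exact: (cmf_comp (measurable_shift (- s)) mf).
Qed.

(** Truncating in size and in space at once gives a function that is both bounded and integrable. *)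
Definition cutoff_at (n : R) f (u : R) : C :=
  if (normc (f u) <= n) && (`|u| <= n) then f u else 0.

Lemma measurable_cutoff_at n f : cmeasurable f -> cmeasurable (cutoff_at n f).
Proof.
move=> mf; have mn := measurable_normc mf; case: (mf) => m1 m2.
have mb : measurable_fun setT (fun u => (normc (f u) <= n) && (`|u| <= n)).
  by apply: measurable_and; apply: measurable_fun_ler.
split.
  rewrite (_ : (fun x => _) = (fun x => if (normc (f x) <= n) && (`|x| <= n)
    then complex.Re (f x) else 0)).
    by apply: measurable_fun_ifT.
  by apply/funext => x; rewrite /cutoff_at; case: ifP.
rewrite (_ : (fun x => _) = (fun x => if (normc (f x) <= n) && (`|x| <= n)
    then complex.Im (f x) else 0)).
  by apply: measurable_fun_ifT.
by apply/funext => x; rewrite /cutoff_at; case: ifP.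
Qed.

Lemma normc_cutoff_at n f u : normc (cutoff_at n f u) <= normc (f u).
Proof. by rewrite /cutoff_at; case: ifP => //; rewrite Normc.normc0 normc_ge0. Qed.

Lemma cutoff_at_bounded n f u : 0 <= n -> normc (cutoff_at n f u) <= n.
Proof. by move=> n0; rewrite /cutoff_at; case: ifP => [/andP[]//|]; rewrite Normc.normc0. Qed.

Lemma Lp_cutoff_at q n f : (1 <= q)%E -> Lp q f -> Lp q (cutoff_at n f).
Proof.
move=> q1 lf; have mf := Lp_measurable lf.
apply: (Lp_le q1 (measurable_cutoff_at n mf) lf).
by apply: aeW => x; exact: normc_cutoff_at.
Qed.

Lemma Lpy_cutoff_at n f : 0 <= n -> cmeasurable f -> Lp +oo%E (cutoff_at n f).
Proof.
move=> n0 mf; apply: (@Lpy_bounded _ _ n) => //; first exact: measurable_cutoff_at.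
by apply: aeW => x; exact: cutoff_at_bounded.
Qed.

Lemma cintegrable_cutoff_at n f : 0 <= n -> cmeasurable f -> cintegrable (cutoff_at n f).
Proof.
move=> n0 mf; apply/cintegrableP; split; first exact: measurable_cutoff_at.
apply: (@le_lt_trans _ _ (\int[mu]_u (n%:E * (\1_(`[- n, n]%classic : set R) u)%:E))%E).
  apply: ge0_le_integral => //.
  - by move=> x _; rewrite lee_fin normc_ge0.
  - exact: (measurable_normcE (measurable_cutoff_at n mf)).
  - apply: emeasurable_funM => //; apply/measurable_EFinP; exact: measurable_indic.
  - move=> x _; rewrite -EFinM lee_fin indicE.
    have [xn|xn] := boolP (x \in _); first by rewrite mulr1 cutoff_at_bounded.
    rewrite mulr0 /cutoff_at; case: ifP => [/andP[_]|]; last by rewrite Normc.normc0.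
    by move: xn; rewrite notin_setE/= in_itv/= -ler_norml => /negP h1 /(negP h1).
rewrite ge0_intZl//; last by apply/measurable_EFinP; exact: measurable_indic.
pose I : set (measurableTypeR R) := `[- n, n]%classic.
have mI : measurable I by exact: measurable_itv.
have -> : (\int[mu]_x (\1_(`[- n, n]%classic : set R) x)%:E)%E = mu I.
  by rewrite (@integral_indic _ (measurableTypeR R) R mu setT measurableT _ mI) setIT.
rewrite lte_mul_pinfty ?lee_fin//.
by rewrite lebesgue_measure_itv/=; case: ifP => _; rewrite ?ltry.
Qed.

Lemma cutoff_at_cvg p f : 1 <= p -> Lp p%:E f ->
  Npow p (fun u => f u - cutoff_at n%:R f u) @[n --> \oo] --> 0%E.
Proof.
move=> p1 [mf nf]; have p0 : 0 < p by rewrite (lt_le_trans ltr01).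
rewrite /Npow.
apply: (@dct0 R (fun (n : nat) u => normc (f u - cutoff_at n%:R f u) `^ p)
  (fun u => normc (f u) `^ p)).
- move=> n; apply/measurable_EFinP; apply: measurable_powc.
  exact: (cmfB mf (measurable_cutoff_at _ mf)).
- move=> n u; rewrite powR_ge0/= ge0_ler_powR ?nnegrE ?normc_ge0 ?(ltW p0)//.
  by rewrite /cutoff_at; case: ifP; rewrite ?subrr ?subr0// Normc.normc0 normc_ge0.
- apply/integrableP; split; first exact: measurable_powc.
  under eq_integral do rewrite gee0_abs ?lee_fin ?powR_ge0//.
  exact/Lpnorm_lty_Npow.
- move=> u; apply: cvg_near_cst; near=> n.
  have h1 : normc (f u) <= n%:R by near: n; exact: nbhs_infty_ger.
  have h2 : `|u| <= n%:R by near: n; exact: nbhs_infty_ger.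
  by rewrite /cutoff_at h1 h2/= subrr Normc.normc0 powR0// gt_eqF.
Unshelve. all: end_near. Qed.

Lemma nint_shift_cvg f : cintegrable f ->
  nint (fun u => f (u - s) - f u) @[s --> (0:R)] --> 0%E.
Proof.
move=> intf; have [i1 i2] := intf; have mf := cintegrable_measurable intf.
have h1 := shift_L1_cvg i1; have h2 := shift_L1_cvg i2.
have h : (\int[mu]_u (`|complex.Re (f (u - s)) - complex.Re (f u)|%:E) +
   \int[mu]_u (`|complex.Im (f (u - s)) - complex.Im (f u)|%:E))%E
   @[s --> (0:R)] --> 0%E.
  by rewrite -[X in _ --> X](adde0 (0 : \bar R)%E); apply: cvgeD.
apply: (squeeze_cvge _ (cvg_cst 0%E) h); apply: nearW => s.
rewrite nint_ge0/=.
have mfs : cmeasurable (fun u => f (u - s)) by exact: (cmf_comp (measurable_shift (- s)) mf).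
have [n1 n2] := cmfB mfs mf.
have m1 : measurable_fun setT (fun u : R => `|complex.Re (f (u - s)) - complex.Re (f u)|%:E : \bar R).
  by apply/measurable_EFinP; apply: measurableT_comp => //; under eq_fun do rewrite -ReB.
have m2 : measurable_fun setT (fun u : R => `|complex.Im (f (u - s)) - complex.Im (f u)|%:E : \bar R).
  by apply/measurable_EFinP; apply: measurableT_comp => //; under eq_fun do rewrite -ImB.
rewrite -ge0_integralD//; apply: ge0_le_integral => //.
- by move=> u _; rewrite lee_fin normc_ge0.
- exact: (measurable_normcE (cmfB mfs mf)).
- exact: emeasurable_funD.
- by move=> u _; rewrite -EFinD lee_fin -ReB -ImB normc_le_ReIm.
Qed.

(** From |f|^p <= M^(p-1) |f|: among functions with a common bound, L_1 smallness implies L_p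
    smallness, which carries continuity of translations from L_1 to L_p. *)
Lemma Npow_le_nint p f (M : R) : 1 <= p -> 0 <= M -> cmeasurable f ->
  (forall u, normc (f u) <= M) -> (Npow p f <= (M `^ (p - 1))%:E * nint f)%E.
Proof.
move=> p1 M0 mf fM; have p0 : 0 < p by rewrite (lt_le_trans ltr01).
rewrite /nint -ge0_intZl ?powR_ge0//; last 2 first.
- exact: measurable_normcE.
- by move=> x; rewrite lee_fin normc_ge0.
apply: ge0_le_integral => //.
- by move=> u _; rewrite lee_fin powR_ge0.
- exact: measurable_powc.
- by apply: emeasurable_funM => //; exact: measurable_normcE.
- move=> u _; rewrite -EFinM lee_fin.
  rewrite -mulr_powRB1 ?normc_ge0// mulrC ler_wpM2r ?normc_ge0//.
  by rewrite ge0_ler_powR ?nnegrE ?normc_ge0// subr_ge0.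
Qed.

Lemma Lpnorm_shift_cvg p f : 1 <= p -> Lp p%:E f ->
  Lpnorm p%:E (fun u => f (u - s) - f u) @[s --> (0:R)] --> 0%E.
Proof.
move=> p1 lf; have mf := Lp_measurable lf.
have p0 : 0 < p by rewrite (lt_le_trans ltr01).
have p1E : (1 <= p%:E)%E by rewrite lee_fin.
apply/(@cvge0P R R (nbhs (0:R))); first by move=> s; exact: Lpnorm_ge0.
move=> e e0; have e3 : 0 < e / 3 by rewrite divr_gt0.
have e3p : 0 < (e / 3) `^ p by rewrite powR_gt0.
have H0 (n : nat) : (0 <= Npow p (fun u => (f u - cutoff_at n%:R f u)%R))%E by exact: Npow_ge0.
have [n _ /(_ n (leqnn n)) hn] := (@cvge0P R nat \oo _ _ H0).1 (cutoff_at_cvg p1 lf) _ e3p.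
pose g := cutoff_at n%:R f.
have mg : cmeasurable g by exact: measurable_cutoff_at.
have ig : cintegrable g by exact: cintegrable_cutoff_at.
have msh (h : R -> C) s : cmeasurable h -> cmeasurable (fun u => h (u - s)).
  by move=> mh; exact: (cmf_comp (measurable_shift (- s)) mh).
have fg : (Lpnorm p%:E (fun u => (f u - g u)%R) <= (e / 3)%:E)%E.
  exact: (Lpnorm_le_Npow p1 (ltW e3)).
(* M bounds a difference of two translates of g; the added 1 keeps the divisor Q positive even if M
   = 0. *)
pose M : R := n%:R *+ 2; pose Q := M `^ (p - 1) + 1.
have Q0 : 0 < Q by rewrite ltr_wpDl// powR_ge0.
have eQ : 0 < (e / 3) `^ p / Q by rewrite divr_gt0.
have H1 (s : R) : (0 <= nint (fun u => (g (u - s) - g u)%R))%E by exact: nint_ge0.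
have := (@cvge0P R R (nbhs (0:R)) _ _ H1).1 (nint_shift_cvg ig) _ eQ.
move=> /(_ (nbhs_filter _)); apply: filterS => s hs.
have gs : (Lpnorm p%:E (fun u => (g (u - s) - g u)%R) <= (e / 3)%:E)%E.
  apply: (Lpnorm_le_Npow p1 (ltW e3)).
  apply: (@le_trans _ _ ((M `^ (p - 1))%:E * nint (fun u => (g (u - s) - g u)%R))%E).
    apply: Npow_le_nint => //; first by rewrite mulrn_wge0.
      exact: (cmfB (msh g s mg) mg).
    move=> u; rewrite /M mulr2n (le_trans (normc_dist _ _))// lerD//; exact: cutoff_at_bounded.
  apply: (@le_trans _ _ (Q%:E * ((e / 3) `^ p / Q)%:E)%E).
    apply: lee_pmul => //; first by rewrite lee_fin powR_ge0.
    by rewrite lee_fin lerDl.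
  by rewrite -EFinM mulrCA divff ?mulr1// gt_eqF.
have fgs : (Lpnorm p%:E (fun u => (f (u - s) - g (u - s))%R) <= (e / 3)%:E)%E.
  by rewrite (Lpnorm_shift s p1E (cmfB mf mg)).
have -> : e%:E = ((e / 3)%:E + (e / 3)%:E + (e / 3)%:E)%E.
  by rewrite -!EFinD; congr EFin; lra.
apply: le_trans (leeD (leeD fgs gs) fg).
have -> : (fun u => f (u - s) - f u) = (fun u =>
   ((f (u - s) - g (u - s)) + (g (u - s) - g u)) - (f u - g u)).
  by apply/funext => u; ring.
have m1 := cmfB (msh f s mf) (msh g s mg); have m2 := cmfB (msh g s mg) mg.
have m3 := cmfB mf mg.
apply: (le_trans (Lpnorm_dist p1E (cmfD m1 m2) m3)).
by apply: leeD => //; exact: Lpnorm_triangle.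
Qed.

End translation_continuity.

(** * Approximate identities *)

Section approximate_identities.
Variable R : realType.
Local Notation C := R[i].
Local Notation mu := (@lebesgue_measure R).
Implicit Types (k f g : R -> C) (p : R) (q : \bar R).

Lemma Lp_bounded_dense p f (e : R) : 1 <= p -> Lp p%:E f -> 0 < e ->
  exists g, [/\ Lp p%:E g, Lp +oo%E g & (Lpnorm p%:E (fun u => (f u - g u)%R) <= e%:E)%E].
Proof.
move=> p1 lf e0; have mf := Lp_measurable lf.
have p0 : 0 < p by rewrite (lt_le_trans ltr01).
have ep : 0 < e `^ p by rewrite powR_gt0.
have H0 (n : nat) : (0 <= Npow p (fun u => (f u - cutoff_at n%:R f u)%R))%E by exact: Npow_ge0.
have [n _ /(_ n (leqnn n)) hn] := (@cvge0P R nat \oo _ _ H0).1 (cutoff_at_cvg p1 lf) _ ep.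
exists (cutoff_at n%:R f); split.
- by apply: Lp_cutoff_at; rewrite ?lee_fin.
- exact: Lpy_cutoff_at.
- exact: (Lpnorm_le_Npow p1 (ltW e0)).
Qed.

Definition scalek (r : R) k (s : R) : C := (r^-1)%:C * k (r^-1 * s).

Lemma measurable_scale (r : R) : measurable_fun setT (fun s : R => r * s).
Proof. exact: measurable_funM. Qed.

Lemma measurable_scalek r k : cmeasurable k -> cmeasurable (scalek r k).
Proof. by move=> mk; apply: cmfZ; exact: (cmf_comp (measurable_scale r^-1) mk). Qed.

Lemma nint_scalek r k : 0 < r -> cmeasurable k -> nint (scalek r k) = nint k.
Proof.
move=> r0 mk; have rV0 : 0 < r^-1 by rewrite invr_gt0.
exact: (nint_cov (cov_scale rV0) mk).
Qed.

Lemma cint_scalek r k : 0 < r -> cmeasurable k -> cint (scalek r k) = cint k.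
Proof.
move=> r0 mk; have rV0 : 0 < r^-1 by rewrite invr_gt0.
exact: (cint_cov (cov_scale rV0) mk).
Qed.

Lemma cintegrable_scalek r k : 0 < r -> cintegrable k -> cintegrable (scalek r k).
Proof.
move=> r0 /cintegrableP[mk nk]; apply/cintegrableP; split.
  exact: measurable_scalek.
by rewrite nint_scalek.
Qed.

(** With om(s) the p-th power of the L_p distance between f and its translate by s, Jensen and the
    substitution s = r x bound the error by a constant times the integral of |k(x)| om(r x). As om
    is bounded and tends to 0 at 0, dominated convergence concludes, for any integrable complex
    kernel. *)
Lemma approx_identity p k f : 1 <= p -> cintegrable k -> Lp p%:E f ->
  Lpnorm p%:E (fun u => conv (scalek r k) f u - cint k * f u) @[r --> 0^'+] --> 0%E.
Proof.
move=> p1 ik lf; have mf := Lp_measurable lf; have [mk nk] := (cintegrableP k).1 ik.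
have p0 : 0 < p by rewrite (lt_le_trans ltr01).
have p1E : (1 <= p%:E)%E by rewrite lee_fin.
have msh s : cmeasurable (fun u => f (u - s)).
  exact: (cmf_comp (measurable_shift (- s)) mf).
have mdiff s : cmeasurable (fun u => f (u - s) - f u).
  exact: (cmfB (msh s) mf).
have nfin : Lpnorm p%:E f \is a fin_num by case: lf => _ ?; rewrite ge0_fin_numE// Lpnorm_ge0.
have nf0 : 0 <= fine (Lpnorm p%:E f) by rewrite fine_ge0// Lpnorm_ge0.
pose om s := Npow p (fun u => f (u - s) - f u).
pose W := (fine (Lpnorm p%:E f) *+ 2) `^ p.
have om0 s : (0 <= om s)%E by exact: Npow_ge0.
have omW s : (om s <= W%:E)%E.
  rewrite /om -(Npow_Lpnorm _ p1) /W -poweR_EFin; apply: poweR_mono.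
  - exact: ltW.
  - exact: Lpnorm_ge0.
  - apply: (le_trans (Lpnorm_dist p1E (msh s) mf)).
    by rewrite (Lpnorm_shift s p1E mf) mulr2n EFinD fineK.
have omfin s : om s \is a fin_num.
  by rewrite ge0_fin_numE// (le_lt_trans (omW s))// ltry.
have mF : cmf (fun z : R * R => f (z.1 - z.2) - f z.1).
  apply: cmfB; first exact: (cmf_comp (@measurable_sub2 R) mf).
  by apply: cmf_comp mf; exact: measurable_fst.
have mom : measurable_fun setT om.
  have mN : measurable_fun setT (fun z : R * R =>
      (normc (f (z.1 - z.2) - f z.1) `^ p)%:E).
    apply/measurable_EFinP.
    exact: (measurableT_comp (@measurable_powR R p) (measurable_normc mF)).
  apply: (@measurable_fun_fubini_tonelli_G _ _ _ _ _ mu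
      (fun z : R * R => (normc (f (z.1 - z.2) - f z.1) `^ p)%:E)) => //.
  by move=> z; rewrite lee_fin powR_ge0.
have om_cvg : om s @[s --> (0:R)] --> 0%E.
  apply/(@cvge0P R R (nbhs (0:R))) => // e e0.
  have H0 (s : R) : (0 <= Lpnorm p%:E (fun u => (f (u - s) - f u)%R))%E by exact: Lpnorm_ge0.
  have ep : 0 < e `^ p^-1 by rewrite powR_gt0.
  have := (@cvge0P R R (nbhs (0:R)) _ _ H0).1 (Lpnorm_shift_cvg p1 lf) _ ep.
  move=> /(_ (nbhs_filter _)); apply: filterS => s hs.
  rewrite /om -(Npow_Lpnorm _ p1) (_ : e%:E = ((e `^ p^-1)%:E `^ p)%E).
    exact: (poweR_mono (ltW p0) (Lpnorm_ge0 _ _) hs).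
  by rewrite poweR_EFin -powRrM mulVf ?gt_eqF// powRr1// ltW.
have main : (\int[mu]_x (normc (k x) * fine (om (r * x)))%:E)%E @[r --> (0:R)] --> 0%E.
  apply: (@dct0_at R (fun r x => normc (k x) * fine (om (r * x))) (fun x => normc (k x) * W)).
  - move=> r; apply: measurable_funM; first exact: measurable_normc.
    apply: (measurableT_comp (@fine_measurable R setT measurableT)).
    exact: (measurableT_comp mom (measurable_scale r)).
  - move=> r x _; rewrite mulr_ge0 ?normc_ge0 ?fine_ge0//= ler_wpM2l ?normc_ge0//.
    by rewrite -lee_fin fineK.
  - under eq_fun do rewrite EFinM; apply: integrableZr => //.
    have mkE := measurable_normcE mk.
    apply/integrableP; split; first exact: mkE.
    by under eq_integral do rewrite gee0_abs ?lee_fin ?normc_ge0//.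
  - move=> x; have rx : r * x @[r --> (0:R)] --> (0:R).
      by rewrite -[X in _ --> X](mul0r x); apply: cvgM; [exact: cvg_id|exact: cvg_cst].
    have := cvg_comp _ _ rx om_cvg => /fine_cvgP[_ h].
    by rewrite -[X in _ --> X](mulr0 (normc (k x))); apply: cvgM => //; exact: cvg_cst.
pose K := fine (nint k).
have K0 : 0 <= K by rewrite fine_ge0// nint_ge0.
apply/(@cvge0P R R (0^'+)); first by move=> r; exact: Lpnorm_ge0.
move=> e e0; pose Q := K `^ (p - 1) + 1.
have Q0 : 0 < Q by rewrite ltr_wpDl// powR_ge0.
have eQ : 0 < e `^ p / Q by rewrite divr_gt0 ?powR_gt0.
have H1 (r : R) : (0 <= \int[mu]_x (normc (k x) * fine (om (r * x)))%:E)%E.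
  by apply: integral_ge0 => x _; rewrite lee_fin mulr_ge0 ?normc_ge0 ?fine_ge0.
have h0 := (@cvge0P R R (nbhs (0:R)) _ _ H1).1 main _ eQ.
near=> r.
have r0 : 0 < r by near: r; exact: nbhs_right_gt.
have hr : (\int[mu]_x (normc (k x) * fine (om (r * x)))%:E <= (e `^ p / Q)%:E)%E.
  by near: r; apply: cvg_within; apply: h0.
have ikr := cintegrable_scalek r0 ik.
have [mkr _] := (cintegrableP _).1 ikr.
have ae_id : \forall u \ae mu, conv (scalek r k) f u - cint k * f u =
    cint (fun s => scalek r k s * (f (u - s) - f u)).
  apply: aeS (ae_conv_integrable p1E ikr lf) => u iu.
  rewrite /conv -(cint_scalek r0 mk) -(cintZr _ ikr) -cintB//.
    by congr cint; apply/funext => s; rewrite mulrBr.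
  have := cintegrableZ (f u) ikr; congr cintegrable.
  by apply/funext => s; rewrite mulrC.
have m1 : cmeasurable (fun u => conv (scalek r k) f u - cint k * f u).
  apply: cmfB; [exact: (measurable_conv mkr mf)|exact: (cmfZ _ mf)].
have m2 : cmeasurable (fun u => cint (fun s => scalek r k s * (f (u - s) - f u))).
  apply: (measurable_cint (F := fun u s => scalek r k s * (f (u - s) - f u))).
  by apply: (cmfM _ mF); apply: (cmf_comp _ mkr); exact: measurable_snd.
rewrite (ae_eq_Lpnorm p1E m1 m2 ae_id).
apply: (Lpnorm_le_Npow p1 (ltW e0)).
apply: (le_trans (Npow_cint_le (F := fun u s => f (u - s) - f u) p1 ikr mF)).
rewrite (nint_scalek r0 mk) -/K.
have -> : (\int[mu]_s ((normc (scalek r k s))%:E * Npow p (fun u : R => (f (u - s) - f u)%R)) =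
    \int[mu]_x (normc (k x) * fine (om (r * x)))%:E)%E.
  have [_ _ _ cv] := cov_scale r0.
  rewrite -cv.
  - apply: eq_integral => x _; rewrite /scalek -/(om (r * x)).
    rewrite Normc.normcM normc_real gtr0_norm ?invr_gt0// mulrA mulVf ?gt_eqF// mul1r.
    rewrite [RHS]EFinM (fineK (omfin _)) -muleA (muleC (om _)) muleA -EFinM; congr (_ * _)%E.
    by rewrite mulrAC mulVf ?gt_eqF// mul1r.
  - by apply: emeasurable_funM; [exact: (measurable_normcE mkr)|exact: mom].
  - by move=> x; apply: mule_ge0; [rewrite lee_fin normc_ge0|exact: Npow_ge0].
apply: (@le_trans _ _ (Q%:E * (e `^ p / Q)%:E)%E).
  apply: lee_pmul => //; rewrite lee_fin ?powR_ge0//.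
  by rewrite /Q lerDl.
by rewrite -EFinM mulrCA divff ?mulr1// gt_eqF.
Unshelve. all: end_near. Qed.

End approximate_identities.

(** * The heat semigroup and its generator *)

Section gaussian_integrals.
Variable R : realType.
Local Notation C := R[i].
Local Notation mu := (@lebesgue_measure R).

Lemma measurable_gaussian (b : R) : measurable_fun setT (fun x : R => expR (- (b * x ^+ 2))).
Proof.
apply: (measurableT_comp (@measurable_expR R)).
by apply: measurable_funN; apply: measurable_funM => //; exact: exprn_measurable.
Qed.

Lemma integral_gaussian (b : R) : 0 < b ->
  (\int[mu]_x (expR (- (b * x ^+ 2)))%:E = (Num.sqrt (pi / b))%:E)%E.
Proof.
move=> b0; have c0 : 0 < Num.sqrt b by rewrite sqrtr_gt0.
have [_ _ _ cv] := cov_scale c0.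
have mg : measurable_fun setT (fun x : R => (gauss_fun x)%:E : \bar R).
  by apply/measurable_EFinP; exact: measurable_gauss_fun.
have := cv _ mg (fun x => gauss_fun_ge0 x).
rewrite integralT_gauss.
rewrite (_ : (fun x => _) = (fun x : R => (expR (- (b * x ^+ 2)))%:E * (Num.sqrt b)%:E)%E); last first.
  by apply/funext => x; rewrite /gauss_fun/= exprMn sqr_sqrtr ?(ltW b0).
rewrite ge0_intZr; first last.
- by move=> x; rewrite lee_fin expR_ge0.
- by apply/measurable_EFinP; exact: measurable_gaussian.
- by rewrite lee_fin ltW.
move=> h.
rewrite sqrtrM ?pi_ge0// sqrtrV ?(ltW b0)// EFinM -h -muleA -EFinM.
by rewrite divff ?gt_eqF// mule1.
Qed.

Lemma integral_gaussian_shift (b m : R) : 0 < b ->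
  (\int[mu]_x (expR (- (b * (x - m) ^+ 2)))%:E = (Num.sqrt (pi / b))%:E)%E.
Proof.
move=> b0; rewrite -(integral_gaussian b0).
rewrite -(ge0_integral_shift (- m) (f := fun x => (expR (- (b * x ^+ 2)))%:E))//.
by apply/measurable_EFinP; exact: measurable_gaussian.
Qed.

Definition heat (t s : R) : R :=
  (4 * pi * t) `^ (- 2^-1) * expR (- (s ^+ 2 * (4 * t)^-1)).

Lemma heat_coefE (t : R) : 0 < t -> (4 * pi * t) `^ (- 2^-1) = (Num.sqrt (4 * pi * t))^-1.
Proof. by move=> t0; rewrite powRN powR12_sqrt// !mulr_ge0 ?pi_ge0// ltW. Qed.

Lemma heat_ge0 (t s : R) : 0 <= heat t s.
Proof. by rewrite mulr_ge0 ?powR_ge0 ?expR_ge0. Qed.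

Lemma measurable_heat (t : R) : measurable_fun setT (heat t).
Proof.
apply: measurable_funM => //; apply: (measurableT_comp (@measurable_expR R)).
by apply: measurable_funN; apply: measurable_funM => //; exact: exprn_measurable.
Qed.

Lemma heatN t s : heat t (- s) = heat t s.
Proof. by rewrite /heat sqrrN. Qed.

Lemma integral_heat (t : R) : 0 < t -> (\int[mu]_s (heat t s)%:E = 1)%E.
Proof.
move=> t0; have b0 : 0 < (4 * t)^-1 by rewrite invr_gt0 mulr_gt0.
rewrite (_ : (fun x => _) = (fun x : R =>
    ((4 * pi * t) `^ (- 2^-1))%:E * (expR (- ((4 * t)^-1 * x ^+ 2)))%:E)%E); last first.
  by apply/funext => x; rewrite /heat EFinM (mulrC (x ^+ 2)).
rewrite ge0_intZl; first last.
- by move=> x; rewrite lee_fin expR_ge0.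
- by apply/measurable_EFinP; exact: measurable_gaussian.
- exact: powR_ge0.
rewrite (integral_gaussian b0) -EFinM heat_coefE// invrK.
rewrite (_ : pi * (4 * t) = 4 * pi * t); last by ring.
by rewrite mulVf// gt_eqF// sqrtr_gt0 !mulr_gt0// pi_gt0.
Qed.

Definition cheat (t : R) (s : R) : C := (heat t s)%:C.

Lemma measurable_cheat t : cmeasurable (cheat t).
Proof. exact: cmf_real (measurable_heat t). Qed.

Lemma nint_cheat t : 0 < t -> nint (cheat t) = 1%E.
Proof.
move=> t0; rewrite -(integral_heat t0); apply: eq_integral => s _.
by rewrite normc_real ger0_norm// heat_ge0.
Qed.

Lemma cintegrable_cheat t : 0 < t -> cintegrable (cheat t).
Proof.
move=> t0; apply/cintegrableP; split; first exact: measurable_cheat.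
by rewrite nint_cheat// ltry.
Qed.

Lemma cint_cheat t : 0 < t -> cint (cheat t) = 1.
Proof. by move=> t0; rewrite cint_real /Rintegral integral_heat. Qed.

Lemma cheat_scale t : 0 < t -> cheat t = scalek (Num.sqrt t) (cheat 1).
Proof.
move=> t0; apply/funext => s; rewrite /cheat /scalek /heat.
rewrite heat_coefE// (heat_coefE ltr01) mulr1 sqrtrM ?mulr_ge0 ?pi_ge0//.
apply: complex_ext; rewrite !ReImE/=; last by ring.
rewrite exprMn exprVn sqr_sqrtr ?(ltW t0)// !mulr1 [RHS]mulrA invfM.
congr (_ * expR _); first exact: mulrC.
by rewrite invfM; ring.
Qed.

Lemma conv_cheat s t : 0 < s -> 0 < t -> conv (cheat s) (cheat t) = cheat (s + t).
Proof.
move=> s0 t0; apply/funext => u.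
have st0 : 0 < s + t by rewrite addr_gt0.
(* Completing the square in v: v^2/(4s) + (u-v)^2/(4t) = b (v-m)^2 + u^2/(4(s+t)). *)
pose b : R := (s + t) / (4 * s * t).
have b0 : 0 < b by rewrite divr_gt0// !mulr_gt0.
pose m : R := s * u / (s + t).
pose c : R := (4 * pi * s) `^ (- 2^-1) * (4 * pi * t) `^ (- 2^-1) *
  expR (- (u ^+ 2 * (4 * (s + t))^-1)).
have nz := (gt_eqF s0, gt_eqF t0, gt_eqF st0).
have E v : cheat s v * cheat t (u - v) = (c * expR (- (b * (v - m) ^+ 2)))%:C.
  rewrite /cheat -rmorphM /=; congr (_%:C).
  rewrite /heat /c mulrACA -!mulrA; do 2 congr (_ * _); rewrite -!expRD; congr expR.
  by rewrite /b /m; field; rewrite ?nz.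
rewrite /conv (_ : (fun v => _) = (fun v => (c * expR (- (b * (v - m) ^+ 2)))%:C)); last first.
  by apply/funext => v; rewrite E.
rewrite cint_real /cheat; congr (_%:C).
have mexp : measurable_fun setT (fun x : R => (expR (- (b * (x - m) ^+ 2)))%:E : \bar R).
  apply/measurable_EFinP.
  exact: (measurableT_comp (measurable_gaussian b) (measurable_shift (- m))).
rewrite /Rintegral; under eq_integral do rewrite EFinM.
rewrite ge0_intZl; first last.
- by move=> x; rewrite lee_fin expR_ge0.
- exact: mexp.
- by rewrite /c !mulr_ge0 ?powR_ge0 ?expR_ge0.
rewrite (integral_gaussian_shift m b0) -EFinM/= /c /heat.
rewrite mulrAC; congr (_ * _); rewrite !heat_coefE//.
have h4 : 0 <= 4 * pi :> R by rewrite mulr_ge0 ?pi_ge0.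
have -> : Num.sqrt (pi / b) = Num.sqrt (4 * pi * s) * Num.sqrt (4 * pi * t) /
    Num.sqrt (4 * pi * (s + t)).
  have sn0 : Num.sqrt (4 * pi * (s + t)) != 0.
    by rewrite gt_eqF// sqrtr_gt0 !mulr_gt0// pi_gt0.
  apply: (mulIf sn0); rewrite divfK// -!sqrtrM; last 2 first.
  - by rewrite divr_ge0 ?pi_ge0// ltW.
  - by rewrite mulr_ge0// ltW.
  have pi0 := gt_eqF (pi_gt0 R).
  by congr Num.sqrt; rewrite /b; field; rewrite ?nz ?pi0.
have ns : Num.sqrt (4 * pi * s) != 0 by rewrite gt_eqF// sqrtr_gt0 !mulr_gt0// pi_gt0.
have nt : Num.sqrt (4 * pi * t) != 0 by rewrite gt_eqF// sqrtr_gt0 !mulr_gt0// pi_gt0.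
have nst : Num.sqrt (4 * pi * (s + t)) != 0 by rewrite gt_eqF// sqrtr_gt0 !mulr_gt0// pi_gt0.
by field; rewrite ns nt nst.
Qed.

End gaussian_integrals.

(** * Tents and the second moment of the Gaussian *)

Section tents.
Variable R : realType.
Local Notation C := R[i].
Local Notation mu := (@lebesgue_measure R).

Lemma measurable_boolR d (T : measurableType d) (b : T -> bool) :
  measurable_fun setT b -> measurable_fun setT (fun x => (b x)%:R : R).
Proof.
move=> mb; rewrite (_ : (fun x => _) = (fun x => if b x then 1 else 0 : R)); last first.
  by apply/funext => x; case: (b x).
by apply: measurable_fun_ifT.
Qed.

Lemma integral_itv_indic (a b : R) : a <= b ->
  (\int[mu]_v ((a <= v <= b)%R%:R)%:E = (b - a)%:E)%E.
Proof.
move=> ab; have mI : measurable (`[a, b]%classic : set (measurableTypeR R)).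
  exact: measurable_itv.
have := @integral_indic _ (measurableTypeR R) R mu setT measurableT _ mI.
rewrite setIT => h; have := lebesgue_measure_itv `[a, b]%R; rewrite -h /= lte_fin => {}h.
rewrite (_ : (b - a)%:E = if a < b then (b%:E - a%:E)%E else 0%E); last first.
  by case: ltgtP ab => // -> _; rewrite subrr.
rewrite -h; apply: eq_integral => v _; rewrite indicE; congr (_%:R%:E).
by rewrite mem_setE in_itv.
Qed.

(** The kernel of second differences: g(u+h) + g(u-h) - 2 g(u) is the integral of tent h(s) g''(u-s)
    ds. *)
Definition tent (h s : R) : R := Num.max 0 (h - `|s|).

Lemma tent_ge0 h s : 0 <= tent h s.
Proof. by rewrite le_max lexx. Qed.

(** Layer-cake form of the tent: integrals of tents become areas computed by Tonelli over |s| <=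
    v. *)
Lemma integral_tent_slice h s :
  (\int[mu]_v ((`|s| <= v <= h)%R%:R)%:E = (tent h s)%:E)%E.
Proof.
have [sh|hs] := leP `|s| h.
  by rewrite integral_itv_indic// /tent max_r// subr_ge0.
rewrite /tent max_l ?subr_le0 ?ltW//; apply: integral0_eq => v _.
case: (boolP (_ <= v <= h)) => // /andP[h1 h2].
by move: (lt_le_trans hs (le_trans h1 h2)); rewrite ltxx.
Qed.

Lemma measurable_abs_le : measurable_fun setT (fun z : R * R => `|z.1| <= z.2).
Proof.
apply: measurable_fun_ler; last exact: measurable_snd.
exact: (measurableT_comp (@normr_measurable R setT) measurable_fst).
Qed.

Lemma integral_abs_le v : (\int[mu]_s ((`|s| <= v)%R%:R)%:E = ((0 <= v)%R%:R * (v *+ 2))%:E)%E.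
Proof.
have [v0|v0] := leP 0 v.
  rewrite mul1r (_ : v *+ 2 = v - (- v)); last by rewrite opprK mulr2n.
  rewrite -integral_itv_indic ?ge0_cp//.
  by apply: eq_integral => s _; rewrite ler_norml.
rewrite mul0r; apply: integral0_eq => s _.
by rewrite (_ : (_ <= _) = false)//; apply/negbTE; rewrite -ltNge (lt_le_trans v0).
Qed.

Let swap_abs_le (w : R -> R) : measurable_fun setT w -> (forall v, 0 <= w v) ->
  (\int[mu]_s \int[mu]_v ((`|s| <= v)%R%:R * w v)%:E =
   \int[mu]_v ((0 <= v)%R%:R * (v *+ 2 * w v))%:E)%E.
Proof.
move=> mw w0.
have mF : measurable_fun setT (fun z : R * R => (((`|z.1| <= z.2)%R%:R : R) * w z.2)%:E).
  apply/measurable_EFinP; apply: measurable_funM.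
    exact: (measurable_boolR measurable_abs_le).
  exact: (measurableT_comp mw measurable_snd).
rewrite (@fubini_tonelli _ _ _ _ _ mu mu
  (fun z : R * R => (((`|z.1| <= z.2)%R%:R : R) * w z.2)%:E) mF); last first.
  by move=> z; rewrite lee_fin mulr_ge0.
apply: eq_integral => v _ /=; under eq_integral do rewrite EFinM.
rewrite ge0_intZr ?lee_fin//; last first.
  apply/measurable_EFinP; apply: measurable_boolR.
  by apply: measurable_fun_ler => //; exact: normr_measurable.
by rewrite integral_abs_le -EFinM mulrA.
Qed.

Lemma measurable_le_cst (h : R) : measurable_fun setT (fun v : R => (v <= h)%R%:R : R).
Proof. by apply: measurable_boolR; exact: measurable_fun_ler. Qed.

Lemma integral_tent h : 0 <= h -> (\int[mu]_s (tent h s)%:E = (h ^+ 2)%:E)%E.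
Proof.
move=> h0; under eq_integral do rewrite -integral_tent_slice.
transitivity (\int[mu]_s \int[mu]_v (((`|s| <= v)%R%:R : R) * (v <= h)%R%:R)%:E)%E.
  apply: eq_integral => s _; apply: eq_integral => v _; congr (_%:E).
  by case: (`|s| <= v) => /=; rewrite ?mul1r ?mul0r.
rewrite (swap_abs_le (measurable_le_cst h))//.
transitivity (\int[mu]_(v in `[0%R, h]) (v *+ 2)%:E)%E.
  rewrite [RHS]integral_mkcond; apply: eq_integral => v _; rewrite patchE mem_setE in_itv/=.
  by case: (0 <= v); case: (v <= h); rewrite /= ?mul1r ?mul0r ?mulr1 ?mulr0.
move: h0; rewrite le_eqVlt => /predU1P[<-|h0].
  by rewrite set_itv1 integral_set1 expr0n.
rewrite (continuous_FTC2 (F := fun v : R => v ^+ 2) h0).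
- by rewrite expr0n/= sube0.
- apply: continuous_subspaceT => v.
  by apply: cvgD; exact: cvg_id.
- split.
  + by move=> v _; exact: exprn_derivable.
  + by apply: cvg_at_right_filter; exact: exprn_continuous.
  + by apply: cvg_at_left_filter; exact: exprn_continuous.
- by move=> v _; rewrite exp_derive1 /= expr1 scaler_nat.
Qed.

Lemma continuous_gaussian (b : R) : continuous (fun v : R => expR (- (b * v ^+ 2))).
Proof.
move=> v; apply: (continuous_comp (f := fun v : R => - (b * v ^+ 2))); last exact: continuous_expR.
by apply: cvgN; apply: cvgM; [exact: cvg_cst|exact: exprn_continuous].
Qed.

(** The Gaussian as the integral of minus its derivative beyond |s|, that is a superposition of
    indicators of |s| <= v; Tonelli then turns its mass into its second moment. *)
Lemma integral_gauss_tail s :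
  (\int[mu]_v (((`|s| <= v)%R%:R : R) * ((0 <= v)%R%:R * (v * 2^-1) * expR (- (4^-1 * v ^+ 2))))%:E =
   (expR (- (4^-1 * s ^+ 2)))%:E)%E.
Proof.
pose F v : R := - expR (- (4^-1 * v ^+ 2)).
have dF v : is_derive v (1:R) F ((v * 2^-1) * expR (- (4^-1 * v ^+ 2))).
  by apply: is_derive_eq; rewrite /GRing.scale/=; set e := expR _; field.
have cF : continuous F by move=> x; apply/differentiable_continuous/derivable1_diffP; case: (dF x).
transitivity (\int[mu]_(v in `[`|s|%R, +oo[) ((v * 2^-1) * expR (- (4^-1 * v ^+ 2)))%:E)%E.
  rewrite [RHS]integral_mkcond; apply: eq_integral => v _; rewrite patchE mem_setE in_itv/= andbT.
  have [sv|] := leP `|s| v; last by rewrite mul0r.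
  by rewrite (le_trans _ sv)// !mul1r.
rewrite (ge0_continuous_FTC2y (F := F) (l := 0)).
- by rewrite /F -EFinB sub0r opprK -normrX ger0_norm// sqr_ge0.
- move=> v sv; rewrite !mulr_ge0 ?expR_ge0// (le_trans _ sv)//.
- apply: continuous_subspaceT => v.
  apply: cvgM; first by apply: cvgM; [exact: cvg_id|exact: cvg_cst].
  exact: continuous_gaussian.
- rewrite -oppr0; apply: cvgN.
  have h : (4^-1 * (v : R) ^+ 2) @[v --> +oo%R] --> +oo%R.
    by apply: gt0_cvgMry => //; exact: cvgr_expr2.
  exact: (cvg_comp _ _ h (@cvgr_expR R)).
- by move=> v _; case: (dF v).
- by apply: cvg_at_right_filter; exact: cF.
- by move=> v _; rewrite derive1E; exact: derive_val.
Qed.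

Lemma heat_second_moment : (\int[mu]_s (heat 1 s * s ^+ 2)%:E = 2%:E)%E.
Proof.
pose g (v : R) := v ^+ 2 * expR (- (4^-1 * v ^+ 2)).
have cg : continuous g.
  move=> v; apply: cvgM; first exact: exprn_continuous.
  exact: continuous_gaussian.
have g0 v : 0 <= g v by rewrite mulr_ge0 ?sqr_ge0 ?expR_ge0.
have mE : measurable_fun setT (fun v : R => (0 <= v)%R%:R * (v * 2^-1) * expR (- (4^-1 * v ^+ 2))).
  apply: measurable_funM; last exact: measurable_gaussian.
  apply: measurable_funM; last exact: measurable_funM.
  by apply: measurable_boolR; exact: measurable_fun_ler.
have half : (\int[mu]_v (g v)%:E = 2%:E * \int[mu]_s (expR (- (4^-1 * s ^+ 2)))%:E)%E.
  rewrite (ge0_symfun_integralT g0 cg); last by move=> v; rewrite /g /= sqrrN.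
  congr (_ * _)%E; under [RHS]eq_integral do rewrite -integral_gauss_tail.
  rewrite swap_abs_le//; last first.
    move=> v; have [v0|] := leP 0 v; last by rewrite !mul0r.
    by rewrite !mulr_ge0 ?expR_ge0.
  rewrite integral_mkcond; apply: eq_integral => v _; rewrite patchE.
  have -> : (v \in [set x : R | 0 <= x]) = (0 <= v) by rewrite mem_setE.
  case: (0 <= v); rewrite ?mul0r// !mul1r /g; congr (_%:E).
  by set e := expR _; field.
have mg : measurable_fun setT (fun v : R => (g v)%:E).
  by apply/measurable_EFinP; exact: continuous_measurable_fun.
have me : measurable_fun setT (fun v : R => (expR (- (4^-1 * v ^+ 2)))%:E).
  by apply/measurable_EFinP; exact: measurable_gaussian.
pose A : R := (4 * pi * 1) `^ (- 2^-1).
have hE s : heat 1 s = A * expR (- (4^-1 * s ^+ 2)).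
  by rewrite /heat -/A mulr1 (mulrC _ 4^-1).
have A0 : 0 <= A by exact: powR_ge0.
transitivity (\int[mu]_s (A%:E * (g s)%:E))%E.
  by apply: eq_integral => s _; rewrite hE -EFinM /g; congr (_%:E); ring.
rewrite (ge0_intZl A0 mg); last by move=> v; rewrite lee_fin.
rewrite half muleCA -(ge0_intZl A0 me); last by move=> v; rewrite lee_fin expR_ge0.
have := integral_heat (@ltr01 R).
under eq_integral do rewrite hE EFinM.
by move=> ->; rewrite mule1.
Qed.

End tents.

(** * The second-difference kernel of the heat semigroup *)

Section second_difference_kernel.
Variable R : realType.
Local Notation C := R[i].
Local Notation mu := (@lebesgue_measure R).
Implicit Types (t : R) (f g h psi : R -> C) (p : R) (q : \bar R).

Lemma heat_scale t s : 0 < t -> heat t s = (Num.sqrt t)^-1 * heat 1 ((Num.sqrt t)^-1 * s).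
Proof.
move=> t0; have := congr1 (fun k => complex.Re (k s)) (cheat_scale t0).
by rewrite /cheat /scalek ReZ.
Qed.

Lemma heat_second_moment_t t : 0 < t -> (\int[mu]_s (heat t s * s ^+ 2)%:E = (2 * t)%:E)%E.
Proof.
move=> t0; have r0 : 0 < (Num.sqrt t)^-1 by rewrite invr_gt0 sqrtr_gt0.
have m2 : measurable_fun setT (fun s : R => (heat 1 s * s ^+ 2)%:E).
  apply/measurable_EFinP; apply: measurable_funM; first exact: measurable_heat.
  exact: exprn_measurable.
have p2 (s : R) : (0 <= (heat 1 s * s ^+ 2)%:E)%E by rewrite lee_fin mulr_ge0 ?sqr_ge0 ?heat_ge0.
have [_ _ _ cv] := cov_scale r0.
rewrite mulrC EFinM -(heat_second_moment R) -(cv _ m2 p2).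
have m3 : measurable_fun setT
    (fun x : R => ((heat 1 ((Num.sqrt t)^-1 * x) * ((Num.sqrt t)^-1 * x) ^+ 2)%:E *
       ((Num.sqrt t)^-1)%:E)%E).
  apply: emeasurable_funM => //.
  exact: (measurableT_comp m2 (measurable_scale (Num.sqrt t)^-1)).
rewrite -(ge0_intZl (ltW t0) m3); last first.
  by move=> x; rewrite mule_ge0// lee_fin ltW.
apply: eq_integral => s _; rewrite (heat_scale s t0) -!EFinM; congr (_%:E).
rewrite exprMn exprVn sqr_sqrtr ?(ltW t0)//.
have sn : Num.sqrt t != 0 by rewrite gt_eqF// sqrtr_gt0.
by field; rewrite sn gt_eqF.
Qed.

Lemma measurable_tent2 : measurable_fun setT (fun z : R * R => tent `|z.2| z.1).
Proof.
apply: measurable_maxr => //; apply: measurable_funB.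
  exact: (measurableT_comp (@normr_measurable R setT) measurable_snd).
exact: (measurableT_comp (@normr_measurable R setT) measurable_fst).
Qed.

Lemma measurable_heat_tent2 t :
  measurable_fun setT (fun z : R * R => heat t z.2 * tent `|z.2| z.1).
Proof.
apply: measurable_funM; last exact: measurable_tent2.
exact: (measurableT_comp (measurable_heat t) measurable_snd).
Qed.

Lemma heat_tent_ge0 t s x : 0 <= heat t s * tent `|s| x.
Proof. by rewrite mulr_ge0 ?heat_ge0 ?tent_ge0. Qed.

(** This is the integral of heat tau (x) over 0 < tau < t, the decaying solution of rho'' = heat t -
    delta_0, written without any integration in time. *)
Definition rho t (x : R) : R := 2^-1 * (\int[mu]_s (heat t s * tent `|s| x)).

Lemma measurable_heat_tent t x : measurable_fun setT (fun s : R => heat t s * tent `|s| x).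
Proof.
have h := measurable_heat_tent2 t.
exact: (measurableT_comp h (pair1_measurable x)).
Qed.

Lemma integral_heat_tent t x : 0 < t ->
  (\int[mu]_s (heat t s * tent `|s| x)%:E = (2 * rho t x)%:E)%E.
Proof.
move=> t0; rewrite /rho mulrA divff ?pnatr_eq0// mul1r /Rintegral fineK//.
rewrite ge0_fin_numE; last by apply: integral_ge0 => s _; rewrite lee_fin heat_tent_ge0.
have m1 : measurable_fun setT (fun s : R => (heat t s)%:E).
  by apply/measurable_EFinP; exact: measurable_heat.
have m2 : measurable_fun setT (fun s : R => (heat t s * s ^+ 2)%:E).
  apply/measurable_EFinP; apply: measurable_funM; first exact: measurable_heat.
  exact: exprn_measurable.
(* Finiteness: a tent has height at most |s| <= 1 + s^2, and the mass and the second moment of the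
   Gaussian are finite. *)
apply: (@le_lt_trans _ _ (\int[mu]_s ((heat t s)%:E + (heat t s * s ^+ 2)%:E))%E).
  apply: ge0_le_integral => //.
  - by move=> s _; rewrite lee_fin heat_tent_ge0.
  - by apply/measurable_EFinP; exact: measurable_heat_tent.
  - exact: emeasurable_funD.
  - move=> s _; rewrite -EFinD lee_fin -[X in X + _]mulr1 -mulrDr ler_wpM2l ?heat_ge0//.
    rewrite ge_max addr_ge0 ?sqr_ge0//= lerBlDr (@le_trans _ _ (1 + s ^+ 2))//; last first.
      by rewrite lerDl normr_ge0.
    rewrite -real_normK ?num_real//; have := sqr_ge0 (`|s| - 2^-1).
    by move: `|s| => v h; nra.
rewrite ge0_integralD//; last 2 first.
- by move=> s _; rewrite lee_fin heat_ge0.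
- by move=> s _; rewrite lee_fin mulr_ge0 ?heat_ge0 ?sqr_ge0.
by rewrite (integral_heat t0) (heat_second_moment_t t0) -EFinD ltry.
Qed.

Lemma rho_ge0 t x : 0 <= rho t x.
Proof. by rewrite mulr_ge0// Rintegral_ge0// => s _; exact: heat_tent_ge0. Qed.

Lemma measurable_rho t : measurable_fun setT (rho t).
Proof.
apply: measurable_funM => //.
exact: (measurable_Rintegral_param (f := fun x s => heat t s * tent `|s| x)
  (measurable_heat_tent2 t)).
Qed.

Lemma rhoN t x : rho t (- x) = rho t x.
Proof. by rewrite /rho /tent normrN. Qed.

(** A tent of half-width |s| has area s^2, so the mass is half the second moment 2 t of the
    Gaussian. *)
Lemma integral_rho t : 0 < t -> (\int[mu]_x (rho t x)%:E = t%:E)%E.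
Proof.
move=> t0.
have mr : measurable_fun setT (fun x : R => (rho t x)%:E).
  by apply/measurable_EFinP; exact: measurable_rho.
have : (2%:E * \int[mu]_x (rho t x)%:E = 2%:E * t%:E)%E.
  rewrite -(ge0_intZl _ mr)//; last by move=> x; rewrite lee_fin rho_ge0.
  under eq_integral do rewrite -EFinM -(integral_heat_tent _ t0).
  have mF : measurable_fun setT (fun z : R * R => (heat t z.2 * tent `|z.2| z.1)%:E).
    by apply/measurable_EFinP; exact: measurable_heat_tent2.
  rewrite (@fubini_tonelli _ _ _ _ _ mu mu
    (fun z : R * R => (heat t z.2 * tent `|z.2| z.1)%:E) mF); last first.
    by move=> z; rewrite lee_fin heat_tent_ge0.
  rewrite -EFinM -(heat_second_moment_t t0); apply: eq_integral => s _ /=.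
  under eq_integral do rewrite EFinM.
  rewrite ge0_intZl ?heat_ge0//; first last.
  - by move=> x; rewrite lee_fin tent_ge0.
  - apply/measurable_EFinP; apply: measurable_maxr => //; exact: measurable_funB.
  by rewrite integral_tent ?normr_ge0// real_normK ?num_real// EFinM.
have fin : (\int[mu]_x (rho t x)%:E)%E != +oo%E -> (\int[mu]_x (rho t x)%:E)%E \is a fin_num.
  by move=> h; rewrite ge0_fin_numE ?lt_neqAle ?h ?leey// integral_ge0// => x _; rewrite lee_fin rho_ge0.
case: (eqVneq (\int[mu]_x (rho t x)%:E)%E +oo%E) => [->|/fin/fineK <-].
  by rewrite mulry gtr0_sg// mul1e.
by rewrite -!EFinM => -[] /(mulfI _) ->//; rewrite pnatr_eq0.
Qed.

Definition crho t (x : R) : C := (rho t x)%:C.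

Lemma measurable_crho t : cmeasurable (crho t).
Proof. exact: cmf_real (measurable_rho t). Qed.

Lemma nint_crho t : 0 < t -> nint (crho t) = t%:E.
Proof.
move=> t0; rewrite -(integral_rho t0); apply: eq_integral => s _.
by rewrite normc_real ger0_norm// rho_ge0.
Qed.

Lemma cintegrable_crho t : 0 < t -> cintegrable (crho t).
Proof.
move=> t0; apply/cintegrableP; split; first exact: measurable_crho.
by rewrite nint_crho// ltry.
Qed.

Lemma cint_crho t : 0 < t -> cint (crho t) = t%:C.
Proof. by move=> t0; rewrite cint_real /Rintegral integral_rho. Qed.

Lemma tent_scale (c v x : R) : 0 < c -> tent (c * v) (c * x) = c * tent v x.
Proof. by move=> c0; rewrite /tent normrM gtr0_norm// -mulrBr maxr_pMr ?mulr0// ltW. Qed.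

(** The reason why rho_t / t is an approximate identity of width sqrt t. *)
Lemma crho_scale t : 0 < t -> crho t = (fun x => t%:C * scalek (Num.sqrt t) (crho 1) x).
Proof.
move=> t0; apply/funext => x; rewrite /crho /scalek.
rewrite -!rmorphM /=; congr (_%:C); rewrite /rho mulrCA [in RHS]mulrA [RHS]mulrCA; congr (_ * _).
have c0 : 0 < Num.sqrt t by rewrite sqrtr_gt0.
have cV0 : 0 < (Num.sqrt t)^-1 by rewrite invr_gt0.
have [_ _ _ cv] := cov_scale cV0.
rewrite /Rintegral -(cv (fun s => (heat 1 s * tent `|s| ((Num.sqrt t)^-1 * x))%:E)); first last.
- by move=> s; rewrite lee_fin heat_tent_ge0.
- by apply/measurable_EFinP; exact: measurable_heat_tent.
have -> : (Num.sqrt t)^-1 * t = Num.sqrt t.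
  rewrite mulrC; by rewrite -{1}(sqr_sqrtr (ltW t0)) expr2 mulfK// gt_eqF.
have mm : measurable_fun setT (fun s : R => (heat 1 ((Num.sqrt t)^-1 * s) *
    tent `|(Num.sqrt t)^-1 * s| ((Num.sqrt t)^-1 * x))%:E : \bar R).
  apply/measurable_EFinP.
  exact: (measurableT_comp (measurable_heat_tent 1 _) (measurable_scale (Num.sqrt t)^-1)).
rewrite /cst ge0_intZr; first last.
- by move=> s; rewrite lee_fin heat_tent_ge0.
- exact: mm.
- by rewrite lee_fin ltW.
have E : (\int[mu]_s (heat t s * tent `|s| x)%:E)%E =
    (\int[mu]_s (heat 1 ((Num.sqrt t)^-1 * s) *
      tent `|(Num.sqrt t)^-1 * s| ((Num.sqrt t)^-1 * x))%:E)%E.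
  apply: eq_integral => s _; congr (_%:E).
  rewrite (heat_scale s t0) normrM gtr0_norm// tent_scale//.
  by rewrite [RHS]mulrCA mulrA.
rewrite E; set I := (\int[mu]_s _)%E.
have Ifin : I \is a fin_num by rewrite /I -E integral_heat_tent.
by rewrite -(fineK Ifin)/= mulrCA divff ?mulr1// gt_eqF.
Qed.

(* g'' = h + c * delta_0 in the sense of distributions, tested against tents. *)
Definition second_primitive (c : C) g h := forall x u : R,
  cintegrable (fun s => (tent `|x| s)%:C * h (u - s)) /\
  g (u + x) + g (u - x) - (g u) *+ 2 = cint (fun s => (tent `|x| s)%:C * h (u - s)) + c * (tent `|x| u)%:C.

Lemma RCM (a b : R) : (a * b)%:C = a%:C * b%:C :> C.
Proof. by apply: complex_ext; rewrite !ReImE/=; ring. Qed.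

Lemma RCD (a b : R) : (a + b)%:C = a%:C + b%:C :> C.
Proof. by apply: complex_ext; rewrite !ReImE/=; ring. Qed.

Lemma RCN (a : R) : (- a)%:C = - a%:C :> C.
Proof. by apply: complex_ext; rewrite !ReImE/=; ring. Qed.

Let mulr2n_split (z : C) : 2 * z = z + z. Proof. by rewrite mulr_natl mulr2n. Qed.

(** The second-difference identity at step s is averaged against heat t (s). Since the Gaussian is
    even, its left side gives 2 (conv (cheat t) g - g); on its right side Fubini averages the tents
    first, which produces 2 rho. *)
Lemma conv_cheatB c t g h u : 0 < t -> cmeasurable h -> second_primitive c g h ->
  cintegrable (fun s => cheat t s * g (u - s)) ->
  cintegrable (fun s => crho t s * h (u - s)) ->
  conv (cheat t) g u - g u = conv (crho t) h u + c * crho t u.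
Proof.
move=> t0 mh gh ig ih.
have it x : cintegrable (fun s => (heat t s * tent `|s| x)%:C : C).
  apply/cintegrableP; split; first exact: cmf_real (measurable_heat_tent t x).
  apply: (@le_lt_trans _ _ (2 * rho t x)%:E); last exact: ltry.
  rewrite -(integral_heat_tent _ t0) le_eqVlt; apply/orP; left; apply/eqP.
  by apply: eq_integral => s _; rewrite normc_real ger0_norm ?heat_tent_ge0.
have ct x : cint (fun s => (heat t s * tent `|s| x)%:C : C) = 2 * crho t x.
  rewrite cint_real /Rintegral (integral_heat_tent x t0).
  have -> : fine (2 * rho t x)%:E = 2 * rho t x by [].
  by rewrite RCM /crho; congr (_ * _); rewrite rmorphMn.
have ig' : cintegrable (fun s => cheat t s * g (u + s)).
  have := cintegrable_reflect 0 ig; congr cintegrable; apply/funext => s.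
  by rewrite sub0r opprK /cheat heatN.
have i1 := cintegrable_cheat t0.
have i1u : cintegrable (fun s => cheat t s * g u).
  by have := cintegrableZ (g u) i1; congr cintegrable; apply/funext => s; rewrite mulrC.
have mh' : cmeasurable (fun s => h (u - s)) by exact: (cmf_comp (measurable_reflect u) mh).
pose F (x s : R) : C := (heat t s * tent `|s| x)%:C * h (u - x).
have mF : cmf (fun z : R * R => F z.1 z.2).
  apply: (cmfM (cmf_real (measurable_heat_tent2 t))).
  exact: (cmf_comp measurable_fst mh').
have nF x : nint (F x) = ((normc (2 * (crho t x * h (u - x))))%:E)%E.
  rewrite /nint /F; under eq_integral do rewrite Normc.normcM EFinM normc_real (ger0_norm (heat_tent_ge0 _ _ _)).
  have mt : measurable_fun setT (fun s : R => (heat t s * tent `|s| x)%:E).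
    by apply/measurable_EFinP; exact: measurable_heat_tent.
  rewrite ge0_intZr; first last.
  - by move=> s; rewrite lee_fin heat_tent_ge0.
  - exact: mt.
  - by rewrite lee_fin normc_ge0.
  rewrite (integral_heat_tent _ t0) -EFinM; congr (_%:E).
  rewrite 2!Normc.normcM mulrA /crho normc_real ger0_norm ?rho_ge0//.
  by rewrite (_ : 2 = (2:R)%:C) ?normc_real ?ger0_norm// rmorphMn.
have intF : (\int[mu]_x nint (F x) < +oo)%E.
  under eq_integral do rewrite nF.
  by have /cintegrableP[] := cintegrableZ 2 ih.
have [_ _ _ E] := cFubini mF intF.
have two0 : (2 : C) != 0 by rewrite pnatr_eq0.
apply: (mulfI two0).
rewrite [RHS]mulrDr mulrCA -ct.
have -> : 2 * conv (crho t) h u = cint (fun x => cint (F x)).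
  rewrite /conv -(cintZ _ ih); congr cint; apply/funext => x.
  by rewrite /F (cintZr (h (u - x)) (it x)) ct mulrA.
rewrite E mulrBr.
have -> : 2 * conv (cheat t) g u =
    cint (fun s => cheat t s * g (u + s)) + cint (fun s => cheat t s * g (u - s)).
  rewrite mulr_natl mulr2n; congr (_ + _); rewrite -(cint_reflect 0); last first.
    exact: cintegrable_measurable ig'.
  by congr cint; apply/funext => s; rewrite sub0r /cheat heatN.
have -> : 2 * g u = cint (fun s => cheat t s * g u) + cint (fun s => cheat t s * g u).
  rewrite (cintZr (g u) i1) (cint_cheat t0) mul1r; exact: mulr2n_split.
rewrite -(cintD ig' ig) -(cintD i1u i1u) -(cintB (cintegrableD ig' ig) (cintegrableD i1u i1u)).
have E2 s : (heat t s)%:C * ((tent `|s| u)%:C * c) = (heat t s * tent `|s| u)%:C * c.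
  by rewrite RCM mulrA.
(* Integrability is read off from the second-difference identity itself, every other term of which
   is already integrable. *)
have iF : cintegrable (fun s => cint (F ^~ s)).
  have iD := cintegrableB (cintegrableD ig' ig) (cintegrableD i1u i1u).
  have := cintegrableB iD (cintegrableZ c (it u)); congr cintegrable; apply/funext => s.
  rewrite -!mulrDr -mulrBr -mulr2n; have [iz ->] := gh s u.
  rewrite mulrDr (mulrC c) /cheat E2 (mulrC c) addrK /F -(cintZ _ iz); congr cint; apply/funext => x.
  by rewrite (RCM (heat t s)) (mulrA _ _ (h (u - x))).
rewrite -(cintZ c (it u)) -(cintD iF (cintegrableZ c (it u))).
congr cint; apply/funext => s; rewrite -!mulrDr -mulrBr -mulr2n; have [iz ->] := gh s u.
rewrite mulrDr (mulrC c) /cheat E2 (mulrC c); congr (_ + _).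
rewrite /F -(cintZ _ iz); congr cint; apply/funext => x.
by rewrite (RCM (heat t s)) (mulrA _ _ (h (u - x))).
Qed.

Definition Hheat q : (R -> C) -> (R -> C) -> Prop := generator q (fun t => conv (cheat t)).

Lemma cvg_sqrt_at_right : Num.sqrt t @[t --> (0:R)^'+] --> (0:R)^'+.
Proof.
have h : Num.sqrt t @[t --> (0:R)^'+] --> (0:R).
  by rewrite -[X in _ --> X]sqrtr0; apply: cvg_at_right_filter; exact: sqrt_continuous.
move=> A [e e0 eA]; have [d d0 dA] := h _ (nbhsx_ballx (0:R) e e0).
exists d => // t td t0; apply: eA; first exact: dA.
by rewrite sqrtr_gt0.
Qed.

(* The semigroup difference quotient of g is an approximate identity acting on h. *)
Lemma Hheat_intro q g h : (1 <= q)%E -> Lp q g -> Lp q h ->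
  (forall t, 0 < t -> \forall u \ae mu, g u - conv (cheat t) g u = conv (crho t) h u) ->
  Hheat q g h.
Proof.
move=> q1 lg lh gh; split => //.
have i1 := cintegrable_crho (@ltr01 R); have c1 := cint_crho (@ltr01 R).
have mg := Lp_measurable lg; have mh := Lp_measurable lh.
have quo t : 0 < t -> \forall u \ae mu, (t^-1)%:C * (g u - conv (cheat t) g u) =
    conv (scalek (Num.sqrt t) (crho 1)) h u.
  move=> t0; have st0 : 0 < Num.sqrt t by rewrite sqrtr_gt0.
  have ik := cintegrable_scalek st0 i1.
  apply: aeS2 (gh _ t0) (ae_conv_integrable q1 ik lh) => u -> iu.
  have E : conv (crho t) h u = t%:C * conv (scalek (Num.sqrt t) (crho 1)) h u.
    rewrite /conv -(cintZ t%:C iu); congr cint; apply/funext => s.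
    by rewrite (crho_scale t0) mulrA.
  rewrite E mulrA -(rmorphM (real_complex R)) /= mulVf ?gt_eqF//.
  by rewrite (_ : 1%:C = 1 :> C)// mul1r.
have mq t : 0 < t -> cmeasurable (fun u => (t^-1)%:C * (g u - conv (cheat t) g u)).
  move=> t0; apply: cmfZ; apply: (cmfB mg); apply: measurable_conv => //.
  exact: measurable_cheat.
have mk t : cmeasurable (conv (scalek (Num.sqrt t) (crho 1)) h).
  apply: measurable_conv => //; apply: measurable_scalek; exact: measurable_crho.
have evt (P : R -> Prop) : (forall t, 0 < t -> P t) -> \forall t \near (0:R)^'+, P t.
  by move=> hP; near=> t; apply: hP; near: t; exact: nbhs_right_gt.
case: q q1 lg lh => [p p1 lg lh|_ lg lh|//] in gh quo *.
- have -> : (p%:E == +oo%E) = false by [].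
  rewrite lee_fin in p1.
  have := cvg_comp _ _ cvg_sqrt_at_right (approx_identity p1 i1 lh).
  apply: cvg_trans; apply: near_eq_cvg; apply: evt => t t0 /=.
  rewrite c1; apply: ae_eq_Lpnorm.
  + by rewrite lee_fin.
  + apply: (cmfB (mk t)); exact: cmfZ.
  + exact: (cmfB (mq t t0) mh).
  + by apply: aeS (quo t t0) => u ->; rewrite mul1r.
(* For p = +oo the even kernel is moved onto psi, where the L_1 approximate identity applies, at the
   cost of the bound M of h. *)
- rewrite eqxx => psi /Lp1P ipsi; have [mpsi npsi] := (cintegrableP psi).1 ipsi.
  have [M M0 hM] := Lpy_bound lh.
  have rk r : reflect (scalek r (crho 1)) = scalek r (crho 1).
    by apply/funext => s; rewrite /reflect /scalek mulrN /crho rhoN.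
  have := cvg_comp _ _ cvg_sqrt_at_right
    (approx_identity (lexx (1:R)) i1 ((Lp1P psi).2 ipsi)).
  rewrite c1 => lim.
  have bnd : \forall t \near (0:R)^'+, 0 <= normc
      (dual_pairing (fun x => (t^-1)%:C * (g x - conv (cheat t) g x)) psi - dual_pairing h psi)
      <= M * fine (Lpnorm 1%E (fun u => conv (scalek (Num.sqrt t) (crho 1)) psi u - 1%:C * psi u)).
    apply: evt => t t0; apply/andP; split; first exact: normc_ge0.
    have st0 : 0 < Num.sqrt t by rewrite sqrtr_gt0.
    have ik := cintegrable_scalek st0 i1.
    have icp := cintegrable_conv ik ipsi.
    have -> : dual_pairing (fun x => (t^-1)%:C * (g x - conv (cheat t) g x)) psi =
        dual_pairing (conv (scalek (Num.sqrt t) (crho 1)) h) psi.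
      apply: ae_eq_cint.
      - exact: (cmfM (mq t t0) mpsi).
      - exact: (cmfM (mk t) mpsi).
      - by apply: aeS (quo t t0) => u ->.
    rewrite (dual_pairing_conv ik lh ipsi) rk /dual_pairing.
    rewrite -cintB; [|exact: dual_pairing_integrable..].
    have idif := cintegrableB icp ipsi; have [mdif ndif] := (cintegrableP _).1 idif.
    have im := dual_pairing_integrable lh idif; have [mm nm] := (cintegrableP _).1 im.
    have -> : (fun x => h x * conv (scalek (Num.sqrt t) (crho 1)) psi x - h x * psi x) =
        (fun x => h x * (conv (scalek (Num.sqrt t) (crho 1)) psi x - psi x)).
      by apply/funext => x; rewrite mulrBr.
    apply: (le_trans (normc_cint_ler mm nm)).
    have -> : (fun u => conv (scalek (Num.sqrt t) (crho 1)) psi u - 1%:C * psi u) =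
        (fun u => conv (scalek (Num.sqrt t) (crho 1)) psi u - psi u).
      by apply/funext => x; rewrite (_ : 1%:C = 1 :> C)// mul1r.
    rewrite Lpnorm1.
    have fdif : nint (fun u => conv (scalek (Num.sqrt t) (crho 1)) psi u - psi u) \is a fin_num.
      by rewrite ge0_fin_numE// nint_ge0.
    rewrite -lee_fin EFinM !fineK//; last by rewrite ge0_fin_numE// nint_ge0.
    rewrite (_ : M%:E = (normc M%:C)%:E); last by rewrite normc_real ger0_norm.
    rewrite -nintZ//; apply: le_nint_ae => //; first exact: cmfZ.
    apply: aeS hM => x hx; rewrite !Normc.normcM normc_real ger0_norm//.
    by rewrite ler_wpM2r// normc_ge0.
  apply: (squeeze_cvgr bnd); first exact: cvg_cst.
  rewrite -[X in _ --> X](mulr0 M); apply: cvgM; first exact: cvg_cst.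
  by move/fine_cvgP : lim => [].
Unshelve. all: by end_near. Qed.

End second_difference_kernel.

(** * Differentiation of complex-valued functions *)

Section complex_derivatives.
Variable R : realType.
Local Notation C := R[i].
Local Notation mu := (@lebesgue_measure R).
Implicit Types (f g : R -> C) (x : R) (c d : C).

Definition is_cder x f d : Prop :=
  is_derive x (1:R) (fun y => complex.Re (f y)) (complex.Re d) /\
  is_derive x (1:R) (fun y => complex.Im (f y)) (complex.Im d).

Definition ccont f : Prop :=
  continuous (fun y => complex.Re (f y)) /\ continuous (fun y => complex.Im (f y)).

Lemma is_derive_congr (h : R -> R) x (a b : R) :
  is_derive x (1:R) h a -> a = b -> is_derive x (1:R) h b.
Proof. by move=> ? <-. Qed.

Lemma is_derive_cont (h h1 : R -> R) : (forall x, is_derive x (1:R) h (h1 x)) -> continuous h.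
Proof.
by move=> hh x; apply/differentiable_continuous/derivable1_diffP; case: (hh x).
Qed.

Lemma is_cder_cont f f1 : (forall x, is_cder x f (f1 x)) -> ccont f.
Proof.
move=> h; split; first exact: (is_derive_cont (fun x => (h x).1)).
exact: (is_derive_cont (fun x => (h x).2)).
Qed.

Lemma is_cder_eq x f c d : is_cder x f c -> c = d -> is_cder x f d.
Proof. by move=> ? <-. Qed.

Lemma is_cder_cst x c : is_cder x (fun=> c) 0.
Proof. by split; exact: is_derive_cst. Qed.

Lemma is_cderD x f g c d : is_cder x f c -> is_cder x g d ->
  is_cder x (fun y => f y + g y) (c + d).
Proof.
move=> [f1 f2] [g1 g2]; split; rewrite ?ReD ?ImD.
  by rewrite (_ : (fun y => _) = (fun y => complex.Re (f y)) \+ (fun y => complex.Re (g y))) ?ReD;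
    [exact: is_deriveD|apply/funext => y; rewrite ReD].
by rewrite (_ : (fun y => _) = (fun y => complex.Im (f y)) \+ (fun y => complex.Im (g y))) ?ImD;
  [exact: is_deriveD|apply/funext => y; rewrite ImD].
Qed.

Lemma is_derive_mul (h k : R -> R) x (a b : R) : is_derive x (1:R) h a -> is_derive x (1:R) k b ->
  is_derive x (1:R) (fun y => h y * k y) (h x * b + a * k x).
Proof.
by move=> hh kk; apply: (is_derive_congr (is_deriveM hh kk)); rewrite /GRing.scale/= (mulrC a).
Qed.

Lemma is_cderM x f g c d : is_cder x f c -> is_cder x g d ->
  is_cder x (fun y => f y * g y) (f x * d + c * g x).
Proof.
move=> [f1 f2] [g1 g2]; split.
- rewrite (_ : (fun y => _) = (fun y => complex.Re (f y) * complex.Re (g y)) -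
      (fun y => complex.Im (f y) * complex.Im (g y))); last by apply/funext => y; rewrite ReM.
  apply: (is_derive_congr (is_deriveB (is_derive_mul f1 g1) (is_derive_mul f2 g2))).
  by rewrite !ReImE; ring.
- rewrite (_ : (fun y => _) = (fun y => complex.Re (f y) * complex.Im (g y)) +
      (fun y => complex.Im (f y) * complex.Re (g y))); last by apply/funext => y; rewrite ImM.
  apply: (is_derive_congr (is_deriveD (is_derive_mul f1 g2) (is_derive_mul f2 g1))).
  by rewrite !ReImE; ring.
Qed.

Lemma is_cderZ x f c d : is_cder x f d -> is_cder x (fun y => c * f y) (c * d).
Proof.
by move=> hf; apply: (is_cder_eq (is_cderM (is_cder_cst x c) hf)); rewrite mul0r addr0.
Qed.

Lemma is_cderN x f d : is_cder x f d -> is_cder x (fun y => - f y) (- d).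
Proof.
move=> hf; rewrite (_ : (fun y => _) = (fun y => -1 * f y)); last first.
  by apply/funext => y; rewrite mulN1r.
by apply: (is_cder_eq (is_cderZ (-1) hf)); rewrite mulN1r.
Qed.

Lemma is_cderB x f g c d : is_cder x f c -> is_cder x g d ->
  is_cder x (fun y => f y - g y) (c - d).
Proof. by move=> hf hg; exact: is_cderD hf (is_cderN hg). Qed.

Lemma is_cder_real x (h : R -> R) (a : R) : is_derive x (1:R) h a -> is_cder x (fun y => (h y)%:C) a%:C.
Proof. by move=> hh; split => //=; exact: is_derive_cst. Qed.

Lemma is_cder_comp x f (h : R -> R) d (a : R) : is_cder (h x) f d -> is_derive x (1:R) h a ->
  is_cder x (fun y => f (h y)) (a%:C * d).
Proof.
move=> [f1 f2] hh; split.
  by apply: (is_derive_congr (is_derive1_comp f1 hh)); rewrite ReZ mulrC.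
by apply: (is_derive_congr (is_derive1_comp f2 hh)); rewrite ImZ mulrC.
Qed.

Lemma is_derive_addl x (u : R) : is_derive x (1:R) (fun y => u + y) 1.
Proof.
by apply: (is_derive_congr (is_deriveD (is_derive_cst u x 1) (is_derive_id x 1))); rewrite add0r.
Qed.

Lemma is_derive_subl x (u : R) : is_derive x (1:R) (fun y => u - y) (- 1).
Proof.
by apply: (is_derive_congr (is_deriveB (is_derive_cst u x 1) (is_derive_id x 1))); rewrite sub0r.
Qed.

Lemma is_derive_mulr x (b : R) : is_derive x (1:R) (fun y => b * y) b.
Proof.
apply: (is_derive_congr (is_derive_mul (is_derive_cst b x 1) (is_derive_id x 1))).
by rewrite mulr1 mul0r addr0.
Qed.

Lemma ccontM f g : ccont f -> ccont g -> ccont (fun y => f y * g y).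
Proof.
move=> [f1 f2] [g1 g2]; split => x.
  by under eq_fun do rewrite ReM; apply: cvgB; apply: cvgM; [exact: f1|exact: g1|exact: f2|exact: g2].
by under eq_fun do rewrite ImM; apply: cvgD; apply: cvgM; [exact: f1|exact: g2|exact: f2|exact: g1].
Qed.

Lemma ccontD f g : ccont f -> ccont g -> ccont (fun y => f y + g y).
Proof.
move=> [f1 f2] [g1 g2]; split => x.
  by under eq_fun do rewrite ReD; apply: cvgD; [exact: f1|exact: g1].
by under eq_fun do rewrite ImD; apply: cvgD; [exact: f2|exact: g2].
Qed.

Lemma ccont_real (h : R -> R) : continuous h -> ccont (fun y => (h y)%:C).
Proof. by move=> ch; split => //= x; exact: cvg_cst. Qed.

Lemma ccont_cst c : ccont (fun=> c).
Proof. by split => x; exact: cvg_cst. Qed.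

Lemma ccontZ c f : ccont f -> ccont (fun y => c * f y).
Proof. exact: (ccontM (ccont_cst c)). Qed.

Lemma ccont_comp f (h : R -> R) : ccont f -> continuous h -> ccont (fun y => f (h y)).
Proof.
move=> [f1 f2] ch; split => x.
  exact: (@continuous_comp _ _ _ h (fun y => complex.Re (f y)) x (ch x) (f1 (h x))).
exact: (@continuous_comp _ _ _ h (fun y => complex.Im (f y)) x (ch x) (f2 (h x))).
Qed.

Lemma ccont_measurable f : ccont f -> cmeasurable f.
Proof. by move=> [f1 f2]; split; exact: continuous_measurable_fun. Qed.

Definition bC (b : bool) : C := (b%:R)%:C.

Lemma normc_bC b (z : C) : normc (bC b * z) <= normc z.
Proof.
rewrite Normc.normcM normc_real; case: b => /=; rewrite ?normr1 ?mul1r// normr0 mul0r.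
exact: normc_ge0.
Qed.

Lemma real_compact_integrable (h : R -> R) (a b : R) : continuous h ->
  mu.-integrable setT (fun s => ((a <= s <= b)%R%:R * h s)%:E) /\
  (\int[mu]_s ((a <= s <= b)%R%:R * h s) = \int[mu]_(s in `[a, b]) h s).
Proof.
move=> ch.
have ih : mu.-integrable `[a, b] (EFin \o h).
  apply: continuous_compact_integrable; first exact: segment_compact.
  exact: continuous_subspaceT.
have E : (fun s => ((a <= s <= b)%R%:R * h s)%:E) = ((EFin \o h) \_ `[a, b])%E.
  apply/funext => s; rewrite patchE mem_setE in_itv/=.
  by case: (_ <= _ <= _); rewrite ?mul1r ?mul0r.
split; last by rewrite /Rintegral E -integral_mkcond.
by rewrite E; apply/(integrable_mkcond _ _).1.
Qed.

Lemma ccont_itv_integrable f (a b : R) : ccont f ->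
  cintegrable (fun s => bC (a <= s <= b) * f s).
Proof.
move=> [f1 f2]; split.
  have [+ _] := real_compact_integrable a b f1.
  by congr integrable; apply/funext => s; rewrite ReZ.
have [+ _] := real_compact_integrable a b f2.
by congr integrable; apply/funext => s; rewrite ImZ.
Qed.

Lemma real_FTC (h h1 : R -> R) (a b : R) : a <= b -> (forall x, is_derive x (1:R) h (h1 x)) ->
  continuous h1 -> \int[mu]_s ((a <= s <= b)%R%:R * h1 s) = h b - h a.
Proof.
move=> ab dh ch1; have [_ ->] := real_compact_integrable a b ch1.
have ch := is_derive_cont dh.
move: ab; rewrite le_eqVlt => /predU1P[<-|ab].
  by rewrite subrr set_itv1 /Rintegral integral_set1.
rewrite /Rintegral (continuous_FTC2 (F := h) ab)//.
- exact: continuous_subspaceT.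
- split.
  + by move=> x _; case: (dh x).
  + by apply: cvg_at_right_filter; exact: ch.
  + by apply: cvg_at_left_filter; exact: ch.
- by move=> x _; rewrite derive1E; case: (dh x).
Qed.

Lemma cFTC f f1 (a b : R) : a <= b -> (forall x, is_cder x f (f1 x)) -> ccont f1 ->
  cint (fun s => bC (a <= s <= b) * f1 s) = f b - f a.
Proof.
move=> ab df [c1 c2]; apply: complex_ext; rewrite ?ReImE /cint/=.
  rewrite -(real_FTC ab (fun x => (df x).1) c1).
  by apply: eq_Rintegral => s _; rewrite ReZ.
rewrite -(real_FTC ab (fun x => (df x).2) c2).
by apply: eq_Rintegral => s _; rewrite ImZ.
Qed.

(** Taylor's formula with integral remainder on both sides of u: the left half of the tent integral
    is reflected onto the right half and the sum has an explicit primitive. *)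
Lemma C2_second_primitive f f1 f2 : (forall x, is_cder x f (f1 x)) ->
  (forall x, is_cder x f1 (f2 x)) -> ccont f2 -> second_primitive 0 f f2.
Proof.
move=> d1 d2 c2 x u; pose h := `|x|; have h0 : 0 <= h by exact: normr_ge0.
have cnt_tent : continuous (tent h).
  move=> s; apply: (@continuous_comp _ _ _ (fun s : R => h - `|s|) (fun v => Num.max 0 v)).
    by apply: cvgB; [exact: cvg_cst|exact: norm_continuous].
  by apply: continuous_max => ?; [exact: cvg_cst|exact: cvg_id].
have cs : continuous (fun s => u - s) by move=> s; apply: cvgB; [exact: cvg_cst|exact: cvg_id].
have ca : continuous (fun s => u + s) by move=> s; apply: cvgD; [exact: cvg_cst|exact: cvg_id].
pose k s := (tent h s)%:C * f2 (u - s).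
have ck : ccont k by apply: ccontM; [exact: ccont_real|exact: ccont_comp].
have kE : k = (fun s => bC (- h <= s <= h) * k s).
  apply/funext => s; rewrite /bC; case: (boolP (- h <= s <= h)) => [_|]; first by rewrite mul1r.
  rewrite -ler_norml -ltNge => hs; rewrite mul0r /k /tent max_l ?mul0r// subr_le0 ltW//.
have ik : cintegrable k by rewrite kE; exact: ccont_itv_integrable.
split => //; rewrite -/h -/k mul0r addr0.
(* G has derivative (h - s)(f2(u+s) + f2(u-s)), and G h - G 0 is the second difference. *)
pose G s := (h - s)%:C * (f1 (u + s) - f1 (u - s)) + (f (u + s) + f (u - s)).
pose G1 s := (h - s)%:C * (f2 (u + s) + f2 (u - s)).
have dG s : is_cder s G (G1 s).
  have e1 := is_cder_comp (h := fun y => u + y) (d1 (u + s)) (is_derive_addl s u).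
  have e2 := is_cder_comp (h := fun y => u - y) (d1 (u - s)) (is_derive_subl s u).
  have e3 := is_cder_comp (h := fun y => u + y) (d2 (u + s)) (is_derive_addl s u).
  have e4 := is_cder_comp (h := fun y => u - y) (d2 (u - s)) (is_derive_subl s u).
  have e5 := is_cder_real (is_derive_subl s h).
  apply: (is_cder_eq (is_cderD (is_cderM e5 (is_cderB e3 e4)) (is_cderD e1 e2))).
  by rewrite /G1 RCN (_ : 1%:C = 1 :> C)//; ring.
have cG1 : ccont G1.
  apply: ccontM; first by apply: ccont_real => s; apply: cvgB; [exact: cvg_cst|exact: cvg_id].
  by apply: ccontD; exact: ccont_comp.
have := cFTC h0 dG cG1.
have -> : G h - G 0 = f (u + x) + f (u - x) - f u *+ 2.
  rewrite /G subrr mul0r add0r !addr0 !subr0 subrr mulr0 add0r -mulr2n; congr (_ - _).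
  by rewrite /h; case: (ger0P x) => _ //; rewrite opprK addrC.
move=> <-.
have i1 : cintegrable (fun s => bC (0 <= s) * k s).
  apply: cintegrable_le ik _; last by move=> s; exact: normc_bC.
  apply: (cmfM _ (ccont_measurable ck)); apply: cmf_real; apply: measurable_boolR.
  exact: measurable_fun_ler.
have i2 : cintegrable (fun s => bC (s < 0) * k s).
  apply: cintegrable_le ik _; last by move=> s; exact: normc_bC.
  apply: (cmfM _ (ccont_measurable ck)); apply: cmf_real; apply: measurable_boolR.
  exact: measurable_fun_ltr.
have -> : cint k = cint (fun s => bC (0 <= s) * k s) + cint (fun s => bC (s < 0) * k s).
  rewrite -(cintD i1 i2); congr cint; apply/funext => s; rewrite /bC.
  by case: leP => _; rewrite mul1r mul0r ?addr0 ?add0r.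
have i2' := cintegrable_reflect 0 i2.
rewrite -[X in _ = _ + X](cint_reflect 0 (cintegrable_measurable i2)) -(cintD i1 i2').
apply: ae_eq_cint.
- exact: cintegrable_measurable (ccont_itv_integrable _ _ cG1).
- exact: cintegrable_measurable (cintegrableD i1 i2').
(* At s = 0 only one of the two halves contributes, so the integrands agree off this null set. *)
have ne0 : \forall s \ae mu, s != 0 :> R.
  exists [set 0]; split; [exact: measurable_set1|exact: lebesgue_measure_set1|].
  by move=> s /= /negP; rewrite negbK => /eqP.
apply: aeS ne0 => s s0; rewrite sub0r oppr_lt0 (lt0r s) s0/= /bC.
case: (leP 0 s) => s0'/=; last by rewrite !mul0r addr0.
rewrite !mul1r /k /G1 /tent normrN (ger0_norm s0') opprK mulrDr addrC.
have [sh|hs] := leP s h; first by rewrite max_r ?subr_ge0//= mul1r.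
by rewrite max_l ?subr_le0 ?(ltW hs)// !mul0r addr0.
Qed.

End complex_derivatives.

(** * The resolvent of the heat generator *)

Section even_extension.
Variable R : realType.
Local Notation C := R[i].

Lemma is_derive_quotP (f : R -> R) (x d : R) :
  is_derive x (1:R) f d <-> h^-1 * (f (x + h) - f x) @[h --> (0:R)^'] --> d.
Proof.
have E : (fun h => h^-1 *: ((f \o shift x) (h *: (1:R)) - f x)) =
    (fun h => h^-1 * (f (x + h) - f x)).
  by apply/funext => h; rewrite /GRing.scale/= mulr1 (addrC x).
split.
  move=> [df <-]; have : derivable f x 1 by [].
  by rewrite /derivable /derive E.
move=> h; split; first by rewrite /derivable E; apply/cvg_ex; exists d.
by rewrite /derive E; exact/cvg_lim.
Qed.

Let cvg_abs_dnbhs : `|h| @[h --> (0:R)^'] --> (0:R)^'.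
Proof.
move=> A [e e0 eA]; exists e => // h; rewrite /ball_/= sub0r normrN => he h0; apply: eA.
  by rewrite /ball_/= sub0r normrN normr_id.
by rewrite normr_eq0.
Qed.

Let near_gt0 (P : R -> Prop) (u : R) : 0 < u -> (forall x, 0 < x -> P x) -> \near u, P u.
Proof. by move=> u0 hP; near=> y; apply: hP; near: y; exact: lt_nbhsr. Unshelve. all: by end_near. Qed.

Let near_lt0 (P : R -> Prop) (u : R) : u < 0 -> (forall x, x < 0 -> P x) -> \near u, P u.
Proof. by move=> u0 hP; near=> y; apply: hP; near: y; exact: lt_nbhsl. Unshelve. all: by end_near. Qed.

(** A vanishing slope at 0 removes the corner of the even extension; with [is_derive_odd] for its
    derivative, functions of |u| are differentiated twice across the origin. *)
Lemma is_derive_even (f f1 : R -> R) : (forall v, is_derive v (1:R) f (f1 v)) -> f1 0 = 0 ->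
  forall u, is_derive u (1:R) (fun y => f `|y|) (Num.sg u * f1 `|u|).
Proof.
move=> df f10 u; have [u0|u0|<-] := ltgtP 0 u.
- rewrite gtr0_sg// mul1r gtr0_norm//.
  apply: near_eq_is_derive (df u).
  by apply: near_gt0 => // x x0; rewrite gtr0_norm.
- rewrite ltr0_sg// mulN1r ltr0_norm//.
  have := is_derive1_comp (g := fun y => - y) (df (- u)) (is_deriveNid u 1).
  rewrite mulrN1; apply: near_eq_is_derive.
  by apply: near_lt0 => // x x0 /=; rewrite ltr0_norm.
- rewrite sgr0 mul0r; apply/is_derive_quotP; apply/cvgr0Pnorm_lt => e e0.
  have /is_derive_quotP h0 := df 0; rewrite f10 in h0.
  have /cvgr0Pnorm_lt/(_ _ e0) := cvg_comp _ _ cvg_abs_dnbhs h0.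
  apply: filterS => y /=; rewrite !add0r normr0 !normrM !normfV normr_id.
  by [].
Qed.

Lemma is_derive_odd (f f1 : R -> R) : (forall v, is_derive v (1:R) f (f1 v)) -> f 0 = 0 ->
  forall u, is_derive u (1:R) (fun y => Num.sg y * f `|y|) (f1 `|u|).
Proof.
move=> df f0 u; have [u0|u0|<-] := ltgtP 0 u.
- rewrite gtr0_norm//; apply: near_eq_is_derive (df u).
  by apply: near_gt0 => // x x0; rewrite gtr0_norm// gtr0_sg// mul1r.
- rewrite ltr0_norm//.
  have := is_deriveN (is_derive1_comp (g := fun y => - y) (df (- u)) (is_deriveNid u 1)).
  rewrite mulrN1 opprK; apply: near_eq_is_derive.
  by apply: near_lt0 => // x x0 /=; rewrite ltr0_norm// ltr0_sg// mulN1r.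
- rewrite normr0; apply/is_derive_quotP.
  have /is_derive_quotP h0 := df 0.
  have := cvg_comp _ _ cvg_abs_dnbhs h0; apply: cvg_trans.
  apply: near_eq_cvg; near=> y => /=.
  rewrite !add0r normr0 sgr0 mul0r f0 !subr0 mulrA; congr (_ * _).
  have y0 : y != 0 by near: y; exact: nbhs_dnbhs_neq.
  case: (ltgtP 0 y) y0 => // y0 _; first by rewrite gtr0_norm// gtr0_sg// mulr1.
  by rewrite ltr0_norm// ltr0_sg// mulrN1 invrN.
Unshelve. all: by end_near. Qed.

End even_extension.

(** * The complex exponential *)

Section complex_exponential.
Variable R : realType.
Local Notation C := R[i].
Implicit Types z w : C.

Definition cexp z : C := (expR (complex.Re z))%:C * (cos (complex.Im z) +i* sin (complex.Im z)).

Lemma Re_cexp z : complex.Re (cexp z) = expR (complex.Re z) * cos (complex.Im z).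
Proof. by rewrite /cexp ReZ. Qed.

Lemma Im_cexp z : complex.Im (cexp z) = expR (complex.Re z) * sin (complex.Im z).
Proof. by rewrite /cexp ImZ. Qed.

Lemma cexpD z w : cexp (z + w) = cexp z * cexp w.
Proof.
apply: complex_ext.
  by rewrite Re_cexp (ReM (cexp z)) !Re_cexp !Im_cexp ReD ImD expRD cosD; ring.
by rewrite Im_cexp (ImM (cexp z)) !Re_cexp !Im_cexp ReD ImD expRD sinD; ring.
Qed.

Lemma cexp0 : cexp 0 = 1.
Proof. by apply: complex_ext; rewrite ?Re_cexp ?Im_cexp /= expR0 ?cos0 ?sin0 mul1r. Qed.

Lemma normc_cexp z : normc (cexp z) = expR (complex.Re z).
Proof.
rewrite normcE Re_cexp Im_cexp !exprMn -mulrDr cos2Dsin2 mulr1.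
by rewrite sqrtr_sqr ger0_norm// expR_ge0.
Qed.

Lemma cexp_real (x : R) : cexp x%:C = (expR x)%:C.
Proof. by apply: complex_ext; rewrite ?Re_cexp ?Im_cexp /= ?cos0 ?sin0 ?mulr1 ?mulr0. Qed.

Lemma is_cder_cexp (x : R) (c : C) : is_cder x (fun y => cexp (c * y%:C)) (c * cexp (c * x%:C)).
Proof.
pose a := complex.Re c; pose b := complex.Im c.
have ReE (y : R) : complex.Re (c * y%:C) = a * y by rewrite ReM/= mulr0 subr0.
have ImE (y : R) : complex.Im (c * y%:C) = b * y by rewrite ImM/= mulr0 add0r.
have de : is_derive x (1:R) (fun y => expR (a * y)) (a * expR (a * x)).
  by apply: (is_derive_congr (is_derive1_comp (is_derive_expR (a * x)) (is_derive_mulr x a))); rewrite mulrC.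
have dc : is_derive x (1:R) (fun y => cos (b * y)) (- (b * sin (b * x))).
  by apply: (is_derive_congr (is_derive1_comp (is_derive_cos (b * x)) (is_derive_mulr x b))); ring.
have ds : is_derive x (1:R) (fun y => sin (b * y)) (b * cos (b * x)).
  by apply: (is_derive_congr (is_derive1_comp (is_derive_sin (b * x)) (is_derive_mulr x b))); ring.
split.
  rewrite (_ : (fun y => _) = (fun y => expR (a * y) * cos (b * y))); last first.
    by apply/funext => y; rewrite Re_cexp ReE ImE.
  apply: (is_derive_congr (is_derive_mul de dc)).
  by rewrite ReM Re_cexp Im_cexp ReE ImE -/a -/b; ring.
rewrite (_ : (fun y => _) = (fun y => expR (a * y) * sin (b * y))); last first.
  by apply/funext => y; rewrite Im_cexp ReE ImE.
apply: (is_derive_congr (is_derive_mul de ds)).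
by rewrite ImM Re_cexp Im_cexp ReE ImE -/a -/b; ring.
Qed.

Lemma ccont_cexp (c : C) : ccont (fun y : R => cexp (c * y%:C)).
Proof. exact: (is_cder_cont (fun x => is_cder_cexp x c)). Qed.

End complex_exponential.

(** * The resolvent kernel *)

Section resolvent_kernel.
Variable R : realType.
Local Notation C := R[i].
Local Notation mu := (@lebesgue_measure R).
Implicit Types (nu : C) (t : R) (f g : R -> C) (q : \bar R).

Definition expk nu (u : R) : C := cexp (- nu * `|u|%:C).

Lemma ccont_expk nu : ccont (expk nu).
Proof.
exact: (@ccont_comp R (fun y => cexp (- nu * y%:C)) (fun u => `|u|) (ccont_cexp (- nu))
  (@norm_continuous R R)).
Qed.

Lemma normc_expk nu u : normc (expk nu u) = expR (- (complex.Re nu * `|u|)).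
Proof. by rewrite /expk normc_cexp ReM ReN/= mulr0 subr0 mulNr. Qed.

Lemma integral_exp_abs (x : R) : 0 < x ->
  (\int[mu]_u (expR (- (x * `|u|)))%:E = (2 / x)%:E)%E.
Proof.
move=> x0; have ce : continuous (fun u : R => expR (- (x * `|u|))).
  move=> u; apply: (continuous_comp (f := fun u : R => - (x * `|u|))); last exact: continuous_expR.
  by apply: cvgN; apply: cvgM; [exact: cvg_cst|exact: norm_continuous].
rewrite (ge0_symfun_integralT _ ce); [|by move=> u; exact: expR_ge0|by move=> u /=; rewrite normrN].
rewrite EFinM; congr (_ * _)%E.
rewrite -set_itvcy.
pose F (u : R) := - x^-1 * expR (- x * u).
have dF u : is_derive u (1:R) F (expR (- x * u)).
  have de := is_derive1_comp (is_derive_expR (- x * u)) (is_derive_mulr u (- x)).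
  apply: (is_derive_congr (is_derive_mul (is_derive_cst (- x^-1) u 1) de)).
  by rewrite mul0r addr0 mulrCA mulrNN mulVf ?gt_eqF// mulr1.
transitivity (\int[mu]_(u in `[0%R, +oo[) (expR (- x * u))%:E)%E.
  apply: eq_integral => u; rewrite inE/= in_itv/= andbT => u0.
  by rewrite ger0_norm// mulNr.
rewrite (ge0_continuous_FTC2y (F := F) (l := 0)).
- by rewrite /F mulr0 expR0 mulr1 -EFinB sub0r opprK.
- by move=> u _; exact: expR_ge0.
- apply: continuous_subspaceT => u.
  apply: (continuous_comp (f := fun u : R => - x * u)); last exact: continuous_expR.
  by apply: cvgM; [exact: cvg_cst|exact: cvg_id].
- rewrite /F -(mulr0 (- x^-1)); apply: cvgM; first exact: cvg_cst.
  have h : (x * u @[u --> +oo%R] --> +oo%R) by apply: gt0_cvgMry => //; exact: cvg_id.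
  have := cvg_comp _ _ h (@cvgr_expR R); apply: cvg_trans; apply: near_eq_cvg.
  by apply: nearW => u /=; rewrite mulNr.
- by move=> u _; case: (dF u).
- by apply: cvg_at_right_filter; exact: (is_derive_cont dF).
- by move=> u _; rewrite derive1E; case: (dF u).
Qed.

Lemma nint_expk nu : 0 < complex.Re nu -> nint (expk nu) = (2 / complex.Re nu)%:E.
Proof.
by move=> x0; rewrite -(integral_exp_abs x0); apply: eq_integral => u _; rewrite normc_expk.
Qed.

Definition resk nu (u : R) : C := - (2 * nu)^-1 * expk nu u.

Lemma nu_neq0 nu : 0 < complex.Re nu -> nu != 0.
Proof. by move=> x0; apply: contraTneq x0 => ->; rewrite ltxx. Qed.

Lemma ccont_resk nu : ccont (resk nu).
Proof. exact: ccontZ (ccont_expk nu). Qed.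

Lemma measurable_resk nu : cmeasurable (resk nu).
Proof. exact: ccont_measurable (ccont_resk nu). Qed.

Lemma normcV (z : C) : normc z^-1 = (normc z)^-1.
Proof.
have [->|z0] := eqVneq z 0; first by rewrite invr0 Normc.normc0 invr0.
have n0 : normc z != 0 by apply/eqP => /normc_eq0/eqP; rewrite (negbTE z0).
by apply: (mulfI n0); rewrite -Normc.normcM !divff// Normc.normc1.
Qed.

Lemma normc2 : normc (2 : C) = 2.
Proof. by rewrite (_ : 2 = (2:R)%:C :> C) ?normc_real ?ger0_norm// rmorphMn. Qed.

Lemma normcN (z : C) : normc (- z) = normc z.
Proof. by rewrite -sub0r normcBC subr0. Qed.

Lemma nint_resk nu : 0 < complex.Re nu ->
  nint (resk nu) = ((normc nu)^-1 / complex.Re nu)%:E.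
Proof.
move=> x0; rewrite nintZ; last exact: ccont_measurable (ccont_expk nu).
rewrite nint_expk// -EFinM normcN normcV Normc.normcM normc2; congr (_%:E).
have n0 : normc nu != 0.
  by apply/eqP => /normc_eq0/eqP; rewrite (negbTE (nu_neq0 x0)).
by field; rewrite n0 gt_eqF.
Qed.

Lemma cintegrable_resk nu : 0 < complex.Re nu -> cintegrable (resk nu).
Proof.
move=> x0; apply/cintegrableP; split; first exact: measurable_resk.
by rewrite nint_resk// ltry.
Qed.

(** The distributional identity |u|'' = 2 delta_0 tested against a tent; it supplies the Dirac term
    of the resolvent kernel. *)
Let abs_tent (x u : R) : `|u + x| + `|u - x| - `|u| *+ 2 = tent `|x| u *+ 2.
Proof.
rewrite /tent; case: (ger0P x) => ?; case: (ger0P u) => ?; case: (ger0P (u + x)) => ?;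
  case: (ger0P (u - x)) => ?; case: leP => ?; lra.
Qed.

(* resk nu - |u|/2 is twice continuously differentiable: the corner of resk nu
   at the origin carries the Dirac mass. *)
Lemma resk_second_primitive nu : 0 < complex.Re nu ->
  second_primitive 1 (resk nu) (fun u => nu ^+ 2 * resk nu u).
Proof.
move=> x0; have n0 := nu_neq0 x0.
(* The linear term cancels the slope of the exponential at 0, so the even extension m has
   derivatives m1 and m2 everywhere. *)
pose f v : C := - (2 * nu)^-1 * cexp (- nu * v%:C) - 2^-1 * v%:C.
pose f1 v : C := 2^-1 * cexp (- nu * v%:C) - 2^-1.
pose f2 v : C := - nu / 2 * cexp (- nu * v%:C).
have d1 (v : R) : is_cder v f (f1 v).
  have did : is_cder v (fun y : R => y%:C) 1 by exact: (is_cder_real (is_derive_id v 1)).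
  apply: (is_cder_eq (is_cderB (is_cderZ (- (2 * nu)^-1) (is_cder_cexp v (- nu))) (is_cderZ 2^-1 did))).
  by rewrite /f1 mulr1; congr (_ - _); field.
have d2 (v : R) : is_cder v f1 (f2 v).
  apply: (is_cder_eq (is_cderB (is_cderZ 2^-1 (is_cder_cexp v (- nu))) (is_cder_cst v 2^-1))).
  by rewrite /f2 subr0; field.
have f10 : f1 0 = 0 by rewrite /f1 mulr0 cexp0 mulr1 subrr.
pose m (u : R) := f `|u|; pose m1 (u : R) := (Num.sg u)%:C * f1 `|u|; pose m2 (u : R) := f2 `|u|.
have dm (u : R) : is_cder u m (m1 u).
  split; rewrite ?ReZ ?ImZ.
    by apply: (is_derive_even (fun v => (d1 v).1)); rewrite f10.
  by apply: (is_derive_even (fun v => (d1 v).2)); rewrite f10.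
have dm1 (u : R) : is_cder u m1 (m2 u).
  split.
    rewrite (_ : (fun y => _) = (fun y => Num.sg y * complex.Re (f1 `|y|))); last first.
      by apply/funext => y; rewrite ReZ.
    by apply: (is_derive_odd (fun v => (d2 v).1)); rewrite f10.
  rewrite (_ : (fun y => _) = (fun y => Num.sg y * complex.Im (f1 `|y|))); last first.
    by apply/funext => y; rewrite ImZ.
  by apply: (is_derive_odd (fun v => (d2 v).2)); rewrite f10.
have m2E : m2 = (fun u => nu ^+ 2 * resk nu u).
  by apply/funext => u; rewrite /m2 /f2 /resk /expk; field.
have cm2 : ccont m2 by rewrite m2E; exact: ccontZ (ccont_resk nu).
have := C2_second_primitive dm dm1 cm2; rewrite m2E => h x u.
have [ix E] := h x u; split => //.
rewrite mul0r addr0 in E; rewrite -E mul1r.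
have mE y : resk nu y = m y + 2^-1 * `|y|%:C by rewrite /m /f /resk /expk subrK.
rewrite !mE.
have A : (tent `|x| u)%:C = 2^-1 * (`|u + x| + `|u - x| - `|u| *+ 2)%:C :> C.
  rewrite abs_tent (_ : (tent `|x| u *+ 2)%:C = (tent `|x| u)%:C *+ 2 :> C) ?rmorphMn//.
  by field.
have A2 : (`|u + x| + `|u - x| - `|u| *+ 2)%:C = `|u + x|%:C + `|u - x|%:C - `|u|%:C *+ 2 :> C.
  by rewrite !RCD RCN mulr2n RCD -mulr2n.
by rewrite A A2; ring.
Qed.

Lemma cintegrable_conv_bounded (k f : R -> C) (M v : R) : cintegrable k -> cmeasurable f ->
  (forall x, normc (f x) <= M) -> cintegrable (fun s => k s * f (v - s)).
Proof.
move=> ik mf fM; have [mk _] := (cintegrableP k).1 ik.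
apply: (@cintegrable_le _ _ (fun s => M%:C * k s)).
- exact: (cmfM mk (cmf_comp (measurable_reflect v) mf)).
- exact: cintegrableZ.
- move=> s; rewrite !Normc.normcM normc_real (mulrC (normc (k s))) ler_wpM2r ?normc_ge0//.
  by rewrite (le_trans (fM _))// ler_norm.
Qed.

Lemma normc_resk_le nu u : 0 < complex.Re nu -> normc (resk nu u) <= normc (- (2 * nu)^-1).
Proof.
move=> x0; rewrite Normc.normcM normc_expk ler_piMr ?normc_ge0// -expR0 ler_expR oppr_le0.
by rewrite mulr_ge0// ltW.
Qed.

Lemma conv_cheat_resk nu t u : 0 < t -> 0 < complex.Re nu ->
  conv (cheat t) (resk nu) u =
  nu ^+ 2 * conv (crho t) (resk nu) u + (crho t u + resk nu u).
Proof.
move=> t0 x0; have mr := measurable_resk nu.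
have bnd k v : cintegrable k -> cintegrable (fun s => k s * resk nu (v - s)).
  by move=> ik; apply: (cintegrable_conv_bounded v ik mr) => y; exact: normc_resk_le.
have i2 : cintegrable (fun s => crho t s * (nu ^+ 2 * resk nu (u - s))).
  have := cintegrableZ (nu ^+ 2) (bnd _ u (cintegrable_crho t0)); congr cintegrable.
  by apply/funext => s; rewrite mulrCA.
have := conv_cheatB t0 (cmfZ (nu ^+ 2) mr) (resk_second_primitive x0)
  (bnd _ u (cintegrable_cheat t0)) i2.
move=> /(canRL (subrK _)) ->; rewrite mul1r -addrA; congr (_ + _).
rewrite /conv -(cintZ _ (bnd _ u (cintegrable_crho t0))); congr cint.
by apply/funext => s; rewrite mulrCA.
Qed.

(** The identity for the kernel is convolved with f by associativity; the term [crho t] left by the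
    Dirac mass becomes conv (crho t) f and accounts for the - f in the value of H. *)
Theorem Hheat_resk q nu f : (1 <= q)%E -> 0 < complex.Re nu -> Lp q f ->
  Hheat q (conv (resk nu) f) (fun u => - nu ^+ 2 * conv (resk nu) f u - f u).
Proof.
move=> q1 x0 lf; have ir := cintegrable_resk x0.
have lg := Lp_conv q1 ir lf.
apply: Hheat_intro => //; first by apply: LpB => //; exact: LpZ.
move=> t t0; have ic := cintegrable_cheat t0; have ih := cintegrable_crho t0.
have ihr := cintegrable_conv ih ir.
have E : conv (cheat t) (resk nu) =
    (fun u => nu ^+ 2 * conv (crho t) (resk nu) u + (1 * crho t u + resk nu u)).
  by apply/funext => u; rewrite conv_cheat_resk// mul1r.
have h1 := conv_assoc q1 ic ir lf.
have i1 : cintegrable (fun u => 1 * crho t u + resk nu u).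
  by apply: cintegrableD => //; exact: cintegrableZ.
have h2 := ae_convDk (nu ^+ 2) q1 ihr i1 lf.
have h3 := ae_convDk 1 q1 ih ir lf.
have h4 := conv_assoc q1 ih ir lf.
have h5 := ae_conv_integrable q1 ih lg.
have h6 := ae_conv_integrable q1 ih lf.
have cj (P Q : R -> Prop) := @aeS2 _ _ R mu P Q (fun u => P u /\ Q u) (fun u a b => conj a b).
apply: aeS3 (cj _ _ h1 h2) (cj _ _ h3 h4) (cj _ _ h5 h6) => u [e1 e2] [e3 e4] [i5 i6].
have -> : conv (crho t) (fun v => - nu ^+ 2 * conv (resk nu) f v - f v) u =
    - nu ^+ 2 * conv (crho t) (conv (resk nu) f) u - conv (crho t) f u.
  rewrite {1}/conv -(cintZ (- nu ^+ 2) i5) -(cintB (cintegrableZ (- nu ^+ 2) i5) i6).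
  by congr cint; apply/funext => s; rewrite mulrBr mulrCA.
by rewrite e1 E e2 e3 e4; ring.
Qed.

End resolvent_kernel.

(** * The heat generator and its resolvents *)

Section heat_generator.
Variable R : realType.
Local Notation C := R[i].
Local Notation mu := (@lebesgue_measure R).
Implicit Types (nu : C) (t : R) (f g h psi : R -> C) (q : \bar R) (p : R).

Lemma Lp_bounded_integrable q f (M : R) : (1 <= q)%E -> cintegrable f ->
  (forall x, normc (f x) <= M) -> Lp q f.
Proof.
move=> q1 i_f fM; have [mf nf] := (cintegrableP f).1 i_f.
have M0 : 0 <= M by exact: le_trans (normc_ge0 (f 0)) (fM 0).
case: q q1 => [p p1|_|//]; last first.
  by apply: (Lpy_bounded mf); apply: aeW.
rewrite lee_fin in p1; split => //; apply/(Lpnorm_lty_Npow _ p1).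
apply: le_lt_trans (Npow_le_nint p1 M0 mf fM) _.
by rewrite lte_mul_pinfty// lee_fin powR_ge0.
Qed.

(** Testing with conj(f) e^{-|x|}, which is integrable because f is bounded, makes the integral of
    |f|^2 e^{-|x|} vanish. *)
Lemma dual_pairing_eq0 f : Lp +oo%E f -> (forall psi, Lp 1%E psi -> dual_pairing f psi = 0) ->
  \forall x \ae mu, f x = 0.
Proof.
move=> lf f0; have mf := Lp_measurable lf.
have one0 : 0 < complex.Re (1 : C) by exact: ltr01.
have me := ccont_measurable (ccont_expk (1 : C)).
have ie : cintegrable (expk (1 : C)).
  by apply/cintegrableP; rewrite nint_expk// ltry.
have lfJ : Lp +oo%E (fun x => (f x)^*%C).
  have [M M0 fM] := Lpy_bound lf; apply: (Lpy_bounded (M := M)); first exact: cmfJ.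
  by apply: aeS fM => x; rewrite normcJ.
have i1 := dual_pairing_integrable lfJ ie.
have i2 := dual_pairing_integrable lf i1.
have := f0 _ ((Lp1P _).2 i1); rewrite /dual_pairing.
have eE x : expk (1 : C) x = (expR (- `|x|))%:C.
  by rewrite /expk (_ : - 1 * `|x|%:C = (- `|x|)%:C) ?cexp_real// mulN1r RCN.
pose w (x : R) : R := normc (f x) ^+ 2 * expR (- `|x|).
have -> : (fun x => f x * ((f x)^*%C * expk 1 x)) = (fun x => (w x)%:C).
  by apply/funext => x; rewrite mulrA mulc_conj eE -RCM.
rewrite cint_real => /(congr1 (@complex.Re R)) /= int0.
have iw : mu.-integrable setT (fun x => (w x)%:E).
  have [+ _] := i2; congr integrable; apply/funext => x.
  by rewrite mulrA mulc_conj eE -RCM.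
have mw : measurable_fun setT (fun x => (w x)%:E) by exact: measurable_int iw.
have w0 x : 0 <= w x by rewrite mulr_ge0 ?sqr_ge0 ?expR_ge0.
have nw : (\int[mu]_x `|(w x)%:E| = 0)%E.
  have : (\int[mu]_x (w x)%:E = 0)%E.
    have fin : (\int[mu]_x (w x)%:E)%E \is a fin_num by exact: integrable_fin_num.
    by rewrite -(fineK fin) (_ : fine _ = 0).
  by move=> <-; apply: eq_integral => x _; rewrite gee0_abs ?lee_fin.
have [h _] := ae_eq_integral_abs mu measurableT mw.
have := h nw; apply: aeS => x /(_ I) /eqP; rewrite eqe mulf_eq0 => /orP[|].
  by rewrite sqrf_eq0 => /eqP /normc_eq0.
by rewrite gt_eqF// expR_gt0.
Qed.

Lemma dual_pairingB f g psi : Lp +oo%E f -> Lp +oo%E g -> cintegrable psi ->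
  dual_pairing (fun x => f x - g x) psi = dual_pairing f psi - dual_pairing g psi.
Proof.
move=> lf lg ip; rewrite /dual_pairing -cintB; [|exact: dual_pairing_integrable..].
by congr cint; apply/funext => x; rewrite mulrBl.
Qed.

Lemma dual_pairing_inj f g : Lp +oo%E f -> Lp +oo%E g ->
  (forall psi, Lp 1%E psi -> dual_pairing f psi = dual_pairing g psi) ->
  \forall x \ae mu, f x = g x.
Proof.
move=> lf lg fg; have lfg : Lp +oo%E (fun x => f x - g x) by apply: LpB => //; exact: leey.
have z psi : Lp 1%E psi -> dual_pairing (fun x => f x - g x) psi = 0.
  by move=> lp; rewrite dual_pairingB ?fg ?subrr//; apply/Lp1P.
by apply: aeS (dual_pairing_eq0 lfg z) => x /eqP; rewrite subr_eq0 => /eqP.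
Qed.

Definition diff_quot t f (u : R) : C := (t^-1)%:C * (f u - conv (cheat t) f u).

Lemma Lp_diff_quot q t f : (1 <= q)%E -> 0 < t -> Lp q f -> Lp q (diff_quot t f).
Proof.
move=> q1 t0 lf; apply: LpZ => //; apply: LpB => //.
by apply: Lp_conv => //; exact: cintegrable_cheat.
Qed.

Lemma conv_diff_quot q k t f : (1 <= q)%E -> cintegrable k -> 0 < t -> Lp q f ->
  \forall u \ae mu, conv k (diff_quot t f) u = diff_quot t (conv k f) u.
Proof.
move=> q1 ik t0 lf; have ic := cintegrable_cheat t0.
have lcf := Lp_conv q1 ic lf.
have i1 := ae_conv_integrable q1 ik lf.
have i2 := ae_conv_integrable q1 ik lcf.
apply: aeS3 i1 i2 (conv_comm q1 ik ic lf) => u i1 i2 e.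
rewrite /diff_quot -e /conv -(cintB i1 i2) -(cintZ _ (cintegrableB i1 i2)).
by congr cint; apply/funext => s; rewrite -mulrBr mulrCA.
Qed.

Lemma near_gt0_at_right (P : R -> Prop) : (forall t, 0 < t -> P t) -> \forall t \near (0:R)^'+, P t.
Proof. by move=> hP; near=> t; apply: hP; near: t; exact: nbhs_right_gt. Unshelve. all: by end_near. Qed.

Lemma Hheat_unique q f h h' : (1 <= q)%E -> Hheat q f h -> Hheat q f h' ->
  \forall u \ae mu, h u = h' u.
Proof.
move=> q1 [lf lh H] [_ lh' H'].
have mf := Lp_measurable lf; have mh := Lp_measurable lh; have mh' := Lp_measurable lh'.
have [qy|qy] := eqVneq q +oo%E; last first.
  rewrite (negbTE qy) in H H'.
  have ld : cmeasurable (fun u => h u - h' u) by exact: cmfB.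
  have [p pq] : exists p, q = p%:E by case: q qy q1 {H H' lf lh lh'} => // p _ _; exists p.
  suff : Lpnorm q (fun u => h u - h' u) = 0%E.
    by move=> /(Lpnorm_eq0 q1 ld); apply: aeS => u /eqP; rewrite subr_eq0 => /eqP.
  apply/eqP; rewrite eq_le Lpnorm_ge0 andbT; apply/lee_addgt0Pr => e e0; rewrite add0e.
  have e20 : 0 < e / 2 by rewrite divr_gt0.
  have h1 := (cvge0P (fun t => Lpnorm_ge0 q _)).1 H _ e20.
  have h2 := (cvge0P (fun t => Lpnorm_ge0 q _)).1 H' _ e20.
  near (0:R)^'+ => t.
  have t0 : 0 < t by near: t; exact: nbhs_right_gt.
  have lq := Lp_diff_quot q1 t0 lf; have mq := Lp_measurable lq.
  have -> : (fun u => h u - h' u) = (fun u => (diff_quot t f u - h' u) - (diff_quot t f u - h u)).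
    by apply/funext => u; ring.
  apply: (le_trans (Lpnorm_dist q1 (cmfB mq mh') (cmfB mq mh))).
  rewrite (splitr e) EFinD; apply: leeD.
    by near: t; exact: h2.
  by near: t; exact: h1.
subst q; rewrite eqxx in H H'; apply: dual_pairing_inj => // psi lpsi.
have lim (a b : C) (F : R -> C) : normc (F t - a) @[t --> (0:R)^'+] --> (0:R) ->
    normc (F t - b) @[t --> (0:R)^'+] --> (0:R) -> a = b.
  move=> ha hb; apply/eqP; rewrite -subr_eq0; apply/eqP/normc_eq0.
  apply/eqP; rewrite eq_le normc_ge0 andbT.
  have hab := cvgD ha hb; rewrite addr0 in hab.
  apply: (cvgr_to_ge (hab _)); apply: nearW => t /=.
  rewrite normcBC (_ : b - a = (F t - a) - (F t - b)); last by ring.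
  exact: normc_dist.
exact: lim (H psi lpsi) (H' psi lpsi).
Unshelve. all: by end_near. Qed.

(** Convolutions commute with the heat semigroup, hence with its difference quotients; for p = +oo
    the kernel goes to the test function, otherwise Young's inequality preserves the limit. *)
Lemma Hheat_conv q k f h : (1 <= q)%E -> cintegrable k -> Hheat q f h ->
  Hheat q (conv k f) (conv k h).
Proof.
move=> q1 ik [lf lh H]; have lkf := Lp_conv q1 ik lf; have lkh := Lp_conv q1 ik lh.
split => //.
have mkf := Lp_measurable lkf; have mkh := Lp_measurable lkh.
have [qy|qy] := eqVneq q +oo%E.
  subst q; rewrite eqxx in H => psi /Lp1P ipsi.
  have ipk := cintegrable_conv (cintegrable_reflect0 ik) ipsi.
  have := H _ ((Lp1P _).2 ipk); apply: cvg_trans; apply: near_eq_cvg.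
  apply: near_gt0_at_right => t t0.
  have lq := Lp_diff_quot q1 t0 lf; have lqk := Lp_diff_quot q1 t0 lkf.
  rewrite -(dual_pairing_conv ik lh ipsi) -/(diff_quot t f) -(dual_pairing_conv ik lq ipsi).
  congr (normc (_ - _)); have [mpsi _] := (cintegrableP psi).1 ipsi.
  apply: ae_eq_cint.
  - exact: (cmfM (Lp_measurable (Lp_conv q1 ik lq)) mpsi).
  - exact: (cmfM (Lp_measurable lqk) mpsi).
  - by apply: aeS (conv_diff_quot q1 ik t0 lf) => u ->.
rewrite (negbTE qy) in H.
apply/(cvge0P (fun t => Lpnorm_ge0 q _)) => e e0.
pose K := fine (nint k); have Kf : nint k = K%:E.
  by have [_ nk] := (cintegrableP k).1 ik; rewrite fineK// ge0_fin_numE// nint_ge0.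
have K0 : 0 <= K by rewrite -lee_fin -Kf nint_ge0.
have eK : 0 < e / (K + 1) by rewrite divr_gt0// ltr_wpDl.
have h1 := (cvge0P (fun t => Lpnorm_ge0 q _)).1 H _ eK.
near=> t.
have t0 : 0 < t by near: t; exact: nbhs_right_gt.
have lq := Lp_diff_quot q1 t0 lf; have lqk := Lp_diff_quot q1 t0 lkf.
have lqh := LpB q1 lq lh.
have -> : Lpnorm q (fun u => (t^-1)%:C * (conv k f u - conv (cheat t) (conv k f) u) - conv k h u) =
    Lpnorm q (conv k (fun u => diff_quot t f u - h u)).
  apply: ae_eq_Lpnorm => //.
  - exact: (cmfB (Lp_measurable lqk) mkh).
  - exact: Lp_measurable (Lp_conv q1 ik lqh).
  apply: aeS3 (conv_diff_quot q1 ik t0 lf) (ae_conv_integrable q1 ik lq) (ae_conv_integrable q1 ik lh).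
  move=> u e1 i1 i2; rewrite -/(diff_quot t (conv k f) u) -e1 /conv -(cintB i1 i2).
  by congr cint; apply/funext => s; rewrite mulrBr.
apply: (le_trans (Lpnorm_conv q1 ik lqh)); rewrite Kf.
apply: (@le_trans _ _ ((K + 1)%:E * (e / (K + 1))%:E)%E).
  apply: lee_pmul => //; first exact: Lpnorm_ge0.
    by rewrite lee_fin lerDl.
  by near: t; exact: h1.
by rewrite -EFinM mulrC divfK// gt_eqF// ltr_wpDl.
Unshelve. all: by end_near. Qed.

Lemma conv_bounded_op q k : (1 <= q)%E -> cintegrable k -> bounded_op q (conv k).
Proof.
move=> q1 ik; split.
- by move=> f; exact: Lp_conv.
- by move=> c f g lf lg; apply/ae_eqP; exact: ae_convD lf lg.
- exists (fine (nint k)) => f lf; have [_ nk] := (cintegrableP k).1 ik.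
  by rewrite fineK ?ge0_fin_numE ?nint_ge0//; exact: Lpnorm_conv.
Qed.

(** [Hheat_resk] gives a right inverse. It is also a left inverse, because it commutes with H and
    values of H are unique almost everywhere. *)
Theorem Hheat_is_resolvent q nu : (1 <= q)%E -> 0 < complex.Re nu ->
  is_resolvent q (Hheat q) (- nu ^+ 2) (conv (resk nu)).
Proof.
move=> q1 x0; have ir := cintegrable_resk x0; split.
- exact: conv_bounded_op.
- move=> f lf; exists (fun u => - nu ^+ 2 * conv (resk nu) f u - f u).
    exact: Hheat_resk.
  by apply/ae_eqP; apply: aeW => u; rewrite subKr.
- move=> f h H; have [lf lh _] := H; apply/ae_eqP.
  have e1 := Hheat_unique q1 (Hheat_conv q1 ir H) (Hheat_resk q1 x0 lf).
  apply: aeS3 e1 (ae_conv_integrable q1 ir lf) (ae_conv_integrable q1 ir lh) => u e1 i1 i2.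
  have -> : conv (resk nu) (fun x => - nu ^+ 2 * f x - h x) u =
      - nu ^+ 2 * conv (resk nu) f u - conv (resk nu) h u.
    rewrite {1}/conv -(cintZ (- nu ^+ 2) i1) -(cintB (cintegrableZ (- nu ^+ 2) i1) i2).
    by congr cint; apply/funext => s; rewrite mulrBr mulrCA.
  by rewrite e1 subKr.
Qed.

End heat_generator.

(** * Approximate eigenvectors and the spectrum *)

Section approximate_eigenvectors.
Variable R : realType.
Local Notation C := R[i].
Local Notation mu := (@lebesgue_measure R).
Implicit Types (f g h : R -> C) (q : \bar R).

Lemma Hheat_C2 q f f1 f2 : (1 <= q)%E -> (forall x, is_cder x f (f1 x)) ->
  (forall x, is_cder x f1 (f2 x)) -> ccont f2 -> Lp q f -> Lp q f2 ->
  Hheat q f (fun u => - f2 u).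
Proof.
move=> q1 d1 d2 c2 lf lf2; apply: Hheat_intro => //; first exact: LpN.
move=> t t0; have ic := cintegrable_cheat t0; have ih := cintegrable_crho t0.
apply: aeS2 (ae_conv_integrable q1 ic lf) (ae_conv_integrable q1 ih lf2) => u i1 i2.
have := conv_cheatB t0 (Lp_measurable lf2) (C2_second_primitive d1 d2 c2) i1 i2.
rewrite mul0r addr0 => e; rewrite -opprB e /conv -(cintN i2); congr cint.
by apply/funext => s; rewrite mulrN.
Qed.

Lemma Lpnorm_neq0 q f : (1 <= q)%E -> cmeasurable f -> (forall x, f x <> 0) -> Lpnorm q f != 0%E.
Proof.
move=> q1 mf fn0; apply/negP => /eqP /(Lpnorm_eq0 q1 mf) [N [mN N0 sub]].
have NT : N = [set: R] by apply/seteqP; split => // x _; apply: sub; exact: fn0.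
by move: N0; rewrite NT; have := mu_setT_gt0 R => /[swap] ->; rewrite ltxx.
Qed.

(** A plane wave e^{iku} times the slow envelope w = 1/(e^{eu} + e^{-eu}), which satisfies |w'| <= e
    w and |w''| <= e^2 w. The error is thus bounded pointwise by f itself, which serves every
    exponent at once and survives composition with a change of coordinates. *)
Lemma approximate_eigenvector q (k d : R) : (1 <= q)%E -> 0 < d ->
  exists f h, [/\ Hheat q f h, Lpnorm q f != 0%E &
    forall u, normc ((k ^+ 2)%:C * f u - h u) <= d * normc (f u)].
Proof.
move=> q1 d0.
(* The error terms w'' and 2 i k w' add up to at most (e^2 + 2 |k| e) w, and e <= 1 bounds e^2 by
   e. *)
pose e := Num.min 1 (d / (1 + 2 * `|k|)).
have k0 : 0 < 1 + 2 * `|k| by rewrite ltr_pwDl// mulr_ge0.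
have e0 : 0 < e by rewrite lt_min ltr01 divr_gt0.
have ed : e ^+ 2 + 2 * `|k| * e <= d.
  have e1 : e <= 1 by rewrite ge_min lexx.
  have e2 : e * (1 + 2 * `|k|) <= d by rewrite -ler_pdivlMr// ge_min lexx orbT.
  have := normr_ge0 k; move: (`|k|) e2 => a; nra.
pose c (u : R) := expR (e * u) + expR (- e * u).
pose s (u : R) := expR (e * u) - expR (- e * u).
have dE (b u : R) : is_derive u (1:R) (fun y => expR (b * y)) (b * expR (b * u)).
  by apply: (is_derive_congr (is_derive1_comp (is_derive_expR (b * u)) (is_derive_mulr u b))); rewrite mulrC.
have dc u : is_derive u (1:R) c (e * s u).
  by apply: (is_derive_congr (is_deriveD (dE e u) (dE (- e) u))); rewrite /s; ring.
have ds u : is_derive u (1:R) s (e * c u).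
  by apply: (is_derive_congr (is_deriveB (dE e u) (dE (- e) u))); rewrite /c; ring.
have c0 u : 0 < c u by rewrite addr_gt0 ?expR_gt0.
have sc u : s u ^+ 2 <= c u ^+ 2.
  rewrite /s /c; have := expR_gt0 (e * u); have := expR_gt0 (- e * u).
  by move: (expR _) (expR _) => a b; nra.
pose w u := (c u)^-1.
pose w1 u := - (e * s u) / c u ^+ 2.
pose w2 u := e ^+ 2 * (2 * s u ^+ 2 - c u ^+ 2) / c u ^+ 3.
have cn0 u : c u != 0 by rewrite gt_eqF.
have dV (f : R -> R) u (a : R) : f u != 0 -> is_derive u (1:R) f a ->
    is_derive u (1:R) (fun y => (f y)^-1) (- a / f u ^+ 2).
  move=> f0 df; apply: (is_derive_congr (is_deriveV f0 df)).
  by rewrite /GRing.scale/= !mulNr mulrC.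
have dw u : is_derive u (1:R) w (w1 u) by exact: dV.
have dc2 u : is_derive u (1:R) (fun y => c y * c y) (2 * (e * s u) * c u).
  by apply: (is_derive_congr (is_derive_mul (dc u) (dc u))); ring.
have dw1 u : is_derive u (1:R) w1 (w2 u).
  have dcv : is_derive u (1:R) (fun y => (c y * c y)^-1) (- (2 * (e * s u) * c u) / (c u * c u) ^+ 2).
    by apply: dV; rewrite ?mulf_neq0.
  rewrite (_ : w1 = (fun y => (- e * s y) * (c y * c y)^-1)); last first.
    by apply/funext => y; rewrite /w1 expr2 !mulNr.
  have des : is_derive u (1:R) (fun y => - e * s y) (- e * (e * c u)).
    by apply: (is_derive_congr (is_derive_mul (is_derive_cst (- e) u 1) (ds u))); rewrite mul0r addr0.
  apply: (is_derive_congr (is_derive_mul des dcv)).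
  by rewrite /w2; field; rewrite cn0.
have w0 u : 0 < w u by rewrite invr_gt0.
have sle u : `|s u| <= c u.
  by rewrite -(ger0_norm (ltW (c0 u))) -ler_sqr ?nnegrE// !real_normK ?num_real.
have w1le u : `|w1 u| <= e * w u.
  have -> : `|w1 u| = e * (`|s u| / c u ^+ 2).
    by rewrite /w1 mulNr normrN !normrM (gtr0_norm e0) normfV (ger0_norm (sqr_ge0 (c u))) mulrA.
  rewrite ler_wpM2l ?(ltW e0)// ler_pdivrMr ?exprn_gt0// /w expr2 mulKf//.
have w2le u : `|w2 u| <= e ^+ 2 * w u.
  rewrite /w2 /w 2!normrM (ger0_norm (sqr_ge0 e)) normfV (ger0_norm (exprn_ge0 3 (ltW (c0 u)))).
  rewrite -mulrA ler_wpM2l ?sqr_ge0// ler_pdivrMr ?exprn_gt0//.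
  rewrite (exprS _ 2) mulKf// ler_norml; have := sc u; have := sqr_ge0 (s u).
  by move: (s u ^+ 2) (c u ^+ 2) => a b; lra.
pose E u := cexp ('i * k%:C * u%:C) : C.
pose f u := (w u)%:C * E u.
pose f1 u := ((w1 u)%:C + 'i * k%:C * (w u)%:C) * E u.
pose f2 u := ((w2 u)%:C + 2 * ('i * k%:C) * (w1 u)%:C - (k ^+ 2)%:C * (w u)%:C) * E u.
have dE1 u : is_cder u E ('i * k%:C * E u) by exact: is_cder_cexp.
have i2 : 'i * k%:C * ('i * k%:C) = - (k ^+ 2)%:C :> C.
  by rewrite mulrACA -expr2 sqr_i -RCM -expr2 mulN1r.
have d1 u : is_cder u f (f1 u).
  by apply: (is_cder_eq (is_cderM (is_cder_real (dw u)) (dE1 u))); rewrite /f1; ring.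
have d2 u : is_cder u f1 (f2 u).
  have := is_cderM (is_cderD (is_cder_real (dw1 u)) (is_cderZ ('i * k%:C) (is_cder_real (dw u)))) (dE1 u).
  move=> h; apply: (is_cder_eq h).
  by rewrite /f2 -[X in _ - X * _]opprK -i2; ring.
have cX n (g : R -> R) : continuous g -> continuous (fun y => g y ^+ n).
  by move=> cg u; exact: (@continuous_comp _ _ _ g (fun y => y ^+ n) u (cg u) (@exprn_continuous _ n _)).
have cw2 : continuous w2.
  move=> u; apply: cvgM.
    apply: cvgM; first exact: cvg_cst.
    apply: cvgB; last exact: (cX 2 _ (is_derive_cont dc)).
    by apply: cvgM; [exact: cvg_cst|exact: (cX 2 _ (is_derive_cont ds))].
  by apply: cvgV; [rewrite expf_neq0|exact: (cX 3 _ (is_derive_cont dc))].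
have cc2 : ccont f2.
  apply: ccontM; last exact: (is_cder_cont dE1).
  apply: ccontD.
    apply: ccontD; first exact: ccont_real.
    by apply: ccontZ; apply: ccont_real; exact: (is_derive_cont dw1).
  rewrite (_ : (fun y => _) = (fun y => - (k ^+ 2)%:C * (w y)%:C)); last first.
    by apply/funext => y; rewrite mulNr.
  by apply: ccontZ; apply: ccont_real; exact: (is_derive_cont dw).
have nE u : normc (E u) = 1.
  rewrite /E normc_cexp (_ : complex.Re _ = 0) ?expR0//.
  by rewrite !(ReM, ImM)/=; ring.
have nf u : normc (f u) = w u.
  by rewrite /f Normc.normcM nE mulr1 normc_real gtr0_norm.
have nik : normc ('i * k%:C : C) = `|k|.
  by rewrite Normc.normcM normc_real normcE/= expr0n/= expr1n add0r sqrtr1 mul1r.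
have mf : cmeasurable f by exact: ccont_measurable (is_cder_cont d1).
have wle1 u : w u <= expR (- (e * `|u|)).
  rewrite /w -(invrK (expR (- _))) lef_pV2 ?posrE ?invr_gt0 ?expR_gt0// -expRN opprK /c.
  by case: (ger0P u) => _; rewrite ?mulrN ?mulNr ?lerDl ?lerDr expR_ge0.
have ife : cintegrable (expk (e%:C : C)) by apply/cintegrableP; rewrite nint_expk// ltry;
  split => //; exact: ccont_measurable (ccont_expk _).
have i_f : cintegrable f.
  by apply: (cintegrable_le mf ife) => u; rewrite nf normc_expk.
have lf : Lp q f.
  apply: (@Lp_bounded_integrable _ _ _ 1 q1 i_f) => u; rewrite nf (le_trans (wle1 u))//.
  by rewrite -expR0 ler_expR oppr_le0 mulr_ge0// ltW.
have key u : normc ((k ^+ 2)%:C * f u + f2 u) <= d * normc (f u).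
  have -> : (k ^+ 2)%:C * f u + f2 u = ((w2 u)%:C + 2 * ('i * k%:C) * (w1 u)%:C) * E u.
    by rewrite /f /f2; ring.
  rewrite Normc.normcM nE mulr1 nf; apply: (le_trans (normc_triangle _ _)).
  rewrite 2!Normc.normcM nik normc2 !normc_real.
  apply: (le_trans (lerD (w2le u) (ler_wpM2l _ (w1le u)))); first by rewrite mulr_ge0.
  by rewrite mulrA -mulrDl ler_wpM2r// ltW.
have lf2 : Lp q f2.
  have : Lp q (fun u => (k ^+ 2)%:C * f u + f2 u).
    have ldf : Lp q (fun u => d%:C * f u) by exact: LpZ.
    apply: (Lp_le q1 _ ldf).
      by apply: cmfD; [exact: cmfZ|exact: ccont_measurable].
    by apply: aeW => u; rewrite Normc.normcM normc_real (gtr0_norm d0).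
  move=> h; have := LpB q1 h (LpZ (k ^+ 2)%:C q1 lf); congr Lp.
  by apply/funext => u; rewrite addrC addKr.
exists f, (fun u => - f2 u); split.
- exact: (Hheat_C2 q1 d1 d2 cc2 lf lf2).
- apply: Lpnorm_neq0 => // u fu0; have := nf u; rewrite fu0 Normc.normc0 => wu.
  by have := w0 u; rewrite -wu ltxx.
- by move=> u; rewrite opprK.
Qed.

(** A resolvent of bound M would give |f| <= M |lam f - h| <= M d |f| in norm, impossible for M d <
    1 and f nonzero. The bound M has no prescribed sign, whence |M| + 1. *)
Lemma spectrum_approximate q (H : (R -> C) -> (R -> C) -> Prop) (lam : C) : (1 <= q)%E ->
  (forall f h, H f h -> Lp q f /\ Lp q h) ->
  (forall d : R, 0 < d -> exists f h, [/\ H f h, Lpnorm q f != 0%E &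
    forall u, normc (lam * f u - h u) <= d * normc (f u)]) ->
  spectrum q H lam.
Proof.
move=> q1 HL app [V [[V1 V2 [M VM]] _ V3]].
have M0 : 0 < `|M| + 1 by rewrite ltr_wpDl.
have d0 : 0 < (2 * (`|M| + 1))^-1 by rewrite invr_gt0 mulr_gt0.
have [f [h [Hfh fn0 fle]]] := app _ d0.
have [lf lh] := HL _ _ Hfh; have [mf nf] := lf; have mh := Lp_measurable lh.
pose g x := lam * f x - h x.
have mg : cmeasurable g by apply: cmfB => //; exact: cmfZ.
have lg : Lp q g by apply: LpB => //; exact: LpZ.
have /ae_eqP e := V3 _ _ Hfh.
have ng : (Lpnorm q g <= ((2 * (`|M| + 1))^-1)%:E * Lpnorm q f)%E.
  have -> : ((2 * (`|M| + 1))^-1)%:E = (normc ((2 * (`|M| + 1))^-1%:C : C))%:E.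
    by rewrite normc_real (gtr0_norm d0).
  rewrite -LpnormZ//; apply: le_Lpnorm => //; first exact: cmfZ.
  by apply: aeW => u; rewrite Normc.normcM normc_real (gtr0_norm d0); exact: fle.
have mVg : cmeasurable (V g) by exact: Lp_measurable (V1 _ lg).
have := VM _ lg; rewrite (ae_eq_Lpnorm q1 mVg mf e) => h1.
have ffin : Lpnorm q f \is a fin_num by rewrite ge0_fin_numE// Lpnorm_ge0.
have F0 : 0 < fine (Lpnorm q f).
  by rewrite fine_gt0// nf andbT lt_neqAle eq_sym fn0 Lpnorm_ge0.
have gfin : Lpnorm q g \is a fin_num by case: lg => _ ?; rewrite ge0_fin_numE// Lpnorm_ge0.
move: h1 ng; rewrite -(fineK ffin) -(fineK gfin) -!EFinM !lee_fin.
have G0 : 0 <= fine (Lpnorm q g) by rewrite fine_ge0// Lpnorm_ge0.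
move: (fine (Lpnorm q f)) (fine (Lpnorm q g)) F0 G0 => F G F0 G0 h1 h2.
have h3 : F <= `|M| * G by apply: (le_trans h1); rewrite ler_wpM2r// ler_norm.
have h4 : 2 * (`|M| + 1) * G <= F.
  by rewrite -ler_pdivlMl ?mulr_gt0.
by move: (normr_ge0 M) h3 h4 F0; move: (`|M|) => a; nra.
Qed.

End approximate_eigenvectors.

(** * The heat kernel at complex times *)

Section holomorphic_kernel.
Variable R : realType.
Local Notation C := R[i].
Local Notation mu := (@lebesgue_measure R).
Implicit Types (f g : R -> C) (w z : C).

Lemma nintD f g : cmeasurable f -> cmeasurable g ->
  (nint (fun x => (f x + g x)%R) <= nint f + nint g)%E.
Proof. by move=> mf mg; rewrite -!Lpnorm1; exact: Lpnorm_triangle. Qed.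

Lemma cexp_taylor (h : C) : normc (cexp h - 1 - h) <= normc h ^+ 2 * expR (normc h).
Proof.
(* Integral remainder on [0, 1]: G has derivative (1 - t) h^2 e^{th}, and G 1 - G 0 = e^h - 1 -
   h. *)
pose G (t : R) : C := (1 - t)%:C * (h * cexp (h * t%:C)) + cexp (h * t%:C).
pose G1 (t : R) : C := (1 - t)%:C * (h ^+ 2 * cexp (h * t%:C)).
have dG t : is_cder t G (G1 t).
  have e := is_cder_cexp t h.
  apply: (is_cder_eq (is_cderD (is_cderM (is_cder_real (is_derive_subl t 1)) (is_cderZ h e)) e)).
  by rewrite /G1 RCN (_ : 1%:C = 1 :> C)//; ring.
have cG1 : ccont G1.
  apply: ccontM; last by apply: ccontZ; exact: ccont_cexp.
  by apply: ccont_real => t; apply: cvgB; [exact: cvg_cst|exact: cvg_id].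
have := cFTC (@ler01 R) dG cG1.
have -> : G 1 - G 0 = cexp h - 1 - h.
  by rewrite /G subrr subr0 mul0r add0r mulr0 cexp0 !mulr1 (_ : 1%:C = 1 :> C)// mul1r opprD addrA addrAC.
move=> <-; have iG := ccont_itv_integrable 0 1 cG1; have [mG nG] := (cintegrableP _).1 iG.
set K := normc h ^+ 2 * _; have K0 : 0 <= K by rewrite mulr_ge0 ?sqr_ge0 ?expR_ge0.
rewrite -lee_fin; apply: (le_trans (normc_cint_le mG)).
apply: (@le_trans _ _ (\int[mu]_s (K%:E * ((0 <= s <= 1)%R%:R)%:E))%E); last first.
  rewrite ge0_intZl//; last first.
    by apply/measurable_EFinP; apply: measurable_boolR; apply: measurable_and; exact: measurable_fun_ler.
  by rewrite integral_itv_indic// subr0 mule1.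
apply: ge0_le_integral => //.
- by move=> s _; rewrite lee_fin normc_ge0.
- exact: measurable_normcE.
- apply: emeasurable_funM => //; apply/measurable_EFinP; apply: measurable_boolR.
  by apply: measurable_and; exact: measurable_fun_ler.
- move=> s _; rewrite -EFinM lee_fin Normc.normcM normc_real ger0_norm// mulrC.
  case: (boolP (0 <= s <= 1)) => [/andP[s0 s1]|]; last by rewrite !mulr0.
  rewrite !mulr1 /G1 2!Normc.normcM normc_real ger0_norm ?subr_ge0//.
  rewrite normc_cexp /K -[X in _ <= X]mul1r ler_pM ?mulr_ge0 ?normc_ge0 ?expR_ge0 ?subr_ge0//.
    by rewrite lerBlDr lerDl.
  rewrite expr2 Normc.normcM -expr2 ler_wpM2l ?sqr_ge0// ler_expR ReM/= mulr0 subr0.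
  apply: (le_trans (ler_norm _)); rewrite normrM (ger0_norm s0).
  by rewrite (le_trans _ (ler_normRe h))// ler_piMr.
Qed.

Definition gk w (s : R) : C := cexp (- w * (s ^+ 2)%:C).

Lemma normc_gk w s : normc (gk w s) = expR (- (complex.Re w * s ^+ 2)).
Proof. by rewrite /gk normc_cexp ReM ReN/= mulr0 subr0 mulNr. Qed.

Lemma measurable_gk w : cmeasurable (gk w).
Proof.
apply: ccont_measurable; apply: (ccont_comp (f := fun y => cexp (- w * y%:C)) (h := fun s : R => s ^+ 2)).
  exact: ccont_cexp.
exact: exprn_continuous.
Qed.

Lemma nint_gk w : 0 < complex.Re w -> nint (gk w) = (Num.sqrt (pi / complex.Re w))%:E.
Proof.
by move=> w0; rewrite -(integral_gaussian w0); apply: eq_integral => s _; rewrite normc_gk.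
Qed.

Lemma cintegrable_gk w : 0 < complex.Re w -> cintegrable (gk w).
Proof.
by move=> w0; apply/cintegrableP; rewrite nint_gk// ltry; split => //; exact: measurable_gk.
Qed.

(** The derivative of [gk] in w. *)
Definition gk1 w (s : R) : C := - (s ^+ 2)%:C * gk w s.

Let pow2_le (x : R) : 0 <= x -> x ^+ 2 / 2 <= expR x.
Proof.
move=> x0; apply: (le_trans _ (expR_ge1Dxn 1 x0)); rewrite (_ : (2`!)%:R = 2)//.
by rewrite lerDr.
Qed.

Lemma measurable_gk1 w : cmeasurable (gk1 w).
Proof.
apply: (cmfM _ (measurable_gk w)); apply: cmfN; apply: cmf_real; exact: exprn_measurable.
Qed.

Lemma cintegrable_gk1 w : 0 < complex.Re w -> cintegrable (gk1 w).
Proof.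
move=> w0; pose c := complex.Re w / 2; have c0 : 0 < c by rewrite divr_gt0.
have ic : cintegrable (fun s => (c^-1)%:C * gk c%:C s) by apply: cintegrableZ; exact: cintegrable_gk.
apply: (cintegrable_le (measurable_gk1 w) ic) => s.
rewrite /gk1 (Normc.normcM (- _)) (Normc.normcM (c^-1)%:C) normcN !normc_real !normc_gk/=.
rewrite ger0_norm ?sqr_ge0// gtr0_norm ?invr_gt0//.
rewrite ler_pdivlMl// mulrA -ler_pdivlMr ?expR_gt0// -expRN -expRD opprK.
have -> : - (c * s ^+ 2) + complex.Re w * s ^+ 2 = c * s ^+ 2 by rewrite /c; field.
by rewrite (le_trans _ (expR_ge1Dx _))// lerDr.
Qed.

Lemma gk_taylor w0 : 0 < complex.Re w0 -> exists K : R, 0 <= K /\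
  forall w, normc (w - w0) <= complex.Re w0 / 2 ->
  (nint (fun s => (gk w s - gk w0 s - (w - w0) * gk1 w0 s)%R) <= (K * normc (w - w0) ^+ 2)%:E)%E.
Proof.
move=> w00; pose c := complex.Re w0 / 2; have c0 : 0 < c by rewrite divr_gt0.
have c20 : 0 < c / 2 by rewrite divr_gt0.
(* 8 / c^2 comes from y^2 / 2 <= e^y at y = c s^2 / 2, the square root is the L_1 norm of gk (c /
   2). *)
pose K := 8 / c ^+ 2 * Num.sqrt (pi / (c / 2)).
have K80 : 0 <= 8 / c ^+ 2 by rewrite divr_ge0// sqr_ge0.
exists K; split; first by rewrite mulr_ge0.
move=> w; set a := normc (w - w0) => ac.
have a0 : 0 <= a by exact: normc_ge0.
have icc : cmeasurable (fun s => (a ^+ 2 * (8 / c ^+ 2))%:C * gk (c / 2)%:C s).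
  by apply: cmfZ; exact: measurable_gk.
apply: (@le_trans _ _ (nint (fun s => (a ^+ 2 * (8 / c ^+ 2))%:C * gk (c / 2)%:C s))); last first.
  rewrite nintZ; last exact: measurable_gk.
  have k0 : 0 <= a ^+ 2 * (8 / c ^+ 2) by rewrite mulr_ge0// sqr_ge0.
  rewrite (nint_gk (w := (c / 2)%:C) c20) normc_real (ger0_norm k0) -EFinM lee_fin.
  rewrite /K /=; set q := Num.sqrt _; rewrite le_eqVlt; apply/orP; left; apply/eqP.
  by move: (8 / c ^+ 2) => b; ring.
apply: le_nint => //; last first.
  by apply: cmfB; [apply: cmfB; exact: measurable_gk|apply: cmfZ; exact: measurable_gk1].
move=> s; pose h : C := - (w - w0) * (s ^+ 2)%:C.
have -> : gk w s - gk w0 s - (w - w0) * gk1 w0 s = gk w0 s * (cexp h - 1 - h).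
  have -> : gk w s = gk w0 s * cexp h by rewrite /gk -cexpD /h; congr cexp; ring.
  by rewrite /gk1 /h; ring.
have nh : normc h = a * s ^+ 2 by rewrite Normc.normcM normcN normc_real ger0_norm ?sqr_ge0.
have k0 : 0 <= a ^+ 2 * (8 / c ^+ 2) by rewrite mulr_ge0// sqr_ge0.
rewrite (Normc.normcM (gk w0 s)) (Normc.normcM (a ^+ 2 * (8 / c ^+ 2))%:C) normc_real (ger0_norm k0) !normc_gk/=.
apply: (@le_trans _ _ (expR (- (complex.Re w0 * s ^+ 2)) * ((a * s ^+ 2) ^+ 2 * expR (c * s ^+ 2)))).
  rewrite ler_wpM2l ?expR_ge0// -nh; apply: (le_trans (cexp_taylor h)).
  by rewrite ler_wpM2l ?sqr_ge0// ler_expR nh ler_wpM2r// sqr_ge0.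
have E1 : expR (- (complex.Re w0 * s ^+ 2)) * expR (c * s ^+ 2) = expR (- (c * s ^+ 2)).
  by rewrite -expRD; congr expR; rewrite /c; field.
have -> : expR (- (complex.Re w0 * s ^+ 2)) * ((a * s ^+ 2) ^+ 2 * expR (c * s ^+ 2)) =
    a ^+ 2 * ((s ^+ 2) ^+ 2 * (expR (- (complex.Re w0 * s ^+ 2)) * expR (c * s ^+ 2))) by ring.
rewrite E1 -[leRHS]mulrA; apply: ler_wpM2l; first exact: sqr_ge0.
have -> : - (c * s ^+ 2) = c / 2 * s ^+ 2 * - 1 + (- (c / 2 * s ^+ 2)) by field.
rewrite expRD (mulrA ((s ^+ 2) ^+ 2)) ler_wpM2r ?expR_ge0// mulrN1 expRN.
rewrite ler_pdivrMr ?expR_gt0//.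
have cs0 : 0 <= c / 2 * s ^+ 2 by rewrite mulr_ge0 ?(ltW c20) ?sqr_ge0.
have -> : (s ^+ 2) ^+ 2 = 8 / c ^+ 2 * ((c / 2 * s ^+ 2) ^+ 2 / 2) by field; rewrite gt_eqF.
by apply: ler_wpM2l => //; exact: pow2_le.
Qed.

Lemma sqrtc_Re_gt0 z : 0 < complex.Re z -> 0 < complex.Re (sqrtc z).
Proof.
case: z => a b /= a0; rewrite sqrtr_gt0 divr_gt0//.
by rewrite ltr_wpDl ?sqrtr_ge0.
Qed.

Lemma normc_sqrtc z : normc (sqrtc z) ^+ 2 = normc z.
Proof. by rewrite expr2 -Normc.normcM -expr2 sqr_sqrtc. Qed.

Lemma le_normc_Re z : 0 < complex.Re z -> complex.Re z <= normc z.
Proof. by move=> z0; rewrite (le_trans _ (ler_normRe z))// ler_norm. Qed.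

(** Up to the factor sqrt pi the normalised Gaussian; by [nint_wk] its L_1 norm depends only on the
    argument of w. *)
Definition wk w (s : R) : C := sqrtc w * gk w s.

Lemma cintegrable_wk w : 0 < complex.Re w -> cintegrable (wk w).
Proof. by move=> w0; apply: cintegrableZ; exact: cintegrable_gk. Qed.

Lemma nint_wk w : 0 < complex.Re w ->
  nint (wk w) = (Num.sqrt (pi * (normc w / complex.Re w)))%:E.
Proof.
move=> w0; rewrite nintZ; last exact: measurable_gk.
rewrite nint_gk// -EFinM; congr (_%:E).
rewrite -(ger0_norm (normc_ge0 (sqrtc w))) -sqrtr_sqr normc_sqrtc -sqrtrM ?normc_ge0//.
by congr Num.sqrt; ring.
Qed.

(** Product rule for the square root and [gk]. The increment of the root is (w - w0) / (v + v0), and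
    |v + v0| >= Re v0 because both roots lie in the right half-plane. *)
Lemma wk_taylor w0 : 0 < complex.Re w0 -> exists D : R -> C, cintegrable D /\
  exists K : R, 0 <= K /\
  forall w, normc (w - w0) <= complex.Re w0 / 2 ->
  (nint (fun s => (wk w s - wk w0 s - (w - w0) * D s)%R) <= (K * normc (w - w0) ^+ 2)%:E)%E.
Proof.
move=> w00; have [K [K0 hK]] := gk_taylor w00.
have i1 := cintegrable_gk1 w00; have i0 := cintegrable_gk w00.
pose v0 := sqrtc w0; have v00 : 0 < complex.Re v0 by exact: sqrtc_Re_gt0.
pose p := complex.Re v0.
exists (fun s => v0 * gk1 w0 s + (2 * v0)^-1 * gk w0 s); split.
  by apply: cintegrableD; exact: cintegrableZ.
have [m1 n1] := (cintegrableP _).1 i1; have [m0 n0] := (cintegrableP _).1 i0.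
pose N1 := fine (nint (gk1 w0)); pose N0 := fine (nint (gk w0)).
have N1E : nint (gk1 w0) = N1%:E by rewrite fineK// ge0_fin_numE// nint_ge0.
have N0E : nint (gk w0) = N0%:E by rewrite fineK// ge0_fin_numE// nint_ge0.
have N10 : 0 <= N1 by rewrite -lee_fin -N1E nint_ge0.
have N00 : 0 <= N0 by rewrite -lee_fin -N0E nint_ge0.
pose S := normc v0 + complex.Re w0 / 2 / p.
have S0 : 0 <= S by rewrite addr_ge0 ?normc_ge0// !divr_ge0// ltW.
exists (S * K + p^-1 * N1 + (2 * p ^+ 3)^-1 * N0); split.
  by rewrite !addr_ge0 ?mulr_ge0 ?invr_ge0 ?(ltW v00)// mulr_ge0// exprn_ge0// ltW.
move=> w aw; set a := normc (w - w0) in aw *.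
have a0 : 0 <= a by exact: normc_ge0.
have w0' : 0 < complex.Re w.
  have := ler_normRe (w - w0); rewrite ReB => h.
  have : complex.Re w0 - complex.Re w <= complex.Re w0 / 2.
    by apply: (le_trans _ aw); apply: (le_trans _ h); rewrite distrC ler_norm.
  lra.
pose v := sqrtc w; have vp : 0 < complex.Re v by exact: sqrtc_Re_gt0.
have sum0 : p <= normc (v + v0).
  apply: (le_trans _ (ler_normRe (v + v0))).
  by rewrite ReD ger0_norm ?lerDr ?(ltW vp)// addr_ge0 ?(ltW vp) ?(ltW v00).
have vv : (v - v0) * (v + v0) = w - w0 by rewrite -subr_sqr !sqr_sqrtc.
have dv : normc (v - v0) <= a / p.
  rewrite ler_pdivlMr// /a -vv Normc.normcM ler_wpM2l ?normc_ge0//.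
have v0n : v0 != 0 by apply: contraTneq v00 => ->; rewrite ltxx.
have svn : v + v0 != 0.
  by apply: contraTneq sum0 => ->; rewrite Normc.normc0 -ltNge.
have p0 : p <= normc v0 by exact: le_normc_Re.
have dv2 : normc (v - v0 - (w - w0) / (2 * v0)) <= (2 * p ^+ 3)^-1 * a ^+ 2.
  have -> : v - v0 - (w - w0) / (2 * v0) = - ((v - v0) * (v - v0) / (2 * v0)).
    by rewrite -vv; field.
  rewrite normcN 2!Normc.normcM normcV Normc.normcM normc2.
  rewrite ler_pdivrMr ?mulr_gt0 ?(lt_le_trans v00 p0)//.
  apply: (@le_trans _ _ ((a / p) * (a / p))); first by apply: ler_pM; rewrite ?normc_ge0.
  have -> : a / p * (a / p) = (2 * p ^+ 3)^-1 * a ^+ 2 * (2 * p) by field; rewrite gt_eqF.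
  by rewrite ler_wpM2l ?ler_wpM2l// mulr_ge0 ?sqr_ge0// invr_ge0 mulr_ge0 ?exprn_ge0// ltW.
have vS : normc v <= S.
  rewrite -[v](subrK v0) addrC (le_trans (normc_triangle _ _))// lerD2l (le_trans dv)//.
  by rewrite ler_wpM2r// invr_ge0 ltW.
have mr : cmeasurable (fun s => gk w s - gk w0 s - (w - w0) * gk1 w0 s).
  by apply: cmfB; [apply: cmfB => //; exact: measurable_gk|exact: cmfZ].
(* The error of the product rule: the remainder of the Gaussian in A, the product of the two
   increments in B, the remainder of the square root in E. *)
pose A s := v * (gk w s - gk w0 s - (w - w0) * gk1 w0 s).
pose B s := (v - v0) * (w - w0) * gk1 w0 s.
pose E s := (v - v0 - (w - w0) / (2 * v0)) * gk w0 s.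
have mA : cmeasurable A by exact: cmfZ.
have mB : cmeasurable B by exact: cmfZ.
have mE : cmeasurable E by exact: cmfZ.
have -> : (fun s => wk w s - wk w0 s - (w - w0) * (v0 * gk1 w0 s + (2 * v0)^-1 * gk w0 s)) =
    (fun s => A s + B s + E s).
  by apply/funext => s; rewrite /wk -/v -/v0 /A /B /E; ring.
apply: (le_trans (nintD (cmfD mA mB) mE)).
apply: (le_trans (leeD (nintD mA mB) (lexx _))).
rewrite 2!mulrDl 2!EFinD; apply: leeD; first apply: leeD.
- rewrite /A nintZ// -mulrA EFinM; apply: lee_pmul; rewrite ?lee_fin ?normc_ge0 ?nint_ge0//.
  exact: hK.
- rewrite /B nintZ// N1E -EFinM lee_fin Normc.normcM -/a [leRHS]mulrAC ler_wpM2r//.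
  apply: (le_trans (ler_wpM2r a0 dv)).
  by rewrite mulrAC -expr2 mulrC.
- by rewrite /E nintZ// N0E -EFinM lee_fin [leRHS]mulrAC ler_wpM2r.
Qed.

(* The heat kernel at complex time z; wk is parametrised by 1/(4z). *)
Definition zheat z (s : R) : C := ((Num.sqrt pi)^-1)%:C * wk ((4 * z)^-1) s.

Lemma Re_inv4 z : 0 < complex.Re z ->
  complex.Re (4 * z)^-1 = complex.Re z / (4 * normc z ^+ 2).
Proof.
move=> z0; have zn := nu_neq0 z0.
have nz : normc z != 0 by rewrite gt_eqF// (lt_le_trans z0)// le_normc_Re.
have -> : (4 * z)^-1 = ((4 * normc z ^+ 2)^-1)%:C * (z^*)%C.
  have e : (4 : C) = (4 : R)%:C by rewrite rmorphMn.
  apply: (@mulfI _ (4 * z)); first by rewrite mulf_neq0// pnatr_eq0.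
  rewrite divff; last by rewrite mulf_neq0// pnatr_eq0.
  rewrite mulrCA -mulrA mulc_conj e -!RCM mulVf//.
  by rewrite mulf_neq0 ?expf_neq0.
by rewrite ReZ ReJ mulrC.
Qed.

Lemma Re_inv4_gt0 z : 0 < complex.Re z -> 0 < complex.Re (4 * z)^-1.
Proof.
move=> z0; rewrite Re_inv4// divr_gt0// mulr_gt0// exprn_gt0//.
by rewrite (lt_le_trans z0)// le_normc_Re.
Qed.

Lemma normc4 : normc (4 : C) = 4.
Proof. by rewrite (_ : 4 = (4:R)%:C :> C) ?normc_real ?ger0_norm// rmorphMn. Qed.

Lemma cintegrable_zheat z : 0 < complex.Re z -> cintegrable (zheat z).
Proof. by move=> z0; apply: cintegrableZ; apply: cintegrable_wk; exact: Re_inv4_gt0. Qed.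

(** A function of the argument of z alone: this is the source of the uniform bounds on sectors. *)
Lemma nint_zheat z : 0 < complex.Re z -> nint (zheat z) = (Num.sqrt (normc z / complex.Re z))%:E.
Proof.
move=> z0; have w0 := Re_inv4_gt0 z0.
have zg : 0 < normc z by rewrite (lt_le_trans z0)// le_normc_Re.
have [mw _] := (cintegrableP _).1 (cintegrable_wk w0).
rewrite nintZ// nint_wk// -EFinM; congr (_%:E).
rewrite normc_real ger0_norm ?invr_ge0// sqrtrM ?pi_ge0// mulKf ?gt_eqF ?sqrtr_gt0 ?pi_gt0//.
congr Num.sqrt; rewrite Re_inv4// normcV Normc.normcM normc4.
by field; rewrite !gt_eqF.
Qed.

Lemma zheat_real t : 0 < t -> zheat t%:C = cheat t.
Proof.
move=> t0; apply/funext => s; rewrite /zheat /wk /gk.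
have e4 : (4 : C) = (4 : R)%:C by rewrite rmorphMn.
have eV (x : R) : (x%:C)^-1 = (x^-1)%:C :> C by rewrite (fmorphV (real_complex R)).
have -> : (4 * t%:C)^-1 = ((4 * t)^-1)%:C :> C by rewrite e4 -RCM eV.
rewrite sqrtc_sqrtr; last by rewrite lecR invr_ge0 mulr_ge0// ltW.
rewrite -RCN -RCM cexp_real -!RCM /cheat /heat heat_coefE//=; congr (_%:C).
rewrite mulrA mulNr (mulrC _ (s ^+ 2)); congr (_ * _).
rewrite sqrtrV; last by rewrite mulr_ge0// ltW.
by rewrite -invfM -sqrtrM ?pi_ge0//; congr (Num.sqrt _)^-1; ring.
Qed.

(** Chain rule with w = 1/(4z), whose derivative is - 1/(4 z0^2). The estimate is on kernels in L_1,
    so Young's inequality makes it one for operator norms on every L_p. *)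
Theorem zheat_holomorphic z0 : 0 < complex.Re z0 -> exists D : R -> C, cintegrable D /\
  exists K d : R, [/\ 0 <= K, 0 < d &
  forall z, normc (z - z0) <= d -> 0 < complex.Re z ->
  (nint (fun s => (zheat z s - zheat z0 s - (z - z0) * D s)%R) <= (K * normc (z - z0) ^+ 2)%:E)%E].
Proof.
move=> z00; have w00 := Re_inv4_gt0 z00; pose w0 := (4 * z0)^-1.
have [D [iD [K [K0 hK]]]] := wk_taylor w00.
have r0 : 0 < normc z0 by rewrite (lt_le_trans z00)// le_normc_Re.
pose r := normc z0.
pose S : R := (Num.sqrt pi)^-1; have S0 : 0 <= S by rewrite invr_ge0.
have [mD nD] := (cintegrableP _).1 iD.
pose ND := fine (nint D); have NDE : nint D = ND%:E by rewrite fineK// ge0_fin_numE// nint_ge0.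
have ND0 : 0 <= ND by rewrite -lee_fin -NDE nint_ge0.
exists (fun s => (S%:C * - (4 * z0 ^+ 2)^-1) * D s); split; first exact: cintegrableZ.
(* r / 2 keeps |z| >= r / 2; the second entry then gives |w - w0| <= Re w0 / 2, the range of
   [wk_taylor]. *)
pose d := Num.min (r / 2) (complex.Re w0 * r ^+ 2).
have d0 : 0 < d by rewrite lt_min divr_gt0//= mulr_gt0// exprn_gt0.
exists (S * (K * (2 * r ^+ 2)^-1 ^+ 2 + (2 * r ^+ 3)^-1 * ND)), d; split => //.
  by rewrite mulr_ge0// addr_ge0// mulr_ge0 ?sqr_ge0// invr_ge0 mulr_ge0// exprn_ge0// ltW.
move=> z; set a := normc (z - z0) => ad z0'.
have a0 : 0 <= a by exact: normc_ge0.
have [ar aw] : a <= r / 2 /\ a <= complex.Re w0 * r ^+ 2 by move: ad; rewrite le_min => /andP.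
have rz : r / 2 <= normc z.
  have : r <= normc z + a.
    rewrite /r /a -[X in normc X <= _](subrK z) addrC (le_trans (normc_triangle _ _))//.
    by rewrite lerD2l normcBC.
  by lra.
have zn := nu_neq0 z0'; have z0n := nu_neq0 z00.
have zr0 : 0 < normc z by rewrite (lt_le_trans _ rz)// divr_gt0.
pose w := (4 * z)^-1.
have four0 : (4 : C) != 0 by rewrite pnatr_eq0.
have dw : normc (w - w0) <= (2 * r ^+ 2)^-1 * a.
  have -> : w - w0 = - ((z - z0) / (4 * z * z0)) by rewrite /w /w0; field; rewrite ?zn ?z0n.
  rewrite normcN Normc.normcM normcV 2!Normc.normcM normc4 -/a -/r mulrC ler_wpM2r//.
  rewrite lef_pV2 ?posrE ?mulr_gt0 ?exprn_gt0//.
  by rewrite expr2 mulrA ler_wpM2r ?(ltW r0)//; lra.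
have dw2 : normc (w - w0 + (z - z0) / (4 * z0 ^+ 2)) <= (2 * r ^+ 3)^-1 * a ^+ 2.
  have -> : w - w0 + (z - z0) / (4 * z0 ^+ 2) = (z - z0) ^+ 2 / (4 * z0 ^+ 2 * z).
    by rewrite /w /w0; field; rewrite ?zn ?z0n.
  rewrite Normc.normcM normcV (Normc.normcM (4 * z0 ^+ 2)) (Normc.normcM 4) normc4.
  rewrite (expr2 (z - z0)) (expr2 z0) (Normc.normcM (z - z0)) (Normc.normcM z0) -/a -/r mulrC -!expr2.
  rewrite ler_wpM2r ?sqr_ge0// lef_pV2 ?posrE ?mulr_gt0 ?exprn_gt0//.
  rewrite exprSr mulrA.
  have := exprn_gt0 2 r0; rewrite -/r; move: (r ^+ 2) => q q0; nra.
have wsmall : normc (w - w0) <= complex.Re w0 / 2.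
  have rn : r != 0 by rewrite gt_eqF.
  have k0 : 0 <= (2 * r ^+ 2)^-1 by rewrite invr_ge0 mulr_ge0// sqr_ge0.
  apply: (le_trans dw); apply: (le_trans (ler_wpM2l k0 aw)); rewrite le_eqVlt; apply/orP; left.
  by apply/eqP; field.
have h := hK w wsmall.
have mw v : cmeasurable (wk v) by apply: cmfZ; exact: measurable_gk.
pose A s := S%:C * (wk w s - wk w0 s - (w - w0) * D s).
pose B s := S%:C * (w - w0 + (z - z0) / (4 * z0 ^+ 2)) * D s.
have mA' : cmeasurable (fun s => wk w s - wk w0 s - (w - w0) * D s).
  exact: (cmfB (cmfB (mw w) (mw w0)) (cmfZ (w - w0) mD)).
have mA : cmeasurable A by exact: cmfZ.
have mB : cmeasurable B by exact: cmfZ.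
have -> : (fun s => zheat z s - zheat z0 s - (z - z0) * (S%:C * - (4 * z0 ^+ 2)^-1 * D s)) =
    (fun s => A s + B s).
  by apply/funext => s; rewrite /zheat -/w -/w0 -/S /A /B; ring.
apply: (le_trans (nintD mA mB)).
rewrite /A /B !nintZ// Normc.normcM normc_real ger0_norm// NDE -mulrA EFinM.
rewrite (mulrDl _ _ (a ^+ 2)) (mulrDr S) EFinD; apply: leeD.
  rewrite EFinM; apply: lee_pmul; rewrite ?lee_fin ?nint_ge0//; apply: (le_trans h).
  rewrite lee_fin -mulrA ler_wpM2l// -exprMn ler_sqr ?nnegrE ?normc_ge0//.
  by rewrite mulr_ge0// invr_ge0 mulr_ge0// exprn_ge0// ltW.
by rewrite -!EFinM lee_fin -mulrA ler_wpM2l// [leRHS]mulrAC ler_wpM2r.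
Qed.

End holomorphic_kernel.

(** * The coefficient *)

Section smooth_functions.
Variable R : realType.
Implicit Types (f g : R -> R) (n : nat).

(** Differentiability of order n by recursion on the derivative, so that closure under products and
    affine substitutions is a plain induction. *)
Fixpoint Cn n f : Prop :=
  if n is n'.+1 then (forall x, derivable f x 1) /\ Cn n' f^`() else True.

Lemma derive1nSr n f : f^`(n.+1) = (f^`())^`(n).
Proof. by rewrite /derive1n iterSr. Qed.

Lemma smoothP f : smooth f <-> forall n, Cn n f.
Proof.
split=> [sf n|cf n x].
  elim: n f sf => [//|n IHn] f sf /=; split; first exact: (sf 0%N).
  by apply: IHn => m x; rewrite -derive1nSr; exact: sf.
have [h _] : (forall x, derivable f^`(n) x 1) /\ True; last exact: h.
split=> // {}x; elim: n f cf x => [|n IHn] f cf x; first by have [h _] := cf 1%N; exact: h.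
by rewrite derive1nSr; apply: IHn => m; have [_ h] := cf m.+1.
Qed.

Lemma Cn_le n f : Cn n.+1 f -> Cn n f.
Proof. by elim: n f => [//|n IHn] f [h1 h2]; split => //; exact: IHn. Qed.

Lemma smooth_derivable f x : smooth f -> derivable f x 1.
Proof. by move=> sf; exact: (sf 0%N). Qed.

Lemma smooth_is_derive f x : smooth f -> is_derive x (1:R) f (f^`() x).
Proof. by move=> sf; rewrite derive1E; split => //; exact: smooth_derivable. Qed.

Lemma smooth_derive1 f : smooth f -> smooth f^`().
Proof. by move=> sf n x; rewrite -derive1nSr; exact: sf. Qed.

Lemma smooth_continuous f : smooth f -> continuous f.
Proof. by move=> sf; apply: is_derive_cont => x; exact: smooth_is_derive. Qed.

Lemma derive1_eq f f1 : (forall x, is_derive x (1:R) f (f1 x)) -> f^`() = f1.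
Proof. by move=> h; apply/funext => x; rewrite derive1E; case: (h x). Qed.

Lemma derivable_is_derive f x : derivable f x 1 -> is_derive x (1:R) f (f^`() x).
Proof. by move=> df; rewrite derive1E; split. Qed.

Lemma Cn_cst n (c : R) : Cn n (fun=> c).
Proof.
elim: n c => [//|n IHn] c; split; first by move=> x; exact: derivable_cst.
by rewrite (derive1_eq (fun x => is_derive_cst c x 1)).
Qed.

Lemma CnD n f g : Cn n f -> Cn n g -> Cn n (fun x => f x + g x).
Proof.
elim: n f g => [//|n IHn] f g [df f1] [dg g1].
have d x := is_deriveD (derivable_is_derive (df x)) (derivable_is_derive (dg x)).
split; first by move=> x; case: (d x).
by rewrite (derive1_eq d); exact: IHn.
Qed.

Lemma CnM n f g : Cn n f -> Cn n g -> Cn n (fun x => f x * g x).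
Proof.
elim: n f g => [//|n IHn] f g cf cg; have [df f1] := cf; have [dg g1] := cg.
have d x := is_derive_mul (derivable_is_derive (df x)) (derivable_is_derive (dg x)).
split; first by move=> x; case: (d x).
by rewrite (derive1_eq d); apply: CnD; apply: IHn => //; exact: Cn_le.
Qed.

Lemma Cn_affine n f (b c : R) : Cn n f -> Cn n (fun x => f (b * x + c)).
Proof.
elim: n f => [//|n IHn] f [df f1].
have da x : is_derive x (1:R) (fun y => b * y + c) b.
  by apply: (is_derive_congr (is_deriveD (is_derive_mulr x b) (is_derive_cst c x 1))); rewrite addr0.
have d x : is_derive x (1:R) (fun y => f (b * y + c)) (derive1 f (b * x + c) * b).
  exact: (is_derive1_comp (g := fun y => b * y + c) (derivable_is_derive (df (b * x + c))) (da x)).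
split; first by move=> x; case: (d x).
by rewrite (derive1_eq d); apply: CnM; [exact: IHn|exact: Cn_cst].
Qed.

Lemma Cn_id n : Cn n (fun x : R => x).
Proof.
case: n => [//|n]; split; first by move=> x; exact: derivable_id.
by rewrite (derive1_eq (fun x => is_derive_id x 1)); exact: Cn_cst.
Qed.

Lemma smooth_cst (c : R) : smooth (fun=> c : R).
Proof. by apply/smoothP => n; exact: Cn_cst. Qed.

Lemma smooth_id : smooth (fun x : R => x).
Proof. by apply/smoothP => n; exact: Cn_id. Qed.

Lemma smoothD f g : smooth f -> smooth g -> smooth (fun x => f x + g x).
Proof. by move=> /smoothP cf /smoothP cg; apply/smoothP => n; exact: CnD. Qed.

Lemma smoothM f g : smooth f -> smooth g -> smooth (fun x => f x * g x).
Proof. by move=> /smoothP cf /smoothP cg; apply/smoothP => n; exact: CnM. Qed.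

Lemma smoothZ (c : R) f : smooth f -> smooth (fun x => c * f x).
Proof. by move=> sf; exact: (smoothM (smooth_cst (c := c)) sf). Qed.

Lemma smoothN f : smooth f -> smooth (fun x => - f x).
Proof.
by move=> sf; rewrite (_ : (fun x => _) = (fun x => -1 * f x)); [exact: smoothZ|apply/funext => x; rewrite mulN1r].
Qed.

Lemma smoothB f g : smooth f -> smooth g -> smooth (fun x => f x - g x).
Proof. by move=> sf sg; exact: smoothD sf (smoothN sg). Qed.

Lemma smooth_affine f (b c : R) : smooth f -> smooth (fun x => f (b * x + c)).
Proof. by move=> /smoothP cf; apply/smoothP => n; exact: Cn_affine. Qed.

Lemma near_eq_derive1 f g (x : R) : (\near x, f x = g x) -> \near x, f^`() x = g^`() x.
Proof.
move=> /near_join; apply: filterS => y fg; rewrite !derive1E.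
exact: near_eq_derive.
Qed.

Lemma near_eq_derive1n n f g (x : R) : (\near x, f x = g x) -> \near x, f^`(n) x = g^`(n) x.
Proof.
elim: n f g => [//|n IHn] f g fg; rewrite !derive1nSr; apply: IHn.
exact: near_eq_derive1.
Qed.

Lemma smooth_local f : (forall x : R, exists2 g, smooth g & \near x, g x = f x) -> smooth f.
Proof.
move=> h n x; have [g sg gf] := h x.
exact: near_eq_derivable (near_eq_derive1n n gf) (sg n x).
Qed.

End smooth_functions.

(** * Local form, bounds and slope of the coefficient *)

Section coefficient_properties.
Variables (R : realType) (chi : R -> R).
Hypothesis chi_smooth : smooth chi.
Hypothesis chi_bounds : forall x : R, 0 <= chi x <= 3.
Hypothesis chi_left : forall x : R, x <= 0 -> chi x = 0.
Hypothesis chi_right : forall x : R, 3 <= x -> chi x = 3.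
Hypothesis chi_mid : forall x : R, 1 <= x <= 2 -> chi x = x.

Lemma bump_term_left n (x : R) : x <= 16 * n%:R -> bump_term chi n x = 0.
Proof.
move=> xn; have n0 : 0 <= n%:R :> R by [].
rewrite /bump_term !chi_left ?subrr//.
  by rewrite mulr_ge0_le0// subr_le0 (le_trans xn)// lerDl.
by rewrite mulr_ge0_le0// subr_le0.
Qed.

Lemma bump_term_right n (x : R) : (0 < n)%N -> 16 * n%:R + 11 <= x -> bump_term chi n x = 0.
Proof.
move=> n0 xn; have n1 : 1 <= n%:R :> R by rewrite ler1n.
by rewrite /bump_term !chi_right ?subrr//; nra.
Qed.

Lemma bump_term_bounds n (x : R) : (0 < n)%N -> 0 <= bump_term chi n x <= 3.
Proof.
move=> n0; have n1 : 1 <= n%:R :> R by rewrite ler1n.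
rewrite /bump_term.
have /andP[h1 h2] := chi_bounds (n%:R * (x - 16 * n%:R)).
have /andP[h3 h4] := chi_bounds (n%:R * (x - (16 * n%:R + 8))).
have [hB|hB] := leP (n%:R * (x - (16 * n%:R + 8))) 0.
  by rewrite (chi_left hB) subr0 h1 h2.
by rewrite (chi_right (x := n%:R * (x - 16 * n%:R))); nra.
Qed.

(** The index 0 stands for the window without a bump, left of the first one. *)
Definition local_coeff m (x : R) : R := 1 + (if (0 < m)%N then bump_term chi m x else 0).

(** The n-th bump lives on [16 n, 16 n + 11], so the open window ]16 m - 5, 16 m + 16[ meets the
    m-th bump only. Consecutive windows overlap, hence the series is locally a single smooth
    term. *)
Lemma bump_partial_sumE m N (x : R) : (m < N)%N -> 16 * m%:R - 5 < x -> x < 16 * m%:R + 16 ->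
  bump_partial_sum chi x N = if (0 < m)%N then bump_term chi m x else 0.
Proof.
move=> mN x1 x2; rewrite /bump_partial_sum.
have zero i : (0 < i)%N -> i != m -> bump_term chi i x = 0.
  move=> i0; rewrite neq_ltn => /orP[im|mi].
    apply: bump_term_right => //.
    have : i%:R + 1 <= m%:R :> R by rewrite natr1 ler_nat.
    by move=> h; lra.
  apply: bump_term_left.
  have : m%:R + 1 <= i%:R :> R by rewrite natr1 ler_nat.
  by move=> h; lra.
case: ifPn => m0; last first.
  rewrite big_nat big1// => i /andP[i1 _]; apply: zero => //.
  by apply: contraNneq m0 => <-.
rewrite (big_cat_nat (n := m)) ?(ltnW mN)//= big_nat big1 ?add0r; last first.
  by move=> i /andP[i1 im]; apply: zero => //; rewrite ltn_eqF.
rewrite big_ltn//= big1_seq ?addr0// => i; rewrite mem_index_iota => /andP[_ /andP[mi _]].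
by apply: zero; [exact: ltn_trans mi|rewrite gtn_eqF].
Qed.

Lemma bump_partial_sum_cvg m (x : R) : 16 * m%:R - 5 < x -> x < 16 * m%:R + 16 ->
  bump_partial_sum chi x N @[N --> \oo] --> (if (0 < m)%N then bump_term chi m x else 0).
Proof.
move=> x1 x2; apply: cvg_near_cst; near=> N.
apply: bump_partial_sumE => //; near: N; exact: nbhs_infty_gt.
Unshelve. all: by end_near. Qed.

Lemma bump_partial_sum_left (x : R) : x < 16 -> bump_partial_sum chi x N @[N --> \oo] --> (0 : R).
Proof.
move=> x16; apply: cvg_near_cst; apply: nearW => N.
rewrite /bump_partial_sum big_nat big1// => i /andP[i1 _]; apply: bump_term_left.
have : 1 <= i%:R :> R by rewrite ler1n.
by move=> h; lra.
Qed.

Lemma coeffE m (x : R) : 16 * m%:R - 5 < x -> x < 16 * m%:R + 16 -> coeff chi x = local_coeff m x.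
Proof. by move=> x1 x2; rewrite /coeff (cvg_lim _ (bump_partial_sum_cvg x1 x2)). Qed.

Lemma coeff_left (x : R) : x < 16 -> coeff chi x = 1.
Proof. by move=> x16; rewrite /coeff (cvg_lim _ (bump_partial_sum_left x16)) ?addr0. Qed.

(** Up to 16 n + 8 the descending half of the bump has not started. *)
Lemma coeff_site n (x : R) : (0 < n)%N -> 16 * n%:R - 5 < x -> x <= 16 * n%:R + 8 ->
  coeff chi x = 1 + chi (n%:R * (x - 16 * n%:R)).
Proof.
move=> n0 x1 x2; rewrite (coeffE (m := n)) ?n0//; last by lra.
rewrite /local_coeff n0 /bump_term [X in _ - X]chi_left ?subr0//.
by rewrite mulr_ge0_le0// subr_le0.
Qed.

Lemma coeff_cover (x : R) : x < 16 \/ exists m, 16 * m%:R - 5 < x /\ x < 16 * m%:R + 16.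
Proof.
have [x16|x16] := ltP x 16; [by left|right].
have x0 : 0 <= x / 16 by rewrite divr_ge0// (le_trans _ x16).
exists (Num.truncn (x / 16)).
have /andP[h1 h2] := truncn_itv x0.
rewrite ler_pdivlMr// in h1; rewrite ltr_pdivrMr// in h2.
have h3 : (Num.truncn (x / 16)).+1%:R = (Num.truncn (x / 16))%:R + 1 :> R by rewrite natr1.
by rewrite h3 in h2; split; lra.
Qed.

Lemma bump_partial_sum_is_cvg (x : R) : cvgn (bump_partial_sum chi x).
Proof.
have [x16|[m [x1 x2]]] := coeff_cover x; apply/cvg_ex.
  by exists 0; exact: bump_partial_sum_left.
by eexists; exact: bump_partial_sum_cvg x1 x2.
Qed.

Lemma coeff_bounds (x : R) : 1 <= coeff chi x <= 4.
Proof.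
have [x16|[m [x1 x2]]] := coeff_cover x; first by rewrite coeff_left// lexx ler1n.
rewrite (coeffE x1 x2) /local_coeff; case: ifPn => [m0|_]; last by rewrite addr0 lexx ler1n.
by have /andP[h1 h2] := bump_term_bounds x m0; apply/andP; split; lra.
Qed.

Lemma smooth_local_coeff m : smooth (local_coeff m).
Proof.
apply: smoothD; first exact: smooth_cst.
case: (0 < m)%N; last exact: smooth_cst.
apply: smoothB.
  have := smooth_affine (b := m%:R) (c := - (m%:R * (16 * m%:R))) chi_smooth; congr smooth.
  by apply/funext => x; rewrite mulrBr.
have := smooth_affine (b := m%:R) (c := - (m%:R * (16 * m%:R + 8))) chi_smooth; congr smooth.
by apply/funext => x; rewrite mulrBr.
Qed.

Lemma smooth_coeff : smooth (coeff chi).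
Proof.
apply: smooth_local => x; have [x16|[m [x1 x2]]] := coeff_cover x.
  exists (fun=> 1); first exact: smooth_cst.
  near=> y; rewrite coeff_left//; near: y; exact: lt_nbhsl.
exists (local_coeff m); first exact: smooth_local_coeff.
near=> y; rewrite (coeffE (m := m))//; near: y; [exact: lt_nbhsr|exact: lt_nbhsl].
Unshelve. all: by end_near. Qed.

Lemma coeff_le4 (x y : R) : coeff chi y <= 4 * coeff chi x.
Proof.
by have /andP[h1 _] := coeff_bounds x; have /andP[_ h2] := coeff_bounds y; lra.
Qed.

(** There the argument of chi is 3/2, the middle of the interval on which chi is the identity. *)
Lemma coeff_slope n : (0 < n)%N -> (coeff chi)^`() (16 * n%:R + (3 / 2) / n%:R) = n%:R.
Proof.
move=> n0; set x := (X in _ X = _).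
have n1 : 1 <= n%:R :> R by rewrite ler1n.
have nn : n%:R != 0 :> R by rewrite pnatr_eq0 -lt0n.
have i0 : 0 < n%:R^-1 :> R by rewrite invr_gt0 ltr0n.
have i1 : n%:R^-1 <= 1 :> R by rewrite invf_le1// ltr0n.
have E : \near x, 1 + n%:R * (x - 16 * n%:R) = coeff chi x.
  near=> y.
  have y1 : 16 * n%:R + n%:R^-1 < y.
    by near: y; apply: lt_nbhsr; rewrite /x; lra.
  have y2 : y < 16 * n%:R + 2 * n%:R^-1.
    by near: y; apply: lt_nbhsl; rewrite /x; lra.
  rewrite (coeff_site (n := n))//; [|lra|lra]; rewrite chi_mid//; apply/andP; split.
    by rewrite -ler_pdivrMl ?ltr0n// mulr1; lra.
  by rewrite -ler_pdivlMl ?ltr0n// mulrC; lra.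
rewrite derive1E -(near_eq_derive _ E).
have d : is_derive x (1:R) (fun y => 1 + n%:R * (y - 16 * n%:R)) n%:R.
  have db : is_derive x (1:R) (fun y : R => y - 16 * n%:R) 1.
    by apply: (is_derive_congr (is_deriveB (is_derive_id x 1) (is_derive_cst _ x 1))); rewrite subr0.
  apply: (is_derive_congr (is_deriveD (is_derive_cst (1 : R) x 1) (is_derive_mul (is_derive_cst (n%:R : R) x 1) db))).
  by rewrite mulr1 mul0r addr0 add0r.
by case: d.
Unshelve. all: by end_near. Qed.

Lemma coeff_slope_unbounded :
  ereal_sup [set (derive1 (coeff chi) x)%:E | x in [set: R]] = +oo%E.
Proof.
set S := ereal_sup _.
have hS n : (0 < n)%N -> (n%:R%:E <= S)%E.
  move=> n0; apply: ereal_sup_ubound; exists (16 * n%:R + (3 / 2) / n%:R) => //.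
  by rewrite coeff_slope.
case: S hS => [r hS|//|hS]; last by have := hS 1%N isT.
have := hS (Num.truncn r).+1 isT; rewrite lee_fin leNgt.
by rewrite (lt_le_trans (truncnS_gt r)).
Qed.

End coefficient_properties.

(** * Straightening the vector field *)

Section straightening.
Variables (R : realType) (a : R -> R).
Hypothesis ca : continuous a.
Hypothesis a_bounds : forall x, 1 <= a x <= 4.
Hypothesis a_left : forall x, x < 1 -> a x = 1.
Local Notation mu := (@lebesgue_measure R).

Lemma a_gt0 x : 0 < a x.
Proof. by have /andP[h _] := a_bounds x; exact: lt_le_trans h. Qed.

Lemma continuous_inva : continuous (fun x => (a x)^-1).
Proof. by move=> x; apply: cvgV; [rewrite gt_eqF// a_gt0|exact: ca]. Qed.

Lemma inva_bounds x : 4^-1 <= (a x)^-1 <= 1.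
Proof.
have /andP[h1 h2] := a_bounds x; have a0 := a_gt0 x.
by rewrite lef_pV2 ?posrE// h2/= invf_le1.
Qed.

(** The base point -1 lies in the region a = 1: F x = x + 1 on [-1, 1[, and F - 1 is the integral
    from 0. *)
Let F x : R := \int[mu]_(s in `[-1, x]) (a s)^-1.

Let dF (x : R) : -1 < x -> is_derive x (1:R) F (a x)^-1.
Proof.
move=> x1; have xx : x < x + 1 by rewrite ltrDl.
have i : mu.-integrable `[-1, x + 1] (EFin \o (fun s => (a s)^-1)).
  apply: continuous_compact_integrable; first exact: segment_compact.
  exact: continuous_subspaceT continuous_inva.
have [h1 h2] := continuous_FTC1_closed xx i x1 (@continuous_inva x).
by split; [exact: h1|rewrite -derive1E; exact: h2].
Qed.

Let F_left (x : R) : -1 <= x -> x < 1 -> F x = x + 1.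
Proof.
move=> x1 x2; rewrite /F; transitivity (\int[mu]_(s in `[-1, x]) (1 : R)).
  apply: eq_Rintegral => s; rewrite inE/= in_itv/= => /andP[_ sx].
  by rewrite a_left ?invr1// (le_lt_trans sx).
rewrite Rintegral_cst//= lebesgue_measure_itv/= lte_fin mul1r.
case: ltP => [_|]; first by rewrite -EFinB opprK.
by move=> h; have -> : x = -1; [apply/eqP; rewrite eq_le x1 h|rewrite addNr].
Qed.

(* a = 1 to the left of 1, so the two formulas agree near 0. *)
Definition Phi x : R := if x < 0 then x else F x - 1.

Lemma is_derive_Phi x : is_derive x (1:R) Phi (a x)^-1.
Proof.
(* 1/2 is interior to [0, 1[, where both formulas for [Phi] agree, so each side of the split has a
   neighbourhood governed by one of them. *)
have [x0|x0] := ltP x (2^-1).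
  rewrite a_left ?invr1; last by apply: (lt_trans x0); rewrite invf_lt1 ?ltr1n.
  apply: near_eq_is_derive (is_derive_id x 1); near=> y; rewrite /Phi; case: ltP => // y0.
  rewrite F_left ?addrK//; first by rewrite (le_trans _ y0).
  by rewrite (@lt_trans _ _ 2^-1)// ?invf_lt1 ?ltr1n//; near: y; exact: lt_nbhsl.
have x1 : -1 < x by rewrite (lt_le_trans _ x0)// (@lt_trans _ _ 0)// ?ltrN10// invr_gt0.
have d := is_deriveB (dF x1) (is_derive_cst (1:R) x 1); rewrite subr0 in d.
apply: near_eq_is_derive d; near=> y; rewrite /Phi ifF//; apply/negbTE; rewrite -leNgt ltW//.
by near: y; apply: lt_nbhsr; rewrite (lt_le_trans _ x0)// invr_gt0.
Unshelve. all: by end_near. Qed.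

Lemma Phi0 : Phi 0 = 0.
Proof. by rewrite /Phi ltxx F_left ?ler0N1 ?ltr01 ?lerN10// add0r subrr. Qed.

Lemma continuous_Phi : continuous Phi.
Proof. exact: is_derive_cont is_derive_Phi. Qed.

Lemma Phi_MVT x y : x <= y -> 4^-1 * (y - x) <= Phi y - Phi x <= y - x.
Proof.
move=> xy; have [c _ ->] := MVT_segment xy (fun z _ => is_derive_Phi z)
  (continuous_subspaceT continuous_Phi).
have /andP[h1 h2] := inva_bounds c; have d0 : 0 <= y - x by rewrite subr_ge0.
by rewrite ler_wpM2r//= ler_piMl.
Qed.

Lemma Phi_dist x y : 4^-1 * `|x - y| <= `|Phi x - Phi y| <= `|x - y|.
Proof.
wlog xy : x y / y <= x => [h|].
  by have [/h//|/ltW /h] := leP y x; rewrite !(distrC y) (distrC (Phi y)).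
have /andP[h1 h2] := Phi_MVT xy.
rewrite ger0_norm ?subr_ge0// ger0_norm ?h1//.
by rewrite (le_trans _ h1)// mulr_ge0// subr_ge0.
Qed.

Lemma Phi_inj : injective Phi.
Proof.
move=> x y xy; have /andP[h _] := Phi_dist x y.
move: h; rewrite xy subrr normr0 pmulr_rle0// normr_le0 subr_eq0.
by move/eqP.
Qed.

Lemma Phi_surj u : exists x, Phi x = u.
Proof.
(* The slope is at least 1/4, so [Phi] reaches |u| at M and - |u| at - M. *)
pose M := 4 * `|u|; have M0 : 0 <= M by rewrite mulr_ge0.
have NM : - M <= M by rewrite (le_trans _ M0)// oppr_le0.
have /andP[h1 _] := Phi_MVT M0; have /andP[h2 _] : 4^-1 * (0 - - M) <= Phi 0 - Phi (- M) <= 0 - - M.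
  by apply: Phi_MVT; rewrite oppr_le0.
rewrite Phi0 !subr0 in h1; rewrite Phi0 !sub0r opprK in h2.
have e : 4^-1 * M = `|u| by rewrite /M mulrA mulVf ?mul1r// pnatr_eq0.
rewrite e in h1 h2; have n1 := ler_norm u; have n2 := ler_norm (- u); rewrite normrN in n2.
have uM : Num.min (Phi (- M)) (Phi M) <= u <= Num.max (Phi (- M)) (Phi M).
  by rewrite ge_min le_max; apply/andP; split; apply/orP; [left|right]; lra.
by have [c _ <-] := IVT NM (continuous_subspaceT continuous_Phi) uM; exists c.
Qed.

Definition Psi u : R := xget 0 [set x | Phi x = u].

Lemma PsiK u : Phi (Psi u) = u.
Proof. by have [x xu] := Phi_surj u; exact: (@xgetPex _ _ [set x | Phi x = u] (ex_intro _ x xu)). Qed.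

Lemma PhiK x : Psi (Phi x) = x.
Proof. by apply: Phi_inj; rewrite PsiK. Qed.

Lemma Phi_le x y : (Phi x <= Phi y) = (x <= y).
Proof.
have [xy|yx] := leP x y.
  have /andP[h _] := Phi_MVT xy; rewrite -subr_ge0 (le_trans _ h)// mulr_ge0// subr_ge0//.
apply/negbTE; rewrite -ltNge; have /andP[h _] := Phi_MVT (ltW yx).
by rewrite -subr_gt0 (lt_le_trans _ h)// mulr_gt0 ?invr_gt0// subr_gt0.
Qed.

Lemma Psi_le u v : (Psi u <= Psi v) = (u <= v).
Proof. by rewrite -Phi_le !PsiK. Qed.

Lemma Psi_lt u v : (Psi u < Psi v) = (u < v).
Proof. by rewrite !ltNge Psi_le. Qed.

Lemma is_derive_Psi u : is_derive u (1:R) Psi (a (Psi u)).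
Proof.
rewrite -{1}(PsiK u) -[a _]invrK; apply: is_derive_inverse.
- by near=> x; exact: PhiK.
- by near=> x; exact: continuous_Phi.
- exact: is_derive_Phi.
- by rewrite invr_eq0 gt_eqF// a_gt0.
Unshelve. all: by end_near. Qed.

Lemma continuous_Psi : continuous Psi.
Proof. exact: is_derive_cont is_derive_Psi. Qed.

Lemma measurable_Phi : measurable_fun setT Phi.
Proof. exact: continuous_measurable_fun continuous_Phi. Qed.

Lemma measurable_Psi : measurable_fun setT Psi.
Proof. exact: continuous_measurable_fun continuous_Psi. Qed.

Lemma integral_inva x y : x <= y ->
  (\int[mu]_(z in `[x, y]) ((a z)^-1)%:E = (Phi y - Phi x)%:E)%E.
Proof.
rewrite le_eqVlt => /predU1P[<-|xy]; first by rewrite subrr set_itv1 integral_set1.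
rewrite (continuous_FTC2 (F := Phi) xy).
- by rewrite EFinB.
- exact: continuous_subspaceT continuous_inva.
- split.
  + by move=> z _; case: (is_derive_Phi z).
  + by apply: cvg_at_right_filter; exact: continuous_Phi.
  + by apply: cvg_at_left_filter; exact: continuous_Phi.
- by move=> z _; rewrite derive1E; case: (is_derive_Phi z).
Qed.

Lemma dist_bounds x y : 4^-1 * `|x - y| <= dist a x y <= `|x - y|.
Proof.
have -> : dist a x y = `|Phi x - Phi y|; last exact: Phi_dist.
rewrite /dist; case: leP => [xy|/ltW yx]; rewrite /Rintegral integral_inva//=.
  by rewrite distrC.
by rewrite normrN.
Qed.

Lemma cov_Phi : is_cov Phi (fun x => (a x)^-1).
Proof.
have mw : measurable_fun setT (fun x : R => (a x)^-1).
  exact: continuous_measurable_fun continuous_inva.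
split => //; first exact: measurable_Phi.
  by move=> x; rewrite invr_gt0 a_gt0.
apply: ge0_change_of_variables => //; first exact: measurable_Phi.
  by move=> x; rewrite invr_ge0 ltW// a_gt0.
move=> c d cd; rewrite /weighted_pushforward.
have -> : Phi @^-1` `]c, d] = `]Psi c, Psi d].
  apply/seteqP; split => x /=; rewrite !in_itv/=.
    by rewrite -Psi_lt -Psi_le PhiK.
  by rewrite -(PhiK x) Psi_lt Psi_le PsiK.
rewrite integral_itv_obnd_cbnd; last first.
  by apply/measurable_EFinP; exact: measurable_funTS.
by rewrite integral_inva ?Psi_le// !PsiK.
Qed.

Lemma Psi_integral_curve x0 : integral_curve a setT x0 (fun t => Psi (Phi x0 + t)).
Proof.
split; first by rewrite addr0 PhiK.
move=> t _; have d := is_derive_Psi (Phi x0 + t).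
apply: (is_derive_congr (is_derive1_comp (g := fun y => Phi x0 + y) d (is_derive_addl t (Phi x0)))).
by rewrite mulr1.
Qed.

(* Phi is constant speed along integral curves. *)
Lemma integral_curve_unique (I : set R) x0 g : is_interval I -> I 0 ->
  integral_curve a I x0 g -> forall t, I t -> g t = Psi (Phi x0 + t).
Proof.
move=> itvI I0 [g0 dg] t It.
have dh s : I s -> is_derive s (1:R) (fun y => Phi (g y)) 1.
  move=> Is; apply: (is_derive_congr (is_derive1_comp (is_derive_Phi (g s)) (dg s Is))).
  by rewrite mulVf// gt_eqF// a_gt0.
have key (x y : R) : I x -> I y -> x <= y -> Phi (g y) - Phi (g x) = y - x.
  move=> Ix Iy xy.
  have dxy z : z \in `[x, y]%R -> is_derive z (1:R) (fun y => Phi (g y)) 1.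
    by rewrite in_itv/= => zxy; apply: dh; exact: itvI zxy.
  have dxy' z : z \in `]x, y[%R -> is_derive z (1:R) (fun y => Phi (g y)) 1.
    by rewrite in_itv/= => /andP[h1 h2]; apply: dxy; rewrite in_itv/= !ltW.
  have cxy : {within `[x, y], continuous (fun y => Phi (g y))}.
    by apply: derivable_within_continuous => z zxy; case: (dxy z zxy).
  by have [c _ ->] := MVT_segment xy dxy' cxy; rewrite mul1r.
rewrite -[g t]PhiK; congr Psi; rewrite -g0.
have [t0|/ltW t0] := leP 0 t.
  by have := key _ _ I0 It t0; rewrite subr0 => /(canRL (subrK _)) ->; rewrite addrC.
have := key _ _ It I0 t0; rewrite sub0r => h.
by apply/eqP; rewrite -subr_eq0 opprD addrA -(opprB (Phi (g 0))) h opprK subrr.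
Qed.

(** The choice made in [flow] is some integral curve, since an explicit one exists; uniqueness
    identifies it. *)
Lemma flowE t x : flow a t x = Psi (Phi x + t).
Proof.
have [h0 h] : integral_curve a setT x (xget (fun=> 0) [set g | integral_curve a setT x g]).
  exact: (@xgetPex _ _ [set g | integral_curve a setT x g] (ex_intro _ _ (Psi_integral_curve x))).
by rewrite /flow; apply: (integral_curve_unique (I := setT)).
Qed.

Lemma coeff_flow_well_defined : flow_well_defined a.
Proof.
move=> x0; split.
  rewrite (_ : flow a ^~ x0 = (fun t => Psi (Phi x0 + t))); first exact: Psi_integral_curve.
  by apply/funext => t; rewrite flowE.
by move=> I g itvI _ I0 cg t It; rewrite flowE; exact: integral_curve_unique cg t It.
Qed.

End straightening.

(** * Bounded operators on L_p and their extensions *)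

Section Lp_operators.
Variable R : realType.
Local Notation C := R[i].
Local Notation mu := (@lebesgue_measure R).
Local Notation op := ((R -> C) -> (R -> C)).
Implicit Types (f g : R -> C) (U V : op) (q : \bar R) (p : R).

Lemma bounded_opB q V f g : (1 <= q)%E -> bounded_op q V -> Lp q f -> Lp q g ->
  \forall x \ae mu, V (fun y => f y - g y) x = V f x - V g x.
Proof.
move=> q1 [_ Vlin _] lf lg; have lfg := LpB q1 lf lg.
have /ae_eqP := Vlin 1 _ _ lfg lg.
rewrite (_ : (fun x => 1 * (f x - g x) + g x) = f); last first.
  by apply/funext => x; rewrite mul1r subrK.
by apply: aeS => x ->; rewrite mul1r addrK.
Qed.

Lemma bounded_op_ae q V f g : (1 <= q)%E -> bounded_op q V -> Lp q f -> Lp q g ->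
  (\forall x \ae mu, f x = g x) -> \forall x \ae mu, V f x = V g x.
Proof.
move=> q1 bV lf lg fg; have [VL _ [M VM]] := bV; have lfg := LpB q1 lf lg.
have n0 : Lpnorm q (fun y => f y - g y) = 0%E.
  rewrite -(@Lpnorm_0 R q q1); apply: ae_eq_Lpnorm => //; first exact: Lp_measurable lfg.
  by apply: aeS fg => x ->; rewrite subrr.
have V0 : Lpnorm q (V (fun y => f y - g y)) = 0%E.
  apply/eqP; rewrite eq_le Lpnorm_ge0 andbT.
  by apply: (le_trans (VM _ lfg)); rewrite n0 mule0.
have lV := VL _ lfg.
apply: aeS2 (Lpnorm_eq0 q1 (Lp_measurable lV) V0) (bounded_opB q1 bV lf lg) => x -> /esym/eqP.
by rewrite subr_eq0 => /eqP.
Qed.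

(** Bounded functions are dense in L_p for finite p, and both extensions are bounded. Thus the
    choice made in [Lp_extension] is immaterial almost everywhere. *)
Lemma Lp_extension_unique p U V V' : 1 <= p -> is_Lp_extension p%:E U V ->
  is_Lp_extension p%:E U V' -> forall f, Lp p%:E f -> \forall x \ae mu, V f x = V' f x.
Proof.
move=> p1 [bV VU] [bV' V'U] f lf; have q1 : (1 <= p%:E)%E by rewrite lee_fin.
have [VL _ [M VM]] := bV; have [VL' _ [M' VM']] := bV'.
have lVf := VL _ lf; have lVf' := VL' _ lf.
have mV := Lp_measurable lVf; have mV' := Lp_measurable lVf'.
suff n0 : Lpnorm p%:E (fun x => V f x - V' f x) = 0%E.
  apply: aeS (Lpnorm_eq0 q1 (cmfB mV mV') n0) => x /eqP.
  by rewrite subr_eq0 => /eqP.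
apply/eqP; rewrite eq_le Lpnorm_ge0 andbT; apply/lee_addgt0Pr => e e0; rewrite add0e.
have K0 : 0 < `|M| + `|M'| + 1 by rewrite ltr_wpDl// addr_ge0.
have d0 : 0 < e / (`|M| + `|M'| + 1) by rewrite divr_gt0.
have [g [lg lgy fg]] := Lp_bounded_dense p1 lf d0.
have lfg := LpB q1 lf lg.
have /ae_eqP eU := VU g lg lgy; have /ae_eqP eU' := V'U g lg lgy.
have E : \forall x \ae mu, V f x - V' f x =
    V (fun y => f y - g y) x - V' (fun y => f y - g y) x.
  have cj (P Q : R -> Prop) := @aeS2 _ _ R mu P Q (fun u => P u /\ Q u) (fun u a b => conj a b).
  apply: aeS2 (cj _ _ (bounded_opB q1 bV lf lg) (bounded_opB q1 bV' lf lg)) (cj _ _ eU eU').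
  by move=> x [-> ->] [-> ->]; ring.
have lV1 := VL _ lfg; have lV2 := VL' _ lfg.
rewrite (ae_eq_Lpnorm q1 (cmfB mV mV') (cmfB (Lp_measurable lV1) (Lp_measurable lV2)) E).
apply: (le_trans (Lpnorm_dist q1 (Lp_measurable lV1) (Lp_measurable lV2))).
have nfin : Lpnorm p%:E (fun y => f y - g y) \is a fin_num.
  by case: lfg => _ ?; rewrite ge0_fin_numE// Lpnorm_ge0.
have := VM _ lfg; have := VM' _ lfg; have := fg.
have n0 : 0 <= fine (Lpnorm p%:E (fun y => f y - g y)) by rewrite fine_ge0// Lpnorm_ge0.
rewrite -(fineK nfin); move: (fine _) n0 => n n0.
rewrite lee_fin ler_pdivlMr// => h1 h2 h3; apply: (le_trans (leeD h3 h2)).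
rewrite -!EFinM -EFinD lee_fin (le_trans _ h1)// -mulrDl mulrC ler_wpM2l//.
by rewrite -[leLHS]addr0 lerD ?lerD ?ler_norm.
Qed.

Lemma Lp_extensionP p U V : is_Lp_extension p%:E U V ->
  is_Lp_extension p%:E U (Lp_extension p%:E U).
Proof.
by move=> h; exact: (@xgetPex _ _ [set V | is_Lp_extension p%:E U V] (ex_intro _ V h)).
Qed.

Lemma opnorm_le q V (M : R) : 0 <= M ->
  (forall f, Lp q f -> (Lpnorm q (V f) <= M%:E * Lpnorm q f)%E) -> (opnorm q V <= M%:E)%E.
Proof.
move=> M0 VM; apply: ge_ereal_sup => _ [f [lf f1] <-].
apply: (le_trans (VM _ lf)); rewrite -[leRHS]mule1.
by apply: lee_pmul; rewrite ?lee_fin// Lpnorm_ge0.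
Qed.

End Lp_operators.

(** * Transfer along the change of coordinates *)

Section transfer.
Variables (R : realType) (a Phi Psi : R -> R).
Local Notation C := R[i].
Local Notation mu := (@lebesgue_measure R).
Local Notation op := ((R -> C) -> (R -> C)).
Hypothesis ma : measurable_fun setT a.
Hypothesis a_bounds : forall x, 1 <= a x <= 4.
Hypothesis PhiK : cancel Phi Psi.
Hypothesis PsiK : cancel Psi Phi.
Hypothesis mPsi : measurable_fun setT Psi.
Hypothesis cPhi : is_cov Phi (fun x => (a x)^-1).
Implicit Types (f g h psi : R -> C) (U V : op) (q : \bar R) (p : R).

Let mPhi : measurable_fun setT Phi. Proof. by case: cPhi. Qed.

Let a0 x : 0 < a x.
Proof. by have /andP[h _] := a_bounds x; exact: lt_le_trans h. Qed.

Let aV x : 4^-1 <= (a x)^-1 <= 1.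
Proof.
by have /andP[h1 h2] := a_bounds x; rewrite lef_pV2 ?posrE// h2/= invf_le1.
Qed.

Lemma cov_Psi : is_cov Psi (fun u => a (Psi u)).
Proof.
have [_ _ w0 cv] := cPhi; split => //; first exact: (measurableT_comp ma mPsi).
move=> f mf f0.
have mF : measurable_fun setT (fun u => f (Psi u) * (a (Psi u))%:E)%E.
  apply: emeasurable_funM; first exact: (measurableT_comp mf mPsi).
  by apply/measurable_EFinP; exact: (measurableT_comp ma mPsi).
rewrite -cv//; last by move=> u; rewrite mule_ge0// lee_fin ltW.
apply: eq_integral => x _; rewrite PhiK -muleA -EFinM mulfV ?mule1//.
by rewrite gt_eqF.
Qed.

Definition pull f (u : R) : C := f (Psi u).
Definition push f (x : R) : C := f (Phi x).
Definition lift U : op := fun f => push (U (pull f)).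

Lemma pushK f : pull (push f) = f.
Proof. by apply/funext => u; rewrite /pull /push PsiK. Qed.

Lemma pullK f : push (pull f) = f.
Proof. by apply/funext => u; rewrite /pull /push PhiK. Qed.

Lemma ae_push (P : R -> Prop) : (\forall u \ae mu, P u) -> \forall x \ae mu, P (Phi x).
Proof. exact: (ae_cov cPhi). Qed.

Lemma ae_pull (P : R -> Prop) : (\forall x \ae mu, P x) -> \forall u \ae mu, P (Psi u).
Proof. exact: (ae_cov cov_Psi). Qed.

Lemma measurable_pull f : cmeasurable f -> cmeasurable (pull f).
Proof. exact: cmf_comp. Qed.

Lemma measurable_push f : cmeasurable f -> cmeasurable (push f).
Proof. exact: cmf_comp. Qed.

Lemma Npow_pull p f : cmeasurable f ->
  Npow p (pull f) = (\int[mu]_x ((normc (f x) `^ p)%:E * ((a x)^-1)%:E))%E.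
Proof.
move=> mf; have [_ _ _ cv] := cPhi; rewrite /Npow -cv.
- by apply: eq_integral => x _; rewrite /pull PhiK.
- exact: measurable_powc (measurable_pull mf).
- by move=> u; rewrite lee_fin powR_ge0.
Qed.

Let mw : measurable_fun setT (fun x => ((a x)^-1)%:E : \bar R).
Proof. by apply/measurable_EFinP; case: cPhi. Qed.

Lemma Npow_pull_le p f : cmeasurable f -> (Npow p (pull f) <= Npow p f)%E.
Proof.
move=> mf; rewrite Npow_pull//; apply: ge0_le_integral => //.
- by move=> x _; rewrite mule_ge0 ?lee_fin ?powR_ge0// invr_ge0 ltW.
- by apply: emeasurable_funM => //; exact: measurable_powc.
- exact: measurable_powc.
- move=> x _; rewrite -EFinM lee_fin ler_piMr ?powR_ge0//.
  by have /andP[] := aV x.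
Qed.

Lemma Npow_le_pull p f : cmeasurable f -> (Npow p f <= 4%:E * Npow p (pull f))%E.
Proof.
move=> mf; rewrite Npow_pull//.
have mP : measurable_fun setT (fun x => ((normc (f x) `^ p)%:E * ((a x)^-1)%:E)%E).
  by apply: emeasurable_funM => //; exact: measurable_powc.
rewrite -(ge0_intZl _ mP)//; last first.
  by move=> x; rewrite mule_ge0 ?lee_fin ?powR_ge0// invr_ge0 ltW.
apply: ge0_le_integral => //.
- by move=> x _; rewrite lee_fin powR_ge0.
- exact: measurable_powc.
- by apply: emeasurable_funM.
- move=> x _; rewrite -!EFinM lee_fin mulrCA ler_peMr ?powR_ge0//.
  by have /andP[h _] := aV x; rewrite -ler_pdivrMl ?mulr1.
Qed.

Lemma Lpnorm_pull_le q f : (1 <= q)%E -> cmeasurable f -> (Lpnorm q (pull f) <= Lpnorm q f)%E.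
Proof.
case: q => [p p1 mf|_ mf|//].
- rewrite !Lpnorm_Npow; apply: poweR_mono; [|exact: Npow_ge0|exact: Npow_pull_le].
  by rewrite invr_ge0 (le_trans ler01).
- have [->|] := eqVneq (Lpnorm +oo%E f) +oo%E; first exact: leey.
  move=> fn; have ffin : Lpnorm +oo%E f \is a fin_num.
    by rewrite ge0_fin_numE ?Lpnorm_ge0// lt_neqAle fn leey.
  rewrite -(fineK ffin); apply/LpnormyP; apply: (ae_pull (P := fun x => normc (f x) <= _)).
  by apply/LpnormyP; rewrite fineK.
Qed.

Lemma Lpnorm_le_pullp p f : 1 <= p -> cmeasurable f ->
  (Lpnorm p%:E f <= (4 `^ p^-1)%:E * Lpnorm p%:E (pull f))%E.
Proof.
move=> p1 mf; have pV : 0 <= p^-1 by rewrite invr_ge0 (le_trans ler01).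
rewrite !Lpnorm_Npow -poweR_EFin -poweRM//; last exact: Npow_ge0.
by apply: poweR_mono; [|exact: Npow_ge0|exact: Npow_le_pull].
Qed.

Lemma powR4_le p : 1 <= p -> 4 `^ p^-1 <= 4 :> R.
Proof.
by move=> p1; rewrite -[leRHS]powRr1// ler_powR ?ler1n// invf_le1// (lt_le_trans ltr01).
Qed.

Lemma Lpnorm_le_pull q f : (1 <= q)%E -> cmeasurable f ->
  (Lpnorm q f <= 4%:E * Lpnorm q (pull f))%E.
Proof.
case: q => [p p1 mf|_ mf|//].
- apply: (le_trans (Lpnorm_le_pullp p1 mf)); apply: lee_pmul; rewrite ?lee_fin ?powR_ge0 ?Lpnorm_ge0//.
  exact: powR4_le.
- have [->|] := eqVneq (Lpnorm +oo%E (pull f)) +oo%E.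
    by rewrite mulry gtr0_sg// mul1e leey.
  move=> fn; have ffin : Lpnorm +oo%E (pull f) \is a fin_num.
    by rewrite ge0_fin_numE ?Lpnorm_ge0// lt_neqAle fn leey.
  apply: (@le_trans _ _ (Lpnorm +oo%E (pull f))).
    have h : \forall u \ae mu, normc (pull f u) <= fine (Lpnorm +oo%E (pull f)).
      by apply/LpnormyP; rewrite fineK.
    rewrite -(fineK ffin); apply/LpnormyP; apply: aeS (ae_push h) => x.
    by rewrite /pull PhiK.
  rewrite -[leLHS]mul1e; apply: lee_pmul => //; first exact: Lpnorm_ge0.
  by rewrite lee_fin ler1n.
Qed.

Lemma Lp_pull q f : (1 <= q)%E -> Lp q f -> Lp q (pull f).
Proof.
move=> q1 [mf nf]; split; first exact: measurable_pull.
exact: le_lt_trans (Lpnorm_pull_le q1 mf) nf.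
Qed.

Lemma Lp_push q f : (1 <= q)%E -> Lp q f -> Lp q (push f).
Proof.
move=> q1 [mf nf]; have mpf := measurable_push mf; split => //.
apply: (le_lt_trans (Lpnorm_le_pull q1 mpf)); rewrite pushK.
by rewrite lte_mul_pinfty// lee_fin.
Qed.

Lemma lift_norm p U (M : R) f : 1 <= p -> 0 <= M ->
  (forall F, Lp p%:E F -> Lp p%:E (U F) /\ (Lpnorm p%:E (U F) <= M%:E * Lpnorm p%:E F)%E) ->
  Lp p%:E f -> (Lpnorm p%:E (lift U f) <= (4 `^ p^-1 * M)%:E * Lpnorm p%:E f)%E.
Proof.
move=> p1 M0 UM lf; have q1 : (1 <= p%:E)%E by rewrite lee_fin.
have [lU hU] := UM _ (Lp_pull q1 lf); have mf := Lp_measurable lf.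
apply: (le_trans (Lpnorm_le_pullp p1 (measurable_push (Lp_measurable lU)))).
rewrite pushK EFinM -muleA; apply: lee_pmul; rewrite ?lee_fin ?powR_ge0 ?Lpnorm_ge0//.
apply: (le_trans hU); apply: lee_pmul; rewrite ?lee_fin ?Lpnorm_ge0//.
exact: Lpnorm_pull_le.
Qed.

Lemma lift_bounded q U : (1 <= q)%E -> bounded_op q U -> bounded_op q (lift U).
Proof.
move=> q1 [UL Ulin [M UM]]; split.
- by move=> f lf; apply: Lp_push => //; apply: UL; exact: Lp_pull.
- move=> c f g lf lg; apply/ae_eqP.
  have /ae_eqP h := Ulin c _ _ (Lp_pull q1 lf) (Lp_pull q1 lg).
  exact: (ae_push h).
- exists (4 * `|M|) => f lf; have lp := Lp_pull q1 lf; have lU := UL _ lp.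
  apply: (le_trans (Lpnorm_le_pull q1 (measurable_push (Lp_measurable lU)))).
  rewrite pushK EFinM -muleA; apply: lee_pmul => //; first exact: Lpnorm_ge0.
  apply: (le_trans (UM _ lp)); apply: (@le_trans _ _ (`|M|%:E * Lpnorm q (pull f))%E).
    by apply: lee_wpmul2r; rewrite ?Lpnorm_ge0// lee_fin ler_norm.
  apply: lee_pmul => //; first exact: Lpnorm_ge0.
  by apply: Lpnorm_pull_le => //; exact: Lp_measurable lf.
Qed.

Let cvg_dom (T : Type) (F : set_system T) (FF : Filter F) (u v : T -> \bar R) :
  (forall x, (0 <= u x)%E) -> (forall x, (0 <= v x)%E) ->
  (\forall x \near F, (u x <= 4%:E * v x)%E) -> v @ F --> 0%E -> u @ F --> 0%E.
Proof.
move=> u0 v0 uv hv; apply/(cvge0P u0) => e e0.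
have e4 : 0 < e / 4 by rewrite divr_gt0.
have h := (cvge0P v0).1 hv _ e4.
near=> x; apply: (@le_trans _ _ (4%:E * v x)%E); first by near: x.
apply: (@le_trans _ _ (4%:E * (e / 4)%:E)%E).
  by apply: lee_pmul => //; near: x; exact: h.
by rewrite -EFinM mulrC divfK// pnatr_eq0.
Unshelve. all: by end_near. Qed.

(** V is an arbitrary choice of extension, equal to the lifted operator only almost everywhere for
    each f; composing V s with V t therefore uses that bounded operators respect almost everywhere
    equality. *)
Lemma transfer_C0_semigroup p (U V : R -> op) : 1 <= p ->
  (forall t, 0 < t -> bounded_op p%:E (V t)) ->
  (forall t, 0 < t -> forall f, Lp p%:E f -> \forall x \ae mu, V t f x = lift (U t) f x) ->
  C0_semigroup p%:E U -> C0_semigroup p%:E V.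
Proof.
move=> p1 bV VU [bU sU cU iU]; have q1 : (1 <= p%:E)%E by rewrite lee_fin.
have lV t f : 0 < t -> Lp p%:E f -> Lp p%:E (V t f).
  by move=> t0 lf; have [h _ _] := bV t t0; exact: h.
have lU t f : 0 < t -> Lp p%:E f -> Lp p%:E (lift (U t) f).
  by move=> t0 lf; have [h _ _] := lift_bounded q1 (bU t t0); exact: h.
split => //.
- move=> s t f s0 t0 lf; apply/ae_eqP; have st0 : 0 < s + t by rewrite addr_gt0.
  have lUt := lU _ _ t0 lf; have lVt := lV _ _ t0 lf.
  have h1 := VU _ st0 _ lf.
  have h2 := bounded_op_ae q1 (bV s s0) lVt lUt (VU _ t0 _ lf).
  have h3 := VU _ s0 _ lUt.
  have /ae_eqP h4' := sU s t (pull f) s0 t0 (Lp_pull q1 lf).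
  have h4 := ae_push h4'.
  apply: aeS2 (aeS2 (fun x a b => conj a b) h1 h2) (aeS2 (fun x a b => conj a b) h3 h4).
  by move=> x [-> ->] [-> ]; rewrite /lift pushK /push => ->.
- move=> f lf t0 t00; have lp := Lp_pull q1 lf.
  apply: (@cvg_dom _ _ (nbhs_filter t0) _ _ _ _ _ (cU _ lp _ t00)) => [t|t|]; [exact: Lpnorm_ge0|exact: Lpnorm_ge0|].
  near=> t; have t1 : 0 < t by near: t; exact: lt_nbhsr.
  have m1 := Lp_measurable (lV _ _ t1 lf); have m2 := Lp_measurable (lV _ _ t00 lf).
  have m3 := Lp_measurable (lU _ _ t1 lf); have m4 := Lp_measurable (lU _ _ t00 lf).
  rewrite (ae_eq_Lpnorm q1 (cmfB m1 m2) (cmfB m3 m4)); last first.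
    by apply: aeS2 (VU _ t1 _ lf) (VU _ t00 _ lf) => x -> ->.
  apply: (le_trans (Lpnorm_le_pull q1 (cmfB m3 m4))).
  rewrite (_ : pull _ = (fun u => U t (pull f) u - U t0 (pull f) u))//.
  by apply/funext => u; rewrite /pull /lift /push PsiK.
- move=> f lf; have lp := Lp_pull q1 lf.
  apply: (@cvg_dom _ (0^'+) _ _ _ _ _ _ (iU _ lp)) => [t|t|]; [exact: Lpnorm_ge0|exact: Lpnorm_ge0|].
  apply: near_gt0_at_right => t t1; have mf := Lp_measurable lf.
  have m1 := Lp_measurable (lV _ _ t1 lf); have m3 := Lp_measurable (lU _ _ t1 lf).
  rewrite (ae_eq_Lpnorm q1 (cmfB m1 mf) (cmfB m3 mf)); last first.
    by apply: aeS (VU _ t1 _ lf) => x ->.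
  apply: (le_trans (Lpnorm_le_pull q1 (cmfB m3 mf))).
  rewrite (_ : pull _ = (fun u => U t (pull f) u - pull f u))//.
  by apply/funext => u; rewrite /pull /lift /push PsiK.
Unshelve. all: by end_near. Qed.

Lemma transfer_C0_group p (U V : R -> op) : 1 <= p ->
  (forall t, bounded_op p%:E (V t)) ->
  (forall t f, Lp p%:E f -> \forall x \ae mu, V t f x = lift (U t) f x) ->
  C0_group p%:E U -> C0_group p%:E V.
Proof.
move=> p1 bV VU [bU iU sU cU]; have q1 : (1 <= p%:E)%E by rewrite lee_fin.
have lV t f : Lp p%:E f -> Lp p%:E (V t f).
  by move=> lf; have [h _ _] := bV t; exact: h.
have lU t f : Lp p%:E f -> Lp p%:E (lift (U t) f).
  by move=> lf; have [h _ _] := lift_bounded q1 (bU t); exact: h.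
split => //.
- move=> f lf; apply/ae_eqP; have /ae_eqP h' := iU _ (Lp_pull q1 lf).
  by apply: aeS2 (VU 0 f lf) (ae_push h') => x ->; rewrite /lift /push => ->; rewrite /pull PhiK.
- move=> s t f lf; apply/ae_eqP.
  have lUt := lU t _ lf; have lVt := lV t _ lf.
  have h1 := VU (s + t) _ lf.
  have h2 := bounded_op_ae q1 (bV s) lVt lUt (VU t _ lf).
  have h3 := VU s _ lUt.
  have /ae_eqP h4' := sU s t (pull f) (Lp_pull q1 lf).
  have h4 := ae_push h4'.
  apply: aeS2 (aeS2 (fun x a b => conj a b) h1 h2) (aeS2 (fun x a b => conj a b) h3 h4).
  by move=> x [-> ->] [-> ]; rewrite /lift pushK /push => ->.
- move=> f lf t0; have lp := Lp_pull q1 lf.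
  apply: (@cvg_dom _ _ (nbhs_filter t0) _ _ _ _ _ (cU _ lp t0)) => [t|t|]; [exact: Lpnorm_ge0|exact: Lpnorm_ge0|].
  apply: nearW => t.
  have m1 := Lp_measurable (lV t _ lf); have m2 := Lp_measurable (lV t0 _ lf).
  have m3 := Lp_measurable (lU t _ lf); have m4 := Lp_measurable (lU t0 _ lf).
  rewrite (ae_eq_Lpnorm q1 (cmfB m1 m2) (cmfB m3 m4)); last first.
    by apply: aeS2 (VU t _ lf) (VU t0 _ lf) => x -> ->.
  apply: (le_trans (Lpnorm_le_pull q1 (cmfB m3 m4))).
  rewrite (_ : pull _ = (fun u => U t (pull f) u - U t0 (pull f) u))//.
  by apply/funext => u; rewrite /pull /lift /push PsiK.
Unshelve. all: by end_near. Qed.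

(* The weight a compensates the Jacobian of Psi. *)
Definition pulla psi (u : R) : C := (a (Psi u))%:C * psi (Psi u).

Lemma cintegrable_pulla psi : cintegrable psi -> cintegrable (pulla psi).
Proof.
by move=> ip; apply/(cintegrable_cov cov_Psi) => //; exact: cintegrable_measurable ip.
Qed.

Lemma dual_pairing_pull f psi : cmeasurable f -> cmeasurable psi ->
  dual_pairing f psi = dual_pairing (pull f) (pulla psi).
Proof.
move=> mf mp; rewrite /dual_pairing -(cint_cov cov_Psi (cmfM mf mp)).
by congr cint; apply/funext => u; rewrite /pull /pulla; ring.
Qed.

Definition pusha psi (x : R) : C := ((a x)^-1)%:C * psi (Phi x).

Lemma cintegrable_pusha psi : cintegrable psi -> cintegrable (pusha psi).
Proof.
by move=> ip; apply/(cintegrable_cov cPhi) => //; exact: cintegrable_measurable ip.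
Qed.

Lemma pulla_pusha psi : pulla (pusha psi) = psi.
Proof.
by apply/funext => u; rewrite /pulla /pusha PsiK mulrA -RCM mulfV ?gt_eqF// mul1r.
Qed.

(* U and V are the semigroups on the two sides of the change of variables. *)
Lemma transfer_generator q (U V : R -> op) f h : (1 <= q)%E ->
  (forall t, 0 < t -> bounded_op q (U t)) ->
  (forall t, 0 < t -> forall f, Lp q f -> Lp q (V t f)) ->
  (forall t, 0 < t -> forall f, Lp q f -> \forall x \ae mu, V t f x = lift (U t) f x) ->
  generator q V f h <-> generator q U (pull f) (pull h).
Proof.
move=> q1 bU LV VU.
have LU t f' : 0 < t -> Lp q f' -> Lp q (U t f').
  by move=> t0 lf; have [h' _ _] := bU t t0; exact: h'.
have Lf : Lp q f <-> Lp q (pull f).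
  by split => [|l]; [exact: Lp_pull|rewrite -(pullK f); exact: Lp_push].
have Lh : Lp q h <-> Lp q (pull h).
  by split => [|l]; [exact: Lp_pull|rewrite -(pullK h); exact: Lp_push].
pose DV t x := (t^-1)%:C * (f x - V t f x).
pose DU t u := (t^-1)%:C * (pull f u - U t (pull f) u).
have DE t : 0 < t -> Lp q f -> \forall u \ae mu, pull (DV t) u = DU t u.
  move=> t0 lf; have h1 := ae_pull (VU t t0 f lf).
  by apply: aeS h1 => u; rewrite /pull /DV => ->; rewrite /DU /lift /push PsiK.
have mDV t : 0 < t -> Lp q f -> Lp q (DV t).
  by move=> t0 lf; apply: LpZ => //; apply: LpB => //; exact: LV.
have mDU t : 0 < t -> Lp q f -> Lp q (DU t).
  by move=> t0 lf; apply: LpZ => //; apply: LpB => //; [exact: Lp_pull|apply: LU => //; exact: Lp_pull].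
suff E : Lp q f -> Lp q h ->
  ((if q == +oo%E then forall psi, Lp 1%E psi ->
      normc (dual_pairing (DV t) psi - dual_pairing h psi) @[t --> 0^'+] --> (0 : R)
    else Lpnorm q (fun x => DV t x - h x) @[t --> 0^'+] --> (0 : \bar R)) <->
  (if q == +oo%E then forall psi, Lp 1%E psi ->
      normc (dual_pairing (DU t) psi - dual_pairing (pull h) psi) @[t --> 0^'+] --> (0 : R)
    else Lpnorm q (fun x => DU t x - pull h x) @[t --> 0^'+] --> (0 : \bar R))).
  split=> [[lf lh H]|[lf lh H]].
    by split; [exact/Lf|exact/Lh|exact/(E lf lh)].
  by have [lf' lh'] := (Lf.2 lf, Lh.2 lh); split => //; exact/(E lf' lh').
move=> lf lh; have mh := Lp_measurable lh; have lph := Lp_pull q1 lh.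
case: ifPn => [/eqP qy|_].
  subst q; have key t psi : 0 < t -> cintegrable psi ->
      dual_pairing (DV t) psi - dual_pairing h psi =
      dual_pairing (DU t) (pulla psi) - dual_pairing (pull h) (pulla psi).
    move=> t0 ip; have mp := cintegrable_measurable ip.
    have mpa := cintegrable_measurable (cintegrable_pulla ip).
    have m1 := Lp_measurable (mDV t t0 lf); have m2 := Lp_measurable (mDU t t0 lf).
    rewrite (dual_pairing_pull m1 mp) (dual_pairing_pull mh mp); congr (_ - _).
    apply: ae_eq_cint.
    - exact: (cmfM (measurable_pull m1) mpa).
    - exact: (cmfM m2 mpa).
    - by apply: aeS (DE t t0 lf) => u ->.
  (* As psi runs through L_1 so does [pulla psi], with inverse [pusha], so the two families of weak*
     tests coincide. *)
  split=> H psi /Lp1P ip.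
    have ipa := cintegrable_pusha ip.
    have := H _ ((Lp1P _).2 ipa); apply: cvg_trans; apply: near_eq_cvg.
    apply: near_gt0_at_right => t t0.
    by rewrite (key t _ t0 ipa) pulla_pusha.
  have ipa := cintegrable_pulla ip.
  have := H _ ((Lp1P _).2 ipa); apply: cvg_trans; apply: near_eq_cvg.
  apply: near_gt0_at_right => t t0.
  by rewrite (key t _ t0 ip).
have key t : 0 < t ->
    Lpnorm q (pull (fun x => DV t x - h x)) = Lpnorm q (fun x => DU t x - pull h x).
  move=> t0; have m1 := Lp_measurable (mDV t t0 lf); have m2 := Lp_measurable (mDU t t0 lf).
  apply: ae_eq_Lpnorm => //.
  - exact: (measurable_pull (cmfB m1 mh)).
  - exact: (cmfB m2 (measurable_pull mh)).
  - by apply: aeS (DE t t0 lf) => u; rewrite /pull => ->.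
split=> H; (apply: (@cvg_dom _ (0^'+) _ _ _ _ _ _ H) => [t|t|]; [exact: Lpnorm_ge0|exact: Lpnorm_ge0|]).
  apply: near_gt0_at_right => t t0; rewrite -key//.
  have md := cmfB (Lp_measurable (mDV t t0 lf)) mh.
  apply: (le_trans (Lpnorm_pull_le q1 md)).
  rewrite -[leLHS]mul1e; apply: lee_pmul => //; first exact: Lpnorm_ge0.
  by rewrite lee_fin ler1n.
apply: near_gt0_at_right => t t0; rewrite -key//.
have md := cmfB (Lp_measurable (mDV t t0 lf)) mh.
exact: (Lpnorm_le_pull q1 md).
Qed.

Lemma transfer_resolvent q (G H : (R -> C) -> (R -> C) -> Prop) (lam : C) W : (1 <= q)%E ->
  (forall f h, H f h -> Lp q f /\ Lp q h) ->
  (forall f h, H f h <-> G (pull f) (pull h)) ->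
  is_resolvent q G lam W -> is_resolvent q H lam (lift W).
Proof.
move=> q1 HL HG [bW W2 W3]; split; first exact: lift_bounded.
- move=> f lf; have [h Gh /ae_eqP e] := W2 _ (Lp_pull q1 lf).
  exists (push h); first by apply/HG; rewrite /lift !pushK.
  apply/ae_eqP; have := ae_push e; apply: aeS => x; rewrite /lift /push => ->.
  by rewrite /pull PhiK.
- move=> f h Hfh; apply/ae_eqP; have /ae_eqP e := W3 _ _ ((HG f h).1 Hfh).
  have := ae_push e; apply: aeS => x; rewrite /lift /push => ->.
  by rewrite /pull PhiK.
Qed.

End transfer.

(** * The translation group and the heat semigroup *)

Section translation_and_heat_semigroups.
Variable R : realType.
Local Notation C := R[i].
Local Notation mu := (@lebesgue_measure R).
Implicit Types (k f g psi : R -> C) (q : \bar R) (p : R).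

Definition shiftop (t : R) (F : R -> C) (u : R) : C := F (u - t).

Lemma shiftop_bounded q t : (1 <= q)%E -> bounded_op q (shiftop t).
Proof.
move=> q1; split.
- by move=> f lf; exact: Lp_shift.
- by move=> c f g _ _; apply/ae_eqP; apply: aeW.
- by exists 1 => f lf; rewrite mul1e Lpnorm_shift//; exact: Lp_measurable lf.
Qed.

Lemma shiftop_C0_group p : 1 <= p -> C0_group p%:E shiftop.
Proof.
move=> p1; have q1 : (1 <= p%:E)%E by rewrite lee_fin.
split.
- by move=> t; exact: shiftop_bounded.
- by move=> f lf; apply/ae_eqP; apply: aeW => u; rewrite /shiftop subr0.
- by move=> s t f lf; apply/ae_eqP; apply: aeW => u; rewrite /shiftop opprD addrA.
- move=> f lf t0; have mf := Lp_measurable lf.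
  have h : t - t0 @[t --> t0] --> (0 : R).
    by rewrite -(subrr t0); apply: cvgB; [exact: cvg_id|exact: cvg_cst].
  have := cvg_comp _ _ h (Lpnorm_shift_cvg p1 lf); apply: cvg_trans.
  apply: near_eq_cvg; near=> t => /=.
  have ml : cmeasurable (fun u => f (u - (t - t0)) - f u).
    by apply: cmfB => //; exact: (cmf_comp (measurable_shift (- (t - t0))) mf).
  rewrite -(Lpnorm_shift t0 q1 ml); congr Lpnorm; apply/funext => u.
  by rewrite /shiftop; congr (f _ - _); ring.
Unshelve. all: by end_near. Qed.

Lemma Lpnorm_cheat_le q t f : (1 <= q)%E -> 0 < t -> Lp q f ->
  (Lpnorm q (conv (cheat t) f) <= Lpnorm q f)%E.
Proof.
move=> q1 t0 lf; have := Lpnorm_conv q1 (cintegrable_cheat t0) lf.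
by rewrite nint_cheat// mul1e.
Qed.

Lemma cheat_semigroup q s t f : (1 <= q)%E -> 0 < s -> 0 < t -> Lp q f ->
  \forall u \ae mu, conv (cheat (s + t)) f u = conv (cheat s) (conv (cheat t) f) u.
Proof.
move=> q1 s0 t0 lf; rewrite -conv_cheat//.
by apply: aeS (conv_assoc q1 (cintegrable_cheat s0) (cintegrable_cheat t0) lf) => u ->.
Qed.

Lemma cheat_cvg0 p f : 1 <= p -> Lp p%:E f ->
  Lpnorm p%:E (fun u => conv (cheat t) f u - f u) @[t --> 0^'+] --> 0%E.
Proof.
move=> p1 lf; have i1 := cintegrable_cheat (@ltr01 R).
have := cvg_comp _ _ (@cvg_sqrt_at_right R) (approx_identity p1 i1 lf).
apply: cvg_trans; apply: near_eq_cvg; apply: near_gt0_at_right => t t0 /=.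
by rewrite -cheat_scale// cint_cheat//; congr Lpnorm; apply/funext => u; rewrite mul1r.
Qed.

(* Contractivity reduces continuity at t0 to continuity at 0. *)
Lemma cheat_dist q s t f : (1 <= q)%E -> 0 < s -> 0 < t -> Lp q f ->
  (Lpnorm q (fun u => (conv (cheat (s + t)) f u - conv (cheat t) f u)%R) <=
   Lpnorm q (fun u => (conv (cheat s) f u - f u)%R))%E.
Proof.
move=> q1 s0 t0 lf; have i1 := cintegrable_cheat s0; have i2 := cintegrable_cheat t0.
have lsf := Lp_conv q1 i1 lf; have ltf := Lp_conv q1 i2 lf.
have st0 : 0 < s + t by rewrite addr_gt0.
have lstf := Lp_conv q1 (cintegrable_cheat st0) lf.
have ld := LpB q1 lsf lf; have ltd := Lp_conv q1 i2 ld.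
rewrite (ae_eq_Lpnorm q1 (cmfB (Lp_measurable lstf) (Lp_measurable ltf)) (Lp_measurable ltd)).
  exact: Lpnorm_cheat_le.
have h2 := cheat_semigroup q1 t0 s0 lf; rewrite addrC in h2.
apply: aeS3 h2 (ae_conv_integrable q1 i2 lsf) (ae_conv_integrable q1 i2 lf) => u -> j1 j2.
by rewrite /conv -(cintB j1 j2); congr cint; apply/funext => v; rewrite mulrBr.
Qed.

Lemma cheat_C0_semigroup p : 1 <= p -> C0_semigroup p%:E (fun t => conv (cheat t)).
Proof.
move=> p1; have q1 : (1 <= p%:E)%E by rewrite lee_fin.
split.
- by move=> t t0; apply: conv_bounded_op => //; exact: cintegrable_cheat.
- by move=> s t f s0 t0 lf; apply/ae_eqP; exact: cheat_semigroup lf.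
- move=> f lf t0 t00.
  apply/(@cvge0P R R (nbhs t0)) => [t|e e0]; first exact: Lpnorm_ge0.
  have h := (@cvge0P R R (0^'+) _ _ (fun t => Lpnorm_ge0 p%:E _)).1 (cheat_cvg0 p1 lf) _ e0.
  have [d d0 hd] := h; near=> t.
  have tpos : 0 < t by near: t; exact: lt_nbhsr.
  have tdist : `|t - t0| < d.
    by near: t; apply/nbhs_ballP; exists d => // y; rewrite /ball/= distrC.
  have step (r : R) : 0 < r -> r < d ->
      (Lpnorm p%:E (fun u => (conv (cheat r) f u - f u)%R) <= e%:E)%E.
    move=> r0 rd; apply: hd => //.
    by rewrite /ball_/= sub0r normrN gtr0_norm.
  have [tt|tt|->] := ltgtP t t0.
  + rewrite LpnormBC -{1}(subrK t t0); apply: (le_trans (cheat_dist q1 _ tpos lf)).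
      by rewrite subr_gt0.
    apply: step; first by rewrite subr_gt0.
    by rewrite distrC gtr0_norm ?subr_gt0// in tdist.
  + rewrite -{1}(subrK t0 t); apply: (le_trans (cheat_dist q1 _ t00 lf)).
      by rewrite subr_gt0.
    apply: step; first by rewrite subr_gt0.
    by rewrite gtr0_norm ?subr_gt0// in tdist.
  + by under eq_fun do rewrite subrr; rewrite Lpnorm_0// lee_fin ltW.
- by move=> f lf; exact: cheat_cvg0.
Unshelve. all: by end_near. Qed.

(** Fubini on k(s) f(u - s) psi(u): convolution with k is the weak* integral of translations, the
    form in which S is defined. *)
Lemma dual_pairing_conv_shift k f psi : cintegrable k -> Lp +oo%E f -> cintegrable psi ->
  cintegrable (fun s => k s * dual_pairing (shiftop s f) psi) /\
  dual_pairing (conv k f) psi = cint (fun s => k s * dual_pairing (shiftop s f) psi).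
Proof.
move=> ik lf ip; have mf := Lp_measurable lf; have [M M0 fM] := Lpy_bound lf.
have [mk nk] := (cintegrableP k).1 ik; have [mp np] := (cintegrableP psi).1 ip.
pose F (s u : R) : C := k s * (f (u - s) * psi u).
have mF : cmf (fun z : R * R => F z.1 z.2).
  apply: (cmfM (cmf_comp measurable_fst mk)).
  apply: (cmfM _ (cmf_comp measurable_snd mp)).
  apply: (cmf_comp (g := fun z : R * R => z.2 - z.1) _ mf).
  by apply: measurable_funB; [exact: measurable_snd|exact: measurable_fst].
have lfs s : Lp +oo%E (shiftop s f) by apply: Lp_shift => //; exact: leey.
have ips s : cintegrable (fun u => shiftop s f u * psi u) by exact: dual_pairing_integrable.
have nfin : nint psi \is a fin_num by rewrite ge0_fin_numE// nint_ge0.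
have mshift s := cintegrable_measurable (ips s).
have nF s : (nint (F s) <= (normc (k s))%:E * (M%:E * nint psi))%E.
  rewrite /F (nintZ (k s) (mshift s)); apply: lee_pmul; rewrite ?lee_fin ?normc_ge0 ?nint_ge0//.
  have -> : M%:E = (normc M%:C)%:E by rewrite normc_real ger0_norm.
  rewrite -nintZ//; apply: le_nint_ae => //; first exact: cmfZ.
  have := ae_shift (- s) fM; apply: aeS => u fu.
  by rewrite 2!Normc.normcM normc_real ger0_norm// ler_wpM2r// normc_ge0.
have iF : (\int[mu]_s nint (F s) < +oo)%E.
  apply: (@le_lt_trans _ _ (\int[mu]_s ((normc (k s))%:E * (M%:E * nint psi)))%E).
    apply: ge0_le_integral => //.
    - by move=> s _; exact: nint_ge0.
    - exact: (measurable_nint (F := F)).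
    - by apply: emeasurable_funM => //; exact: measurable_normcE.
  have K0 : (0 <= M%:E * nint psi)%E by rewrite mule_ge0 ?lee_fin ?nint_ge0.
  rewrite (ge0_intZr K0 (measurable_normcE mk)); last by move=> s; rewrite lee_fin normc_ge0.
  rewrite -(fineK nfin) -EFinM -/(nint k).
  have kfin : nint k \is a fin_num by rewrite ge0_fin_numE// nint_ge0.
  by rewrite -(fineK kfin) -EFinM ltry.
have [_ iC _ E] := cFubini mF iF.
have cE s : cint (F s) = k s * dual_pairing (shiftop s f) psi by rewrite /F (cintZ (k s) (ips s)).
split; first by move: iC; congr cintegrable; apply/funext => s; rewrite cE.
transitivity (cint (fun u => cint (F ^~ u))); last first.
  by rewrite -E; congr cint; apply/funext => s; rewrite cE.
apply: ae_eq_cint.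
- exact: (cmfM (measurable_conv mk mf) mp).
- apply: (measurable_cint (F := fun u s => F s u)).
  by apply: (cmf_comp _ mF (g := fun z : R * R => (z.2, z.1))); exact: measurable_swap.
- apply: aeS (ae_conv_integrable (leey (1 : \bar R)) ik lf) => u iu.
  rewrite /conv -(cintZr _ iu); congr cint; apply/funext => s.
  by rewrite /F mulrA.
Qed.

End translation_and_heat_semigroups.

(** * The group, the semigroup and the generator of the vector field *)

Section straightened_semigroups.
Variables (R : realType) (a Phi Psi : R -> R).
Local Notation C := R[i].
Local Notation mu := (@lebesgue_measure R).
Local Notation op := ((R -> C) -> (R -> C)).
Hypothesis ma : measurable_fun setT a.
Hypothesis a_bounds : forall x, 1 <= a x <= 4.
Hypothesis PhiK : cancel Phi Psi.
Hypothesis PsiK : cancel Psi Phi.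
Hypothesis mPsi : measurable_fun setT Psi.
Hypothesis cPhi : is_cov Phi (fun x => (a x)^-1).
Hypothesis flowE : forall t x, flow a t x = Psi (Phi x + t).
Implicit Types (f g h psi phi : R -> C) (U V : op) (q : \bar R) (p : R).

Local Notation pull := (pull Psi).
Local Notation push := (push Phi).
Local Notation lift := (lift Phi Psi).
Local Notation S t := (lift (conv (cheat t))).

Let Lpu q f (q1 : (1 <= q)%E) := Lp_pull ma a_bounds PhiK mPsi cPhi q1 (f := f).

Lemma Tgroup_lift t : Tgroup a t = lift (shiftop t).
Proof. by apply/funext => phi; apply/funext => y; rewrite /Tgroup flowE. Qed.

Lemma lift_bounded_op q U : (1 <= q)%E -> bounded_op q U -> bounded_op q (lift U).
Proof. exact: (lift_bounded ma a_bounds PhiK PsiK mPsi cPhi). Qed.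

Lemma Tgroup_extension p t : 1 <= p -> is_Lp_extension p%:E (Tgroup a t) (lift (shiftop t)).
Proof.
move=> p1; have q1 : (1 <= p%:E)%E by rewrite lee_fin.
split; first by apply: lift_bounded_op => //; exact: shiftop_bounded.
by move=> f _ _; rewrite Tgroup_lift; apply/ae_eqP; exact: aeW.
Qed.

Lemma Tgroup_LpP p t : 1 <= p -> is_Lp_extension p%:E (Tgroup a t) (Tgroup_Lp a p%:E t).
Proof. by move=> p1; apply: Lp_extensionP; exact: Tgroup_extension p1. Qed.

Lemma Tgroup_Lp_C0 p : 1 <= p -> C0_group p%:E (Tgroup_Lp a p%:E).
Proof.
move=> p1.
have h1 t : bounded_op p%:E (Tgroup_Lp a p%:E t) by case: (Tgroup_LpP t p1).
have h2 t f : Lp p%:E f -> \forall x \ae mu, Tgroup_Lp a p%:E t f x = lift (shiftop t) f x.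
  exact: (Lp_extension_unique p1 (Tgroup_LpP t p1) (Tgroup_extension t p1)).
exact: (transfer_C0_group ma a_bounds PhiK PsiK mPsi cPhi p1 h1 h2 (shiftop_C0_group p1)).
Qed.

Lemma is_Ssemigroup_lift t phi : 0 < t -> Lp +oo%E phi -> is_Ssemigroup a t phi (S t phi).
Proof.
move=> t0 lphi; have q1 := leey (1 : \bar R); have ic := cintegrable_cheat t0.
have [bl _ _] := lift_bounded_op q1 (conv_bounded_op q1 ic).
have lS := bl _ lphi; have lp := Lpu q1 lphi.
split => // psi /Lp1P ip F; have mp := cintegrable_measurable ip.
have ipa := cintegrable_pulla ma a_bounds PhiK mPsi cPhi ip.
have [iC E] := dual_pairing_conv_shift ic lp ipa.
(* Integrability is known for c F, the pairing weighted by the full Gaussian, and passes to F on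
   dividing by c. *)
pose c : C := ((4 * pi * t) `^ (- 2^-1))%:C.
have c0 : c != 0.
  apply/eqP => /(congr1 (@complex.Re R))/=; apply/eqP; rewrite gt_eqF// powR_gt0//.
  by rewrite !mulr_gt0// pi_gt0.
have DE s : dual_pairing (Tgroup a s phi) psi =
    dual_pairing (shiftop s (pull phi)) (pulla a Psi psi).
  have lT : Lp +oo%E (Tgroup a s phi).
    rewrite Tgroup_lift; have [h _ _] := lift_bounded_op q1 (shiftop_bounded s q1); exact: h.
  rewrite (dual_pairing_pull ma a_bounds PhiK mPsi cPhi (Lp_measurable lT) mp); congr dual_pairing.
  by rewrite Tgroup_lift /lift pushK.
have FE s : c * F s = cheat t s * dual_pairing (shiftop s (pull phi)) (pulla a Psi psi).
  by rewrite /F DE /cheat /heat RCM mulrA.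
have iF : cintegrable F.
  have := cintegrableZ c^-1 iC; congr cintegrable; apply/funext => s.
  by rewrite -FE mulKf.
split => //; rewrite -/c -(cintZ c iF).
rewrite (dual_pairing_pull ma a_bounds PhiK mPsi cPhi (Lp_measurable lS) mp).
rewrite /lift pushK// E; congr cint; apply/funext => s.
by rewrite FE.
Qed.

Lemma SsemigroupP t phi : 0 < t -> Lp +oo%E phi -> is_Ssemigroup a t phi (Ssemigroup a t phi).
Proof.
move=> t0 lphi; have h := is_Ssemigroup_lift t0 lphi.
exact: (@xgetPex _ _ [set g | is_Ssemigroup a t phi g] (ex_intro _ _ h)).
Qed.

Lemma Ssemigroup_ae t phi : 0 < t -> Lp +oo%E phi ->
  \forall x \ae mu, Ssemigroup a t phi x = S t phi x.
Proof.
move=> t0 lphi; have [l1 h1] := SsemigroupP t0 lphi; have [l2 h2] := is_Ssemigroup_lift t0 lphi.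
apply: dual_pairing_inj => // psi lpsi.
by have [_ ->] := h1 _ lpsi; have [_ ->] := h2 _ lpsi.
Qed.

Lemma Ssemigroup_extension p t : 1 <= p -> 0 < t ->
  is_Lp_extension p%:E (Ssemigroup a t) (S t).
Proof.
move=> p1 t0; have q1 : (1 <= p%:E)%E by rewrite lee_fin.
split.
  by apply: lift_bounded_op => //; apply: conv_bounded_op => //; exact: cintegrable_cheat.
by move=> f _ ly; apply/ae_eqP; apply: aeS (Ssemigroup_ae t0 ly) => x ->.
Qed.

Lemma Ssemigroup_LpP p t : 1 <= p -> 0 < t ->
  is_Lp_extension p%:E (Ssemigroup a t) (Ssemigroup_Lp a p%:E t).
Proof. by move=> p1 t0; apply: Lp_extensionP; exact: Ssemigroup_extension p1 t0. Qed.

Lemma Ssemigroup_Lp_ae q t f : (1 <= q)%E -> 0 < t -> Lp q f ->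
  \forall x \ae mu, Ssemigroup_Lp a q t f x = S t f x.
Proof.
case: q => [p p1 t0 lf|_ t0 lf|//]; last by rewrite /Ssemigroup_Lp eqxx; exact: Ssemigroup_ae.
rewrite lee_fin in p1.
exact: (Lp_extension_unique p1 (Ssemigroup_LpP p1 t0) (Ssemigroup_extension p1 t0) lf).
Qed.

Lemma Ssemigroup_Lp_Lp q t f : (1 <= q)%E -> 0 < t -> Lp q f -> Lp q (Ssemigroup_Lp a q t f).
Proof.
case: q => [p p1 t0 lf|_ t0 lf|//].
  by rewrite lee_fin in p1; have [[h _ _] _] := Ssemigroup_LpP p1 t0; exact: h.
by rewrite /Ssemigroup_Lp eqxx; have [] := SsemigroupP t0 lf.
Qed.

Lemma Ssemigroup_Lp_C0 p : 1 <= p -> C0_semigroup p%:E (Ssemigroup_Lp a p%:E).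
Proof.
move=> p1; have q1 : (1 <= p%:E)%E by rewrite lee_fin.
have h1 t : 0 < t -> bounded_op p%:E (Ssemigroup_Lp a p%:E t).
  by move=> t0; case: (Ssemigroup_LpP p1 t0).
have h2 t : 0 < t -> forall f, Lp p%:E f -> \forall x \ae mu, Ssemigroup_Lp a p%:E t f x = S t f x.
  by move=> t0 f lf; exact: Ssemigroup_Lp_ae.
exact: (transfer_C0_semigroup ma a_bounds PhiK PsiK mPsi cPhi p1 h1 h2 (cheat_C0_semigroup p1)).
Qed.

Lemma opnorm_lift_conv p k : 1 <= p -> cintegrable k ->
  forall f, Lp p%:E f ->
  (Lpnorm p%:E (lift (conv k) f) <= (4 `^ p^-1 * fine (nint k))%:E * Lpnorm p%:E f)%E.
Proof.
move=> p1 ik f lf; have q1 : (1 <= p%:E)%E by rewrite lee_fin.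
have [mk nk] := (cintegrableP k).1 ik.
apply: (lift_norm ma a_bounds PhiK PsiK mPsi cPhi p1) => //; first by rewrite fine_ge0// nint_ge0.
move=> F lF; split; first exact: Lp_conv.
by rewrite fineK ?ge0_fin_numE ?nint_ge0//; exact: Lpnorm_conv.
Qed.

Lemma opnorm_Ssemigroup p t : 1 <= p -> 0 < t ->
  (opnorm p%:E (Ssemigroup_Lp a p%:E t) <= (4 `^ p^-1)%:E)%E.
Proof.
move=> p1 t0; have q1 : (1 <= p%:E)%E by rewrite lee_fin.
apply: opnorm_le => [|f lf]; first exact: powR_ge0.
have ic := cintegrable_cheat t0.
have [bl _ _] := lift_bounded_op q1 (conv_bounded_op q1 ic).
rewrite (ae_eq_Lpnorm q1 (Lp_measurable (Ssemigroup_Lp_Lp q1 t0 lf)) (Lp_measurable (bl _ lf))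
  (Ssemigroup_Lp_ae q1 t0 lf)).
by have := opnorm_lift_conv p1 ic lf; rewrite nint_cheat// mulr1.
Qed.

Lemma Hgen_heat q f h : (1 <= q)%E -> Hgen a q f h <-> Hheat q (pull f) (pull h).
Proof.
move=> q1; apply: (transfer_generator ma a_bounds PhiK PsiK mPsi cPhi) => //.
- by move=> t t0; apply: conv_bounded_op => //; exact: cintegrable_cheat.
- by move=> t t0 f' lf; exact: Ssemigroup_Lp_Lp.
- by move=> t t0 f' lf; exact: Ssemigroup_Lp_ae.
Qed.

Lemma Hgen_Lp q f h : Hgen a q f h -> Lp q f /\ Lp q h.
Proof. by case. Qed.

Lemma Hgen_resolvent q (nu : C) : (1 <= q)%E -> 0 < complex.Re nu ->
  is_resolvent q (Hgen a q) (- nu ^+ 2) (lift (conv (resk nu))).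
Proof.
move=> q1 nu0; apply: (transfer_resolvent ma a_bounds PhiK PsiK mPsi cPhi q1) (Hheat_is_resolvent q1 nu0).
  by move=> f h; exact: Hgen_Lp.
by move=> f h; exact: Hgen_heat.
Qed.

(** Off [0, oo) the number - lam avoids the cut of the principal root, whose values there lie in the
    open right half-plane: [sqrtc (- lam)] is an admissible nu. *)
Lemma sqrtc_opp_Re_gt0 (lam : C) : ~ (0 <= complex.Re lam /\ complex.Im lam = 0) ->
  0 < complex.Re (sqrtc (- lam)).
Proof.
case: lam => x y /= h; rewrite sqrtr_gt0 divr_gt0// -ltrBlDr sub0r opprK.
have [y0|y0] := eqVneq y 0.
  have x0 : x < 0 by rewrite ltNge; apply/negP => x0; exact: h.
  by rewrite (lt_le_trans x0) ?sqrtr_ge0.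
rewrite (le_lt_trans (ler_norm x))// -sqrtr_sqr ltr_sqrt !sqrrN ?ltrDl ?exprn_even_gt0//.
by rewrite ltr_pwDr ?sqr_ge0// exprn_even_gt0.
Qed.

Lemma resolvent_exists q (lam : C) : (1 <= q)%E -> ~ (0 <= complex.Re lam /\ complex.Im lam = 0) ->
  is_resolvent q (Hgen a q) lam (lift (conv (resk (sqrtc (- lam))))).
Proof.
move=> q1 hl; have := Hgen_resolvent q1 (sqrtc_opp_Re_gt0 hl).
by rewrite sqr_sqrtc opprK.
Qed.

(** Approximate eigenvectors are transported by composition with [Phi], which preserves their
    pointwise estimate, so no norm constant enters. *)
Lemma Hgen_spectrum q : (1 <= q)%E ->
  spectrum q (Hgen a q) = [set lam : C | 0 <= complex.Re lam /\ complex.Im lam = 0].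
Proof.
move=> q1; apply/seteqP; split => lam.
  move=> sl; apply: contrapT => hl; apply: sl.
  by exists (lift (conv (resk (sqrtc (- lam))))); exact: resolvent_exists.
move=> [l0 li]; apply: (spectrum_approximate q1) => [f h|d d0]; first exact: Hgen_Lp.
have [f [h [Hfh fn0 fle]]] := approximate_eigenvector (Num.sqrt (complex.Re lam)) q1 d0.
have [lf _ _] := Hfh.
exists (push f), (push h); split.
- by apply/Hgen_heat => //; rewrite !pushK.
- apply: contraNneq fn0 => n0.
  rewrite eq_le Lpnorm_ge0 andbT -n0 -{1}(pushK PsiK f).
  apply: (Lpnorm_pull_le ma a_bounds PhiK mPsi cPhi q1).
  exact: (measurable_push cPhi (Lp_measurable lf)).
- move=> x; have := fle (Phi x); rewrite sqr_sqrtr// /push.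
  by rewrite (_ : (complex.Re lam)%:C = lam)//; case: lam l0 li fle => u v /= _ ->.
Qed.

End straightened_semigroups.

(** * Arguments of complex numbers *)

Section arguments.
Variable R : realType.
Local Notation C := R[i].
Implicit Types z : C.

Lemma cos_arg_bounds z : z != 0 -> -1 <= complex.Re z / normc z <= 1.
Proof.
move=> z0; have n0 : 0 < normc z.
  by rewrite lt_neqAle normc_ge0 andbT eq_sym; apply: contra z0 => /eqP/normc_eq0 ->.
by rewrite -ler_norml normrM normfV (gtr0_norm n0) ler_pdivrMr// mul1r ler_normRe.
Qed.

Lemma normr_arg z : z != 0 -> `|arg z| = acos (complex.Re z / normc z).
Proof.
move=> z0; rewrite /arg normrM [X in _ * X = _]ger0_norm; last exact: acos_ge0 (cos_arg_bounds z0).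
by case: ifP => _; rewrite ?normrN normr1 mul1r.
Qed.

Lemma arg_lt_Re z (th : R) : z != 0 -> th <= pi -> `|arg z| < th ->
  cos th * normc z < complex.Re z.
Proof.
move=> z0 thpi; rewrite normr_arg// => h.
have n0 : 0 < normc z.
  by rewrite lt_neqAle normc_ge0 andbT eq_sym; apply: contra z0 => /eqP/normc_eq0 ->.
have cb := cos_arg_bounds z0; have a0 := acos_ge0 cb.
rewrite -ltr_pdivlMr// -[ltRHS]acosK; last by rewrite in_itv.
rewrite ltr_cos// in_itv/= ?a0 ?acos_lepi//.
by rewrite thpi (ltW (le_lt_trans a0 h)).
Qed.

Lemma arg_ge_Re z (th : R) : z != 0 -> 0 <= th <= pi -> th <= `|arg z| ->
  complex.Re z <= cos th * normc z.
Proof.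
move=> z0 thpi; rewrite normr_arg// => h.
have n0 : 0 < normc z.
  by rewrite lt_neqAle normc_ge0 andbT eq_sym; apply: contra z0 => /eqP/normc_eq0 ->.
have cb := cos_arg_bounds z0; have a0 := acos_ge0 cb.
rewrite -ler_pdivrMr// -[leLHS]acosK; last by rewrite in_itv.
rewrite leNgt ltr_cos; first by rewrite -leNgt.
  by rewrite in_itv/= a0 acos_lepi.
by rewrite in_itv.
Qed.

Lemma cos_lt1 (th : R) : 0 < th -> th <= pi -> cos th < 1.
Proof.
move=> t0 tpi; rewrite -cos0 ltr_cos// in_itv/= ?lexx ?pi_ge0//.
by rewrite ltW.
Qed.

End arguments.

Lemma continuous_heat (R : realType) (t : R) : continuous (@heat R t).
Proof.
move=> s; apply: cvgM; first exact: cvg_cst.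
apply: (continuous_comp (f := fun s : R => - (s ^+ 2 * (4 * t)^-1))); last exact: continuous_expR.
by apply: cvgN; apply: cvgM; [exact: exprn_continuous|exact: cvg_cst].
Qed.

(** * The kernel, holomorphy and type S_{0+} *)

Section kernel_and_holomorphy.
Variables (R : realType) (a Phi Psi : R -> R).
Local Notation C := R[i].
Local Notation mu := (@lebesgue_measure R).
Local Notation op := ((R -> C) -> (R -> C)).
Hypothesis ca : continuous a.
Hypothesis a_bounds : forall x, 1 <= a x <= 4.
Hypothesis PhiK : cancel Phi Psi.
Hypothesis PsiK : cancel Psi Phi.
Hypothesis mPsi : measurable_fun setT Psi.
Hypothesis cPhi : is_cov Phi (fun x => (a x)^-1).
Hypothesis flowE : forall t x, flow a t x = Psi (Phi x + t).
Hypothesis cont_Phi : continuous Phi.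
Hypothesis Phi_dist : forall x y, 4^-1 * `|x - y| <= `|Phi x - Phi y|.
Implicit Types (f g h psi phi : R -> C) (U V : op) (q : \bar R) (p : R).

Local Notation pull := (pull Psi).
Local Notation push := (push Phi).
Local Notation lift := (lift Phi Psi).
Let ma : measurable_fun setT a. Proof. exact: continuous_measurable_fun. Qed.

Let a0 x : 0 < a x.
Proof. by have /andP[h _] := a_bounds x; exact: lt_le_trans h. Qed.

(** The factor 1/a(y) is the density du/dy of the coordinate u = Phi(y). *)
Definition Skernel (t x y : R) : R := (a y)^-1 * heat t (Phi x - Phi y).

Lemma Skernel_is_kernel t : 0 < t -> is_kernel a t (Skernel t).
Proof.
move=> t0; have ic := cintegrable_cheat t0.
have mc := measurable_cheat t.
have icx x : cintegrable (fun v => cheat t (Phi x - v)) by exact: cintegrable_reflect.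
split.
- move=> [x y]; apply: cvgM => /=.
    apply: cvgV; first by rewrite gt_eqF.
    by apply: (@continuous_comp _ _ _ snd a (x, y)); [exact: cvg_snd|exact: ca].
  apply: (@continuous_comp _ _ _ (fun z : R * R => Phi z.1 - Phi z.2) (@heat R t) (x, y)); last exact: continuous_heat.
  apply: cvgB.
    by apply: (@continuous_comp _ _ _ fst Phi (x, y)); [exact: cvg_fst|exact: cont_Phi].
  by apply: (@continuous_comp _ _ _ snd Phi (x, y)); [exact: cvg_snd|exact: cont_Phi].
- move=> x; have [+ _] := (cintegrable_cov cPhi (cintegrable_measurable (icx x))).2 (icx x).
  by congr integrable; apply/funext => y; rewrite ReZ.
- move=> phi lphi; apply/ae_eqP.
  have h := Ssemigroup_ae ma a_bounds PhiK PsiK mPsi cPhi flowE t0 lphi.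
  have mp := measurable_pull (Psi := Psi) mPsi (Lp_measurable lphi).
  apply: aeS h => x ->; rewrite /lift /push /conv.
  have m1 : cmeasurable (fun s => cheat t s * pull phi (Phi x - s)).
    exact: (cmfM mc (cmf_comp (measurable_reflect (Phi x)) mp)).
  rewrite -(cint_reflect (Phi x) m1) -(cint_cov cPhi); last first.
    apply: (cmf_comp (measurable_reflect (Phi x)) m1).
  congr cint; apply/funext => y; rewrite /pull.
  have -> : Phi x - (Phi x - Phi y) = Phi y by ring.
  by rewrite PhiK (RCM (a y)^-1 (heat t (Phi x - Phi y))) -[RHS]mulrA.
Qed.

(** 64 = 4 * 4^2: the Gaussian's own 4 and the square of the 4 in [Phi_dist]; the density 1/a(y) is
    at most 1. *)
Lemma Skernel_le t x y : 0 < t -> Skernel t x y <=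
  (4 * pi * t) `^ (- 2^-1) * expR (- (`|x - y| ^+ 2 * (64 * t)^-1)).
Proof.
move=> t0; have aV : (a y)^-1 <= 1.
  by have /andP[h _] := a_bounds y; rewrite invf_le1.
apply: (@le_trans _ _ (heat t (Phi x - Phi y))).
  by rewrite /Skernel ler_piMl ?heat_ge0.
rewrite /heat ler_wpM2l ?powR_ge0// ler_expR lerN2.
have h := Phi_dist x y; rewrite -(real_normK (num_real (Phi x - Phi y))).
have h2 : (4^-1 * `|x - y|) ^+ 2 <= `|Phi x - Phi y| ^+ 2 by rewrite ler_sqr ?nnegrE ?mulr_ge0.
have t4 : 0 <= (4 * t)^-1 by rewrite invr_ge0 mulr_ge0// ltW.
apply: (le_trans _ (ler_wpM2r t4 h2)); rewrite le_eqVlt; apply/orP; left; apply/eqP.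
by rewrite exprMn; field; rewrite gt_eqF.
Qed.

(** With nu^2 = - lam the bound on lam times the resolvent is 4^{1/p} |nu| / Re nu, and (Re nu)^2 =
    (|lam| - Re lam)/2 >= |lam| (1 - cos th)/2 on the given set of lam. *)
Lemma Hgen_type_S0plus p : 1 <= p -> type_S0plus p%:E (Hgen a p%:E).
Proof.
move=> p1; have q1 : (1 <= p%:E)%E by rewrite lee_fin.
split.
  move=> lam; rewrite (Hgen_spectrum ma a_bounds PhiK PsiK mPsi cPhi flowE q1) => -[l0 li].
  by exists (complex.Re lam) => //; apply: complex_ext.
move=> th /andP[th0 thpi]; have c1 := cos_lt1 th0 (ltW thpi).
have d0 : 0 < 1 - cos th by rewrite subr_gt0.
exists (4 `^ p^-1 * Num.sqrt (2 / (1 - cos th))) => lam /eqP ln0 hth.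
have n0 : 0 < normc lam.
  by rewrite lt_neqAle normc_ge0 andbT eq_sym; apply: contra ln0 => /eqP/normc_eq0 ->.
have hRe : complex.Re lam <= cos th * normc lam.
  by apply: arg_ge_Re => //; rewrite (ltW th0) ltW.
have hl : ~ (0 <= complex.Re lam /\ complex.Im lam = 0).
  move=> [l0 li]; have nE : normc lam = complex.Re lam.
    by rewrite normcE li expr0n addr0 sqrtr_sqr ger0_norm.
  by rewrite nE in n0 hRe; nra.
pose nu := sqrtc (- lam); have nu0 : 0 < complex.Re nu by exact: sqrtc_opp_Re_gt0.
exists (lift (conv (resk nu))); first exact: resolvent_exists.
have ir := cintegrable_resk nu0.
apply: opnorm_le => [|f lf]; first by rewrite mulr_ge0 ?powR_ge0.
have [bl _ _] := lift_bounded_op ma a_bounds PhiK PsiK mPsi cPhi q1 (conv_bounded_op q1 ir).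
rewrite LpnormZ//; last exact: Lp_measurable (bl _ lf).
have := opnorm_lift_conv ma a_bounds PhiK PsiK mPsi cPhi p1 ir lf.
rewrite nint_resk//= => h.
apply: (@le_trans _ _ ((normc lam)%:E * ((4 `^ p^-1 * ((normc nu)^-1 / complex.Re nu))%:E * Lpnorm p%:E f))%E).
  by apply: lee_pmul; rewrite ?lee_fin ?normc_ge0 ?Lpnorm_ge0.
rewrite muleA -EFinM; apply: lee_pmul; rewrite ?Lpnorm_ge0// lee_fin.
  by rewrite !mulr_ge0 ?powR_ge0 ?invr_ge0 ?normc_ge0// ltW.
rewrite mulrCA ler_wpM2l ?powR_ge0//.
have nn : normc nu ^+ 2 = normc lam by rewrite normc_sqrtc normcN.
have nun : 0 < normc nu by rewrite (lt_le_trans nu0)// le_normc_Re.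
have -> : normc lam * ((normc nu)^-1 / complex.Re nu) = normc nu / complex.Re nu.
  by rewrite -nn; field; rewrite !gt_eqF.
have r0 : 0 <= normc nu / complex.Re nu by rewrite divr_ge0// ltW.
rewrite -(ger0_norm r0) -sqrtr_sqr ler_sqrt ?divr_ge0 ?(ltW d0)// exprMn exprVn nn.
have Renu : complex.Re nu ^+ 2 = (normc lam - complex.Re lam) / 2.
  have /(congr1 (@complex.Re R)) := sqr_sqrtc (- lam); rewrite -/nu expr2 ReM ReN => e1.
  have := sqr_normc nu; rewrite nn => e2.
  by apply: (@mulIf _ 2); rewrite ?pnatr_eq0// divfK ?pnatr_eq0//; lra.
rewrite Renu ler_pdivrMr; last by rewrite -Renu exprn_gt0.
rewrite mulrAC ler_pdivlMr// mulrC.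
have -> : 2 * ((normc lam - complex.Re lam) / 2) = normc lam - complex.Re lam by field.
by lra.
Qed.

Lemma Ssemigroup_holomorphic p : 1 <= p ->
  has_bounded_holomorphic_extension p%:E (Ssemigroup_Lp a p%:E).
Proof.
move=> p1; have q1 : (1 <= p%:E)%E by rewrite lee_fin.
exists (fun z => lift (conv (zheat z))); split.
- move=> z z0; apply: (lift_bounded_op ma a_bounds PhiK PsiK mPsi cPhi q1).
  by apply: conv_bounded_op => //; exact: cintegrable_zheat.
- move=> t t0 f lf; rewrite zheat_real//; apply/ae_eqP.
  by apply: aeS (Ssemigroup_Lp_ae ma a_bounds PhiK PsiK mPsi cPhi flowE q1 t0 lf) => x ->.
- move=> z0 z00; have [D [iD [K [d [K0 d0 hK]]]]] := zheat_holomorphic z00.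
  exists (lift (conv D)).
    by apply: (lift_bounded_op ma a_bounds PhiK PsiK mPsi cPhi q1); exact: conv_bounded_op.
  move=> e e0; have K40 : 0 < 4 * (K + 1) by rewrite mulr_gt0// ltr_wpDl.
  (* The operator norm of the remainder is at most 4 K r^2, and r < e / (4 (K + 1)) makes this at
     most e r. *)
  exists (Num.min d (e / (4 * (K + 1)))); first by rewrite lt_min d0 divr_gt0.
  move=> z zRe; rewrite lt_min => /andP[zd ze].
  set r := normc (z - z0) in zd ze *; have r0 : 0 <= r by exact: normc_ge0.
  have iz := cintegrable_zheat zRe; have iz0 := cintegrable_zheat z00.
  pose k s := zheat z s - zheat z0 s - (z - z0) * D s.
  have iDz := cintegrableZ (z - z0) iD.
  have ik : cintegrable k by apply: cintegrableB => //; exact: cintegrableB.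
  apply: opnorm_le => [|f lf]; first by rewrite mulr_ge0// ltW.
  have lp := Lp_pull ma a_bounds PhiK mPsi cPhi q1 lf.
  have L k' : cintegrable k' -> Lp p%:E (lift (conv k') f).
    move=> ik'; have [h _ _] := lift_bounded_op ma a_bounds PhiK PsiK mPsi cPhi q1
      (conv_bounded_op q1 ik'); exact: h.
  have E : \forall x \ae mu, lift (conv (zheat z)) f x - lift (conv (zheat z0)) f x -
      (z - z0) * lift (conv D) f x = lift (conv k) f x.
    have h : \forall u \ae mu, conv (zheat z) (pull f) u - conv (zheat z0) (pull f) u -
        (z - z0) * conv D (pull f) u = conv k (pull f) u.
      apply: aeS3 (ae_conv_integrable q1 iz lp) (ae_conv_integrable q1 iz0 lp)
        (ae_conv_integrable q1 iD lp) => u j1 j2 j3.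
      rewrite /conv -(cintB j1 j2) -(cintZ (z - z0) j3) -(cintB (cintegrableB j1 j2) (cintegrableZ (z - z0) j3)).
      by congr cint; apply/funext => s; rewrite /k; ring.
    exact: (ae_push cPhi h).
  have mL k' (ik' : cintegrable k') := Lp_measurable (L k' ik').
  rewrite (ae_eq_Lpnorm q1 (cmfB (cmfB (mL _ iz) (mL _ iz0)) (cmfZ (z - z0) (mL _ iD))) (mL _ ik) E).
  apply: (le_trans (opnorm_lift_conv ma a_bounds PhiK PsiK mPsi cPhi p1 ik lf)).
  have kr : fine (nint k) <= K * r ^+ 2.
    have [_ nk] := (cintegrableP k).1 ik.
    by rewrite -lee_fin fineK ?ge0_fin_numE ?nint_ge0//; apply: hK => //; exact: ltW.
  apply: lee_wpmul2r; first exact: Lpnorm_ge0.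
  rewrite lee_fin; apply: (@le_trans _ _ (4 * (K * r ^+ 2))).
    apply: ler_pM => //; rewrite ?powR_ge0 ?fine_ge0 ?nint_ge0//.
    exact: powR4_le.
  rewrite expr2 !mulrA ler_wpM2r//; apply: (@le_trans _ _ (r * (4 * (K + 1)))).
    by rewrite mulrC ler_wpM2l// ler_wpM2l// lerDl.
  by rewrite -ler_pdivlMr// ltW.
(* 4 bounds 4^{1/p}, and |z| / Re z < 1 / cos th in the sector. *)
- move=> th thpi; exists (4 * Num.sqrt (cos th)^-1) => z /eqP zn hth.
  have th0 : 0 < th by exact: le_lt_trans (normr_ge0 _) hth.
  have cth : 0 < cos th by apply: cos_gt0_pihalf; rewrite thpi andbT (lt_trans _ th0)// oppr_lt0 divr_gt0 ?pi_gt0.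
  have n0 : 0 < normc z.
    by rewrite lt_neqAle normc_ge0 andbT eq_sym; apply: contra zn => /eqP/normc_eq0 ->.
  have thle : th <= pi.
    by apply: (le_trans (ltW thpi)); rewrite ler_pdivrMr// ler_peMr ?pi_ge0// ler1n.
  have hRe := arg_lt_Re zn thle hth.
  have zRe : 0 < complex.Re z by apply: lt_trans hRe; rewrite mulr_gt0.
  have iz := cintegrable_zheat zRe.
  apply: opnorm_le => [|f lf]; first by rewrite mulr_ge0.
  apply: (le_trans (opnorm_lift_conv ma a_bounds PhiK PsiK mPsi cPhi p1 iz lf)).
  apply: lee_wpmul2r; first exact: Lpnorm_ge0.
  rewrite nint_zheat//= lee_fin; apply: ler_pM; rewrite ?powR_ge0//; first exact: powR4_le.
  rewrite ler_sqrt ?invr_ge0 ?(ltW cth)// ler_pdivrMr// mulrC -ler_pdivrMr ?invr_gt0//.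
  by rewrite invrK mulrC ltW.
Qed.

End kernel_and_holomorphy.

(** * The numerical range *)

Section compactly_supported.
Variable R : realType.
Local Notation mu := (@lebesgue_measure R).
Implicit Types (u v b g : R -> R) (K L n c : R).

Definition vanishes_off L u := forall x, L < `|x| -> u x = 0.

Definition test_fun L u := smooth u /\ vanishes_off L u.

Definition real_Hmin b u x : R := - (b x * derive1 (fun y => b y * derive1 u y) x).

Lemma vanishes_near L u x : vanishes_off L u -> L < `|x| -> \near x, u x = 0.
Proof.
move=> vu Lx; have h : \near x, L < `|x| by exact: (cvgr_gt _ (@norm_continuous _ _ x) _ Lx).
by apply: filterS h => y; exact: vu.
Qed.

Lemma derive1_near0 u (x : R) : (\near x, u x = 0) -> \near x, derive1 u x = 0.
Proof.
move=> u0; have h := near_eq_derive1 (g := fun=> 0) u0; apply: filterS h => y ->.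
by rewrite (derive1_eq (fun x => is_derive_cst (0:R) x 1)).
Qed.

Lemma vanishes_derive1 L u : vanishes_off L u -> vanishes_off L (derive1 u).
Proof. by move=> vu x Lx; apply: nbhs_singleton (derive1_near0 (vanishes_near vu Lx)). Qed.

Lemma vanishes_mull L u v : vanishes_off L u -> vanishes_off L (fun x => u x * v x).
Proof. by move=> vu x /vu ->; rewrite mul0r. Qed.

Lemma vanishes_mulr L u v : vanishes_off L v -> vanishes_off L (fun x => u x * v x).
Proof. by move=> vu x /vu ->; rewrite mulr0. Qed.

Lemma real_Hmin_near0 b u x : (\near x, u x = 0) -> real_Hmin b u x = 0.
Proof.
move=> /derive1_near0 u0; rewrite /real_Hmin.
have h : \near x, b x * derive1 u x = 0 by apply: filterS u0 => y ->; rewrite mulr0.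
by rewrite (nbhs_singleton (derive1_near0 h)) mulr0 oppr0.
Qed.

Lemma real_Hmin_vanishes L b u : vanishes_off L u -> vanishes_off L (real_Hmin b u).
Proof. by move=> vu x Lx; apply: real_Hmin_near0; exact: vanishes_near vu Lx. Qed.

Lemma smooth_real_Hmin b u : smooth b -> smooth u -> smooth (real_Hmin b u).
Proof.
move=> sb su.
exact: (smoothN (smoothM sb (smooth_derive1 (smoothM sb (smooth_derive1 su))))).
Qed.

Lemma derive1M u v : smooth u -> smooth v ->
  derive1 (fun x => u x * v x) = (fun x => derive1 u x * v x + u x * derive1 v x).
Proof.
move=> su sv; apply: derive1_eq => x.
apply: (is_derive_congr (is_derive_mul (smooth_is_derive x su) (smooth_is_derive x sv))).
exact: addrC.
Qed.

Lemma derive1_linear u v (s t : R) : smooth u -> smooth v ->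
  derive1 (fun x => s * u x + t * v x) = (fun x => s * derive1 u x + t * derive1 v x).
Proof.
move=> su sv; apply: derive1_eq => x.
have d w (r : R) (sw : smooth w) : is_derive x (1:R) (fun y => r * w y) (r * derive1 w x).
  by apply: (is_derive_congr (is_derive_mul (is_derive_cst r x 1) (smooth_is_derive x sw))); rewrite mul0r addr0.
exact: is_deriveD (d _ s su) (d _ t sv).
Qed.

Lemma real_Hmin_linear b u v (s t : R) x : smooth b -> smooth u -> smooth v ->
  real_Hmin b (fun x => s * u x + t * v x) x = s * real_Hmin b u x + t * real_Hmin b v x.
Proof.
move=> sb su sv; rewrite /real_Hmin derive1_linear//.
rewrite (_ : (fun y => b y * _) = fun y => s * (b y * derive1 u y) + t * (b y * derive1 v y)); last first.
  by apply/funext => y; ring.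
rewrite (derive1_linear s t (smoothM sb (smooth_derive1 su)) (smoothM sb (smooth_derive1 sv))).
have E (B p q : R) : - (B * (s * p + t * q)) = s * - (B * p) + t * - (B * q) by ring.
exact: E.
Qed.

Lemma derive1_affine u n c : smooth u ->
  derive1 (fun x => u (n * x + c)) = (fun x => n * derive1 u (n * x + c)).
Proof.
move=> su; apply: derive1_eq => x.
have da : is_derive x (1:R) (fun y => n * y + c) n.
  by apply: (is_derive_congr (is_deriveD (is_derive_mulr x n) (is_derive_cst c x 1))); rewrite addr0.
apply: (is_derive_congr (is_derive1_comp (g := fun y => n * y + c) (smooth_is_derive (n * x + c) su) da)).
by rewrite mulrC.
Qed.

Lemma continuous_affine n c : continuous (fun x : R => n * x + c).
Proof. by move=> x; apply: cvgD; [apply: cvgM; [exact: cvg_cst|exact: cvg_id]|exact: cvg_cst]. Qed.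

(** The gap L < K gives every point a neighbourhood on which either u vanishes or a is the rescaled
    b, as derivatives require; the two derivatives produce n^2. *)
Lemma real_Hmin_affine a b u n c K L x : smooth b -> test_fun L u -> L < K ->
  (forall y, `|n * y + c| < K -> a y = b (n * y + c)) ->
  real_Hmin a (fun y => u (n * y + c)) x = n ^+ 2 * real_Hmin b u (n * x + c).
Proof.
move=> sb [su vu] LK ab.
have ca := continuous_comp (@continuous_affine n c x) (@norm_continuous _ _ (n * x + c)).
have [xK|xK] := ltP `|n * x + c| K; last first.
  have Lx := lt_le_trans LK xK.
  rewrite (real_Hmin_vanishes b vu Lx) mulr0; apply: real_Hmin_near0.
  have h : \near x, L < `|n * x + c| by exact: (cvgr_gt _ ca _ Lx).
  by apply: filterS h => y; exact: vu.
have h : \near x, `|n * x + c| < K by exact: (cvgr_lt _ ca _ xK).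
have sbu : smooth (fun y => b y * derive1 u y) by exact: (smoothM sb (smooth_derive1 su)).
rewrite /real_Hmin ab// derive1_affine//.
(* The summand 0 * 0 gives the right side the shape expected by [derive1_linear]. *)
have E : \near x, a x * (n * derive1 u (n * x + c)) =
    n * (b (n * x + c) * derive1 u (n * x + c)) + 0 * 0.
  by apply: filterS h => y yK; rewrite ab//; ring.
rewrite (nbhs_singleton (near_eq_derive1 (g := fun x => n * (b (n * x + c) * derive1 u (n * x + c)) + 0 * 0) E)).
rewrite (derive1_linear n 0 (u := fun x => b (n * x + c) * derive1 u (n * x + c)) (v := fun=> 0)) ?mul0r ?addr0; last 2 first.
- exact: (smooth_affine (b := n) (c := c) sbu).
- exact: smooth_cst.
rewrite (derive1_affine n c sbu); ring.
Qed.

Lemma vanishes_integrable L g : continuous g -> vanishes_off L g ->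
  mu.-integrable setT (EFin \o g).
Proof.
move=> cg vg; have [+ _] := real_compact_integrable (- L) L cg.
congr integrable; apply/funext => s /=; case: (boolP (- L <= s <= L)) => [_|]; first by rewrite mul1r.
by rewrite -ler_norml -ltNge => /vg ->; rewrite mulr0.
Qed.

Lemma Rintegral_derive1 L g : 0 <= L -> smooth g -> vanishes_off L g ->
  \int[mu]_x (derive1 g x) = 0.
Proof.
move=> L0 sg vg; have L1 : - (L + 1) <= L + 1 by lra.
have := real_FTC L1 (fun x => smooth_is_derive x sg) (smooth_continuous (smooth_derive1 sg)).
rewrite !vg ?normrN ?(ger0_norm (addr_ge0 L0 ler01)) ?ltrDl// subrr => h; rewrite -[RHS]h.
apply: eq_Rintegral => s _; case: (boolP (- (L + 1) <= s <= L + 1)) => [_|]; first by rewrite mul1r.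
rewrite -ler_norml -ltNge => hs; rewrite mul0r (vanishes_derive1 vg)//.
by rewrite (le_lt_trans _ hs)// lerDl.
Qed.

(** The outer factor b is differentiated together with u. The resulting term u b' b v' destroys
    symmetry and positivity of the form. *)
Lemma integration_by_parts_Hmin L b u v : 0 <= L -> smooth b -> smooth v -> test_fun L u ->
  \int[mu]_x (u x * real_Hmin b v x) =
  \int[mu]_x ((derive1 u x * b x + u x * derive1 b x) * (b x * derive1 v x)).
Proof.
move=> L0 sb sv [su vu].
have sub := smoothM su sb; have sbv := smoothM sb (smooth_derive1 sv).
pose G x := (u x * b x) * (b x * derive1 v x).
have sG : smooth G by exact: smoothM.
have vG : vanishes_off L G by do 2 apply: vanishes_mull.
have E x : (derive1 u x * b x + u x * derive1 b x) * (b x * derive1 v x) = u x * real_Hmin b v x + derive1 G x.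
  by rewrite /G (derive1M sub sbv) (derive1M su sb) /real_Hmin; ring.
under [RHS]eq_Rintegral do rewrite E.
have i1 : mu.-integrable setT (EFin \o (fun x => u x * real_Hmin b v x)).
  apply: (vanishes_integrable (L := L)); last exact: vanishes_mull.
  exact: (smooth_continuous (smoothM su (smooth_real_Hmin sb sv))).
have i2 : mu.-integrable setT (EFin \o derive1 G).
  apply: (vanishes_integrable (L := L)); last exact: vanishes_derive1.
  exact: (smooth_continuous (smooth_derive1 sG)).
by rewrite (RintegralD _ i1 i2)// (Rintegral_derive1 L0 sG vG) addr0.
Qed.

Lemma Rintegral_step (r s e : R) : r <= s ->
  mu.-integrable setT (EFin \o (fun x : R => (r <= x <= s)%R%:R * e)) /\
  \int[mu]_x ((r <= x <= s)%R%:R * e) = e * (s - r).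
Proof.
move=> rs; have [i1 ->] := real_compact_integrable r s (@cst_continuous _ _ e).
split; first exact: i1.
rewrite Rintegral_cst//= lebesgue_measure_itv/= lte_fin; congr (_ * _).
by case: ltP => // sr; have -> : r = s; [apply/eqP; rewrite eq_le rs sr|rewrite subrr].
Qed.

Lemma Rintegral_le_step L g (c d K p q : R) : continuous g -> vanishes_off L g ->
  0 <= K -> p <= q ->
  (forall x, g x <= (- K <= x <= K)%R%:R * c + (p <= x <= q)%R%:R * d) ->
  \int[mu]_x g x <= c * (2 * K) + d * (q - p).
Proof.
move=> cg vg K0 pq h; have ig := vanishes_integrable cg vg.
have KK : - K <= K by lra.
have [i1 e1] := Rintegral_step c KK; have [i2 e2] := Rintegral_step d pq.
rewrite (_ : c * _ + _ = \int[mu]_x ((- K <= x <= K)%R%:R * c + (p <= x <= q)%R%:R * d)).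
  by apply: le_Rintegral => //; exact: (integrableD measurableT i1 i2).
by rewrite (RintegralD _ i1 i2)// e1 e2 opprK; congr (_ * _ + _); ring.
Qed.

Lemma Rintegral_gt0 L g (d p q : R) : continuous g -> vanishes_off L g -> p < q -> 0 < d ->
  (forall x, 0 <= g x) -> (forall x, p <= x <= q -> d <= g x) -> 0 < \int[mu]_x g x.
Proof.
move=> cg vg pq d0 g0 h; have ig := vanishes_integrable cg vg.
have [i1 e1] := Rintegral_step d (ltW pq).
apply: (@lt_le_trans _ _ (d * (q - p))); first by rewrite mulr_gt0// subr_gt0.
rewrite -e1; apply: le_Rintegral => // x _.
by case: (boolP (p <= x <= q)) => [/h|_]; rewrite ?mul1r ?mul0r.
Qed.

Lemma Rintegral_affine L g n c : continuous g -> vanishes_off L g -> 0 < n ->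
  \int[mu]_x g (n * x + c) = n^-1 * \int[mu]_x g x.
Proof.
move=> cg vg n0; have n1 : n != 0 by rewrite gt_eqF.
have mg : measurable_fun setT g by exact: continuous_measurable_fun.
pose k x := n^-1 * g x.
have mk : measurable_fun setT k by exact: measurable_funM.
have mkc : measurable_fun setT (fun x : R => k (x + c)).
  exact: (measurableT_comp mk (measurable_shift c)).
rewrite -RintegralZl//; last exact: vanishes_integrable cg vg.
rewrite /Rintegral -(integral_cov (cov_shift c) mk).
have := integral_cov (cov_scale n0) mkc; rewrite /cst /k => h.
under [in RHS]eq_integral do rewrite mulr1.
rewrite -h; congr fine; apply: eq_integral => x _; congr EFin.
by rewrite -[RHS]mulrA [RHS]mulrCA -[LHS]mulr1; congr (_ * _); rewrite mulVf.
Qed.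

End compactly_supported.

(** * The profile, its form and its twist *)

Section profiles.
Variables (R : realType) (chi : R -> R).
Local Notation mu := (@lebesgue_measure R).
Hypothesis chi_smooth : smooth chi.
Hypothesis chi_bounds : forall x : R, 0 <= chi x <= 3.
Hypothesis chi_mono : forall x : R, 0 <= derive1 chi x.
Hypothesis chi_left : forall x : R, x <= 0 -> chi x = 0.
Hypothesis chi_right : forall x : R, 3 <= x -> chi x = 3.
Hypothesis chi_mid : forall x : R, 1 <= x <= 2 -> chi x = x.

Definition Hform (b u v : R -> R) : R := \int[mu]_x (u x * real_Hmin b v x).

Lemma derive1_near_cst (u : R -> R) (c x : R) : (\near x, u x = c) -> derive1 u x = 0.
Proof.
move=> h; rewrite (nbhs_singleton (near_eq_derive1 (g := fun=> c) h)).
by rewrite (derive1_eq (fun x => is_derive_cst c x 1)).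
Qed.

Lemma derive1_chi_off (x : R) : x < 0 \/ 3 < x -> derive1 chi x = 0.
Proof.
case=> hx.
  by apply: (derive1_near_cst (c := 0)); near=> y; rewrite chi_left// ltW//; near: y; exact: lt_nbhsl.
by apply: (derive1_near_cst (c := 3)); near=> y; rewrite chi_right// ltW//; near: y; exact: lt_nbhsr.
Unshelve. all: by end_near. Qed.

Lemma derive1_chi_mid (x : R) : 1 < x < 2 -> derive1 chi x = 1.
Proof.
move=> /andP[x1 x2].
have h : \near x, chi x = x.
  near=> y; rewrite chi_mid//; apply/andP; split; apply: ltW; near: y; [exact: lt_nbhsr|exact: lt_nbhsl].
rewrite (nbhs_singleton (near_eq_derive1 (g := fun x => x) h)).
by rewrite (derive1_eq (fun x => is_derive_id x 1)).
Unshelve. all: by end_near. Qed.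

Lemma derive1_chi_bounded : exists2 M : R, 1 <= M & forall x, derive1 chi x <= M.
Proof.
have c1 : continuous (derive1 chi) by exact: (smooth_continuous (smooth_derive1 chi_smooth)).
have [c _ cM] := EVT_max (ler0n R 3) (continuous_subspaceT c1).
exists (derive1 chi c + 1); first by rewrite lerDr chi_mono.
move=> x; have [x0|x0] := ltP x 0; first by rewrite derive1_chi_off ?addr_ge0//; left.
have [x3|x3] := ltP 3 x; first by rewrite derive1_chi_off ?addr_ge0//; right.
by rewrite (le_trans (cM x _)) ?lerDl// in_itv/= x0.
Qed.

(** For L > 0 it climbs from 0 at - 4 L to 1 at - L; with - L in place of L it is the mirror
    image. *)
Definition half_cutoff (L s : R) : R := 3^-1 * chi (L^-1 * s + 4).

Definition cutoff (L s : R) : R := half_cutoff L s * half_cutoff (- L) s.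

Lemma smooth_half_cutoff L : smooth (half_cutoff L).
Proof. exact: (smoothZ (c := 3^-1) (smooth_affine (b := L^-1) (c := 4) chi_smooth)). Qed.

Lemma half_cutoff_bounds L s : 0 <= half_cutoff L s <= 1.
Proof.
by have /andP[h1 h2] := chi_bounds (L^-1 * s + 4); rewrite /half_cutoff; apply/andP; split; lra.
Qed.

Lemma derive1_half_cutoff L s :
  derive1 (half_cutoff L) s = 3^-1 * (L^-1 * derive1 chi (L^-1 * s + 4)).
Proof.
have sa := smooth_affine (b := L^-1) (c := 4) chi_smooth.
have s0 : smooth (fun=> 0 : R) by exact: smooth_cst.
rewrite (_ : half_cutoff L = (fun s => 3^-1 * chi (L^-1 * s + 4) + 0 * 0)); last first.
  by apply/funext => y; rewrite mul0r addr0.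
by rewrite (derive1_linear 3^-1 0 sa s0) (derive1_affine L^-1 4 chi_smooth) mul0r addr0.
Qed.

Lemma smooth_cutoff L : smooth (cutoff L).
Proof. exact: (smoothM (@smooth_half_cutoff L) (@smooth_half_cutoff (- L))). Qed.

Lemma cutoff_vanishes L : 0 < L -> vanishes_off (4 * L) (cutoff L).
Proof.
move=> L0 s; rewrite /cutoff /half_cutoff invrN; have i0 : 0 < L^-1 by rewrite invr_gt0.
have e : L^-1 * L = 1 by rewrite mulVf// gt_eqF.
rewrite real_ltr_normr ?num_real// => /orP[h|h].
  by rewrite [X in _ * (_ * X)]chi_left ?mulr0//; nra.
by rewrite chi_left ?mulr0 ?mul0r//; nra.
Qed.

Lemma cutoff1 L s : 0 < L -> `|s| <= L -> cutoff L s = 1.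
Proof.
move=> L0; rewrite ler_norml => /andP[h1 h2].
have i0 : 0 < L^-1 by rewrite invr_gt0.
have e : L^-1 * L = 1 by rewrite mulVf// gt_eqF.
by rewrite /cutoff /half_cutoff invrN !chi_right ?mulVf ?mulr1//; nra.
Qed.

Lemma derive1_cutoff_mid L s : 0 < L -> `|s| < L -> derive1 (cutoff L) s = 0.
Proof.
move=> L0 sL; apply: (derive1_near_cst (c := 1)).
have h : \near s, `|s| < L by exact: (cvgr_lt _ (@norm_continuous _ _ s) _ sL).
by apply: filterS h => y yL; apply: cutoff1 => //; exact: ltW.
Qed.

Lemma derive1_cutoff L s : derive1 (cutoff L) s =
  derive1 (half_cutoff L) s * half_cutoff (- L) s + half_cutoff L s * derive1 (half_cutoff (- L)) s.
Proof. by rewrite /cutoff (derive1M (@smooth_half_cutoff L) (@smooth_half_cutoff (- L))). Qed.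

Lemma derive1_cutoff_le L M s : 0 < L -> (forall x, derive1 chi x <= M) ->
  `|derive1 (cutoff L) s| <= M / L.
Proof.
move=> L0 hM; have i0 : 0 < L^-1 by rewrite invr_gt0.
rewrite derive1_cutoff !derive1_half_cutoff invrN.
set d1 := derive1 chi _; set d2 := derive1 chi _.
have /andP[p1 p2] := half_cutoff_bounds L s; have /andP[p3 p4] := half_cutoff_bounds (- L) s.
set h1 := half_cutoff L s in p1 p2 *; set h2 := half_cutoff (- L) s in p3 p4 *.
have d10 : 0 <= d1 by exact: chi_mono.
have d20 : 0 <= d2 by exact: chi_mono.
have d1M : d1 <= M by exact: hM.
have d2M : d2 <= M by exact: hM.
have q1 : 0 <= d1 * h2 <= M by rewrite mulr_ge0//= (le_trans _ d1M)// ler_piMr.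
have q2 : 0 <= h1 * d2 <= M by rewrite mulr_ge0//= (le_trans _ d2M)// ler_piMl.
rewrite (_ : _ + _ = L^-1 * (3^-1 * (d1 * h2 - h1 * d2))); last by ring.
rewrite normrM gtr0_norm// mulrC ler_wpM2r ?(ltW i0)// ler_norml.
by move: q1 q2 => /andP[? ?] /andP[? ?]; apply/andP; split; lra.
Qed.

Let b (s : R) : R := 1 + chi s.

Let smooth_b : smooth b.
Proof. exact: (smoothD (smooth_cst (c := 1)) chi_smooth). Qed.

Let derive1_b : derive1 b = derive1 chi.
Proof.
apply: derive1_eq => x.
apply: (is_derive_congr (is_deriveD (is_derive_cst (1:R) x 1) (smooth_is_derive x chi_smooth))).
exact: add0r.
Qed.

Definition profile (L s : R) : R := (8 - chi s) * cutoff L s.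

Let smooth_8chi : smooth (fun s => 8 - chi s).
Proof. exact: (smoothB (smooth_cst (c := 8)) chi_smooth). Qed.

Lemma smooth_profile L : smooth (profile L).
Proof. exact: (smoothM smooth_8chi (@smooth_cutoff L)). Qed.

Lemma profile_vanishes L : 0 < L -> vanishes_off (4 * L) (profile L).
Proof. by move=> L0; apply: vanishes_mulr; exact: cutoff_vanishes. Qed.

Lemma derive1_profile L s :
  derive1 (profile L) s = - derive1 chi s * cutoff L s + (8 - chi s) * derive1 (cutoff L) s.
Proof.
rewrite (derive1M smooth_8chi (@smooth_cutoff L)); congr (_ * _ + _).
have d x : is_derive x (1:R) (fun s => 8 - chi s) (- derive1 chi x).
  apply: (is_derive_congr (is_deriveB (is_derive_cst (8:R) x 1) (smooth_is_derive x chi_smooth))).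
  exact: sub0r.
by rewrite (derive1_eq d).
Qed.

(* The gain comes from [0, 3], where the cutoff is 1 and the integrand is
   - b (7 - 2 chi) chi'^2; elsewhere chi' = 0 and only the cutoff contributes. *)
Lemma profile_integrand_le L M s : 4 <= L -> 1 <= M -> (forall x, derive1 chi x <= M) ->
  (derive1 (profile L) s * b s + profile L s * derive1 b s) * (b s * derive1 (profile L) s) <=
  (- (4 * L) <= s <= 4 * L)%R%:R * ((32 * (M / L)) ^+ 2) + (5 / 4 <= s <= 7 / 4)%R%:R * (- 1).
Proof.
move=> L4 M1 hM; have L0 : 0 < L by lra.
have /andP[c1 c2] := chi_bounds s; have d0 := chi_mono s.
have c0 : 0 <= (32 * (M / L)) ^+ 2 by exact: sqr_ge0.
rewrite derive1_b.
have [/andP[s0 s3]|hs] := boolP (0 <= s <= 3).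
  have sL : `|s| < L by rewrite ger0_norm//; lra.
  rewrite derive1_profile /profile (cutoff1 L0 (ltW sL)) (derive1_cutoff_mid L0 sL) !mulr1 mulr0 addr0 /b.
  have -> : (- (4 * L) <= s <= 4 * L) = true by apply/andP; split; lra.
  set d := derive1 chi s in d0 *; set c := chi s in c1 c2 *.
  (* The left side is - d^2 (1 + c)(7 - 2 c), and both factors are at least 1 for 0 <= c <= 3. *)
  have E : (- d * (1 + c) + (8 - c) * d) * ((1 + c) * - d) <= - d ^+ 2.
    have k : 1 <= (1 + c) * (7 - 2 * c) by nra.
    rewrite (_ : _ * _ = - (d ^+ 2 * ((1 + c) * (7 - 2 * c)))); last by ring.
    by rewrite lerN2 ler_peMr ?sqr_ge0.
  apply: (le_trans E); rewrite mul1r.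
  (* This interval lies inside ]1, 2[, where chi' = 1, so the gain there is at least 1. *)
  case: (boolP (5 / 4 <= s <= 7 / 4)) => [/andP[h1 h2]|_].
    have d1 : d = 1 by apply: derive1_chi_mid; apply/andP; split; lra.
    by rewrite d1 expr1n mul1r lerDr.
  by rewrite mul0r addr0 (le_trans _ c0)// oppr_le0 sqr_ge0.
have -> : (5 / 4 <= s <= 7 / 4) = false.
  by apply/negbTE; apply: contra hs => /andP[h1 h2]; apply/andP; split; lra.
have d00 : derive1 chi s = 0.
  by apply: derive1_chi_off; move: hs; rewrite negb_and -!ltNge => /orP[]; [left|right].
rewrite mul0r addr0 d00 mulr0 addr0.
have [_|hs4] := boolP (- (4 * L) <= s <= 4 * L); last first.
  have h : 4 * L < `|s| by rewrite ltNge ler_norml.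
  rewrite (vanishes_derive1 (profile_vanishes L0) h) !mulr0.
  by rewrite mul0r.
rewrite mul1r derive1_profile d00 oppr0 mul0r add0r (exprMn 2 32).
have := derive1_cutoff_le s L0 hM; set e := derive1 _ _; set m := M / L => he.
have e2 : e ^+ 2 <= m ^+ 2 by rewrite -(real_normK (num_real e)) ler_sqr ?nnegrE// (le_trans _ he).
rewrite /b (_ : _ * _ * (1 + chi s) * _ = ((1 + chi s) * (8 - chi s)) ^+ 2 * e ^+ 2); last by ring.
(* From 1 + chi <= 4 and 8 - chi <= 8. *)
have k0 : 0 <= (1 + chi s) * (8 - chi s) <= 32 by apply/andP; split; nra.
apply: ler_pM; rewrite ?sqr_ge0//; move: k0 => /andP[k1 k2].
by rewrite ler_sqr ?nnegrE.
Qed.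

Lemma Hform_profile_lt0 : exists2 L, 4 <= L & Hform b (profile L) (profile L) < 0.
Proof.
have [M M1 hM] := derive1_chi_bounded.
(* The cutoff costs at most 8 L (32 M / L)^2 = (128 M)^2 / (2 L), less than the gain 1/2 from
   [5/4, 7/4] once L > (128 M)^2. *)
pose L := 4 + (128 * M) ^+ 2.
have L4 : 4 <= L by rewrite lerDl sqr_ge0.
have L0 : 0 < L by lra.
exists L => //; rewrite /Hform.
have L40 : 0 <= 4 * L by lra.
have tp : test_fun (4 * L) (profile L) by split; [exact: smooth_profile|exact: profile_vanishes].
rewrite (integration_by_parts_Hmin L40 smooth_b (@smooth_profile L) tp).
have sp := @smooth_profile L; have sp1 := smooth_derive1 sp.
have cg := smooth_continuous (smoothM (smoothD (smoothM sp1 smooth_b) (smoothM sp (smooth_derive1 smooth_b)))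
   (smoothM smooth_b sp1)).
apply: le_lt_trans (Rintegral_le_step cg _ L40 _ (fun s => profile_integrand_le s L4 M1 hM)) _.
- by do 2 apply: vanishes_mulr; apply: vanishes_derive1; exact: (proj2 tp).
- by lra.
rewrite (_ : _ + _ = ((128 * M) ^+ 2 / L - 1) / 2); last by field; rewrite gt_eqF.
by rewrite ltr_pdivrMr// mul0r subr_lt0 ltr_pdivrMr// mul1r /L ltrDr.
Qed.

(** After integration by parts the symmetric terms cancel and b b' (u v' - v u') remains. For v = s
    u this is b b' u^2, nonnegative as b increases and at least 1 on [5/4, 7/4]. *)
Lemma Hform_twist_gt0 L : 4 <= L ->
  0 < Hform b (profile L) (fun s => s * profile L s) - Hform b (fun s => s * profile L s) (profile L).
Proof.
have h57 : 5 / 4 < 7 / 4 :> R by lra.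
move=> L4; have L0 : 0 < L by lra.
have L40 : 0 <= 4 * L by lra.
have b1 s : 1 <= b s by have /andP[c1 c2] := chi_bounds s; rewrite /b lerDl.
have low s : 5 / 4 <= s <= 7 / 4 -> 1 <= b s * derive1 chi s * (profile L s * profile L s).
  move=> /andP[h1 h2]; have /andP[c1 c2] := chi_bounds s.
  have s12 : 1 < s < 2 by apply/andP; split; lra.
  have sL : `|s| <= L by rewrite ger0_norm; lra.
  rewrite (derive1_chi_mid s12) /profile (cutoff1 L0 sL) !mulr1.
  have := b1 s; have e8 : 1 <= (8 - chi s) * (8 - chi s) by nra.
  by move=> bs; nra.
have sp := @smooth_profile L; have sp1 := smooth_derive1 sp; have vp := profile_vanishes L0.
have sv := smoothM (@smooth_id R) sp; have sv1 := smooth_derive1 sv; have sb1 := smooth_derive1 smooth_b.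
have vv : vanishes_off (4 * L) (fun s => s * profile L s) by exact: vanishes_mulr.
have tp : test_fun (4 * L) (profile L) by [].
have tv : test_fun (4 * L) (fun s => s * profile L s) by [].
have e1 : Hform b (profile L) (fun s => s * profile L s) = _ := integration_by_parts_Hmin L40 smooth_b sv tp.
have e2 : Hform b (fun s => s * profile L s) (profile L) = _ := integration_by_parts_Hmin L40 smooth_b sp tv.
rewrite e1 e2.
have dv s : derive1 (fun s => s * profile L s) s = profile L s + s * derive1 (profile L) s.
  by rewrite (derive1M (@smooth_id R) sp) (derive1_eq (fun x => is_derive_id x 1)) mul1r.
have sg1 := smoothM (smoothD (smoothM sp1 smooth_b) (smoothM sp sb1)) (smoothM smooth_b sv1).
have sg2 := smoothM (smoothD (smoothM sv1 smooth_b) (smoothM sv sb1)) (smoothM smooth_b sp1).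
have vg1 := vanishes_mulr (fun s => derive1 (profile L) s * b s + profile L s * derive1 b s)
  (vanishes_mulr b (vanishes_derive1 vv)).
have vg2 := vanishes_mulr (fun s => derive1 (fun s => s * profile L s) s * b s + (s * profile L s) * derive1 b s)
  (vanishes_mulr b (vanishes_derive1 vp)).
rewrite -(RintegralB measurableT (vanishes_integrable (smooth_continuous sg1) vg1)
  (vanishes_integrable (smooth_continuous sg2) vg2)).
under eq_Rintegral => s _.
  rewrite !dv derive1_b (_ : _ - _ = b s * derive1 chi s * (profile L s * profile L s)); last by ring.
  over.
have sh := smoothM (smoothM smooth_b (smooth_derive1 chi_smooth)) (smoothM sp sp).
have vh : vanishes_off (4 * L) (fun s => b s * derive1 chi s * (profile L s * profile L s)).
  by move=> s hs; rewrite (vp s hs) !mulr0.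
apply: (Rintegral_gt0 (d := 1) (p := 5 / 4) (q := 7 / 4) (smooth_continuous sh) vh) => //.
- move=> s; rewrite -expr2 mulr_ge0 ?sqr_ge0// mulr_ge0 ?chi_mono//.
  exact: le_trans (b1 s).
Qed.

Lemma Hform_cutoff_gt0 : 0 < Hform (fun=> 1) (cutoff 1) (cutoff 1).
Proof.
have sc := @smooth_cutoff 1; have sc1 := smooth_derive1 sc.
have vc := cutoff_vanishes (ltr01 : 0 < 1 :> R).
have L40 : 0 <= 4 * 1 :> R by rewrite mulr1.
rewrite /Hform (integration_by_parts_Hmin L40 (smooth_cst (c := 1)) sc (conj sc vc)).
under eq_Rintegral => s _.
  rewrite (derive1_eq (fun x => is_derive_cst (1:R) x 1)) mulr0 addr0 mulr1 mul1r.
  over.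
have sh := smoothM sc1 sc1.
have vh := vanishes_mulr (derive1 (cutoff 1)) (vanishes_derive1 vc).
(* On this interval s + 4 lies in [5/4, 7/4], so the rising half of the cutoff has slope 1/3 and the
   other half is constantly 1. *)
apply: (Rintegral_gt0 (d := 9^-1) (p := - (11 / 4)) (q := - (9 / 4)) (smooth_continuous sh) vh) => //.
- by lra.
- by move=> s; rewrite -expr2 sqr_ge0.
- move=> s /andP[h1 h2].
  rewrite derive1_cutoff !derive1_half_cutoff invrN invr1 mul1r !mulN1r.
  rewrite derive1_chi_mid; last by apply/andP; split; lra.
  rewrite derive1_chi_off; last by right; lra.
  rewrite /half_cutoff invrN invr1 mulN1r [in chi (_ + 4)]chi_right; last by lra.
  by lra.
Qed.

Lemma Rintegral_sqr_cutoff_gt0 : 0 < \int[mu]_s (cutoff 1 s * cutoff 1 s).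
Proof.
have sc := @smooth_cutoff 1; have sh := smoothM sc sc.
have vc := cutoff_vanishes (ltr01 : 0 < 1 :> R).
have L40 : 0 <= 4 * 1 :> R by rewrite mulr1.
have vh := vanishes_mulr (cutoff 1) vc.
apply: (Rintegral_gt0 (d := 1) (p := - 1) (q := 1) (smooth_continuous sh) vh) => //.
- by move=> s; rewrite -expr2 sqr_ge0.
- by move=> s h; rewrite cutoff1 ?ltr01 ?ler_norml// mulr1.
Qed.

End profiles.

(** * Forms and norms of complex test functions *)

Section test_functions.
Variables (R : realType) (a : R -> R).
Local Notation C := R[i].
Local Notation mu := (@lebesgue_measure R).
Hypothesis smooth_a : smooth a.
Implicit Types (u v w U W g : R -> R) (L : R).

Definition cpair U W : R -> C := fun x => U x +i* W x.

Lemma vanishes_bounded L g : continuous g -> vanishes_off L g -> exists M : R, forall x, `|g x| <= M.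
Proof.
move=> cg vg; pose K := `|L|; have K0 : - K <= K by rewrite ge0_cp ?normr_ge0.
have cn : continuous (fun x => `|g x|).
  by move=> x; apply: (@continuous_comp _ _ _ g (fun y : R => `|y|) x); [exact: cg|exact: norm_continuous].
have [c _ cM] := EVT_max K0 (continuous_subspaceT cn).
exists `|g c| => x; have [hx|hx] := boolP (- K <= x <= K); first by apply: cM; rewrite in_itv.
rewrite vg ?normr0//; rewrite -ler_norml -ltNge in hx.
exact: le_lt_trans (ler_norm L) hx.
Qed.

Lemma cpair_Lp q L U W : (1 <= q)%E -> continuous U -> continuous W ->
  vanishes_off L U -> vanishes_off L W -> Lp q (cpair U W).
Proof.
move=> q1 cU cW vU vW; have [M hM] := vanishes_bounded cU vU; have [N hN] := vanishes_bounded cW vW.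
apply: (Lp_bounded_integrable (M := M + N) q1).
  by split; [exact: vanishes_integrable cU vU|exact: vanishes_integrable cW vW].
by move=> x; apply: (le_trans (normc_le_ReIm _)); apply: lerD; [exact: hM|exact: hN].
Qed.

Lemma Hmin_cpair U W : Hmin a (cpair U W) = cpair (real_Hmin a U) (real_Hmin a W).
Proof.
have E (P Q : R -> R) : Xop a (cpair P Q) = cpair (fun x => a x * derive1 P x) (fun x => a x * derive1 Q x).
  by apply/funext => x; apply: complex_ext; rewrite /Xop ?ReZ ?ImZ.
by apply/funext => x; rewrite /Hmin !E; apply: complex_ext; rewrite ?ReN ?ImN.
Qed.

Lemma Ccinfty_cpair L U W : test_fun L U -> test_fun L W -> Ccinfty (cpair U W).
Proof.
move=> [sU vU] [sW vW]; split; first exact: (conj sU sW).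
apply: (subclosed_compact (B := `[- L, L]%classic)); [exact: closed_closure|exact: segment_compact|].
have h : [set x | cpair U W x <> 0] `<=` `[- L, L]%classic.
  move=> x /= hx; rewrite in_itv/= -ler_norml leNgt; apply/negP => Lx; apply: hx.
  by rewrite /cpair vU// vW.
by apply: subset_trans (closure_subset h) _; rewrite -((closure_id _).1 (@itv_closed _ _ (- L) L)).
Qed.

Lemma inner_cpair L U W : test_fun L U -> test_fun L W ->
  inner (cpair U W) (Hmin a (cpair U W)) =
    (Hform a U U + Hform a W W) +i* (Hform a U W - Hform a W U).
Proof.
move=> [sU vU] [sW vW].
have i P Q : smooth P -> smooth Q -> vanishes_off L P ->
    mu.-integrable setT (EFin \o (fun x => P x * real_Hmin a Q x)).
  move=> sP sQ vP; apply: (vanishes_integrable (L := L) (smooth_continuous (smoothM sP (smooth_real_Hmin smooth_a sQ)))).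
  exact: vanishes_mull.
rewrite /inner Hmin_cpair /cint /Hform; congr (_ +i* _).
  rewrite -(RintegralD measurableT (i _ _ sU sU vU) (i _ _ sW sW vW)).
  by apply: eq_Rintegral => x _; rewrite ReM ReJ ImJ/= mulNr opprK.
rewrite -(RintegralB measurableT (i _ _ sU sW vU) (i _ _ sW sU vW)).
by apply: eq_Rintegral => x _; rewrite ImM ReJ ImJ/= mulNr.
Qed.

Lemma Lpnorm2_cpair L U W : test_fun L U -> test_fun L W ->
  Lpnorm 2%:E (cpair U W) = (Num.sqrt (\int[mu]_x (U x * U x) + \int[mu]_x (W x * W x)))%:E.
Proof.
move=> [sU vU] [sW vW].
have i P : smooth P -> vanishes_off L P -> mu.-integrable setT (EFin \o (fun x => P x * P x)).
  by move=> sP vP; apply: (vanishes_integrable (L := L) (smooth_continuous (smoothM sP sP))); exact: vanishes_mull.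
rewrite Lpnorm_Npow -(RintegralD measurableT (i _ sU vU) (i _ sW vW)).
have E : (\int[mu]_x (normc (cpair U W x) `^ 2)%:E = (\int[mu]_x (U x * U x + W x * W x))%:E)%E.
  rewrite /Rintegral fineK; last first.
    apply: integrable_fin_num => //.
    exact: (integrableD measurableT (i _ sU vU) (i _ sW vW)).
  apply: eq_integral => x _; congr EFin.
  by rewrite powR_mulrn ?normc_ge0// sqr_normc !expr2.
rewrite /Npow E poweR_EFin powR12_sqrt//.
by apply: Rintegral_ge0 => x _; rewrite addr_ge0// -expr2 sqr_ge0.
Qed.

Lemma test_fun_combine L u v (s t : R) : test_fun L u -> test_fun L v ->
  test_fun L (fun x => s * u x + t * v x).
Proof.
move=> [su vu] [sv vv]; split; first exact: (smoothD (smoothZ (c := s) su) (smoothZ (c := t) sv)).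
by move=> x hx; rewrite vu ?vv// !mulr0 addr0.
Qed.

Lemma test_funW L K u : L <= K -> test_fun L u -> test_fun K u.
Proof. by move=> LK [su vu]; split => // x hx; apply: vu; exact: le_lt_trans hx. Qed.

Lemma test_fun_affine L u (n c : R) : 0 < n -> test_fun L u ->
  test_fun ((L + `|c|) / n) (fun x => u (n * x + c)).
Proof.
move=> n0 [su vu]; split; first exact: (smooth_affine (b := n) (c := c) su).
move=> x; rewrite ltr_pdivrMr// -ltrBrDr => hx; apply: vu; apply: (lt_le_trans hx).
rewrite -{1}(gtr0_norm n0) -normrM (mulrC x) -{1}(addrK c (n * x)).
by rewrite lerBlDr ler_normB.
Qed.

(* The cross terms vanish when the supports of u and v are disjoint from that
   of w. *)
Lemma disjoint_Rintegral L u w v' w' (s t p q : R) :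
  continuous u -> continuous w -> continuous v' -> continuous w' ->
  vanishes_off L u -> vanishes_off L w ->
  (forall x, u x * w' x = 0) -> (forall x, w x * v' x = 0) ->
  \int[mu]_x ((s * u x + t * w x) * (p * v' x + q * w' x)) =
  s * p * \int[mu]_x (u x * v' x) + t * q * \int[mu]_x (w x * w' x).
Proof.
move=> cu cw cv' cw' vu vw uw wv.
have cM (f g : R -> R) : continuous f -> continuous g -> continuous (fun x => f x * g x).
  by move=> cf cg x; apply: cvgM; [exact: cf|exact: cg].
have i1 := vanishes_integrable (cM _ _ cu cv') (vanishes_mull v' vu).
have i2 := vanishes_integrable (cM _ _ cw cw') (vanishes_mull w' vw).
rewrite -(RintegralZl _ measurableT i1) -(RintegralZl _ measurableT i2) -RintegralD//; last 2 first.
- apply: (vanishes_integrable (L := L) (cM _ _ (@cst_continuous _ _ (s * p)) (cM _ _ cu cv'))).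
  by move=> x hx; rewrite vu// mul0r mulr0.
- apply: (vanishes_integrable (L := L) (cM _ _ (@cst_continuous _ _ (t * q)) (cM _ _ cw cw'))).
  by move=> x hx; rewrite vw// mul0r mulr0.
apply: eq_Rintegral => x _.
transitivity (s * p * (u x * v' x) + t * q * (w x * w' x) + s * q * (u x * w' x) + t * p * (w x * v' x)).
  by ring.
by rewrite uw wv !mulr0 !addr0.
Qed.

End test_functions.

(** * The generator on test functions *)

Section generator_on_test_functions.
Variables (R : realType) (a Phi Psi : R -> R).
Local Notation C := R[i].
Local Notation mu := (@lebesgue_measure R).
Hypothesis smooth_a : smooth a.
Hypothesis a_bounds : forall x, 1 <= a x <= 4.
Hypothesis PhiK : cancel Phi Psi.
Hypothesis PsiK : cancel Psi Phi.
Hypothesis mPsi : measurable_fun setT Psi.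
Hypothesis cPhi : is_cov Phi (fun x => (a x)^-1).
Hypothesis flowE : forall t x, flow a t x = Psi (Phi x + t).
Hypothesis is_derive_Psi : forall u, is_derive u (1:R) Psi (a (Psi u)).
Implicit Types (U W : R -> R) (q : \bar R).

Let ma : measurable_fun setT a.
Proof. exact: continuous_measurable_fun (smooth_continuous smooth_a). Qed.

(** In the coordinate u the field X is d/du, since P o Psi has derivative (a P') o Psi; the claim
    becomes [Hheat_C2]. *)
Lemma Hgen_cpair q L U W : (1 <= q)%E -> test_fun L U -> test_fun L W ->
  Hgen a q (cpair U W) (Hmin a (cpair U W)).
Proof.
move=> q1 [sU vU] [sW vW].
apply/(Hgen_heat ma a_bounds PhiK PsiK mPsi cPhi flowE _ _ q1); rewrite Hmin_cpair.
pose X (P : R -> R) x := a x * derive1 P x.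
have sX P : smooth P -> smooth (X P) by move=> sP; exact: (smoothM smooth_a (smooth_derive1 sP)).
have vX P : vanishes_off L P -> vanishes_off L (X P).
  by move=> vP; apply: vanishes_mulr; exact: vanishes_derive1.
have dX P u : smooth P -> is_derive u (1:R) (fun u => P (Psi u)) (X P (Psi u)).
  move=> sP; apply: (is_derive_congr (is_derive1_comp (g := Psi) (smooth_is_derive (Psi u) sP) (is_derive_Psi u))).
  exact: mulrC.
have lp P Q : smooth P -> smooth Q -> vanishes_off L P -> vanishes_off L Q -> Lp q (pull Psi (cpair P Q)).
  move=> sP sQ vP vQ; apply: (Lp_pull ma a_bounds PhiK mPsi cPhi q1).
  exact: (cpair_Lp (L := L) q1 (smooth_continuous sP) (smooth_continuous sQ)).
have -> : pull Psi (cpair (real_Hmin a U) (real_Hmin a W)) = (fun u => - pull Psi (cpair (X (X U)) (X (X W))) u).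
  by apply/funext => u; apply: complex_ext; rewrite ?ReN ?ImN.
have cPsi : continuous Psi by exact: is_derive_cont is_derive_Psi.
apply: (Hheat_C2 (f1 := pull Psi (cpair (X U) (X W))) q1).
- by move=> u; split; exact: dX.
- by move=> u; split; apply: dX; exact: sX.
- apply: (ccont_comp (f := cpair (X (X U)) (X (X W)))) => //.
  exact: (conj (smooth_continuous (sX _ (sX _ sU))) (smooth_continuous (sX _ (sX _ sW)))).
- exact: lp.
- exact: (lp _ _ (sX _ (sX _ sU)) (sX _ (sX _ sW)) (vX _ (vX _ vU)) (vX _ (vX _ vW))).
Qed.

End generator_on_test_functions.

(** * Test functions at two scales *)

Section scaled_profiles.
Variables (R : realType) (a b u v w : R -> R) (L : R).
Local Notation C := R[i].
Local Notation mu := (@lebesgue_measure R).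
Hypothesis smooth_a : smooth a.
Hypothesis smooth_b : smooth b.
Hypothesis tu : test_fun L u.
Hypothesis tv : test_fun L v.
Hypothesis tw : test_fun L w.
Hypothesis a_site : forall (n : nat) y, (0 < n)%N ->
  `|n%:R * y - 16 * n%:R ^+ 2| < 5 * n%:R -> a y = b (n%:R * y - 16 * n%:R ^+ 2).
Hypothesis a_left : forall y, y < 16 -> a y = 1.

(** The factor n is n^2 from the two derivatives times 1/n from dx. *)
Lemma Hform_affine (a' b' f g : R -> R) (n c K : R) : smooth b' -> test_fun L f -> test_fun L g ->
  L < K -> 0 < n -> (forall y, `|n * y + c| < K -> a' y = b' (n * y + c)) ->
  Hform a' (fun x => f (n * x + c)) (fun x => g (n * x + c)) = n * Hform b' f g.
Proof.
move=> sb tf tg LK n0 hab; have [sf vf] := tf; have [sg vg] := tg.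
have sfg := smoothM sf (smooth_real_Hmin sb sg); have vfg := vanishes_mull (real_Hmin b' g) vf.
pose G x := n ^+ 2 * (f x * real_Hmin b' g x).
transitivity (\int[mu]_x G (n * x + c)).
  by apply: eq_Rintegral => x _; rewrite (real_Hmin_affine x sb tg LK hab) mulrCA.
have sG : smooth G by exact: (smoothZ (c := n ^+ 2) sfg).
have vG : vanishes_off L G by move=> x hx; rewrite /G vf// mul0r mulr0.
rewrite (Rintegral_affine c (smooth_continuous sG) vG n0).
rewrite (RintegralZl _ measurableT (vanishes_integrable (smooth_continuous sfg) vfg)) mulrA.
by rewrite expr2 mulrA mulVf ?mul1r// gt_eqF.
Qed.

Lemma Rintegral_mul_affine (f g : R -> R) (n c : R) : test_fun L f -> test_fun L g -> 0 < n ->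
  \int[mu]_x (f (n * x + c) * g (n * x + c)) = n^-1 * \int[mu]_x (f x * g x).
Proof.
move=> [sf vf] [sg vg] n0.
exact: (Rintegral_affine c (smooth_continuous (smoothM sf sg)) (vanishes_mull g vf) n0).
Qed.

(** U = s u_n + t w_l and W = p v_n, where u and v are squeezed onto the n-th site and w is dilated
    by l about 0. L < 5 n keeps the site functions within distance 5 of 16 n, L < 10 l keeps w_l in
    |y| < 10 where a = 1; the supports are disjoint and forms and norms add up. *)
Lemma two_scale_test_functions (n : nat) (l s t p : R) : (0 < n)%N -> 0 <= L ->
  L < 5 * n%:R -> 0 < l -> L < 10 * l ->
  exists K U W, [/\ test_fun K U, test_fun K W,
    Hform a U U + Hform a W W = n%:R * (s ^+ 2 * Hform b u u + p ^+ 2 * Hform b v v) +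
      l * (t ^+ 2 * Hform (fun=> 1) w w),
    Hform a U W - Hform a W U = n%:R * (s * p * (Hform b u v - Hform b v u)) &
    \int[mu]_x (U x * U x) + \int[mu]_x (W x * W x) =
      n%:R^-1 * (s ^+ 2 * \int[mu]_x (u x * u x) + p ^+ 2 * \int[mu]_x (v x * v x)) +
      l^-1 * (t ^+ 2 * \int[mu]_x (w x * w x))].
Proof.
move=> n0 L0 Ln l0 Ll; have nR : 0 < n%:R :> R by rewrite ltr0n.
have n1 : 1 <= n%:R :> R by rewrite ler1n.
pose c : R := - (16 * n%:R ^+ 2).
have site y : `|n%:R * y + c| < 5 * n%:R -> a y = b (n%:R * y + c) by exact: a_site.
have left y : `|l * y + 0| < 10 * l -> a y = (fun=> 1) (l * y + 0).
  rewrite addr0 ltr_norml => /andP[_ h]; apply: a_left.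
  rewrite mulrC ltr_pM2r// in h; exact: (lt_trans h (ltr_nat R 10 16)).
have off x : L < `|n%:R * x + c| \/ L < `|l * x + 0|.
  have [h1|h1] := ltP L `|n%:R * x + c|; [by left|right].
  rewrite addr0 (lt_le_trans Ll)//; move: (le_lt_trans h1 Ln); rewrite ltr_norml /c => /andP[h2 _].
  have x10 : 10 <= x.
    rewrite leNgt; apply/negP => x10; move: h2; rewrite ltNge => /negP; apply.
    by rewrite expr2; nra.
  by rewrite (le_trans _ (ler_norm _))// mulrC ler_wpM2l// ltW.
pose w1 x := w (l * x + 0).
pose K := Num.max ((L + `|c|) / n%:R) ((L + `|0 : R|) / l).
have tu1 : test_fun K (fun x => u (n%:R * x + c)) by apply: test_funW (test_fun_affine c nR tu); rewrite le_max lexx.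
have tv1 : test_fun K (fun x => v (n%:R * x + c)) by apply: test_funW (test_fun_affine c nR tv); rewrite le_max lexx.
have tw1 : test_fun K w1 by apply: test_funW (test_fun_affine 0 l0 tw); rewrite le_max lexx orbT.
have H1 f (tf : test_fun L f) x : L < `|n%:R * x + c| -> real_Hmin a (fun x => f (n%:R * x + c)) x = 0.
  move=> hx; rewrite (real_Hmin_affine x smooth_b tf Ln site).
  by rewrite (real_Hmin_vanishes b (proj2 tf) hx) mulr0.
have Hw x : L < `|l * x + 0| -> real_Hmin a w1 x = 0.
  move=> hx; rewrite (real_Hmin_affine x (smooth_cst (c := 1)) tw Ll left).
  by rewrite (real_Hmin_vanishes _ (proj2 tw) hx) mulr0.
have cH f (tf : test_fun K f) : continuous (real_Hmin a f).
  exact: (smooth_continuous (smooth_real_Hmin smooth_a (proj1 tf))).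
have HF f g : test_fun K (fun x => f (n%:R * x + c)) -> test_fun K (fun x => g (n%:R * x + c)) ->
    test_fun L f -> test_fun L g ->
    forall s t p q, Hform a (fun x => s * f (n%:R * x + c) + t * w1 x) (fun x => p * g (n%:R * x + c) + q * w1 x) =
      n%:R * (s * p * Hform b f g) + l * (t * q * Hform (fun=> 1) w w).
  move=> tf1 tg1 tf tg s' t' p' q'.
  have e1 := Hform_affine smooth_b tf tg Ln nR site.
  have e2 := Hform_affine (smooth_cst (c := 1)) tw tw Ll l0 left.
  rewrite -mulrCA -e1 -mulrCA -e2 /Hform.
  rewrite -(disjoint_Rintegral s' t' p' q' (smooth_continuous (proj1 tf1)) (smooth_continuous (proj1 tw1))
    (cH _ tg1) (cH _ tw1) (proj2 tf1) (proj2 tw1)).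
  - by apply: eq_Rintegral => x _; rewrite (real_Hmin_linear _ _ _ smooth_a (proj1 tg1) (proj1 tw1)).
  - by move=> x; have [/(proj2 tf) ->|/Hw ->] := off x; rewrite ?mul0r ?mulr0.
  - by move=> x; have [/(H1 _ tg) ->|/(proj2 tw)] := off x; rewrite ?mulr0// /w1 => ->; rewrite mul0r.
have HL f : test_fun K (fun x => f (n%:R * x + c)) -> test_fun L f ->
    forall s t, \int[mu]_x ((s * f (n%:R * x + c) + t * w1 x) * (s * f (n%:R * x + c) + t * w1 x)) =
      n%:R^-1 * (s ^+ 2 * \int[mu]_x (f x * f x)) + l^-1 * (t ^+ 2 * \int[mu]_x (w x * w x)).
  move=> tf1 tf s' t'.
  have e1 := Rintegral_mul_affine c tf tf nR.
  have e2 := Rintegral_mul_affine 0 tw tw l0.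
  rewrite -mulrCA -e1 -mulrCA -e2 !expr2.
  have [cf cw] := (smooth_continuous (proj1 tf1), smooth_continuous (proj1 tw1)).
  rewrite -(disjoint_Rintegral s' t' s' t' cf cw cf cw (proj2 tf1) (proj2 tw1))//.
  - by move=> x; have [/(proj2 tf) ->|/(proj2 tw)] := off x; rewrite ?mul0r// /w1 => ->; rewrite mulr0.
  - by move=> x; have [/(proj2 tf) ->|/(proj2 tw)] := off x; rewrite ?mulr0// /w1 => ->; rewrite mul0r.
(* The summand with coefficient 0 lets [HF] and [HL] cover W as well. *)
exists K, (fun x => s * u (n%:R * x + c) + t * w1 x), (fun x => p * v (n%:R * x + c) + 0 * w1 x).
split; [exact: (test_fun_combine s t tu1 tw1)|exact: (test_fun_combine p 0 tv1 tw1)|..].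
- have E1 := HF u u tu1 tu1 tu tu s t s t; have E2 := HF v v tv1 tv1 tv tv p 0 p 0.
  apply: (etrans (f_equal2 (fun x y : R => x + y) E1 E2)).
  by move: (Hform b u u) (Hform b v v) (Hform _ w w) => A B D; ring.
- have E1 := HF u v tu1 tv1 tu tv s t p 0; have E2 := HF v u tv1 tu1 tv tu p 0 s t.
  apply: (etrans (f_equal2 (fun x y : R => x - y) E1 E2)).
  by move: (Hform b u v) (Hform b v u) (Hform _ w w) => A B D; ring.
- have E1 := HL u tu1 tu s t; have E2 := HL v tv1 tv p 0.
  apply: (etrans (f_equal2 (fun x y : R => x + y) E1 E2)).
  by move: (\int[mu]_x (u x * u x)) (\int[mu]_x (v x * v x)) (\int[mu]_x (w x * w x)) => A B D; ring.
Qed.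

End scaled_profiles.

(** * The numerical range *)

Section numerical_range.
Variables (R : realType) (chi : R -> R).
Local Notation C := R[i].
Local Notation mu := (@lebesgue_measure R).
Hypothesis chi_smooth : smooth chi.
Hypothesis chi_bounds : forall x : R, 0 <= chi x <= 3.
Hypothesis chi_mono : forall x : R, 0 <= derive1 chi x.
Hypothesis chi_left : forall x : R, x <= 0 -> chi x = 0.
Hypothesis chi_right : forall x : R, 3 <= x -> chi x = 3.
Hypothesis chi_mid : forall x : R, 1 <= x <= 2 -> chi x = x.

Let a := coeff chi.
Let sa : smooth a. Proof. exact: (smooth_coeff chi_smooth chi_left chi_right). Qed.
Let ca : continuous a. Proof. exact: (smooth_continuous sa). Qed.
Let a_bounds : forall x, 1 <= a x <= 4.
Proof. exact: (coeff_bounds chi_bounds chi_left chi_right). Qed.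
Let a_left16 x : x < 16 -> a x = 1. Proof. exact: coeff_left. Qed.
Let a_left x : x < 1 -> a x = 1.
Proof. by move=> x1; apply: a_left16; rewrite (lt_trans x1)// ltr1n. Qed.

Let a_site (n : nat) (y : R) : (0 < n)%N ->
  `|n%:R * y - 16 * n%:R ^+ 2| < 5 * n%:R -> a y = 1 + chi (n%:R * y - 16 * n%:R ^+ 2).
Proof.
move=> n0; have nR : 0 < n%:R :> R by rewrite ltr0n.
rewrite (_ : _ - _ = n%:R * (y - 16 * n%:R)); last by ring.
rewrite normrM gtr0_norm// (mulrC 5) ltr_pM2l// ltr_norml => /andP[h1 h2].
by rewrite /a (coeff_site chi_left chi_right n0); [|lra|lra].
Qed.

(** Forgets the profiles and keeps the constants: Q0, Q1, D are the forms of u, v = s u and w, r is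
    the twist, m0, m1, m3 are squared norms, L is a common support radius. What remains is algebra
    in n, l, s, t, p. *)
Lemma two_scale_family : exists Q0 Q1 r D m0 m1 m3 L : R,
  [/\ Q0 < 0, 0 < r, 0 < D, 0 < m3 & [/\ 0 <= m0, 0 <= m1 & 1 <= L]] /\
  forall (n : nat) (l s t p : R), (0 < n)%N -> L < 5 * n%:R -> L < 10 * l ->
  exists f, [/\ Ccinfty f, Hgen a 2%:E f (Hmin a f),
    inner f (Hmin a f) = (n%:R * (s ^+ 2 * Q0 + p ^+ 2 * Q1) + l * (t ^+ 2 * D)) +i* (n%:R * (s * p * r)) &
    Lpnorm 2%:E f = (Num.sqrt (n%:R^-1 * (s ^+ 2 * m0 + p ^+ 2 * m1) + l^-1 * (t ^+ 2 * m3)))%:E].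
Proof.
have LL (L : R) : 4 <= L -> [/\ 0 < L, 1 <= 4 * L, 0 <= 4 * L & 4 * 1 <= 4 * L] by move=> h; split; lra.
have ll (L l : R) : 1 <= L -> L < 10 * l -> 0 < l by move=> h1 h2; lra.
have [L L4 Q0] := Hform_profile_lt0 chi_smooth chi_bounds chi_mono chi_left chi_right chi_mid.
have r0 := Hform_twist_gt0 chi_smooth chi_bounds chi_mono chi_left chi_right chi_mid L4.
have D0 := Hform_cutoff_gt0 chi_smooth chi_left chi_right chi_mid.
have m30 := Rintegral_sqr_cutoff_gt0 chi_smooth chi_left chi_right.
have [L0 L1 L40 L44] := LL L L4.
set u := profile chi L in Q0 r0; set w := cutoff chi 1 in D0 m30.
pose v s := s * u s; pose b s := 1 + chi s.
have sb : smooth b by exact: (smoothD (smooth_cst (c := 1)) chi_smooth).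
have tu : test_fun (4 * L) u.
  by split; [exact: (@smooth_profile _ _ chi_smooth L)|exact: (profile_vanishes chi_left L0)].
have tv : test_fun (4 * L) v.
  by split; [exact: (smoothM (@smooth_id R) (proj1 tu))|exact: (vanishes_mulr id (proj2 tu))].
have tw : test_fun (4 * L) w.
  apply: (test_funW L44).
  by split; [exact: (@smooth_cutoff _ _ chi_smooth 1)|exact: (cutoff_vanishes chi_left ltr01)].
exists (Hform b u u), (Hform b v v), (Hform b u v - Hform b v u), (Hform (fun=> 1) w w),
  (\int[mu]_x (u x * u x)), (\int[mu]_x (v x * v x)), (\int[mu]_x (w x * w x)), (4 * L).
split.
  split; [exact: Q0|exact: r0|exact: D0|exact: m30|split => //].
  - by apply: Rintegral_ge0 => x _; rewrite -expr2 sqr_ge0.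
  - by apply: Rintegral_ge0 => x _; rewrite -expr2 sqr_ge0.
move=> n l s t p n0 Ln Ll; have l0 := ll _ _ L1 Ll.
have [K [U [W [tU tW <- <- <-]]]] := two_scale_test_functions sa sb tu tv tw a_site a_left16 s t p n0 L40 Ln l0 Ll.
exists (cpair U W); split.
- exact: (Ccinfty_cpair tU tW).
- apply: (Hgen_cpair sa a_bounds (PhiK ca a_bounds a_left) (PsiK ca a_bounds a_left)
    (measurable_Psi ca a_bounds a_left) (cov_Phi ca a_bounds a_left) (flowE ca a_bounds a_left)
    (is_derive_Psi ca a_bounds a_left) _ tU tW).
  by rewrite lee_fin ler1n.
- exact: (inner_cpair sa tU tW).
- exact: (Lpnorm2_cpair tU tW).
Qed.

Lemma Hmin_not_semibounded c : exists phi : R -> C, Ccinfty phi /\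
  complex.Re (inner phi (Hmin a phi)) < - c * fine (Lpnorm 2%:E phi) ^+ 2.
Proof.
have [Q0 [Q1 [r [D [m0 [m1 [m3 [L [[hQ0 r0 D0 m30 [m00 m10 L1]] fam]]]]]]]]] := two_scale_family.
(* With s = 1 and t = p = 0 the form is n Q0 and the squared norm m0 / n <= m0, so n (- Q0) > |c| m0
   suffices. *)
pose x := L + `|c| * m0 / - Q0; have x0 : 0 <= x.
  by rewrite addr_ge0 ?(le_trans _ L1)// divr_ge0 ?mulr_ge0// oppr_ge0 ltW.
pose n := (Num.truncn x).+1; have xn : x < n%:R by exact: truncnS_gt.
have n1 : 1 <= n%:R :> R by rewrite ler1n.
have cm : `|c| * m0 < n%:R * - Q0.
  rewrite -ltr_pdivrMr ?oppr_gt0//; apply: le_lt_trans xn.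
  by rewrite lerDr (le_trans _ L1).
have Ln : L < n%:R.
  by apply: le_lt_trans xn; rewrite lerDl divr_ge0 ?mulr_ge0// oppr_ge0 ltW.
have [f [cf _ fE nE]] := fam n (L + 1) 1 0 0 isT ltac:(lra) ltac:(lra).
exists f; split => //; rewrite fE nE /= !expr0n expr1n !mul0r !mulr0 !addr0 !mul1r.
rewrite sqr_sqrtr ?mulr_ge0 ?invr_ge0//.
have h : - (n%:R^-1 * (`|c| * m0)) <= - c * (n%:R^-1 * m0).
  have -> : - c * (n%:R^-1 * m0) = - (n%:R^-1 * (c * m0)) by ring.
  by rewrite lerN2 ler_wpM2l ?invr_ge0// ler_wpM2r// ler_norm.
apply: lt_le_trans h; rewrite ltrNr -mulrN.
apply: (@le_lt_trans _ _ (`|c| * m0)); last exact: cm.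
by rewrite ler_piMl ?mulr_ge0// invf_le1// (lt_le_trans ltr01).
Qed.

(* K is the mass n s^2 of the site profile and t is used to correct the real
   part; the two free scales n and l then normalise the function. *)
Lemma numerical_range_full z : numerical_range (Hgen a 2%:E) z.
Proof.
have [Q0 [Q1 [r [D [m0 [m1 [m3 [L [[hQ0 r0 D0 m30 [m00 m10 L1]] fam]]]]]]]]] := two_scale_family.
case: z => X Y.
(* V > V0 will force l >= L, so that the dilated w fits into the region a = 1. *)
pose V0 := L ^+ 2 * D / m3; have V00 : 0 <= V0 by apply: divr_ge0; [apply: mulr_ge0; [exact: sqr_ge0|exact: ltW]|exact: ltW].
pose B := `|X| + (Y / r) ^+ 2 * `|Q1| + V0.
have B0 : 0 <= B by rewrite !addr_ge0// mulr_ge0// sqr_ge0.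
(* K (- Q0) outweighs |X|, the part due to v and V0 together, which leaves V > V0 for w. *)
pose K := 1 + B / - Q0; have NQ0 : 0 < - Q0 by rewrite oppr_gt0.
have K1 : 1 <= K by rewrite lerDl divr_ge0// ltW.
have K0 : 0 < K by lra.
(* With p = s e the imaginary part n s^2 e r = K e r equals Y. *)
pose e := Y / (K * r).
have Ke : K * e ^+ 2 <= (Y / r) ^+ 2.
  rewrite (_ : K * _ = (Y / r) ^+ 2 / K); last by rewrite /e; field; rewrite !gt_eqF.
  by rewrite ler_pdivrMr// ler_peMr// sqr_ge0.
have Ke0 : 0 <= K * e ^+ 2 by rewrite mulr_ge0 ?sqr_ge0// ltW.
(* The real part that w has to supply: V = l t^2 D. *)
pose V := X - K * (Q0 + e ^+ 2 * Q1).
have VV0 : V0 < V.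
  have h1 : K * - Q0 = - Q0 + B by rewrite /K mulrDl mul1r divfK// gt_eqF.
  have h2 : K * e ^+ 2 * Q1 <= (Y / r) ^+ 2 * `|Q1|.
    apply: (@le_trans _ _ (K * e ^+ 2 * `|Q1|)); first by rewrite ler_wpM2l// ler_norm.
    by rewrite ler_wpM2r.
  have h3 : - X <= `|X| by rewrite -normrN ler_norm.
  have -> : V = X + K * - Q0 - K * e ^+ 2 * Q1 by rewrite /V; ring.
  by rewrite h1 /B; lra.
have V_gt0 : 0 < V by exact: le_lt_trans VV0.
pose M := K * (m0 + e ^+ 2 * m1); have M0 : 0 <= M.
  by rewrite mulr_ge0 ?(ltW K0)// addr_ge0// mulr_ge0// sqr_ge0.
(* The site functions take the share q = M / n^2 of the squared norm; n > 2 M and n >= 1 make it at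
   most 1/2. *)
pose n := (Num.truncn (L + 2 * M)).+1.
have xn : L + 2 * M < n%:R by exact: truncnS_gt.
have n1 : 1 <= n%:R :> R by rewrite ler1n.
have n0 : 0 < n%:R :> R by rewrite ltr0n.
pose q := M / n%:R ^+ 2.
have q0 : 0 <= q by rewrite divr_ge0// sqr_ge0.
have q2 : q <= 2^-1.
  rewrite ler_pdivrMr ?exprn_gt0// expr2; nra.
pose P := 1 - q; have P0 : 0 < P by rewrite /P; lra.
have P1 : P <= 1 by rewrite /P; lra.
(* The remaining share P of the squared norm is t^2 m3 / l = V m3 / (l^2 D). *)
pose l := Num.sqrt (V * m3 / (D * P)).
have DP0 : 0 < D * P by rewrite mulr_gt0.
have l2 : l ^+ 2 = V * m3 / (D * P) by rewrite sqr_sqrtr// divr_ge0 ?mulr_ge0// ltW.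
have L0 : 0 <= L by lra.
have Ll : L <= l.
  rewrite -(ler_sqr (x := L)) ?nnegrE ?sqrtr_ge0// l2 ler_pdivlMr//.
  apply: (@le_trans _ _ (L ^+ 2 * D)).
    by rewrite mulrA ler_piMr// mulr_ge0 ?sqr_ge0// ltW.
  by rewrite -ler_pdivrMr// ltW.
have l0 : 0 < l by lra.
pose s := Num.sqrt (K / n%:R); pose t := Num.sqrt (V / (l * D)).
have s2 : s ^+ 2 = K / n%:R by rewrite sqr_sqrtr// divr_ge0 ?(ltW K0).
have t2 : t ^+ 2 = V / (l * D) by rewrite sqr_sqrtr// divr_ge0 ?mulr_ge0// ltW.
have nn : n%:R != 0 :> R by rewrite gt_eqF.
have ln : l != 0 by rewrite gt_eqF.
have [rn Dn Kn Pn] : [/\ r != 0, D != 0, K != 0 & P != 0] by split; rewrite gt_eqF.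
have Ln5 : L < 5 * n%:R by lra.
have Ll10 : L < 10 * l by lra.
have [f [_ Hf fE nE]] := fam n l s t (s * e) isT Ln5 Ll10.
exists f, (Hmin a f); split => //.
  rewrite nE (_ : _ + _ = 1) ?sqrtr1// exprMn s2 t2.
  have -> : l^-1 * (V / (l * D) * m3) = P.
    have h : V * m3 = l ^+ 2 * (D * P) by rewrite l2 divfK// gt_eqF.
    transitivity (V * m3 / (l ^+ 2 * D)); first by field; rewrite ln Dn.
    by rewrite h; field; rewrite ln Dn.
  have -> : n%:R^-1 * (K / n%:R * m0 + K / n%:R * e ^+ 2 * m1) = q.
    by rewrite /q /M; field.
  by rewrite /P subrKC.
rewrite fE exprMn s2 t2; congr (_ +i* _).
  have -> : l * (V / (l * D) * D) = V by field; rewrite ln Dn.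
  have -> : n%:R * (K / n%:R * Q0 + K / n%:R * e ^+ 2 * Q1) = K * (Q0 + e ^+ 2 * Q1) by field.
  by rewrite /V addrC subrK.
transitivity (n%:R * (s ^+ 2 * e * r)); last by ring.
by rewrite s2 /e; field; rewrite nn rn Kn.
Qed.

End numerical_range.

Theorem mainTheorem6 (R : realType) (chi : R -> R)
  (chi_smooth : smooth chi)
  (chi_bounds : forall x : R, 0 <= chi x <= 3)
  (chi_mono : forall x : R, 0 <= chi^`() x)
  (chi_left : forall x : R, x <= 0 -> chi x = 0)
  (chi_right : forall x : R, 3 <= x -> chi x = 3)
  (chi_mid : forall x : R, 1 <= x <= 2 -> chi x = x) :
  let a := coeff chi in
  (* the objects are well defined *)
  ((forall x : R, cvgn (bump_partial_sum chi x)) /\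
   (forall x : R, 1 <= a x <= 4) /\
   flow_well_defined a /\
   (forall (t : R) phi, 0 < t -> Lp +oo%E phi -> is_Ssemigroup a t phi (Ssemigroup a t phi))) /\
  smooth a /\
  ereal_sup [set (derive1 a x)%:E | x in [set: R]] = +oo%E /\
  (* (i) *)
  ((forall x y : R, a y <= 4 * a x) /\
   (forall p : R, 1 <= p ->
      ((forall t : R, is_Lp_extension p%:E (Tgroup a t) (Tgroup_Lp a p%:E t)) /\
       C0_group p%:E (Tgroup_Lp a p%:E)) /\
      ((forall t : R, 0 < t -> is_Lp_extension p%:E (Ssemigroup a t) (Ssemigroup_Lp a p%:E t)) /\
       C0_semigroup p%:E (Ssemigroup_Lp a p%:E)) /\
      (forall t : R, 0 < t ->
         (opnorm p%:E (Ssemigroup_Lp a p%:E t) <= (4 `^ p^-1)%:E)%E))) /\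
  (* (ii) *)
  ((forall c : R, exists phi : R -> R[i], Ccinfty phi /\
      complex.Re (inner phi (Hmin a phi)) <
        - c * fine (Lpnorm 2%:E phi) ^+ 2) /\
   (exists M : R, forall t : R, 0 < t ->
      (opnorm 2%:E (Ssemigroup_Lp a 2%:E t) <= M%:E)%E)) /\
  (* (iii) *)
  ((forall x y : R, 4^-1 * `|x - y| <= dist a x y <= `|x - y|) /\
   (exists K : R -> R -> R -> R,
      (forall t : R, 0 < t -> is_kernel a t (K t)) /\
      (forall t x y : R, 0 < t ->
         K t x y <= (4 * pi * t) `^ (- 2^-1) *
                    expR (- (`|x - y| ^+ 2 * (64 * t)^-1))))) /\
  (* (iv) *)
  ((forall (p : \bar R) lam, (1 <= p)%E ->
      spectrum p (Hgen a p) lam -> 0 <= complex.Re lam) /\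
   (forall p q : \bar R, (1 <= p)%E -> (1 <= q)%E ->
      spectrum p (Hgen a p) = spectrum q (Hgen a q))) /\
  (* (v) *)
  ((forall r : R, r <= 0 -> numerical_range (Hgen a 2%:E) r%:C) /\
   numerical_range (Hgen a 2%:E) <> spectrum 2%:E (Hgen a 2%:E) /\
   numerical_range (Hgen a 2%:E) = [set: R[i]]) /\
  (* (vi) *)
  ((forall p : R, 1 <= p ->
      has_bounded_holomorphic_extension p%:E (Ssemigroup_Lp a p%:E)) /\
   (forall p : R, 1 <= p -> type_S0plus p%:E (Hgen a p%:E)) /\
   ~ sectorial (Hgen a 2%:E)).
Proof.
move=> a; have sa : smooth a by exact: (smooth_coeff chi_smooth chi_left chi_right).
have ca : continuous a by exact: (smooth_continuous sa).
have ab : forall x, 1 <= a x <= 4 by exact: (coeff_bounds chi_bounds chi_left chi_right).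
have al x : x < 1 -> a x = 1.
  by move=> x1; apply: (coeff_left chi_left); rewrite (lt_trans x1)// ltr1n.
have ma : measurable_fun setT a by exact: continuous_measurable_fun.
have [pK qK] := (PhiK ca ab al, PsiK ca ab al).
have [mP cP] := (measurable_Psi ca ab al, cov_Phi ca ab al).
have fE := flowE ca ab al.
have full : numerical_range (Hgen a 2%:E) = [set: R[i]].
  apply/seteqP; split => // z _.
  exact: (numerical_range_full chi_smooth chi_bounds chi_mono chi_left chi_right chi_mid).
have q12 : (1 <= 2%:E :> \bar R)%E by rewrite lee_fin ler1n.
have spec q (q1 : (1 <= q)%E) := Hgen_spectrum ma ab pK qK mP cP fE q1.
refine (conj (conj _ (conj _ (conj _ _))) (conj _ (conj _ (conj (conj _ _) (conj (conj _ _)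
  (conj (conj _ _) (conj (conj _ _) (conj (conj _ (conj _ _)) (conj _ (conj _ _)))))))))).
- exact: (bump_partial_sum_is_cvg chi_left chi_right).
- exact: ab.
- exact: (coeff_flow_well_defined ca ab al).
- by move=> t phi t0; exact: (SsemigroupP ma ab pK qK mP cP fE t0).
- exact: sa.
- exact: (coeff_slope_unbounded chi_left chi_right chi_mid).
- exact: (coeff_le4 chi_bounds chi_left chi_right).
- move=> p p1; split; [|split].
  + split; first by move=> t; exact: (Tgroup_LpP ma ab pK qK mP cP fE t p1).
    exact: (Tgroup_Lp_C0 ma ab pK qK mP cP fE p1).
  + split; first by move=> t t0; exact: (Ssemigroup_LpP ma ab pK qK mP cP fE p1 t0).
    exact: (Ssemigroup_Lp_C0 ma ab pK qK mP cP fE p1).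
  + by move=> t t0; exact: (opnorm_Ssemigroup ma ab pK qK mP cP fE p1 t0).
- exact: (Hmin_not_semibounded chi_smooth chi_bounds chi_mono chi_left chi_right chi_mid).
- exists (4 `^ 2^-1) => t t0.
  exact: (opnorm_Ssemigroup ma ab pK qK mP cP fE (ler1n R 2) t0).
- exact: (dist_bounds ca ab al).
- exists (Skernel a (Phi a)); split.
    by move=> t t0; exact: (Skernel_is_kernel ca ab pK qK mP cP fE (continuous_Phi ca ab al) t0).
  move=> t x y t0; apply: (Skernel_le ab _ _ _ t0) => u v.
  by have /andP[] := Phi_dist ca ab al u v.
- by move=> p lam p1; rewrite (spec _ p1) => -[].
- by move=> p q p1 q1; rewrite (spec _ p1) (spec _ q1).
- by move=> r _; rewrite full.
- rewrite full (spec _ q12) => h.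
  (* -1 belongs to the numerical range and lies off the spectrum [0, oo). *)
  have : [set: R[i]] (- 1) by [].
  by rewrite h /= => -[]; rewrite oppr_ge0 ler10.
- exact: full.
- by move=> p p1; exact: (Ssemigroup_holomorphic ca ab pK qK mP cP fE p1).
- by move=> p p1; exact: (Hgen_type_S0plus ca ab pK qK mP cP fE p1).
- rewrite /sectorial full => -[g [th [thpi h]]].
  (* The point at distance 1 to the left of the vertex has argument pi seen from it, beyond every
     theta < pi / 2. *)
  have [/eqP|] := h (g%:C - 1) I.
    by rewrite -subr_eq0 addrAC subrr sub0r oppr_eq0 oner_eq0.
  rewrite addrAC subrr sub0r normr_arg ?oppr_eq0 ?oner_eq0//.
  rewrite normcN (normc_real 1) normr1 ReN/= divr1 acosN1.
  by rewrite leNgt (lt_trans thpi)// ltr_pdivrMr// ltr_pMr ?pi_gt0// ltr1n.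
Qed.
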